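(* Let $\mathbb{X}=G/K$ be a rank one Riemannian symmetric space of non-compact type, let $a>1$, let $B$ be a ball of arbitrary radius in $\mathbb{X}$, and let $s>\frac12$. For $f\in C_c^\infty(K\backslash G/K)$ put $$S_tf(x)=c\int_0^\infty \widehat f(\lambda)\,e^{it(\lambda^2+\rho^2)^{a/2}}\,\phi_\lambda(x)\,|c(\lambda)|^{-2}\,d\lambda,\qquad S^*f(x)=\sup_{0<t<1}|S_tf(x)| .$$ Then there is a constant $C'>0$, independent of $f$, such that $$\|S^*f\|_{L^2(B)}\le C'\,\|f\|_{H^s(\mathbb{X})}\qquad\text{for all } f\in C_c^\infty(K\backslash G/K).$$
   Context: $G$ is a connected noncompact semisimple Lie group with finite center and real rank one, with Lie algebra $\mathfrak g$, Cartan involution $\theta$, Cartan decomposition $\mathfrak g=\mathfrak k\oplus\mathfrak p$, maximal compact subgroup $K=\exp\mathfrak k$, and $\mathbb{X}=G/K$, with base point $o=eK$. $\mathfrak a$ is a maximal abelian subspace of $\mathfrak p$ (so $\dim\mathfrak a=1$). The nonzero roots are $\{\pm\alpha\}$ or $\{\pm\alpha,\pm2\alpha\}$, with $\mathfrak g_\beta=\{X\in\mathfrak g:[H,X]=\beta(H)X\ \forall H\in\mathfrak a\}$, $m_1=\dim\mathfrak g_\alpha$, $m_2=\dim\mathfrak g_{2\alpha}$ (possibly $0$), $\mathfrak n=\mathfrak g_\alpha\oplus\mathfrak g_{2\alpha}$, $N=\exp\mathfrak n$. $H_0\in\mathfrak a$ is the element with $\alpha(H_0)=1$, and $a_t=\exp(tH_0)$,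 $A=\{a_t:t\in\mathbb{R}\}$. Identify $\mathfrak a^*$ and $\mathfrak a^*_{\mathbb{C}}$ with $\mathbb{R}$ and $\mathbb{C}$ via $z\mapsto z\alpha$, and $\mathfrak a$ with $\mathbb{R}$ via $t\mapsto tH_0$. Put $\rho=\frac12(m_1+2m_2)$ and $n=\dim\mathbb{X}=m_1+m_2+1$. Functions on $\mathbb{X}$ are right $K$-invariant functions on $G$; radial functions are the $K$-biinvariant functions on $G$, and $C_c^\infty(K\backslash G/K)$ is the space of smooth compactly supported $K$-biinvariant functions. The measure on $\mathbb{X}$ is the $G$-invariant Riemannian measure; in polar coordinates $G=K\overline{A^+}K$ ($\overline{A^+}=\{a_t:t\ge0\}$) the Haar measure is $\int_G f\,dg=C\int_K\int_0^\infty\int_K f(k_1a_tk_2)D(t)\,dk_1\,dt\,dk_2$, $D(t)=(\sinh t)^{m_1}(\sinh 2t)^{m_2}$. $\Delta$ is the Laplace–Beltrami operator of $\mathbb{X}$, the metric being normalized so that $H_0$ has norm $1$. The Iwasawa decomposition is $g=k(g)\exp(H(g))\,n(g)\in KAN$. For $\lambda\in\mathbb{C}$ the spherical function is $\phi_\lambda(x)=\int_K e^{-(i\lambda+\rho)H(x^{-1}k)}\,dk$; it is the radial function with $\Delta\phi_\lambda=-(\lambda^2+\rho^2)\phi_\lambda$ and $\phi_\lambda(o)=1$. The spherical Fourier transform of a suitable radial function $f$ is $\widehat f(\lambda)=\int_{\mathbb{X}}f(x)\phi_\lambda(x)\,dx$, $\lambda\in\mathbb{R}$. $c(\lambda)$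 is the Harish-Chandra $\mathbf c$-function, i.e. the meromorphic function with $c(\lambda)=\lim_{t\to\infty}e^{(\rho-i\lambda)t}\phi_\lambda(a_t)$ for $\operatorname{Im}\lambda<0$. The constant $c>0$ in front of the integral is the one in the inversion formula $f(x)=c\int_0^\infty\widehat f(\lambda)\phi_\lambda(x)|c(\lambda)|^{-2}d\lambda$, valid for $f\in C_c^\infty(K\backslash G/K)$. Sobolev space: for $s\in\mathbb{R}$, $H^s(\mathbb{X})$ is the image of $L^2(\mathbb{X})$ under $(-\Delta)^{-s/2}$, with norm $\|f\|_{H^s}=\|(-\Delta)^{s/2}f\|_{L^2}$; for radial $f$, up to a normalizing constant, $\|f\|_{H^s}^2=\int_0^\infty(\lambda^2+\rho^2)^s|\widehat f(\lambda)|^2|c(\lambda)|^{-2}\,d\lambda$. *)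

(* Defs.v *)
From HB Require Import structures.
From mathcomp Require Import all_boot all_order all_algebra complex.
From mathcomp Require Import all_classical all_reals all_analysis.
From mathcomp Require Import measurable_realfun.
Set Implicit Arguments.
Unset Strict Implicit.
Unset Printing Implicit Defensive.
Import Order.TTheory GRing.Theory Num.Theory.
Import numFieldNormedType.Exports.
Local Open Scope classical_set_scope.
Local Open Scope ring_scope.

(** Meant for [U] open in a finite-dimensional [V]; then [C_k k U f] says that
    [f] is of class C^k on [U]. *)
Fixpoint C_k (R : realType) (V W : normedModType R) (k : nat)
    (U : set V) (f : V -> W) : Prop :=
  match k with
  | 0%N => forall x, U x -> {for x, continuous f}
  | k'.+1 => (forall x, U x -> differentiable f x) /\
             (forall v, C_k k' U (fun x => 'D_v f x))
  end.

Definition smooth_on (R : realType) (V W : normedModType R)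
  (U : set V) (f : V -> W) : Prop := forall k, C_k k U f.

(** [cinv] inverts [cmap] on the domain [cdom]; both maps are arbitrary outside
    of [cdom] and of its image. *)
Record chart (R : realType) (G : Type) (n : nat) := Chart {
  cdom : set G;
  cmap : G -> 'rV[R]_n;
  cinv : 'rV[R]_n -> G }.

Definition cimg (R : realType) (G : Type) n (c : chart R G n) : set 'rV[R]_n :=
  cmap c @` cdom c.

Definition is_chart (R : realType) (G : topologicalType) n
    (c : chart R G n) : Prop :=
  [/\ open (cdom c), open (cimg c),
      forall x, cdom c x -> cinv c (cmap c x) = x,
      forall x, cdom c x -> {for x, continuous (cmap c)} &
      forall y, cimg c y -> {for y, continuous (cinv c)}].

HB.mixin Record isLieGroup (R : realType) G of Group G & PointedTopological G := {
  lie_dim : nat;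
  atlas : set (chart R G lie_dim);
  lie_hausdorff : hausdorff_space G;
  lie_second_countable : @second_countable G;
  atlas_chart : forall c, atlas c -> is_chart c;
  atlas_cover : forall x : G, exists2 c, atlas c & cdom c x;
  atlas_compat : forall c d, atlas c -> atlas d ->
    smooth_on (cmap c @` (cdom c `&` cdom d)) (cmap d \o cinv c);
  mulg_continuous : continuous (fun p : G * G => (p.1 * p.2)%g);
  invg_continuous : continuous (fun x : G => x^-1%g);
  mulg_smooth : forall c d e, atlas c -> atlas d -> atlas e ->
    smooth_on [set p : 'rV[R]_lie_dim * 'rV[R]_lie_dim |
                [/\ cimg c p.1, cimg d p.2 & cdom e (cinv c p.1 * cinv d p.2)%g]]
              (fun p => cmap e (cinv c p.1 * cinv d p.2)%g);
  invg_smooth : forall c e, atlas c -> atlas e ->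
    smooth_on [set y | cimg c y /\ cdom e (cinv c y)^-1%g]
              (fun y => cmap e (cinv c y)^-1%g)
}.

#[short(type="lieGroupType")]
HB.structure Definition LieGroup (R : realType) :=
  {G of isLieGroup R G & Group G & PointedTopological G}.

Definition smooth_fun (R : realType) (G : lieGroupType R) (f : G -> R) : Prop :=
  forall c, (@atlas R G) c -> smooth_on (cimg c) (f \o cinv c : _ -> R^o).

(** The left-invariant vector field whose flow is [x |-> x * ex (t X)],
    applied to [f]. *)
Definition lderiv (R : realType) (G : lieGroupType R) (g : lmodType R)
    (ex : g -> G) (X : g) (f : G -> R) : G -> R :=
  fun x => derive1 (fun t : R => f (x * ex (t *: X))%g) 0.

(** [lieAlgebra G]: a vector space in bijection, through [lie_exp], with the
    one-parameter subgroups of [G]; its linear structure and its bracket are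
    those of the left-invariant vector fields. This determines the Lie algebra
    of [G] with its exponential map up to isomorphism. *)
Record lieAlgebra (R : realType) (G : lieGroupType R) := LieAlgebra {
  lie_sort :> vectType R;
  lie_br : lie_sort -> lie_sort -> lie_sort;
  lie_exp : lie_sort -> G;
  lie_expD : forall X (s t : R),
    lie_exp ((s + t) *: X) = (lie_exp (s *: X) * lie_exp (t *: X))%g;
  lie_exp_continuous : forall X, continuous (fun t : R => lie_exp (t *: X));
  lie_exp_onto : forall gam : R -> G, continuous gam ->
    (forall s t, gam (s + t) = (gam s * gam t)%g) ->
    exists! X, forall t, gam t = lie_exp (t *: X);
  lie_linear : forall (c : R) X Y f, smooth_fun f -> forall x,
    lderiv lie_exp (c *: X + Y) f x =
    c * lderiv lie_exp X f x + lderiv lie_exp Y f x;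
  lie_bracket : forall X Y f, smooth_fun f -> forall x,
    lderiv lie_exp (lie_br X Y) f x =
    lderiv lie_exp X (lderiv lie_exp Y f) x -
    lderiv lie_exp Y (lderiv lie_exp X f) x }.

Arguments lie_br {R G} l _ _ : rename.
Arguments lie_exp {R G} l _ : rename.

Section LieAlgebraNotions.
Variables (R : realType) (G : lieGroupType R) (g : lieAlgebra G).
Local Notation "[[ X , Y ]]" := (lie_br g X Y) (at level 0).

Definition ad (X : g) : 'End(g) := linfun (lie_br g X).

(** The trace of [ad X \o ad Y], computed in a basis of [g]. *)
Definition killing (X Y : g) : R :=
  \sum_(i < \dim {:g}) coord (vbasis {:g}) i [[X, [[Y, (vbasis {:g})`_i]]]].

Definition semisimple : Prop :=
  forall X : g, (forall Y, killing X Y = 0) -> X = 0.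

Definition cartan_involution (theta : 'End(g)) : Prop :=
  [/\ forall X, theta (theta X) = X,
      forall X Y, theta [[X, Y]] = [[theta X, theta Y]] &
      forall X, X != 0 -> 0 < - killing X (theta X)].

Definition kk (theta : 'End(g)) : {vspace g} := lker (theta - \1)%VF.
Definition pp (theta : 'End(g)) : {vspace g} := lker (theta + \1)%VF.

Definition abelian_sub (a : {vspace g}) : Prop :=
  forall X Y, X \in a -> Y \in a -> [[X, Y]] = 0.

Definition maximal_abelian_in (p a : {vspace g}) : Prop :=
  [/\ (a <= p)%VS, abelian_sub a &
      forall b : {vspace g}, (a <= b)%VS -> (b <= p)%VS -> abelian_sub b ->
        (b <= a)%VS].

(** Elements of the dual of [a] are represented by linear forms on [g], of
    which only the restriction to [a] matters. *)
Definition rootspace (a : {vspace g}) (beta : 'Hom(g, R^o)) : {vspace g} :=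
  (\bigcap_(i < \dim a)
     lker (ad (vbasis a)`_i - (beta (vbasis a)`_i : R) *: \1%VF))%VS.

Definition is_root (a : {vspace g}) (beta : 'Hom(g, R^o)) : Prop :=
  (exists2 H, H \in a & beta H != 0) /\ rootspace a beta != 0%VS.

End LieAlgebraNotions.

Record rankOneSpace (R : realType) (G : lieGroupType R) (g : lieAlgebra G) :=
RankOneSpace {
  theta : 'End(g);
  fa : {vspace g};
  alpha : 'Hom(g, R^o);
  H0 : g;
  theta_cartan : cartan_involution theta;
  fa_maximal : maximal_abelian_in (pp theta) fa;
  fa_dim1 : \dim fa = 1%N;
  alpha_root : is_root fa alpha;
  roots_alpha : forall beta, is_root fa beta ->
    exists2 c : R, c \in [:: 1; -1; 2; -2] &
      forall H, H \in fa -> beta H = c * alpha H;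
  H0_fa : H0 \in fa;
  alpha_H0 : alpha H0 = 1 }.

Notation borel G := (g_sigma_algebraType (@open G)).

Section Geometry.
Variables (R : realType) (G : lieGroupType R) (g : lieAlgebra G).
Variable X : rankOneSpace g.

Definition g1 : {vspace g} := rootspace (fa X) (alpha X).
Definition g2 : {vspace g} := rootspace (fa X) (2 *: alpha X).
Definition m1 : nat := \dim g1.
Definition m2 : nat := \dim g2.
Definition rho : R := (m1%:R + 2 * m2%:R) / 2.

Definition Ksub : set G := lie_exp g @` [set Y | Y \in kk (theta X)].
Definition Nsub : set G := lie_exp g @` [set Y | Y \in (g1 + g2)%VS].
Definition aexp (t : R) : G := lie_exp g (t *: H0 X).

(** The Riemannian metric at [o] in the normalization [|H0| = 1]. *)
Definition pnorm (Y : g) : R :=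
  Num.sqrt (killing Y Y / killing (H0 X) (H0 X)).

(** The preimage in [G] of the ball of [G/K] with center [x0 K] and radius [r]:
    [Y |-> x0 exp(Y) K] is the Riemannian exponential map at [x0 K], and [G/K]
    is complete. *)
Definition ball_GK (x0 : G) (r : R) : set G :=
  [set x | exists Y k, [/\ Y \in pp (theta X), pnorm Y < r, Ksub k &
                           x = (x0 * lie_exp g Y * k)%g]].

Definition maximal_compact : Prop :=
  compact (Ksub) /\
  forall L : set G, compact L -> L 1%g ->
    (forall x y, L x -> L y -> L (x * y^-1)%g) -> Ksub `<=` L -> L `<=` Ksub.

(** The Iwasawa projections, with [fa] identified with [R] through [H0]; they
    are unique. *)
Definition iwasawa (kap : G -> G) (H : G -> R) (nu : G -> G) : Prop :=
  forall x, [/\ Ksub (kap x), Nsub (nu x) & x = (kap x * aexp (H x) * nu x)%g].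

Definition haar (mu : {measure set (borel G) -> \bar R}) : Prop :=
  [/\ forall (x : G) (A : set (borel G)), measurable A ->
        mu ((fun y : G => (x * y)%g) @^-1` A) = mu A,
      forall A : set G, compact A -> (mu A < +oo)%E &
      (0 < mu setT)%E].

(** The normalized Haar measure of [K], as a measure on [G]. *)
Definition haarK (dk : probability (borel G) R) : Prop :=
  dk Ksub = 1%E /\
  forall (k : G) (A : set (borel G)), Ksub k -> measurable A ->
    dk ((fun y : G => (k * y)%g) @^-1` A) = dk A.

Definition sinh (t : R) : R := (expR t - expR (- t)) / 2.

Definition polarD (t : R) : R := sinh t ^+ m1 * sinh (2 * t) ^+ m2.

Definition polar_coordinates (mu : {measure set (borel G) -> \bar R})
    (dk : probability (borel G) R) (C : R) : Prop :=
  (forall x : G, exists k1 t k2,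
     [/\ Ksub k1, 0 <= t, Ksub k2 & x = (k1 * aexp t * k2)%g]) /\
  (forall f : borel G -> \bar R, measurable_fun setT f ->
     (forall x, (0 <= f x)%E) ->
     (\int[mu]_x f x =
      C%:E * \int[dk]_(k1 in Ksub) \int[lebesgue_measure]_(t in `[0%R, +oo[)
               \int[dk]_(k2 in Ksub)
                  (f (k1 * aexp t * k2)%g * (polarD t)%:E))%E).

Definition cint d (T : measurableType d) (m : {measure set T -> \bar R})
    (D : set T) (f : T -> R[i]) : R[i] :=
  (Rintegral m D (fun x => complex.Re (f x)) +i*
   Rintegral m D (fun x => complex.Im (f x)))%C.

Definition cabs (z : R[i]) : R := ComplexField.Normc.normc z.

Definition cexp (z : R[i]) : R[i] :=
  ((expR (complex.Re z) * cos (complex.Im z))%R +i*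
   (expR (complex.Re z) * sin (complex.Im z))%R)%C.

Definition Cc_radial (f : G -> R[i]) : Prop :=
  [/\ smooth_fun (fun x => complex.Re (f x)),
      smooth_fun (fun x => complex.Im (f x)),
      compact (closure [set x | f x != 0]) &
      forall k1 k2 x, Ksub k1 -> Ksub k2 -> f (k1 * x * k2)%g = f x].

Section Spherical.
Variables (mu : {measure set (borel G) -> \bar R}) (dk : probability (borel G) R).
Variable H : G -> R.

Definition phi (lam : R[i]) (x : G) : R[i] :=
  cint dk Ksub
    (fun k : G => cexp (- ('i%C * lam + rho%:C%C) * (H (x^-1 * k)%g)%:C%C)).

Definition fhat (f : G -> R[i]) (lam : R) : R[i] :=
  cint mu setT (fun x : G => f x * phi lam%:C%C x).

Definition meromorphic (h : R[i] -> R[i]) : Prop :=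
  forall z0 : R[i]^o, exists n (u : R[i]^o -> R[i]^o),
    (\forall z \near z0, derivable u z 1) /\
    (\forall z \near z0^', h z = u z / (z - z0) ^+ n).

Definition harish_chandra_c (cf : R[i] -> R[i]) : Prop :=
  meromorphic cf /\
  forall lam : R[i], complex.Im lam < 0 ->
    (cexp ((rho%:C%C - 'i%C * lam) * t%:C%C) * phi lam (aexp t) : R[i]^o)
      @[t --> +oo] --> (cf lam : R[i]^o).

Section Plancherel.
Variables (cf : R[i] -> R[i]) (c : R).

(** The density [|c(lam)|^-2]; on the real line a meromorphic function
    [cf] is determined up to a set of measure zero. *)
Definition plancherel (lam : R) : R := (cabs (cf lam%:C%C) ^+ 2)^-1.

Definition inversion_formula : Prop :=
  forall f, Cc_radial f -> forall x,
    f x = c%:C%C * cint lebesgue_measure `[0%R, +oo[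
      (fun lam : R => fhat f lam * phi lam%:C%C x * (plancherel lam)%:C%C).

Definition S_ (a t : R) (f : G -> R[i]) (x : G) : R[i] :=
  c%:C%C * cint lebesgue_measure `[0%R, +oo[
    (fun lam : R =>
       fhat f lam
       * cexp ('i%C * (t * (lam ^+ 2 + rho ^+ 2) `^ (a / 2))%:C%C)
       * phi lam%:C%C x * (plancherel lam)%:C%C).

Definition Sstar (a : R) (f : G -> R[i]) (x : G) : \bar R :=
  ereal_sup [set (cabs (S_ a t f x))%:E | t in `]0%R, 1%R[].

(** For radial [f]: the [L2] norm of [(- Delta)^(s / 2) f], computed on the
    spectral side, up to a normalizing constant. *)
Definition Hs_norm (s : R) (f : G -> R[i]) : \bar R :=
  ((\int[lebesgue_measure]_(lam in `[0%R, +oo[)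
      ((lam ^+ 2 + rho ^+ 2) `^ s * cabs (fhat f lam) ^+ 2
       * plancherel lam)%:E) `^ 2^-1)%E.

End Plancherel.
End Spherical.
End Geometry.

Definition L2_norm_on (R : realType) (G : lieGroupType R)
    (mu : {measure set (borel G) -> \bar R}) (B : set G) (u : G -> \bar R) :
    \bar R :=
  Lnorm mu 2%:E ((u : borel G -> \bar R) \_ B).

(* Main.v *)
(** By Cauchy-Schwarz in [lam] with the weight [(lam^2 + rho^2)^s], the supremum
    over [t] of [|S_t f x|^2] is at most [C |f|_(H^s)^2 Q x], where [Q x] is the
    integral of [(lam^2 + rho^2)^(- s) |phi_lam x|^2 |c lam|^-2]; as [s > 1/2], no
    oscillation has to be used. For a radial cutoff [chi], put
    [N lam = int chi |phi_lam|^2]. By dyadic summation [Q] is integrable on the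
    ball as soon as [int_0^L N lam |c lam|^-2 dlam = O(L)]. On the support of
    [chi], the Taylor expansion of the cosine approximates [phi_lam], for
    [lam <= L], within [e^(- J)] by the span of [J = O(L)] functions that do not
    depend on [lam]. If [(e_i)] is an orthonormal basis of this span in
    [L^2(chi)], the Plancherel identity for the radial function [chi e_i] bounds
    [int <phi_lam, e_i>^2 |c lam|^-2 dlam] uniformly, and the sum over [i] gives
    [O(L)].

    The Plancherel identity follows from the inversion formula by Fubini because
    [phi_lam] is real for real [lam]. Indeed inversion gives [f x^-1 = f x] for
    radial [f], while comparing the asymptotics in polar coordinates of the
    integral of a shell translated by [y] shows that [k |-> kap (y k)] has
    modulus [e^(- 2 rho H (y k))] on [K], whence
    [phi_(- lam) x = phi_lam x^-1]. *)
Require Import Defs.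
From HB Require Import structures.
From mathcomp Require Import all_boot all_order all_algebra complex.
From mathcomp Require Import all_classical all_reals all_analysis.
From mathcomp Require Import measurable_realfun ring lra.
Set Implicit Arguments.
Unset Strict Implicit.
Unset Printing Implicit Defensive.
Import Order.TTheory GRing.Theory Num.Theory.
Import numFieldNormedType.Exports.
Local Open Scope classical_set_scope.
Local Open Scope ring_scope.

(** * Functions of class C^k *)

(** The hypotheses give [kap], [H] and [nu] as bare maps and [K] as the image of [kk] under the
    exponential; all regularity is extracted from the adjoint representation. If [v] is an
    eigenvector of [ad H0] for its largest eigenvalue [j], the squared length of [Ad x v] is
    [e^(2 j H x)] times that of [v], which gives the continuity of [H] and its cocycle identity. The
    logarithm of the Hilbert-Schmidt norm of [Ad x] is a biinvariant substitute [tau] for the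
    distance to [o], and [H y] is the limit of [tau (y a_t) - t]; this turns the asymptotics of
    shells into statements on [H]. A convolution argument then makes [H] smooth, so that products of
    a cutoff with averages of functions of [H] are admissible in the inversion formula. The number
    of approximating functions can be linear in [L] because their error [e^(- J)] only has to beat a
    lower bound for [N lam] of size [L^(- dim X)], obtained near [o], where [phi_lam] does not
    oscillate yet. The condition [s > 1/2] is the convergence of the geometric series of ratio
    [2 / 4^s]. *)

Section CkCalculus.
Variable R : realType.
Implicit Types V W Z : normedModType R.

Lemma Ck_cont V W k (U : set V) (f : V -> W) :
  C_k k U f -> forall x, U x -> {for x, continuous f}.
Proof.
case: k => [//|k] [df _] x Ux.
exact/differentiable_continuous/df.
Qed.

Lemma Ck_pred V W k (U : set V) (f : V -> W) : C_k k.+1 U f -> C_k k U f.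
Proof.
elim: k f => [|k IH] f; first by move=> fC x Ux; exact: (Ck_cont fC).
by move=> [df Df]; split=> // v; exact/IH/Df.
Qed.

Lemma Ck_sub V W k (U U' : set V) (f : V -> W) :
  U' `<=` U -> C_k k U f -> C_k k U' f.
Proof.
move=> sU; elim: k f => [|k IH] f; first by move=> fC x /sU; exact: fC.
by move=> [df Df]; split=> [x /sU /df//|v]; exact/IH/Df.
Qed.

(** [C_k] is a conjunction of conditions at the single points of [U], each of them about full
    neighbourhoods, so arbitrary sets [U'] can serve for the localization. *)
Lemma Ck_loc V W k (U : set V) (f : V -> W) :
  (forall x, U x -> exists U', U' x /\ C_k k U' f) -> C_k k U f.
Proof.
elim: k f => [|k IH] f lf.
  by move=> x /lf[U' [U'x fC]]; exact: fC.
split=> [x /lf[U' [U'x [df _]]]|v]; first exact: df.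
by apply: IH => x /lf[U' [U'x [_ Df]]]; exists U'; split=> //; exact: Df.
Qed.

Lemma diff_eps V W (f : V -> W) (x : V) (L : {linear V -> W}) :
  continuous L ->
  (forall e, 0 < e -> \forall h \near 0, `|f (h + x) - f x - L h| <= e * `|h|) ->
  differentiable f x /\ 'd f x = L :> (V -> W).
Proof.
move=> cL H.
have E : f \o shift x = cst (f x) + L +o_ (nbhs 0) id.
  apply/eqaddoP => e e0; move: (H _ e0); apply: filterS => h.
  by rewrite /= opprD addrA.
have DL := diff_unique cL E.
split=> //; apply/diff_locallyP; rewrite DL; split=> //.
Qed.

(** [g - f] vanishes near [x], hence is differentiable at [x] with differential 0, and
    [g = f + (g - f)]. *)
Lemma near_eq_differentiable V W (f g : V -> W) (x : V) :
  (\near x, f x = g x) -> differentiable f x -> differentiable g x.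
Proof.
move=> fg df.
have fgx : f x = g x by exact: nbhs_singleton fg.
have : differentiable (g - f) x.
  apply: (proj1 (@diff_eps _ _ _ _ (\0 : V -> W) _ _)); first exact: cst_continuous.
  move=> e e0.
  have : \forall h \near 0, f (h + x) = g (h + x).
    by move: fg; rewrite (near_shift 0 x); apply: filterS => h /=; rewrite ?subr0 ?add0r ?addr0 1?addrC.
  apply: filterS => h /= fgh.
  rewrite (_ : _ - _ - _ = 0) ?normr0 ?mulr_ge0// ?ltW//.
  by rewrite -[LHS]/(g (h + x) - f (h + x) - (g x - f x) - 0) fgx fgh !subrr.
move=> dg; have := differentiableD df dg.
rewrite (_ : f + (g - f) = g)//; apply/funext => y.
by rewrite -[LHS]/(f y + (g y - f y)) addrC subrK.
Qed.

Lemma Ck_ext V W k (U : set V) (f g : V -> W) :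
  open U -> (forall x, U x -> f x = g x) -> C_k k U f -> C_k k U g.
Proof.
move=> oU; elim: k f g => [|k IH] f g fg.
  move=> fC x Ux; have fgx : \near x, f x = g x.
    by near do apply: fg; exact: open_nbhs_nbhs.
  rewrite /prop_for /continuous_at -(fg _ Ux).
  by apply: cvg_trans (fC x Ux); apply: near_eq_cvg.
move=> [df Df].
have fgx x : U x -> \near x, f x = g x.
  by move=> Ux; near do apply: fg; exact: open_nbhs_nbhs.
split=> [x Ux|v]; first exact: near_eq_differentiable (fgx _ Ux) (df _ Ux).
by apply: IH (Df v) => x Ux; apply: near_eq_derive; exact: fgx.
Unshelve. all: by end_near. Qed.

Lemma Ck_cst V W k (U : set V) (c : W) : C_k k U (cst c : V -> W).
Proof.
elim: k c => [c x _|k IH c]; first exact: cst_continuous.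
split=> [x _|v]; first exact: differentiable_cst.
rewrite (_ : (fun x => _) = cst 0); first exact: IH.
by apply/funext => x; rewrite derive_cst.
Qed.

Lemma Ck_lin V W k (U : set V) (L : {linear V -> W}) :
  continuous L -> C_k k U L.
Proof.
move=> cL; case: k => [x _|k]; first exact: cL.
have dL x : differentiable L x by exact: linear_differentiable.
split=> // v; rewrite (_ : (fun x => _) = cst (L v)); first exact: Ck_cst.
by apply/funext => x; rewrite deriveE// diff_lin.
Qed.

Lemma Ck_post V W Z k (U : set V) (f : V -> W) (L : {linear W -> Z}) :
  open U -> continuous L -> C_k k U f -> C_k k U (L \o f).
Proof.
move=> oU cL; elim: k f => [|k IH] f.
  move=> fC x Ux; apply: continuous_comp; [exact: fC|exact: cL].
move=> [df Df].
have dL x : differentiable L x by exact: linear_differentiable.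
split=> [x Ux|v].
  by apply: differentiable_comp => //; exact: df.
apply: (Ck_ext oU _ (IH _ (Df v))) => x Ux /=.
rewrite [RHS]deriveE; last by apply: differentiable_comp => //; exact: df.
by rewrite diff_comp ?diff_lin//=; [rewrite deriveE//; exact: df|exact: df].
Qed.

Lemma Ck_add V W k (U : set V) (f g : V -> W) :
  open U -> C_k k U f -> C_k k U g -> C_k k U (fun x => f x + g x).
Proof.
move=> oU; elim: k f g => [|k IH] f g.
  by move=> fC gC x Ux; apply: continuousD; [exact: fC|exact: gC].
move=> [df Df] [dg Dg]; split=> [x Ux|v].
  by apply: differentiableD; [exact: df|exact: dg].
apply: (Ck_ext oU _ (IH _ _ (Df v) (Dg v))) => x Ux /=.
rewrite -[RHS]/('D_v (f + g) x) deriveD//; apply: diff_derivable; auto.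
Qed.

Lemma Ck_sum V W k (U : set V) (I : Type) (r : seq I) (F : I -> V -> W) :
  open U -> (forall i, C_k k U (F i)) -> C_k k U (fun x => \sum_(i <- r) F i x).
Proof.
move=> oU FC; elim: r => [|i r IH].
  by under eq_fun do rewrite big_nil; exact: Ck_cst.
by under eq_fun do rewrite big_cons; apply: Ck_add.
Qed.

Lemma Ck_mul V k (U : set V) (f g : V -> R^o) :
  open U -> C_k k U f -> C_k k U g -> C_k k U (fun x => f x * g x : R^o).
Proof.
move=> oU; elim: k f g => [|k IH] f g.
  by move=> fC gC x Ux; apply: continuousM; [exact: fC|exact: gC].
move=> fC gC; have [df Df] := fC; have [dg Dg] := gC; split=> [x Ux|v].
  by apply: differentiableM; [exact: df|exact: dg].
have := Ck_add oU (IH _ _ (Ck_pred fC) (Dg v)) (IH _ _ (Ck_pred gC) (Df v)).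
apply: (Ck_ext oU) => x Ux /=.
rewrite -[RHS]/('D_v (f * g) x) deriveM//; apply: diff_derivable; auto.
Qed.

(** Finite dimension in the form that the chain rule consumes: a spanning family with continuous
    coordinates, a property stable under products. *)
Definition has_coords W := exists (I : finType) (e : I -> W)
  (co : I -> {linear W -> R^o}),
  (forall i, continuous (co i)) /\ forall w, w = \sum_i co i w *: e i.

(** The derivative of [g \o f] along [v] is the sum over [i] of the coordinate [co i] of ['D_v f]
    times the derivative of [g] along [e i] taken at [f x]. The factors are of class C^k by
    induction, so [Ck_mul] and [Ck_sum] conclude. *)
Lemma Ck_comp V W k (U : set V) (U' : set W) (f : V -> W) (g : W -> R^o) :
  has_coords W -> open U -> (forall x, U x -> U' (f x)) ->
  C_k k U f -> C_k k U' g -> C_k k U (g \o f).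
Proof.
move=> [I [e [co [cco cE]]]] oU fU.
elim: k g => [|k IH] g.
  move=> fC gC x Ux; apply: continuous_comp; [exact: fC|exact/gC/fU].
move=> fC [dg Dg]; have [df Df] := fC; split=> [x Ux|v].
  by apply: differentiable_comp; [exact: df|exact/dg/fU].
have H : C_k k U (fun x => \sum_i (co i \o (fun x => 'D_v f x)) x *
    ((fun y => 'D_(e i) g y) \o f) x : R^o).
  apply: Ck_sum => // i; apply: Ck_mul => //.
    by apply: Ck_post => //; exact: Df.
  by apply: IH; [exact: Ck_pred|exact: Dg].
apply: (Ck_ext oU _ H) => x Ux /=.
have dgx : differentiable g (f x) by apply/dg/fU.
have dfx := df x Ux.
rewrite [RHS]deriveE; last exact: differentiable_comp.
rewrite diff_comp//= -[X in 'd g _ X](deriveE v dfx) [in RHS](cE ('D_v f x)).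
rewrite raddf_sum; apply: eq_bigr => i _.
by rewrite [RHS]linearZ/= (deriveE (e i) dgx).
Qed.

Lemma Ck_pair V W W' k (U : set V) (f : V -> W) (g : V -> W') :
  open U -> C_k k U f -> C_k k U g -> C_k k U (fun x => (f x, g x)).
Proof.
move=> oU; elim: k f g => [|k IH] f g.
  by move=> fC gC x Ux; apply: cvg_pair; [exact: fC|exact: gC].
move=> [df Df] [dg Dg]; split=> [x Ux|v].
  by apply: differentiable_pair; [exact: df|exact: dg].
apply: (Ck_ext oU _ (IH _ _ (Df v) (Dg v))) => x Ux /=.
have dfx := df x Ux; have dgx := dg x Ux.
rewrite [RHS]deriveE; last exact: differentiable_pair.
by rewrite diff_pair//= !deriveE.
Qed.

Lemma has_coords_R : has_coords (R^o : normedModType R).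
Proof.
exists 'I_1, (fun=> 1), (fun=> idfun); split=> [_ x|w]; first exact: cvg_id.
by rewrite big_ord1 /= [RHS]mulr1.
Qed.

Lemma has_coords_rV n : has_coords ('rV[R]_n : normedModType R).
Proof.
have lc (j : 'I_n) : linear (fun w : 'rV[R]_n => w ord0 j : R^o).
  by move=> a u v; rewrite !mxE.
pose co j : {linear 'rV[R]_n -> R^o} :=
  HB.pack (fun w : 'rV[R]_n => w ord0 j : R^o)
    (GRing.isLinear.Build R 'rV[R]_n R^o _ _ (lc j)).
exists 'I_n, (fun j => delta_mx 0 j), co; split=> [j|w] /=.
  move=> x; exact: coord_continuous.
exact: row_sum_delta.
Qed.

Lemma has_coords_prod V W : has_coords V -> has_coords W ->
  has_coords ((V * W)%type : normedModType R).
Proof.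
move=> [I [e [co [cco cE]]]] [J [e' [co' [cco' cE']]]].
pose E (k : I + J) : V * W := match k with inl i => (e i, 0) | inr j => (0, e' j) end.
pose CO (k : I + J) : V * W -> R^o :=
  match k with inl i => co i \o fst | inr j => co' j \o snd end.
have lc k : linear (CO k).
  by case: k => i a u v; rewrite /CO/= linearP.
pose co2 k : {linear (V * W)%type -> R^o} :=
  HB.pack (CO k) (GRing.isLinear.Build R (V * W)%type R^o _ _ (lc k)).
exists (I + J)%type, E, co2; split.
  case=> i x; apply: continuous_comp.
  - exact: cvg_fst.
  - exact: cco.
  - exact: cvg_snd.
  - exact: cco'.
move=> [u w]; rewrite big_sumType/=.
have H1 (K : finType) (a : K -> R) (b : K -> V * W) :
    \sum_i a i *: b i = (\sum_i a i *: (b i).1, \sum_i a i *: (b i).2).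
  elim/big_rec3 : _ => [//|i x1 x2 x3 _ ->].
  by [].
rewrite !H1/=.
under [X in (_, X) + _]eq_bigr do rewrite scaler0.
under [X in _ + (X, _)]eq_bigr do rewrite scaler0.
rewrite !big1_eq -cE -cE'.
by congr (_, _); rewrite ?addr0 ?add0r.
Qed.


(** The derivative along [v] is [v f'], with [f'] again in [S]. This serves for the exponential, the
    functions [flat P] and the combinations of sine and cosine. *)
Lemma Ck_family (S : set (R -> R)) :
  (forall f, S f -> exists2 f', S f' & forall x, is_derive x (1 : R^o) (f : R^o -> R^o) (f' x)) ->
  forall f, S f -> forall k, C_k k setT (f : R^o -> R^o).
Proof.
move=> SS f Sf k; elim: k f Sf => [|k IH] f Sf; have [f' Sf' df] := SS _ Sf.
  move=> x _; apply: differentiable_continuous.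
  by apply/derivable1_diffP; exact: ex_derive.
have dfx (x : R^o) : differentiable (f : R^o -> R^o) x.
  by apply/derivable1_diffP; exact: ex_derive.
split=> [x _|v]; first exact: dfx.
have := Ck_mul openT (Ck_cst k setT (v : R^o)) (IH _ Sf').
apply: (Ck_ext openT) => x _ /=.
rewrite deriveE// -[v in RHS]mulr1 [RHS]linearZ/= -deriveE//.
by rewrite (@derive_val _ _ _ _ _ _ _ (df x)).
Qed.

Lemma Ck_expR k : C_k k setT (@expR R : R^o -> R^o).
Proof.
apply: (@Ck_family [set expR]) => // f ->; exists expR => // x.
exact: is_derive_expR.
Qed.

(** For [P = 1] this is the classical smooth function that is flat at 0. The factor [P] in [1 / t]
    makes the family closed under derivation: [P] becomes [X^2 (P - P')]. *)
Definition flat (P : {poly R}) (t : R) : R :=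
  if 0 < t then P.[t^-1] * expR (- t^-1) else 0.

Lemma flat_bound (P : {poly R}) :
  exists2 A : R, 0 <= A & forall t, `|t| <= 1 -> `|flat P t| <= A * t ^+ 2.
Proof.
set n := size P.
(* The polynomial costs at most [t^(- n)] and the exponential gains [t^m]; with [m = n + 2] a square
   of [t] is left over. *)
have [m mE] : exists m, m = (n + 2)%N by exists (n + 2)%N.
have m0 : m%:R != 0 :> R by rewrite mE pnatr_eq0 addn2.
have mp : 0 < m%:R :> R by rewrite lt_neqAle eq_sym m0/=.
pose A := (\sum_(i < n) `|P`_i|) * m%:R ^+ m.
have S0 : 0 <= \sum_(i < n) `|P`_i| by apply: sumr_ge0.
exists A => [|t t1]; first by rewrite mulr_ge0// exprn_ge0.
rewrite /flat; case: ifPn => [t0|_]; last first.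
  by rewrite normr0 mulr_ge0 ?sqr_ge0// mulr_ge0// exprn_ge0.
have s1 : 1 <= t^-1 by rewrite invf_ge1//; move: t1; rewrite gtr0_norm.
have s0 : 0 < t^-1 by rewrite invr_gt0.
rewrite normrM [`|expR _|]gtr0_norm ?expR_gt0//.
have HP : `|P.[t^-1]| <= (\sum_(i < n) `|P`_i|) * t^-1 ^+ n.
  rewrite horner_coef mulr_suml; apply: (le_trans (ler_norm_sum _ _ _)).
  apply: ler_sum => i _; rewrite normrM ler_wpM2l// normrX gtr0_norm//.
  by rewrite ler_weXn2l// ltnW.
(* From [e^u >= 1 + u >= u] at [u = 1 / (m t)], raised to the power [m]. *)
have HE : expR (- t^-1) <= m%:R ^+ m * t ^+ m.
  rewrite expRN -[leRHS]invrK lef_pV2 ?posrE ?expR_gt0 ?invr_gt0 ?mulr_gt0 ?exprn_gt0//.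
  rewrite -exprMn -exprVn invfM.
  rewrite [X in expR X](_ : t^-1 = m%:R * (m%:R^-1 * t^-1)); last by rewrite mulrA mulfV// mul1r.
  rewrite expRM_natl.
  have h0 : 0 <= m%:R^-1 / t by rewrite mulr_ge0// ltW// invr_gt0.
  rewrite lerXn2r ?nnegrE ?expR_ge0//.
  by apply: (le_trans _ (expR_ge1Dx _)); rewrite lerDr.
apply: (le_trans (ler_pM _ _ HP HE)) ; rewrite ?expR_ge0//.
rewrite /A mulrACA {1 3}mE !exprD.
have tn : t^-1 ^+ n * t ^+ n = 1.
  by rewrite -exprMn mulVf ?gt_eqF// expr1n.
by rewrite [X in _ * X](_ : _ = t ^+ 2) ?mE ?exprD//; rewrite mulrA tn mul1r.
Qed.

Lemma is_derive_flat (P : {poly R}) (x : R) :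
  is_derive x (1 : R^o) (flat P : R^o -> R^o) (flat ('X ^+ 2 * (P - P^`())) x).
Proof.
have [x0|x0|->] := ltgtP x 0.
- rewrite /(flat ('X ^+ 2 * _)) ltNge ltW//=.
  apply: (@near_eq_is_derive R R^o R^o (cst 0)).
  near=> y; rewrite /flat ltNge; case: leP => // /lt_geF.
  by have -> : y <= 0; [apply: ltW; near: y; exact: lt_nbhsl|].
- pose g : R -> R := fun t => P.[t^-1] * expR (- t^-1).
  apply: (@near_eq_is_derive R R^o R^o g).
    near=> y; rewrite /flat /g; have -> // : 0 < y.
    by near: y; exact: lt_nbhsr.
  have x00 : x != 0 by rewrite gt_eqF.
  have dinv : is_derive x (1 : R^o) (fun t : R => t^-1) (- x^-2).
    by apply: (is_derive_eq (is_deriveV x00 (is_derive_id (x : R^o) (1 : R^o)))); rewrite /GRing.scale/= mulr1.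
  have dP : is_derive x (1 : R^o) (fun t : R => P.[t^-1]) (P^`().[x^-1] * - x^-2).
    exact: (@is_derive1_comp _ (horner P) (fun t => t^-1)).
  have dE : is_derive x (1 : R^o) (fun t : R => expR (- t^-1))
     (expR (- x^-1) * x^-2).
    have dN := is_deriveN dinv; rewrite opprK in dN.
    exact: (@is_derive1_comp _ expR (fun t => - t^-1)).
  apply: (is_derive_eq (is_deriveM dP dE)).
  rewrite /flat x0 /= !hornerE /GRing.scale/=; field; exact: x00.
(* At 0 the difference quotient is at most [A |h|], so the derivative is 0, the default value of
   [flat]. *)
- have [A A0 HA] := flat_bound P.
  have -> : flat ('X ^+ 2 * (P - P^`())) 0 = 0 by rewrite /flat ltxx.
  have f0 : flat P 0 = 0 by rewrite /flat ltxx.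
  have L : h^-1 *: (flat P (h *: (1 : R^o) + 0) - flat P 0) @[h --> 0^'] --> (0 : R^o).
    apply/cvgrPdist_le => e e0.
    have eA : 0 < e / (A + 1) by rewrite divr_gt0// ltr_wpDl.
    near=> h; rewrite sub0r normrN f0 subr0 addr0 {2}/GRing.scale/= mulr1.
    have h1 : `|h| <= 1 by near: h; apply: dnbhs0_le.
    have h2 : `|h| <= e / (A + 1) by near: h; apply: dnbhs0_le.
    have h0 : h != 0 by near: h; exact: nbhs_dnbhs_neq.
    rewrite normrM normfV ler_pdivrMl ?normr_gt0//.
    apply: (le_trans (HA _ h1)).
    rewrite -[h ^+ 2]ger0_norm ?sqr_ge0// normrX expr2 mulrCA ler_wpM2l//.
    apply: (@le_trans _ _ (A * (e / (A + 1)))); first by rewrite ler_wpM2l.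
    by rewrite mulrA ler_pdivrMr ?ltr_wpDl// mulrC mulrDr mulr1 lerDl ltW.
  split; first by apply/cvg_ex; exists 0.
  exact: cvg_lim L.
Unshelve. all: by end_near. Qed.

Lemma Ck_flat (P : {poly R}) k : C_k k setT (flat P : R^o -> R^o).
Proof.
apply: (@Ck_family (range flat)) => [f [Q _ <-]|]; last by exists P.
exists (flat ('X ^+ 2 * (Q - Q^`()))); first by exists ('X ^+ 2 * (Q - Q^`())).
by move=> x; exact: is_derive_flat.
Qed.

Lemma is_derive_line V W (f : V -> W) (y0 h : V) (t : R) :
  derivable f (t *: h + y0) h ->
  is_derive (t : R^o) (1 : R^o) ((fun t => f (t *: h + y0)) : R^o -> W)
    ('D_h f (t *: h + y0)).
Proof.
move=> df.
have E : (fun k : R => k^-1 *: (((fun t : R^o => f (t *: h + y0)) \o shift (t : R^o)) (k *: (1 : R^o)) -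
    f (t *: h + y0))) =
    (fun k => k^-1 *: ((f \o shift (t *: h + y0)) (k *: h) - f (t *: h + y0))).
  apply/funext => k /=; congr (_ *: (f _ - _)).
  by rewrite addrA -scalerDl /GRing.scale/= mulr1.
by split; rewrite /derivable /derive E.
Qed.

Lemma derive_rVE n (f : 'rV[R]_n -> R^o) (y h : 'rV[R]_n) :
  differentiable f y ->
  'D_h f y = \sum_(i < n) h ord0 i * 'D_(delta_mx ord0 i) f y.
Proof.
move=> df; rewrite deriveE// [X in 'd _ _ X](row_sum_delta h) raddf_sum.
by apply: eq_bigr => i _; rewrite [LHS]linearZ/= -deriveE.
Qed.

Lemma derive_slice V V' W (P : V * V' -> W) (y : V) (z v : V') :
  differentiable P (y, z) -> 'D_v (fun z => P (y, z)) z = 'D_(0, v) P (y, z).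
Proof.
move=> dP.
have E : (fun k : R => k^-1 *: (((fun z => P (y, z)) \o shift z) (k *: v) - P (y, z))) =
    (fun k => k^-1 *: ((P \o shift (y, z)) (k *: (0, v)) - P (y, z))).
  apply/funext => k /=; congr (_ *: (P _ - _)).
  by congr (_, _); rewrite /= ?scaler0 ?add0r.
by rewrite /derive E.
Qed.

End CkCalculus.

(** * Smooth functions on a Lie group *)

Lemma open_setI_preimage (S T : topologicalType) (A : set S) (B : set T)
    (f : S -> T) : open A -> (forall y, A y -> {for y, continuous f}) ->
  open B -> open (A `&` f @^-1` B).
Proof.
move=> oA fc oB; rewrite openE => y [Ay By].
apply: filterI; first exact: open_nbhs_nbhs.
by apply: (fc _ Ay); apply: open_nbhs_nbhs.
Qed.

Lemma open_setX (S T : topologicalType) (A : set S) (B : set T) :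
  open A -> open B -> open (A `*` B).
Proof.
move=> oA oB; rewrite openE => -[x y] [/= Ax By].
by exists (A, B) => //=; split; exact: open_nbhs_nbhs.
Qed.

Lemma near_eq_continuous (S T : topologicalType) (f g : S -> T) (x : S) :
  (\near x, f x = g x) -> {for x, continuous f} -> {for x, continuous g}.
Proof.
move=> fg; rewrite /prop_for /continuous_at (nbhs_singleton fg).
by apply: cvg_trans; apply: near_eq_cvg; apply: filterS fg => y ->.
Qed.

Section SmoothFunctions.
Variables (R : realType) (G : lieGroupType R).
Local Notation n := (@lie_dim R G).
Local Notation rV := ('rV[R]_n : normedModType R).
Implicit Types (c d e : chart R G n) (f g : G -> R).

Lemma mulg_continuous_at (S : topologicalType) (f g : S -> G) (x : S) :
  {for x, continuous f} -> {for x, continuous g} ->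
  {for x, continuous (fun y => (f y * g y)%g)}.
Proof.
move=> cf cg.
apply: (@continuous_comp _ _ _ (fun y => (f y, g y)) (fun p => p.1 * p.2)%g).
  exact: cvg_pair.
exact: mulg_continuous.
Qed.

Lemma chart_spec c : atlas c -> [/\ open (cdom c), open (cimg c),
  forall x, cdom c x -> cinv c (cmap c x) = x,
  forall x, cdom c x -> {for x, continuous (cmap c)} &
  forall y, cimg c y -> {for y, continuous (cinv c)}].
Proof. exact: atlas_chart. Qed.

Lemma cimg_cmap c x : cdom c x -> cimg c (cmap c x).
Proof. by exists x. Qed.

Lemma cimgP c y : atlas c -> cimg c y ->
  cdom c (cinv c y) /\ cmap c (cinv c y) = y.
Proof. by move=> /chart_spec[_ _ K _ _] [x cx <-]; rewrite K. Qed.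

Lemma open_chart_trans c d : atlas c -> atlas d ->
  open (cimg c `&` cinv c @^-1` (cdom d)).
Proof.
move=> /chart_spec[_ oc _ _ cc] /chart_spec[od _ _ _ _].
exact: open_setI_preimage.
Qed.

Lemma chart_transE c d : atlas c ->
  cmap c @` (cdom c `&` cdom d) = cimg c `&` cinv c @^-1` (cdom d).
Proof.
move=> ac; have [_ _ K _ _] := chart_spec ac.
apply/seteqP; split=> y.
  by move=> [x [cx dx] <-]; split; [exact: cimg_cmap|rewrite /= K].
move=> [cy dy]; exists (cinv c y); last by have [_] := cimgP ac cy.
by split=> //; have [] := cimgP ac cy.
Qed.

(** Transition maps are smooth by [atlas_compat], so smoothness near a point can be tested in one
    chart of one's choice, on a small open set. *)
Lemma smooth_funP f : smooth_fun f <->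
  forall x, exists c, [/\ atlas c, cdom c x & exists U, [/\ open U,
    U (cmap c x), U `<=` cimg c & forall k, C_k k U (f \o cinv c : _ -> R^o)]].
Proof.
split=> [fS x|H].
  have [c ac cx] := atlas_cover x; exists c; split=> //; exists (cimg c).
  have [_ oc _ _ _] := chart_spec ac.
  by split=> //; [exact: cimg_cmap|move=> k; exact: fS].
move=> d ad k; apply: Ck_loc => y dy.
have [Ddy Kdy] := cimgP ad dy.
have [c [ac cx [U [oU Ux Uc fC]]]] := H (cinv d y).
pose A := cimg d `&` cinv d @^-1` (cdom c).
have oA : open A by exact: open_chart_trans.
have tr : smooth_on A (cmap c \o cinv d).
  by rewrite /A -chart_transE//; exact: atlas_compat.
pose B := A `&` (cmap c \o cinv d) @^-1` U.
have oB : open B.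
  have tr0 := tr 0%N.
  by apply: (@open_setI_preimage rV rV A U) => //; exact: tr0.
exists B; split=> //.
have := @Ck_comp R rV rV k B U (cmap c \o cinv d) (f \o cinv c)
  (has_coords_rV R n) oB _ _ (fC k).
move=> /(_ (fun z => @proj2 _ _)) /(_ (Ck_sub (@subIsetl _ _ _) (tr k))).
apply: Ck_ext => // z [[dz cz] _] /=.
by have [_ _ Kc _ _] := chart_spec ac; rewrite Kc.
Qed.

Lemma smooth_continuous f : smooth_fun f -> continuous f.
Proof.
move=> fS x; have [c ac cx] := atlas_cover x.
have [oc _ K cc _] := chart_spec ac.
have H : {for x, continuous ((f \o cinv c) \o cmap c)}.
  apply: continuous_comp; first exact: cc.
  by apply: (fS c ac 0%N); exact: cimg_cmap.
move: H; rewrite /prop_for /continuous_at /= K//; apply: cvg_trans.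
apply: near_eq_cvg; near=> y => /=; rewrite K//.
by near: y; exact: open_nbhs_nbhs.
Unshelve. all: by end_near. Qed.

Lemma smooth_cst (a : R) : smooth_fun (fun _ : G => a).
Proof. by move=> c ac k; exact: (@Ck_cst R rV R^o k _ a). Qed.

Lemma smooth_add f g : smooth_fun f -> smooth_fun g ->
  smooth_fun (fun x => f x + g x).
Proof.
move=> fS gS c ac k; have [_ oc _ _ _] := chart_spec ac.
exact: (Ck_add oc (fS c ac k) (gS c ac k)).
Qed.

Lemma smooth_mul f g : smooth_fun f -> smooth_fun g ->
  smooth_fun (fun x => f x * g x).
Proof.
move=> fS gS c ac k; have [_ oc _ _ _] := chart_spec ac.
exact: (Ck_mul oc (fS c ac k) (gS c ac k)).
Qed.

Lemma smooth_comp (h : R -> R) f : (forall k, C_k k setT (h : R^o -> R^o)) ->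
  smooth_fun f -> smooth_fun (h \o f).
Proof.
move=> hS fS c ac k; have [_ oc _ _ _] := chart_spec ac.
exact: (Ck_comp (has_coords_R R) oc (fun _ _ => I) (fS c ac k) (hS k)).
Qed.

Lemma smooth_sum (I : Type) (r : seq I) (F : I -> G -> R) :
  (forall i, smooth_fun (F i)) -> smooth_fun (fun x => \sum_(i <- r) F i x).
Proof.
move=> FS; elim: r => [|i r IH].
  by under eq_fun do rewrite big_nil; exact: smooth_cst.
by under eq_fun do rewrite big_cons; apply: smooth_add.
Qed.

(** Near [p] the product is read in a chart [e] around it: the function is [f \o cinv e] composed
    with [cmap e \o m], and [mulg_smooth] applies to the latter. *)
Lemma smooth_mulg2 f c d : smooth_fun f -> atlas c -> atlas d ->
  smooth_on (cimg c `*` cimg d)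
    ((fun p => f (cinv c p.1 * cinv d p.2)%g) : (rV * rV)%type -> R^o).
Proof.
move=> fS ac ad k; apply: Ck_loc => p [cp dp].
have [_ oc _ _ cc] := chart_spec ac; have [_ od _ _ cd] := chart_spec ad.
have [e ae ep] := atlas_cover (cinv c p.1 * cinv d p.2)%g.
have [oe _ Ke _ _] := chart_spec ae.
pose m := fun p : rV * rV => (cinv c p.1 * cinv d p.2)%g.
pose A := (cimg c `*` cimg d) `&` m @^-1` (cdom e).
have oA : open A.
  apply: open_setI_preimage => //; first exact: open_setX.
  move=> q [cq dq]; apply: mulg_continuous_at.
    by apply: continuous_comp; [exact: cvg_fst|exact: cc].
  by apply: continuous_comp; [exact: cvg_snd|exact: cd].
have AE : A = [set p | [/\ cimg c p.1, cimg d p.2 & cdom e (m p)]].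
  by apply/seteqP; split=> q /= [] => [[]|]; split.
have mS : C_k k A (cmap e \o m).
  by rewrite AE; exact: mulg_smooth.
exists A; split=> //.
have H := @Ck_comp R _ _ k A (cimg e) (cmap e \o m) (f \o cinv e)
  (has_coords_rV R n) oA (fun q h => cimg_cmap (proj2 h)) mS (fS e ae k).
by apply: (Ck_ext oA _ H) => q [_ /= eq]; rewrite Ke.
Qed.

Lemma smooth_invg f : smooth_fun f -> smooth_fun (fun x => f x^-1%g).
Proof.
move=> fS c ac k; apply: Ck_loc => y cy.
have [_ oc _ _ cc] := chart_spec ac.
have [e ae ey] := atlas_cover (cinv c y)^-1%g.
have [oe _ Ke _ _] := chart_spec ae.
pose m := fun y : rV => (cinv c y)^-1%g.
pose A := cimg c `&` m @^-1` (cdom e).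
have oA : open A.
  apply: open_setI_preimage => // q cq.
  by apply: continuous_comp; [exact: cc|exact: invg_continuous].
have mS : C_k k A (cmap e \o m) by exact: invg_smooth.
exists A; split=> //.
have H := @Ck_comp R _ _ k A (cimg e) (cmap e \o m) (f \o cinv e)
  (has_coords_rV R n) oA (fun q h => cimg_cmap (proj2 h)) mS (fS e ae k).
by apply: (Ck_ext oA _ H) => q [_ /= eq]; rewrite Ke.
Qed.

Lemma smooth_mulr f h : smooth_fun f -> smooth_fun (fun x => f (x * h)%g).
Proof.
move=> fS c ac k; have [_ oc _ _ _] := chart_spec ac.
have [d ad dh] := atlas_cover h; have [_ _ Kd _ _] := chart_spec ad.
have P : C_k k (cimg c) (fun y : rV => (y, cmap d h)).
  apply: Ck_pair => //; last exact: Ck_cst.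
  by apply: (@Ck_lin _ _ _ _ _ (idfun : {linear rV -> rV})) => x; exact: cvg_id.
have := @Ck_comp R rV (rV * rV)%type k (cimg c) (cimg c `*` cimg d) _ _
  (has_coords_prod (has_coords_rV R n) (has_coords_rV R n)) oc _ P
  (smooth_mulg2 fS ac ad k).
by rewrite /comp/= Kd//; apply=> y cy; split=> //=; exact: cimg_cmap.
Qed.

Lemma smooth_mull f h : smooth_fun f -> smooth_fun (fun x => f (h * x)%g).
Proof.
move=> fS; have := smooth_invg (smooth_mulr h^-1%g (smooth_invg fS)).
by under eq_fun do rewrite invgM !invgK.
Qed.

(** A bump function at [x], supported in the open set [O]. *)
Lemma smooth_bump (x : G) (O : set G) : open O -> O x ->
  exists b : G -> R, [/\ smooth_fun b, forall y, 0 <= b y, 0 < b x &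
    exists K, [/\ compact K, K `<=` O & forall y, ~ K y -> b y = 0]].
Proof.
move=> oO Ox; have [c ac cx] := atlas_cover x.
have [oc oi Kc cc ci] := chart_spec ac.
pose y0 := cmap c x.
have cy0 : cimg c y0 by exact: cimg_cmap.
pose A := cimg c `&` cinv c @^-1` O.
have oA : open A by exact: open_setI_preimage.
have Ay0 : A y0 by split=> //=; rewrite Kc.
have /nbhs_ballP[e /= e0 eA] : nbhs y0 A by exact: open_nbhs_nbhs.
(* The norm of [rV] is a maximum, hence not smooth. The bump is built on the squared Euclidean
   distance, whose balls lie in those of the maximum norm. *)
pose q (y : rV) : R := \sum_(i < n) (y ord0 i - y0 ord0 i) ^+ 2.
pose B := [set y : rV | q y <= (e / 2) ^+ 2].
have qC k : C_k k setT (q : rV -> R^o).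
  apply: Ck_sum; first exact: openT.
  move=> i; have [I [e' [co [cco _]]]] := has_coords_rV R n.
  have lc : linear (fun w : rV => w ord0 i : R^o) by move=> a u v; rewrite !mxE.
  pose L : {linear rV -> R^o} := HB.pack (fun w : rV => w ord0 i : R^o)
    (GRing.isLinear.Build R rV R^o _ _ lc).
  have C1 : C_k k setT (fun y : rV => y ord0 i - y0 ord0 i : R^o).
    apply: Ck_add; [exact: openT| |exact: Ck_cst].
    by apply: (@Ck_lin _ _ _ _ _ L) => z; exact: coord_continuous.
  exact: (Ck_mul openT C1 C1).
have Be y : B y -> ball y0 e y.
  move=> By; rewrite -ball_normE/= [`|_|]mx_normrE.
  apply: (@le_lt_trans _ _ (e / 2)); last by rewrite ltr_pdivrMr// ltr_pMr// ltr1n.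
  apply/bigmax_leP; split=> [|[i j] _ /=]; first by rewrite divr_ge0// ltW.
  rewrite !mxE !ord1 distrC -[leRHS]gtr0_norm ?divr_gt0//.
  rewrite -ler_sqr ?nnegrE// -!normrX !ger0_norm ?sqr_ge0//.
  apply: le_trans By; rewrite /q (bigD1 j)//= lerDl.
  by apply: sumr_ge0 => k _; exact: sqr_ge0.
have cB : compact B.
  apply: bounded_closed_compact.
    exists (`|y0| + e); split=> [|M eM y /Be]; first exact: num_real.
    rewrite -ball_normE/= => yB; apply: ltW; apply: le_lt_trans eM.
    rewrite -(subrK y0 y) addrC; apply: (le_trans (ler_normD _ _)).
    by rewrite lerD2l distrC ltW.
  have -> : B = q @^-1` [set z | z <= (e / 2) ^+ 2] by [].
  by apply: closed_comp; [move=> z _; exact: (qC 0%N)|exact: closed_le].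
pose K := cinv c @` B.
have cK : compact K.
  apply: continuous_compact => //; apply: continuous_in_subspaceT => y /set_mem By.
  by apply: ci; have [] := eA _ (Be _ By).
have KO : K `<=` O by move=> _ [y By <-]; have [] := eA _ (Be _ By).
pose b (y : G) : R := if y \in cdom c then flat 1 ((e / 2) ^+ 2 - q (cmap c y)) else 0.
have bK y : ~ K y -> b y = 0.
  move=> nK; rewrite /b; case: ifPn => // /set_mem cy; rewrite /flat.
  case: ifPn => //; rewrite subr_gt0 => qlt; exfalso; apply: nK.
  by exists (cmap c y); [exact: ltW|rewrite Kc].
(* [K] is closed because [G] is Hausdorff, so [b] vanishes near every point outside of the domain of
   the chart. *)
have clK : closed K by apply: compact_closed => //; exact: lie_hausdorff.
exists b; split.
- apply/smooth_funP => y; have [cy|ncy] := pselect (cdom c y).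
    exists c; split=> //; exists (cimg c); split=> //; first exact: cimg_cmap.
    move=> k.
    have : C_k k (cimg c) (fun z : rV => flat 1 ((e / 2) ^+ 2 - q z) : R^o).
      apply: (@Ck_comp R rV R^o k (cimg c) setT (fun z : rV => (e / 2) ^+ 2 - q z : R^o) (flat 1) (has_coords_R R) oi) => //.
        apply: (Ck_sub (@subsetT _ _)).
        apply: Ck_add; [exact: openT|exact: Ck_cst|].
        have := Ck_mul openT (Ck_cst k setT (-1 : R^o)) (qC k).
        by apply: Ck_ext => [|z _]; [exact: openT|rewrite /= mulN1r].
      exact: Ck_flat.
    apply: Ck_ext => // z cz /=; have [Dz Ez] := cimgP ac cz.
    by rewrite /b mem_set// Ez.
  have [d ad dy] := atlas_cover y; have [_ od Kd _ cd] := chart_spec ad.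
  exists d; split=> //; exists (cimg d `&` cinv d @^-1` (~` K)); split.
  + by apply: open_setI_preimage => //; exact: closed_openC.
  + split; first exact: cimg_cmap.
    rewrite /= Kd// => -[z Bz zy]; apply: ncy; rewrite -zy.
    by have [] := cimgP ac (proj1 (eA _ (Be _ Bz))).
  + exact: subIsetl.
  + move=> k; apply: (@Ck_ext _ _ _ _ _ (cst 0)); last exact: Ck_cst.
      by apply: open_setI_preimage => //; exact: closed_openC.
    by move=> z [_ /= /bK ->].
- move=> y; rewrite /b/flat; case: ifP => // _; case: ifP => // _.
  by rewrite hornerC mul1r expR_ge0.
- rewrite /b mem_set// /flat /q big1 => [|i _]; last by rewrite subrr expr0n.
  by rewrite subr0 exprn_gt0 ?divr_gt0// hornerC mul1r expR_gt0.
- by exists K.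
Qed.

End SmoothFunctions.

(** * Integrals depending smoothly on a group element *)

Section MeasureFacts.
Context d (T : measurableType d) (R : realType) (m : {measure set T -> \bar R}).

Lemma bounded_integrable (D : set T) (f : T -> R) (M : R) :
  measurable D -> (m D < +oo)%E -> measurable_fun D f ->
  (forall x, D x -> `|f x| <= M) -> m.-integrable D (EFin \o f).
Proof.
move=> mD Dfin mf fM; apply: measurable_bounded_integrable => //.
exists M; split; first exact: num_real.
by move=> N MN x Dx; exact/(le_trans (fM _ Dx))/ltW.
Qed.

Lemma norm_Rintegral_le (D : set T) (f : T -> R) (M : R) :
  measurable D -> (m D < +oo)%E -> measurable_fun D f ->
  (forall x, D x -> `|f x| <= M) ->
  `|\int[m]_(x in D) f x|%R <= M * fine (m D).
Proof.
move=> mD Dfin mf fM; have fi := bounded_integrable mD Dfin mf fM.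
apply: (le_trans (le_normr_Rintegral mD fi)).
rewrite -Rintegral_cst//; apply: le_Rintegral => //.
- exact: integrable_norm.
- by apply: (@bounded_integrable _ _ `|M|) => //; exact: measurable_cst.
Qed.

Lemma Rintegral_sum (I : Type) (s : seq I) (D : set T) (F : I -> T -> R) :
  measurable D -> (forall i, m.-integrable D (EFin \o F i)) ->
  \int[m]_(x in D) (\sum_(i <- s) F i x) = \sum_(i <- s) \int[m]_(x in D) F i x.
Proof.
move=> mD Fi; elim: s => [|i s IH].
  by under eq_Rintegral do rewrite big_nil; rewrite Rintegral_cst// mul0r big_nil.
under eq_Rintegral do rewrite big_cons.
rewrite RintegralD// ?big_cons ?IH//.
rewrite (_ : EFin \o _ = (fun x => \sum_(j <- s) (EFin \o F j) x)%E); last first.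
  by apply/funext => x /=; rewrite sumEFin.
exact: integrable_sum.
Qed.

End MeasureFacts.

(** The denominator is [k + 1] so that an epsilon divided by it stays positive when there are no
    coordinates. *)
Lemma sum_const_le (R : realFieldType) (k : nat) (x y : R) : 0 <= x -> 0 <= y ->
  \sum_(i < k) x * (y / (k%:R + 1)) <= y * x.
Proof.
move=> x0 y0; rewrite sumr_const card_ord -[leLHS]mulr_natr -mulrA [leRHS]mulrC ler_wpM2l//.
by rewrite mulrAC ler_pdivrMr ?ltr_wpDl// mulrDr mulr1 lerDl.
Qed.

Lemma continuous_sum_at (R : realType) (S : topologicalType) (I : Type) (s : seq I)
    (F : I -> S -> R) (x : S) : (forall i, {for x, continuous (F i)}) ->
  {for x, continuous (fun x => \sum_(i <- s) F i x)}.
Proof.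
move=> FC; elim: s => [|i s IH].
  rewrite (_ : (fun x => _) = cst 0); first exact: cst_continuous.
  by apply/funext => y; rewrite big_nil.
rewrite (_ : (fun x => _) = (fun x => F i x + \sum_(j <- s) F j x)); last first.
  by apply/funext => y; rewrite big_cons.
by apply: continuousD; [exact: FC|exact: IH].
Qed.

Lemma continuous_sum (R : realType) (S : topologicalType) (I : Type) (s : seq I)
    (F : I -> S -> R) : (forall i, continuous (F i)) ->
  continuous (fun x => \sum_(i <- s) F i x).
Proof. by move=> FC x; apply: continuous_sum_at => i; exact: FC. Qed.

Section BorelG.
Variables (R : realType) (G : lieGroupType R).
Local Notation n := (@lie_dim R G).
Local Notation rV := ('rV[R]_n : normedModType R).

Lemma open_borel (A : set G) : open A -> measurable (A : set (borel G)).
Proof. exact: sub_sigma_algebra. Qed.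

Lemma closed_borel (A : set G) : closed A -> measurable (A : set (borel G)).
Proof.
move=> cA; rewrite -[A]setCK; apply: measurableC; apply: open_borel.
exact: closed_openC.
Qed.

Lemma compact_borel (A : set G) : compact A -> measurable (A : set (borel G)).
Proof. by move=> cA; apply: closed_borel; apply: compact_closed => //; exact: lie_hausdorff. Qed.

Lemma continuous_borel (f : G -> R) :
  continuous f -> measurable_fun setT (f : borel G -> R).
Proof.
move=> cf; apply: (measurability _ (RGenOpens.measurableE R)).
move=> _ [_ [a [b ->] <-]]; rewrite setTI; apply: open_borel.
by apply: open_comp => // x _; exact: cf.
Qed.

Section JointCk.
Variables (T : topologicalType).

(** Continuity, jointly with the parameter [q], of all the derivatives in [y] of
    order at most [k]. *)
Fixpoint JC (k : nat) (U : set rV) (F : T -> rV -> R^o) : Prop :=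
  (forall q y, U y -> {for (q, y), continuous (fun p : T * rV => F p.1 p.2)}) /\
  match k with
  | 0%N => True
  | k'.+1 => (forall q y, U y -> differentiable (F q) y) /\
             (forall v, JC k' U (fun q y => 'D_v (F q) y))
  end.

Lemma JC_cont k U F : JC k U F ->
  forall q y, U y -> {for (q, y), continuous (fun p : T * rV => F p.1 p.2)}.
Proof. by case: k => [|k] []. Qed.

Lemma JC_contl k U F y : JC k U F -> U y -> continuous (fun q => F q y).
Proof.
move=> /JC_cont JF Uy q.
apply: (@continuous_comp _ _ _ (fun q => (q, y)) (fun p => F p.1 p.2)).
  exact: (cvg_pair cvg_id (cvg_cst y)).
exact: JF.
Qed.

(** The tube lemma: continuity at the pairs [(z, y0)] becomes uniform for [z] in the compact set
    [Q]. *)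
Lemma JC_uniform k U F Q y0 (e : R) : JC k U F -> compact Q -> U y0 -> 0 < e ->
  \forall y \near y0, forall z, Q z -> `|F z y - F z y0| <= e.
Proof.
move=> JF /compact_near_coveringP cQ Uy0 e0.
apply: (cQ _ (nbhs y0) (fun y z => `|F z y - F z y0| <= e)) => z Qz.
have e20 : 0 < e / 2 by rewrite divr_gt0.
have /cvgrPdist_le/(_ _ e20) H := @JC_cont _ _ _ JF z y0 Uy0.
have H2 : \forall z' \near z & y \near y0, `|F z y0 - F z' y| <= e / 2 by [].
have H3 : \forall z' \near z & y \near y0, `|F z y0 - F z' y0| <= e / 2.
  have cF := @JC_contl k U F y0 JF Uy0 z.
  move/cvgrPdist_le : cF => /(_ _ e20) H'.
  exists ([set z' | `|F z y0 - F z' y0| <= e / 2], setT) => //=.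
    by split=> //; exact: filterT.
  by move=> [p q] [].
have FF : Filter (filter_prod (nbhs z) (nbhs y0)).
  by apply: filter_prod_filter; exact: nbhs_filter.
apply: (@filterS _ _ FF _ _ _ (@filterI _ _ FF _ _ H2 H3)) => -[z' y] [/= h2 h3].
rewrite (splitr e) -(subrK (F z y0) (F z' y)) -addrA.
apply: (le_trans (ler_normD _ _)); rewrite lerD//.
by rewrite distrC.
Qed.

(** The mean value theorem on the segment from [y0] to [h + y0] reduces the remainder to increments
    of the finitely many partial derivatives, which are small uniformly on [Q] by [JC_uniform]. *)
Lemma JC_diff_uniform k U F Q y0 (e : R) : open U -> JC k.+1 U F -> compact Q ->
  U y0 -> 0 < e -> \forall h \near 0, forall z, Q z ->
  `|F z (h + y0) - F z y0 - \sum_(i < n) h ord0 i * 'D_(delta_mx ord0 i) (F z) y0|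
    <= e * `|h|.
Proof.
move=> oU JF cQ Uy0 e0; have [_ [dF DF]] := JF.
have en0 : 0 < e / (n%:R + 1) by rewrite divr_gt0// ltr_wpDl.
have H : \forall y \near y0, forall i : 'I_n, forall z, Q z ->
    `|'D_(delta_mx ord0 i) (F z) y - 'D_(delta_mx ord0 i) (F z) y0| <= e / (n%:R + 1).
  have FF : Filter (nbhs y0) by exact: nbhs_filter.
  apply: (@filter_forall _ _ (fun i y => forall z, Q z ->
    `|'D_(delta_mx ord0 i) (F z) y - 'D_(delta_mx ord0 i) (F z) y0| <= e / (n%:R + 1)) _ FF) => i.
  exact: (JC_uniform (DF (delta_mx ord0 i)) cQ Uy0 en0).
have HU : \forall y \near y0, U y by exact: open_nbhs_nbhs.
have FF : Filter (nbhs y0) by exact: nbhs_filter.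
have /(@nbhs_ballP _ rV)[d /= d0 Hd] := @filterI _ _ FF _ _ H HU.
apply/nbhs_ballP; exists d => //= h; rewrite -ball_normE/= sub0r normrN => hd z Qz.
have Hs t : 0 <= t <= 1 -> ball y0 d (t *: h + y0).
  move=> /andP[t0 t1]; rewrite -ball_normE/= opprD addrA addrAC subrr add0r normrN.
  by rewrite normrZ ger0_norm// (le_lt_trans _ hd)// ler_piMl.
pose g (t : R) : R := F z (t *: h + y0).
have dg (t : R) : 0 <= t <= 1 -> is_derive (t : R^o) (1 : R^o) (g : R^o -> R^o)
    ('D_h (F z) (t *: h + y0)).
  move=> t01; have [_ Ut] := Hd _ (Hs _ t01).
  by apply: (@is_derive_line _ rV R^o (F z)); exact/diff_derivable/dF.
have [||t t01] := @MVT_segment R g (fun t => 'D_h (F z) (t *: h + y0)) 0 1 ler01.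
- by move=> t; rewrite in_itv/= => /andP[/ltW t0 /ltW t1]; apply: dg; rewrite t0.
- apply: continuous_in_subspaceT => t /set_mem; rewrite /= in_itv/= => t01.
  by apply: differentiable_continuous; apply/derivable1_diffP; have [] := dg t t01.
rewrite /g scale1r scale0r add0r subr0 mulr1 => ->.
have t01' : 0 <= t <= 1 by move: t01; rewrite in_itv.
have [Ht Ut] := Hd _ (Hs _ t01').
rewrite deriveE; last exact: dF.
rewrite [X in 'd _ _ X](row_sum_delta h) raddf_sum -sumrB.
apply: (le_trans (ler_norm_sum _ _ _)).
apply: (@le_trans _ _ (\sum_(i < n) `|h| * (e / (n%:R + 1)))).
  apply: ler_sum => i _.
  rewrite [X in `|X - _|]linearZ/= -deriveE; last exact: dF.
  rewrite -[X in `|X|]mulrBr normrM; apply: ler_pM => //; last exact: Ht.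
  by rewrite [leRHS]mx_normrE; apply: (le_bigmax _ _ (ord0, i)).
by apply: sum_const_le => //; exact: ltW.
Qed.

End JointCk.

Section IntegralSmooth.
Variables (m : {measure set (borel G) -> \bar R}) (Q : set G) (r : G -> R) (M : R).
Hypotheses (cQ : compact Q) (Qfin : (m Q < +oo)%E)
  (mr : measurable_fun (Q : set (borel G)) (r : borel G -> R)) (rM : forall z, Q z -> `|r z| <= M).

Let mQ : measurable (Q : set (borel G)). Proof. exact: compact_borel. Qed.

Lemma measurable_weight (f : G -> R) : continuous f ->
  measurable_fun (Q : set (borel G)) (fun z : borel G => r z * f z).
Proof.
move=> cf; apply: measurable_funM => //.
by apply: measurable_funTS; exact: continuous_borel.
Qed.

Lemma integrable_weight (f : G -> R) : continuous f ->
  m.-integrable (Q : set (borel G)) (EFin \o (fun z : borel G => r z * f z)).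
Proof.
move=> cf.
have [B fB] : exists B, forall z, Q z -> `|f z| <= B.
  have : bounded_set (f @` Q).
    apply: compact_bounded; apply: continuous_compact => //.
    exact: continuous_subspaceT.
  move=> [B [_ HB]]; exists (B + 1) => z Qz; apply: (HB (B + 1)); last by exists z.
  by rewrite ltrDl.
apply: (@bounded_integrable _ _ _ _ _ _ (M * B)) => //.
  exact: measurable_weight.
by move=> z Qz; rewrite normrM ler_pM// ?rM// fB.
Qed.

(** Differentiation under the integral sign: the uniform first-order estimate of [JC_diff_uniform]
    is integrated over [Q] against the bounded weight [r]. *)
Lemma Ck_Rintegral k (U : set rV) (F : G -> rV -> R^o) : open U -> JC k U F ->
  C_k k U ((fun y => \int[m]_(z in Q) (r z * F z y)) : rV -> R^o).
Proof.
move=> oU.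
have Mm : exists2 A, 0 < A & `|M| * fine (m Q) <= A.
  by exists (`|M| * fine (m Q) + 1); rewrite ?ler_wpDr// ltr_wpDl// mulr_ge0// fine_ge0.
have [A A0 MA] := Mm.
elim: k F => [|k IH] F JF.
  move=> y0 Uy0; have FF : Filter (nbhs y0) by exact: nbhs_filter.
  apply/(@cvgrPdist_le _ _ _ _ FF) => e e0.
  have eA : 0 < e / A by rewrite divr_gt0.
  have H := JC_uniform JF cQ Uy0 eA.
  have HU : \forall y \near y0, U y by exact: open_nbhs_nbhs.
  apply: (@filterS _ _ FF _ _ _ (@filterI _ _ FF _ _ H HU)) => y [Hy Uy].
  rewrite distrC -RintegralB//; last 2 first.
    exact: integrable_weight (JC_contl JF Uy).
    exact: integrable_weight (JC_contl JF Uy0).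
  apply: (@le_trans _ _ (`|M| * (e / A) * fine (m Q))).
    apply: norm_Rintegral_le => //.
      exact: measurable_funB (measurable_weight (JC_contl JF Uy))
        (measurable_weight (JC_contl JF Uy0)).
    move=> z Qz; rewrite -mulrBr normrM; apply: ler_pM => //; last exact: Hy.
    by rewrite (le_trans (rM Qz))// ler_norm.
  by rewrite mulrAC mulrA ler_pdivrMr// mulrC ler_wpM2l// ltW.
have [_ [dF DF]] := JF.
pose c y i := \int[m]_(z in Q) (r z * 'D_(delta_mx ord0 i) (F z) y).
(* The expected differential, with the integrated partial derivatives as coefficients; [diff_eps]
   wants it as a continuous linear map. *)
pose L y (h : rV) : R := \sum_(i < n) h ord0 i * c y i.
have lL y : linear (L y : rV -> R^o).
  move=> a u v; rewrite /L scaler_sumr -big_split/=; apply: eq_bigr => i _.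
  by rewrite !mxE mulrDl /GRing.scale/= mulrA.
pose L' y : {linear rV -> R^o} :=
  HB.pack (L y : rV -> R^o) (GRing.isLinear.Build R rV R^o _ _ (lL y)).
have cL y : continuous (L' y).
  apply: continuous_sum => i h.
  have ci : {for h, continuous (fun h : rV => h ord0 i : R)} by exact: coord_continuous.
  exact: (continuousM ci (@cst_continuous rV R (c y i) h)).
have LE y h : U y -> L y h = \int[m]_(z in Q) (r z * 'D_h (F z) y).
  move=> Uy.
  have -> : \int[m]_(z in Q) (r z * 'D_h (F z) y) =
      \int[m]_(z in Q) (\sum_(i < n) h ord0 i * (r z * 'D_(delta_mx ord0 i) (F z) y)).
    apply: eq_Rintegral => z _; rewrite deriveE; last exact: dF.
    rewrite [X in 'd _ _ X](row_sum_delta h) raddf_sum mulr_sumr.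
    apply: eq_bigr => i _; rewrite [X in _ * X]linearZ/= -deriveE; last exact: dF.
    by rewrite mulrCA.
  have I1 i : m.-integrable (Q : set (borel G))
      (EFin \o (fun z : borel G => r z * 'D_(delta_mx ord0 i) (F z) y)).
    exact: integrable_weight (JC_contl (DF _) Uy).
  rewrite Rintegral_sum//; last first.
    move=> i; have := integrableZl mQ (h ord0 i) (I1 i).
    by apply: eq_integrable => // z _ /=; rewrite EFinM.
  by apply: eq_bigr => i _; rewrite RintegralZl.
have main y0 : U y0 -> differentiable ((fun y => \int[m]_(z in Q) (r z * F z y)) : rV -> R^o) y0
   /\ 'd ((fun y => \int[m]_(z in Q) (r z * F z y)) : rV -> R^o) y0 = L' y0 :> (rV -> R^o).
  move=> Uy0; apply: diff_eps => // e e0.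
  have eA : 0 < e / A by rewrite divr_gt0.
  have H := JC_diff_uniform oU JF cQ Uy0 eA.
  have HU : \forall h \near 0, U (h + y0).
    have : \forall y \near y0, U y by exact: open_nbhs_nbhs.
    by rewrite (near_shift 0 y0); apply: filterS => h /=; rewrite subr0.
  have FF : Filter (nbhs (0 : rV)) by exact: nbhs_filter.
  apply: (@filterS _ _ FF _ _ _ (@filterI _ _ FF _ _ H HU)) => h [Hh Uh] /=.
  rewrite LE// -RintegralB//; last 2 first.
    exact: integrable_weight (JC_contl JF Uh).
    exact: integrable_weight (JC_contl JF Uy0).
  rewrite -RintegralB//; last 2 first.
    have i1 := integrable_weight (JC_contl JF Uh).
    have i2 := integrable_weight (JC_contl JF Uy0).
    exact: (integrableB mQ i1 i2).
    exact: integrable_weight (JC_contl (DF h) Uy0).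
  apply: (@le_trans _ _ (`|M| * (e / A * `|h|) * fine (m Q))).
    apply: norm_Rintegral_le => //.
      apply: measurable_funB; last exact: measurable_weight (JC_contl (DF h) Uy0).
      exact: measurable_funB (measurable_weight (JC_contl JF Uh))
        (measurable_weight (JC_contl JF Uy0)).
    move=> z Qz; rewrite -!mulrBr normrM; apply: ler_pM => //.
      by rewrite (le_trans (rM Qz))// ler_norm.
    apply: le_trans (Hh z Qz).
    by rewrite (derive_rVE h (dF z y0 Uy0)).
  rewrite mulrAC mulrA ler_wpM2r// mulrA ler_pdivrMr// mulrC ler_wpM2l//.
  exact: ltW.
split=> [y Uy|v]; first by have [] := main y Uy.
apply: (Ck_ext oU _ (IH _ (DF v))) => y Uy /=.
have [dI dE] := main y Uy.
by rewrite [RHS]deriveE// dE/= -LE.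
Qed.

End IntegralSmooth.

(** The parameter of [JC] runs through [G]. In a chart [d] around it, joint continuity follows from
    a function [P] of class C^k in both variables, since a derivative in [y] along [v] is one of [P]
    along [(v, 0)]. *)
Lemma JC_charts c k (F : G -> rV -> R^o) : atlas c -> (forall d, atlas d ->
    exists2 P : rV * rV -> R^o, C_k k (cimg c `*` cimg d) P &
    forall q y, cdom d q -> cimg c y -> F q y = P (y, cmap d q)) -> JC k (cimg c) F.
Proof.
move=> ac; have [_ oc _ _ _] := chart_spec ac.
have slice (P : rV * rV -> R^o) d q y : atlas d -> cdom d q -> cimg c y ->
    differentiable P (y, cmap d q) ->
    differentiable (fun z => P (z, cmap d q)) y /\
    forall v, 'D_v (fun z => P (z, cmap d q)) y = 'D_(v, 0) P (y, cmap d q).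
  move=> ad dq cy dP.
  have dp : differentiable (fun z : rV => (z, cmap d q)) y.
    by apply: differentiable_pair; [exact: ex_diff|exact: differentiable_cst].
  have dPp : differentiable (P \o (fun z : rV => (z, cmap d q))) y.
    exact: differentiable_comp.
  split=> // v; rewrite deriveE//.
  have -> : (fun z => P (z, cmap d q)) = P \o (fun z : rV => (z, cmap d q)) by [].
  rewrite diff_comp// [RHS]deriveE//=; congr ('d _ _ _).
  have dd : is_diff y (fun z : rV => (z, cmap d q)) (fun v => (v, 0)).
    exact: (@is_diff_pair _ _ _ _ id id (cst (cmap d q)) 0).
  by rewrite diff_val.
have nearE (P : rV * rV -> R^o) (F' : G -> rV -> R^o) d q y : atlas d -> cdom d q -> cimg c y ->
    (forall q y, cdom d q -> cimg c y -> F' q y = P (y, cmap d q)) ->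
    \forall z \near y, P (z, cmap d q) = F' q z.
  move=> ad dq cy PE; have H : \forall z \near y, cimg c z by exact: open_nbhs_nbhs.
  by apply: filterS H => z cz; rewrite PE.
have contF k' (F' : G -> rV -> R^o) : (forall d, atlas d ->
    exists2 P : rV * rV -> R^o, C_k k' (cimg c `*` cimg d) P &
    forall q y, cdom d q -> cimg c y -> F' q y = P (y, cmap d q)) ->
    forall q y, cimg c y -> {for (q, y), continuous (fun p : G * rV => F' p.1 p.2)}.
  move=> FP q y cy; have [d ad dq] := atlas_cover q.
  have [od oid Kd cd _] := chart_spec ad.
  have [P PC PE] := FP d ad.
  apply: (@near_eq_continuous _ _ (P \o (fun p : G * rV => (p.2, cmap d p.1)))).
    exists (cdom d, cimg c) => /=; first by split; exact: open_nbhs_nbhs.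
    by move=> -[q' y'] [/= dq' cy']; rewrite PE.
  apply: continuous_comp => /=; last first.
    by apply: (Ck_cont PC); split=> //=; exact: cimg_cmap.
  have c1 : {for (q, y), continuous (fun p : G * rV => p.2)} by exact: cvg_snd.
  have c2 : {for (q, y), continuous (fun p : G * rV => cmap d p.1)}.
    by apply: (@continuous_comp _ _ _ fst (cmap d)); [exact: cvg_fst|exact: cd].
  exact: (cvg_pair c1 c2).
elim: k F => [|k IH] F FP; first by split=> //; exact: contF FP.
split; first exact: contF FP.
split=> [q y cy|v].
  have [d ad dq] := atlas_cover q; have [P [dP _] PE] := FP d ad.
  apply: (near_eq_differentiable (nearE _ _ _ _ _ ad dq cy PE)).
  by apply: (proj1 (slice P d q y ad dq cy _)); apply: dP; split=> //; exact: cimg_cmap.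
apply: IH => d ad; have [P [dP DP] PE] := FP d ad.
exists (fun p => 'D_(v, 0) P p); first exact: DP.
move=> q y dq cy; rewrite -(near_eq_derive _ (nearE _ _ _ _ _ ad dq cy PE)).
by apply: (proj2 (slice P d q y ad dq cy _)); apply: dP; split=> //; exact: cimg_cmap.
Qed.

Lemma JC_mulg f c k : smooth_fun f -> atlas c ->
  JC k (cimg c) (fun (q : G) (y : rV) => f (cinv c y * q)%g : R^o).
Proof.
move=> fS ac; apply: JC_charts => // d ad.
exists (fun p => f (cinv c p.1 * cinv d p.2)%g); first exact: smooth_mulg2.
by move=> q y dq cy /=; have [_ _ Kd _ _] := chart_spec ad; rewrite Kd.
Qed.

Lemma JC_mulgl f c k : smooth_fun f -> atlas c ->
  JC k (cimg c) (fun (q : G) (y : rV) => f (q * cinv c y)%g : R^o).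
Proof.
move=> fS ac; apply: JC_charts => // d ad.
have [_ oc _ _ _] := chart_spec ac; have [_ od _ _ _] := chart_spec ad.
exists (fun p => f (cinv d p.2 * cinv c p.1)%g); last first.
  by move=> q y dq cy /=; have [_ _ Kd _ _] := chart_spec ad; rewrite Kd.
have swapC : C_k k (cimg c `*` cimg d) ((fun p => (p.2, p.1)) : rV * rV -> rV * rV).
  apply: Ck_pair; [exact: open_setX| |].
    by apply: (@Ck_lin _ _ _ _ _ (snd : {linear (rV * rV)%type -> rV})) => p; exact: cvg_snd.
  by apply: (@Ck_lin _ _ _ _ _ (fst : {linear (rV * rV)%type -> rV})) => p; exact: cvg_fst.
apply: (@Ck_comp R (rV * rV)%type (rV * rV)%type k (cimg c `*` cimg d) (cimg d `*` cimg c)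
  (fun p => (p.2, p.1)) (fun p => f (cinv d p.1 * cinv c p.2)%g)
  (has_coords_prod (has_coords_rV R n) (has_coords_rV R n)) (open_setX oc od) _ swapC).
  by move=> p [].
exact: smooth_mulg2.
Qed.

Lemma smooth_Rintegral (m : {measure set (borel G) -> \bar R}) (Q : set G)
    (r f : G -> R) (M : R) :
  compact Q -> (m Q < +oo)%E ->
  measurable_fun (Q : set (borel G)) (r : borel G -> R) ->
  (forall z, Q z -> `|r z| <= M) -> smooth_fun f ->
  smooth_fun (fun x : G => \int[m]_(z in (Q : set (borel G))) (r z * f (x * z)%g)).
Proof.
move=> cQ Qfin mr rM fS c ac k; have [_ oc _ _ _] := chart_spec ac.
exact: (Ck_Rintegral cQ Qfin mr rM oc (JC_mulg k fS ac)).
Qed.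

End BorelG.

(** * One-parameter subgroups and the adjoint representation *)

Lemma near_forall (T : topologicalType) (x : T) (n : nat) (P : 'I_n -> T -> Prop) :
  (forall i, \forall y \near x, P i y) -> \forall y \near x, forall i, P i y.
Proof. by move=> H; apply: filter_forall => i; exact: H. Qed.

Section RealFacts.
Variable R : realType.

(** The interval only has to contain the points [s + t] with [|t| < 1] and [0 <= s <= 1] that occur
    in [fc_gam_derivable]. *)
Lemma antiderivative (f : R -> R) : continuous f ->
  exists F : R -> R, forall x, -2 < x < 2 -> is_derive (x : R^o) (1 : R^o) (F : R^o -> R^o) (f x).
Proof.
move=> cf.
exists (fun x => \int[lebesgue_measure]_(t in [set` `[(-3 : R), x]]) f t) => x /andP[x1 x2].
have fi : lebesgue_measure.-integrable `[(-3 : R), 3] (EFin \o f).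
  apply: continuous_compact_integrable; first exact: segment_compact.
  exact: continuous_subspaceT.
have x3 : x < 3 by lra.
have x3' : -3 < x by lra.
have [dF EF] := continuous_FTC1_closed x3 fi x3' (cf x).
by split; [exact: dF|rewrite -derive1E].
Qed.

Lemma is_derive0_near (A : R -> R) (l : R) : is_derive (0 : R^o) (1 : R^o) (A : R^o -> R^o) l ->
  A 0 = 0 -> forall e, 0 < e -> \forall t \near 0, `|A t - t * l| <= e * `|t|.
Proof.
move=> [dA <-] A0 e e0.
have /derivable_nbhsP/eqaddoP/(_ _ e0) := dA.
apply: filterS => h /=.
rewrite -[X in `|X|]/(A (h * 1 + 0) - (A 0 + h * 'D_1 A 0)).
by rewrite A0 add0r addr0 mulr1.
Qed.

(** The slope [l] may depend on [e]: the difference quotients satisfy the Cauchy criterion, and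
    their limit need not be known in advance. *)
Lemma derivable0P (f : R -> R) : f 0 = 0 ->
  (forall e, 0 < e -> exists l, \forall t \near 0, `|f t - t * l| <= e * `|t|) ->
  derivable (f : R^o -> R^o) 0 1.
Proof.
move=> f0 H; apply/cauchy_cvgP/cauchy_exP => e e0.
have e20 : 0 < e / 2 by rewrite divr_gt0.
have [l Hl] := H _ e20; exists l.
have : \forall t \near 0^', `|f t - t * l| <= e / 2 * `|t| by exact: cvg_within.
apply: filter_app; near=> t => Ht.
have t0 : t != 0 by near: t; exact: nbhs_dnbhs_neq.
rewrite -ball_normE/= f0 subr0 addr0 /GRing.scale/= mulr1.
have -> : l - t^-1 * f t = - (t^-1 * (f t - t * l)).
  by rewrite mulrBr mulKf// opprB.
rewrite normrN normrM normfV ltr_pdivrMl ?normr_gt0//.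
apply: (le_lt_trans Ht); rewrite mulrC ltr_pM2l ?normr_gt0//.
by rewrite ltr_pdivrMr// ltr_pMr// ltr1n.
Unshelve. all: by end_near. Qed.

(** The error is measured by the unknown functions themselves. A first application, with [w] small
    enough for absorption, shows that they are O(t); then the error is [w] times O(t) for every [w],
    and [derivable0P] applies. *)
Lemma derivable0_family (n : nat) (phi : 'I_n -> R -> R) :
  (forall i, phi i 0 = 0) ->
  (forall w, 0 < w -> exists A : 'I_n -> R -> R, exists l : 'I_n -> R,
    [/\ forall i, A i 0 = 0,
      forall i, is_derive (0 : R^o) (1 : R^o) (A i : R^o -> R^o) (l i) &
      \forall t \near 0, forall i, `|A i t - phi i t| <= w * \sum_j `|phi j t|]) ->
  forall i, derivable (phi i : R^o -> R^o) 0 1.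
Proof.
move=> phi0 H.
have n1 : 0 < n%:R + 1 :> R by rewrite ltr_wpDl.
have [C C0 HC] : exists2 C, 0 < C & \forall t \near 0, \sum_j `|phi j t| <= C * `|t|.
  (* With this [w] the [n] errors add up to at most half of the sum of the [|phi j t|], which is
     absorbed on the left. *)
  have w0 : 0 < 1 / (n%:R + 1) / 2 :> R by rewrite divr_gt0// divr_gt0.
  have [A [l [A0 dA HA]]] := H _ w0.
  pose D : R := \sum_j (`|l j| + 1).
  have D0 : 0 <= D by apply: sumr_ge0 => j _; rewrite addr_ge0.
  exists (2 * D + 1); first by rewrite ltr_wpDl// mulr_ge0.
  have HA2 : \forall t \near 0, forall i, `|A i t - t * l i| <= 1 * `|t|.
    by apply: near_forall => i; exact: is_derive0_near.
  apply: filterS2 HA HA2 => t HA HA2.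
  set M := \sum_j _.
  have M0 : 0 <= M by apply: sumr_ge0.
  have S1 : \sum_j `|A j t| <= D * `|t|.
    rewrite mulr_suml; apply: ler_sum => j _.
    rewrite -(subrK (t * l j) (A j t)) (le_trans (ler_normD _ _))//.
    by rewrite mulrDl addrC lerD// normrM mulrC.
  have S2 : \sum_j `|A j t - phi j t| <= M / 2.
    apply: (@le_trans _ _ (\sum_(j < n) M * (1 / (n%:R + 1)) / 2)).
      apply: ler_sum => j _; apply: (le_trans (HA j)).
      by rewrite mulrC mulrA.
    by rewrite -mulr_suml ler_pM2r ?invr_gt0// -[leRHS]mul1r; apply: sum_const_le.
  have S3 : M <= \sum_j `|A j t| + \sum_j `|A j t - phi j t|.
    rewrite -big_split/=; apply: ler_sum => j _.
    by rewrite -{1}(subKr (A j t) (phi j t)) ler_normB.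
  have := normr_ge0 t; nra.
move=> i; apply: derivable0P => // e e0.
have w0 : 0 < e / 2 / C by rewrite !divr_gt0.
have [A [l [A0 dA HA]]] := H _ w0; exists (l i).
have e20 : 0 < e / 2 by rewrite divr_gt0.
have HA2 := is_derive0_near (dA i) (A0 i) e20.
apply: filterS3 HA HA2 HC => t HA HA2 HC.
rewrite (splitr e) mulrDl -(subrK (A i t) (phi i t)) -addrA.
apply: (le_trans (ler_normD _ _)); rewrite lerD//.
rewrite distrC; apply: (le_trans (HA i)).
rewrite -mulrA ler_pM2l// ler_pdivrMl//.
Qed.

Lemma MVT_bound (g dg : R -> R) (e B : R) : 0 <= e ->
  (forall s, 0 <= s <= e -> is_derive (s : R^o) (1 : R^o) (g : R^o -> R^o) (dg s)) ->
  (forall s, 0 <= s <= e -> `|dg s| <= B) -> `|g e - g 0| <= B * e.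
Proof.
move=> e0 Hd HB.
have [||s s01 ->] := @MVT_segment R g dg 0 e e0.
- by move=> s; rewrite in_itv/= => /andP[s0 s1]; apply: Hd; rewrite !ltW.
- apply: continuous_in_subspaceT => s /set_mem; rewrite /= in_itv/= => s01.
  by apply: differentiable_continuous; apply/derivable1_diffP; have [] := Hd s s01.
rewrite subr0 normrM (ger0_norm e0) ler_wpM2r// HB//.
Qed.

End RealFacts.

Section ChartAtOne.
Variables (R : realType) (G : lieGroupType R).
Local Notation n := (@lie_dim R G).
Local Notation rV := ('rV[R]_n : normedModType R).

Lemma smooth_cutoff (c : chart R G n) (b : G -> R) (K : set G) (h : rV -> R^o) :
  atlas c -> smooth_fun b -> compact K -> K `<=` cdom c ->
  (forall y, ~ K y -> b y = 0) -> (forall k, C_k k (cimg c) h) ->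
  smooth_fun (fun x => b x * h (cmap c x)).
Proof.
move=> ac bS cK Kc bK hS.
have [oc oi Ec cc ci] := chart_spec ac.
have clK : closed K by apply: compact_closed => //; exact: lie_hausdorff.
apply/smooth_funP => y; have [cy|ncy] := pselect (cdom c y).
  exists c; split=> //; exists (cimg c); split=> //; first exact: cimg_cmap.
  move=> k; apply: (Ck_ext oi _ (Ck_mul oi (bS c ac k) (hS k))) => z cz /=.
  by have [_ ->] := cimgP ac cz.
have [d ad dy] := atlas_cover y; have [_ od Kd _ cd] := chart_spec ad.
have oA : open (cimg d `&` cinv d @^-1` (~` K)).
  by apply: open_setI_preimage => //; exact: closed_openC.
exists d; split=> //; exists (cimg d `&` cinv d @^-1` (~` K)); split=> //.
- by split; [exact: cimg_cmap|rewrite /= Kd// => /Kc].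
- move=> k; apply: (@Ck_ext _ _ _ _ _ (cst 0)) => //; last exact: Ck_cst.
  by move=> z [_ /= /bK ->]; rewrite mul0r.
Qed.

(** The mean value theorem for [x |-> f (x q) - f (x q0)] in the chart: its partial derivatives are
    small for [q] near [q0], by joint continuity. *)
Lemma increment_estimate (c : chart R G n) (f : G -> R) (x0 q0 : G) (e : R) :
  atlas c -> cdom c x0 -> smooth_fun f -> 0 < e ->
  \forall q \near q0 & x \near x0,
    `|f (x * q)%g - f (x0 * q)%g - (f (x * q0)%g - f (x0 * q0)%g)|
      <= e * `|cmap c x - cmap c x0|.
Proof.
move=> ac cx0 fS e0.
have [oc oi Ec cc ci] := chart_spec ac.
pose F (q : G) (y : rV) : R^o := f (cinv c y * q)%g.
have JF := JC_mulg 1 fS ac; rewrite -/F in JF.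
have [_ [dF DF]] := JF.
set y0 := cmap c x0.
have cy0 : cimg c y0 by exact: cimg_cmap.
have en : 0 < e / (n%:R + 1) / 2 by rewrite !divr_gt0// ltr_wpDl.
have FP : Filter (nbhs (q0, y0)) by exact: nbhs_filter.
have H : \forall p \near (q0, y0), forall i : 'I_n,
    `|'D_(delta_mx ord0 i) (F q0) y0 - 'D_(delta_mx ord0 i) (F p.1) p.2| <= e / (n%:R + 1) / 2.
  apply: (@filter_forall _ _ (fun i (p : G * rV) => `|'D_(delta_mx ord0 i) (F q0) y0 - 'D_(delta_mx ord0 i) (F p.1) p.2| <= e / (n%:R + 1) / 2) _ FP) => i.
  move: (proj1 (DF (delta_mx ord0 i)) q0 y0 cy0) => /(@cvgrPdist_le _ _ _ _ FP)/(_ _ en).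
  by apply: filterS.
have [[U V] /= [Oq0 Vy0] OV] := H.
have : nbhs y0 (V `&` cimg c).
  have FF : Filter (nbhs y0) by exact: nbhs_filter.
  by apply: (@filterI _ _ FF) => //; exact: open_nbhs_nbhs.
move=> /(@nbhs_ballP _ rV)[d /= d0 Hd].
have Od : \forall x \near x0, cdom c x /\ ball y0 d (cmap c x).
  apply: filterI; first exact: open_nbhs_nbhs.
  by apply: (cc _ cx0); exact: nbhsx_ballx.
exists (U, [set x | cdom c x /\ ball y0 d (cmap c x)]) => //= -[q x] /= [Oq [cx bx]].
set h := cmap c x - y0.
have hE : 1 *: h + y0 = cmap c x by rewrite scale1r subrK.
have hd : `|h| < d by move: bx; rewrite -ball_normE/= distrC.
have Hs t : 0 <= t <= 1 -> (V `&` cimg c) (t *: h + y0).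
  move=> /andP[t0 t1]; apply: Hd; rewrite -ball_normE/= opprD addrA addrAC subrr add0r normrN.
  by rewrite normrZ ger0_norm// (le_lt_trans _ hd)// ler_piMl.
have E x' : cdom c x' -> forall q', f (x' * q')%g = F q' (cmap c x').
  by move=> cx' q'; rewrite /F Ec.
rewrite !E// -hE -/y0 -[X in _ - F q X - _](add0r y0) -[X in _ - (_ - F q0 X)](add0r y0).
rewrite -(scale0r h).
(* The segment between the images of [x0] and [x] in the chart, parametrized by [[0, 1]]. *)
pose g (t : R) : R := F q (t *: h + y0) - F q0 (t *: h + y0).
pose dg (t : R) : R := 'D_h (F q) (t *: h + y0) - 'D_h (F q0) (t *: h + y0).
have -> : F q (1 *: h + y0) - F q (0 *: h + y0) - (F q0 (1 *: h + y0) - F q0 (0 *: h + y0)) =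
    g 1 - g 0 by rewrite /g !opprB addrACA [in RHS]addrACA; congr (_ + _); rewrite addrC.
rewrite -[leRHS]mulr1; apply: (@MVT_bound R g dg) => // t t01.
  have [_ Ut] := Hs _ t01.
  apply: is_deriveB; apply: (@is_derive_line _ rV R^o); exact/diff_derivable/dF.
have [Vt Ut] := Hs _ t01.
rewrite /dg !derive_rVE; [|exact: dF|exact: dF].
rewrite -sumrB; apply: (le_trans (ler_norm_sum _ _ _)).
apply: (@le_trans _ _ (\sum_(i < n) `|h| * (e / (n%:R + 1)))); last first.
  by apply: sum_const_le => //; exact: ltW.
apply: ler_sum => i _; rewrite -mulrBr normrM; apply: ler_pM => //.
  by rewrite [leRHS]mx_normrE; apply: (le_bigmax _ _ (ord0, i)).
rewrite -(subrK ('D_(delta_mx ord0 i) (F q0) y0) ('D_(delta_mx ord0 i) (F q) _)) -addrA.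
apply: (le_trans (ler_normD _ _)); rewrite [leRHS]splitr lerD//.
  by rewrite distrC; apply: (OV (q, _) _ i); split.
apply: (OV (q0, _) _ i); split=> //=; exact: nbhs_singleton.
Qed.

End ChartAtOne.

Lemma is_derive_mulr (R : realType) (c s : R) :
  is_derive (s : R^o) (1 : R^o) ((fun s => s * c) : R^o -> R^o) c.
Proof.
have H := is_deriveZ c (is_derive_id (s : R^o) (1 : R^o)).
rewrite (_ : (fun s => s * c) = c \*: id); last by apply/funext => t; rewrite mulrC.
by apply: (is_derive_eq H); rewrite /GRing.scale/= mulr1.
Qed.

Lemma is_derive_compd (R : realType) (V : normedModType R) (cu : R^o -> V)
    (F : V -> R^o) (t : R^o) : derivable cu t 1 -> differentiable F (cu t) ->
  is_derive t (1 : R^o) (F \o cu) ('D_('D_1 cu t) F (cu t)).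
Proof.
move=> /derivable1_diffP dcu dF.
have dcomp : differentiable (F \o cu) t by exact: differentiable_comp.
split; first exact: diff_derivable.
by rewrite deriveE// diff_comp//= -(deriveE _ dcu) -deriveE.
Qed.

Lemma JC_derive (R : realType) (G : lieGroupType R) (T : topologicalType) k
    (U : set ('rV[R]_(@lie_dim R G) : normedModType R)) (F : T -> _ -> R^o) v :
  JC k.+1 U F -> JC k U (fun q y => 'D_v (F q) y).
Proof. by move=> [_ [_ H]]; exact: H. Qed.

Section OneParameterSubgroups.
Variables (R : realType) (G : lieGroupType R) (g : lieAlgebra G).
Local Notation n := (@lie_dim R G).
Local Notation rV := ('rV[R]_n : normedModType R).
Local Notation gam X t := (lie_exp g (t *: X)).

Lemma lie_exp0 : lie_exp g 0 = 1%g.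
Proof.
have := @lie_expD _ _ g 0 0 0; rewrite !scaler0 => /(congr1 (fun x => (lie_exp g 0)^-1 * x)%g).
by rewrite mulVg mulgA mulVg mul1g.
Qed.

Lemma gamN X (t : R) : gam X (- t) = (gam X t)^-1%g.
Proof.
apply: (@mulgI _ (gam X t)).
by rewrite -lie_expD subrr scale0r lie_exp0 mulgV.
Qed.

Variables (c0 : chart R G n) (b : G -> R) (Kb : set G).
Hypotheses (ac0 : atlas c0) (c01 : cdom c0 1%g) (bS : smooth_fun b) (b1 : 0 < b 1%g)
  (cKb : compact Kb) (Kb0 : Kb `<=` cdom c0) (bK : forall y, ~ Kb y -> b y = 0).
Let y0 := cmap c0 1%g.

(** The coordinates of [c0] centred at 1, cut off by the bump function [b] so as to be smooth on the
    whole group; where [b] is positive they determine the coordinates. *)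
Definition fc (i : 'I_n) (x : G) : R := b x * (cmap c0 x ord0 i - y0 ord0 i).

Lemma fc_smooth i : smooth_fun (fc i).
Proof.
apply: (smooth_cutoff (h := fun y : rV => y ord0 i - y0 ord0 i) ac0 bS cKb Kb0 bK) => k.
apply: (@Ck_sub _ _ _ _ setT) => //.
have lc : linear (fun w : rV => w ord0 i : R^o) by move=> a u v; rewrite !mxE.
pose L : {linear rV -> R^o} := HB.pack (fun w : rV => w ord0 i : R^o)
  (GRing.isLinear.Build R rV R^o _ _ lc).
apply: Ck_add; [exact: openT| |exact: Ck_cst].
by apply: (@Ck_lin _ _ _ _ _ L) => z; exact: coord_continuous.
Qed.

Lemma fc1 i : fc i 1%g = 0.
Proof. by rewrite /fc subrr mulr0. Qed.

Lemma gam_near X (O : set G) : nbhs 1%g O -> \forall t \near (0 : R), O (gam X t).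
Proof.
move=> O1; have := @lie_exp_continuous _ _ g X 0.
by apply; rewrite scale0r lie_exp0.
Qed.

Lemma cmap_le : exists2 k, 0 < k & \forall x \near (1%g : G),
  [/\ cdom c0 x, 0 < b x & `|cmap c0 x - y0| <= k * \sum_j `|fc j x|].
Proof.
exists (2 / b 1%g); first by rewrite divr_gt0.
have [oc _ _ cc _] := chart_spec ac0.
have bc : {for 1%g, continuous b} by exact: smooth_continuous.
have Hb : \forall x \near (1%g : G), b 1%g / 2 < b x.
  by apply: (cvgr_gt _ bc); rewrite ltr_pdivrMr// ltr_pMr// ltr1n.
have Hc : \forall x \near (1%g : G), cdom c0 x by exact: open_nbhs_nbhs.
apply: filterS2 Hb Hc => x Hb Hc.
have bx0 : 0 < b x by apply: lt_trans Hb; rewrite divr_gt0.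
split=> //; rewrite [leLHS]mx_normrE.
apply/bigmax_leP; split=> [|[i j] _ /=].
  by rewrite mulr_ge0 ?sumr_ge0// divr_ge0// ltW.
rewrite !mxE !ord1 (bigD1 j)//= mulrDr.
rewrite -[leLHS]addr0 lerD//; last by rewrite mulr_ge0 ?sumr_ge0// divr_ge0// ltW.
rewrite /fc normrM (gtr0_norm bx0) mulrA ler_peMl//.
by rewrite mulrAC ler_pdivlMr// mul1r mulrC -ler_pdivrMr// ltW.
Qed.

(** A continuous one-parameter subgroup is differentiable. Its coordinates satisfy
    [phi (s + t) - phi s ~ phi t] by [increment_estimate] at 1. The mean of the left-hand side over
    [0 <= s <= ep] is differentiable in [t], being a difference of primitives, and approximates
    [phi t] in the sense of [derivable0_family]. *)
Lemma fc_gam_derivable X i :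
  derivable ((fun t => fc i (gam X t)) : R^o -> R^o) 0 1.
Proof.
apply: (@derivable0_family R n (fun i t => fc i (gam X t))) => {i}[i|w w0].
  by rewrite scale0r lie_exp0 fc1.
have [k k0 Hk] := cmap_le.
have wk : 0 < w / k by rewrite divr_gt0.
have : exists2 U : set G, nbhs 1%g U & exists2 V : set G, nbhs 1%g V &
    forall q x, U q -> V x -> forall i,
      `|fc i (x * q)%g - fc i q - fc i x| <= w / k * `|cmap c0 x - y0|.
  have FP : Filter (nbhs (1%g : G, 1%g : G)) by exact: nbhs_filter.
  have : \forall p \near (1%g : G, 1%g : G), forall i,
      `|fc i (p.2 * p.1)%g - fc i p.1 - fc i p.2| <= w / k * `|cmap c0 p.2 - y0|.
    apply: near_forall => i.
    have := increment_estimate 1%g ac0 c01 (fc_smooth i) wk.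
    by apply: filterS => -[q x] /=; rewrite mul1g !mulg1 fc1 subr0.
  by move=> [[U V] /= [U1 V1] H]; exists U => //; exists V => // q x Uq Vx i; exact: (H (q, x)).
move=> [U U1 [V V1 UV]].
have /nbhs_ballP[e /= e0 He] := gam_near X U1.
pose ep := Num.min (e / 2) 1.
have ep0 : 0 < ep by rewrite lt_min ltr01 divr_gt0.
have ep1 : ep <= 1 by rewrite ge_min lexx orbT.
have epe s : 0 <= s <= ep -> U (gam X s).
  move=> /andP[s0 s1]; apply: He; rewrite -ball_normE/= sub0r normrN ger0_norm//.
  apply: (le_lt_trans s1); rewrite /ep gt_min ltr_pdivrMr// ltr_pMr// ltr1n//.
have cphi i : continuous (fun t : R => fc i (gam X t)).
  move=> t; apply: continuous_comp; first exact: lie_exp_continuous.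
  exact: smooth_continuous (fc_smooth i) _.
pose P i := sval (cid (antiderivative (cphi i))).
have dP i x : -2 < x < 2 -> is_derive (x : R^o) (1 : R^o) (P i : R^o -> R^o) (fc i (gam X x)).
  exact: (svalP (cid (antiderivative (cphi i)))).
have dPs i a x : -2 < x + a < 2 ->
    is_derive (x : R^o) (1 : R^o) ((fun x => P i (x + a)) : R^o -> R^o) (fc i (gam X (x + a))).
  move=> xa; have [d1 d2] := dP i _ xa.
  have := @is_derive_line R R^o R^o (P i) a 1 x.
  by rewrite /GRing.scale/= mulr1 d2; under eq_fun do rewrite mulr1; apply.
exists (fun i t => (P i (t + ep) - P i t - (P i ep - P i 0)) / ep).
exists (fun i => (fc i (gam X ep) - fc i (gam X 0)) / ep).
split=> [i|i|].
- by rewrite add0r subrr mul0r.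
- have ep2 : -2 < 0 + ep < 2 by rewrite add0r; lra.
  have d1 := dPs i ep 0 ep2; rewrite add0r in d1.
  have d2 : is_derive (0 : R^o) (1 : R^o) (P i : R^o -> R^o) (fc i (gam X 0)).
    by apply: dP; lra.
  have d3 := is_deriveB (is_deriveB d1 d2) (is_derive_cst (P i ep - P i 0 : R^o) (0 : R^o) 1).
  have d4 := is_deriveZ ep^-1 d3.
  rewrite (_ : (fun t => _) = ep^-1 \*: ((fun x => P i (x + ep)) - P i - cst (P i ep - P i 0))).
    by apply: (is_derive_eq d4); rewrite subr0 /GRing.scale/= mulrC.
  by apply/funext => t; rewrite mulrC.
have Hk2 := gam_near X Hk; have HV := gam_near X V1.
have H1 : \forall t \near (0 : R), `|t| < 1.
  by apply/nbhs_ballP; exists 1 => //= t; rewrite -ball_normE/= sub0r normrN.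
apply: filterS3 Hk2 HV H1 => t [_ _ Hk2] HV H1 i.
have {}H1 : -1 < t < 1 by rewrite -ltr_norml.
(* [gg ep - gg 0] is [ep] times the error of the approximation, and the derivative of [gg] is the
   defect of additivity, bounded by [UV]. *)
pose gg s := P i (s + t) - P i s - s * fc i (gam X t).
pose dgg s := fc i (gam X (s + t)) - fc i (gam X s) - fc i (gam X t).
have Hg : `|gg ep - gg 0| <= (w / k * `|cmap c0 (gam X t) - y0|) * ep.
  apply: (@MVT_bound _ gg dgg) => [|s /andP[s0 s1]|s s01]; first exact: ltW.
    apply: is_deriveB; last first.
      exact: is_derive_mulr.
    by apply: is_deriveB; [apply: dPs; lra|apply: dP; lra].
  by rewrite /dgg (addrC s) lie_expD; exact: (UV _ _ (epe _ s01) HV i).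
rewrite -(ler_pM2r ep0) -[X in _ * X <= _](gtr0_norm ep0) -normrM mulrBl divfK ?gt_eqF//.
have -> : P i (t + ep) - P i t - (P i ep - P i 0) - fc i (gam X t) * ep = gg ep - gg 0.
  by rewrite /gg mul0r subr0 add0r (addrC ep t); ring.
apply: (le_trans Hg); rewrite ler_pM2r//.
by rewrite -mulrA ler_pM2l// ler_pdivrMl.
Qed.

Lemma coord_gam X i : is_derive (0 : R^o) (1 : R^o)
  ((fun t => cmap c0 (gam X t) ord0 i) : R^o -> R^o)
  ('D_1 ((fun t => fc i (gam X t)) : R^o -> R^o) 0 / b 1%g).
Proof.
have [k k0 Hk] := cmap_le; have {}Hk := gam_near X Hk.
have Hl := @fc_gam_derivable X i.
have cb : (b (gam X h))^-1 @[h --> (0 : R)^'] --> (b 1%g)^-1.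
  apply: cvgV; first by rewrite gt_eqF.
  apply: cvg_within_filter; rewrite -{1}lie_exp0 -(scale0r X).
  have H : {for (0 : R), continuous (fun t : R => b (gam X t))}.
    by apply: continuous_comp; [exact: lie_exp_continuous|exact: smooth_continuous].
  exact: H.
have FF : Filter (0 : R)^' by apply: (@filter_filter _ (0 : R)^'); exact: Proper_dnbhs_numFieldType.
have H := @cvgM R R (0 : R)^' FF _ _ _ _ Hl cb.
suff L : h^-1 *: ((((fun t => cmap c0 (gam X t) ord0 i) : R^o -> R^o) \o shift (0 : R^o)) (h *: (1 : R^o)) -
    cmap c0 (gam X 0) ord0 i) @[h --> (0 : R)^'] --> ('D_1 ((fun t => fc i (gam X t)) : R^o -> R^o) 0 / b 1%g : R^o).
  by split; [apply/cvg_ex; eexists; exact: L|exact: cvg_lim L].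
apply: cvg_trans H; apply: near_eq_cvg.
have {}Hk : \forall t \near (0 : R)^', [/\ cdom c0 (gam X t), 0 < b (gam X t)
    & `|cmap c0 (gam X t) - y0| <= k * \sum_j `|fc j (gam X t)|].
  exact: cvg_within.
apply: filterS Hk => t [_ bt _] /=.
rewrite addr0 !scale0r lie_exp0 fc1 subr0 /GRing.scale/= !mulr1 /fc.
by rewrite -mulrA mulrAC mulfV ?mul1r// gt_eqF.
Qed.

Lemma chart_gam_derivable X :
  derivable ((fun t => cmap c0 (gam X t)) : R^o -> rV) 0 1.
Proof.
apply/derivable_mxP => i0 i; rewrite ord1 {i0}.
by have [] := coord_gam X i.
Qed.

(** The tangent vector of the one-parameter subgroup of [X] at 1, read in the chart [c0]. *)
Definition tau X : rV := 'D_1 ((fun t => cmap c0 (gam X t)) : R^o -> rV) 0.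

Lemma smooth_chart_at f x k : smooth_fun f ->
  C_k k (cimg c0) ((fun y => f (x * cinv c0 y)%g) : rV -> R^o).
Proof. by move=> fS; exact: (smooth_mull x fS ac0 k). Qed.

Lemma cy0 : cimg c0 y0. Proof. exact: cimg_cmap. Qed.

Lemma lderiv_chart f x X : smooth_fun f ->
  is_derive (0 : R^o) (1 : R^o) ((fun t => f (x * gam X t)%g) : R^o -> R^o)
    ('D_(tau X) ((fun y => f (x * cinv c0 y)%g) : rV -> R^o) y0).
Proof.
move=> fS; set F := (fun y : rV => _ : R^o).
have dF : differentiable F y0 by have [dF _] := smooth_chart_at x 1 fS; exact: dF cy0.
have [_ _ E _ _] := chart_spec ac0.
pose cu := (fun t => cmap c0 (gam X t)) : R^o -> rV.
have cu0 : cu 0 = y0 by rewrite /cu scale0r lie_exp0.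
rewrite -cu0 in dF *.
apply: (@near_eq_is_derive R R^o R^o (F \o cu)); last first.
  by apply: is_derive_compd => //; exact: chart_gam_derivable.
have [oc _ _ _ _] := chart_spec ac0.
have := gam_near X (open_nbhs_nbhs (conj oc c01)).
by apply: filterS => t ct; rewrite /F /cu /= E.
Qed.

Lemma lderivE f x X : smooth_fun f ->
  lderiv (lie_exp g) X f x = 'D_(tau X) ((fun y => f (x * cinv c0 y)%g) : rV -> R^o) y0.
Proof.
by move=> fS; have [_ <-] := lderiv_chart x X fS; rewrite /lderiv derive1E.
Qed.

Lemma lderiv_at f x X (t : R) : smooth_fun f ->
  is_derive (t : R^o) (1 : R^o) ((fun t => f (x * gam X t)%g) : R^o -> R^o)
    (lderiv (lie_exp g) X f (x * gam X t)%g).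
Proof.
move=> fS; rewrite (lderivE _ _ fS).
have := lderiv_chart (x * gam X t)%g X fS.
set F := (fun s => f (x * gam X t * gam X s)%g) : R^o -> R^o.
set F2 := (fun s => f (x * gam X s)%g) : R^o -> R^o.
have E : (fun h : R => h^-1 *: ((F2 \o shift (t : R^o)) (h *: (1 : R^o)) - F2 t)) =
    (fun h : R => h^-1 *: ((F \o shift (0 : R^o)) (h *: (1 : R^o)) - F 0)).
  apply/funext => h /=; rewrite /F /F2 addr0 scale0r lie_exp0 mulg1.
  by rewrite (addrC _ t) lie_expD mulgA /GRing.scale/= mulr1.
by move=> [d1 d2]; split; rewrite /derivable /derive ?E.
Qed.

Lemma lderiv_fc X i : lderiv (lie_exp g) X (fc i) 1%g = b 1%g * tau X ord0 i.
Proof.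
have -> : tau X ord0 i = 'D_1 ((fun t => fc i (gam X t)) : R^o -> R^o) 0 / b 1%g.
  rewrite /tau derive_mx; last exact: chart_gam_derivable.
  by rewrite mxE; have [_ ->] := coord_gam X i.
rewrite mulrCA mulfV ?mulr1 ?gt_eqF// /lderiv derive1E.
by under eq_fun do rewrite mul1g.
Qed.

Lemma tau_linear (a : R) X Y : tau (a *: X + Y) = a *: tau X + tau Y.
Proof.
apply/rowP => i; rewrite !mxE; apply: (mulfI (lt0r_neq0 b1)).
rewrite -lderiv_fc lie_linear; last exact: fc_smooth.
by rewrite !lderiv_fc mulrDr mulrCA.
Qed.

Lemma smooth_eq (x y : G) : (forall f, smooth_fun f -> f x = f y) -> x = y.
Proof.
move=> H; apply: contrapT => xy.
have oO : open (~` [set y]).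
  apply: closed_openC; apply: accessible_closed_set1.
  exact/hausdorff_accessible/lie_hausdorff.
have [f [fS _ fx [K [_ KO fK]]]] := smooth_bump oO xy.
move: fx; rewrite (H _ fS) fK ?ltxx// => Ky.
by have := KO _ Ky; apply.
Qed.

(** If the velocity is 0, every smooth function is constant along the subgroup, which is therefore
    trivial since smooth functions separate points; the uniqueness in [lie_exp_onto] gives
    [X = 0]. *)
Lemma tau_inj0 X : tau X = 0 -> X = 0.
Proof.
move=> tX.
have gc t : gam X t = 1%g.
  apply: smooth_eq => f fS.
  have D0 (s : R) : is_derive (s : R^o) (1 : R^o) ((fun t => f (1 * gam X t)%g) : R^o -> R^o) 0.
    apply: (is_derive_eq (lderiv_at 1%g X s fS)); rewrite lderivE// tX.
    exact: derive0.
  have := is_derive_0_is_cst t 0 D0.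
  by rewrite !mul1g scale0r lie_exp0.
have [|s t|Z [_ ZU]] := @lie_exp_onto _ _ g (cst 1%g); first exact: cst_continuous.
  by rewrite /= mulg1.
by rewrite -(ZU X) ?(ZU 0)// => t; rewrite ?scaler0 ?lie_exp0// gc.
Qed.

(** In charts [LD X f] is a partial derivative, along [(0, tau X)], of the smooth function of two
    variables given by [f] of the product. *)
Lemma lderiv_smooth f X : smooth_fun f -> smooth_fun (lderiv (lie_exp g) X f).
Proof.
move=> fS c ac k; have [_ oc _ _ _] := chart_spec ac.
have PS := smooth_mulg2 fS ac ac0.
set P := (fun p : rV * rV => f (cinv c p.1 * cinv c0 p.2)%g : R^o) in PS.
have [dP DP] := PS k.+1.
have Pr : C_k k (cimg c) ((fun y => (y, y0)) : rV -> rV * rV).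
  apply: Ck_pair => //; last exact: Ck_cst.
  by apply: (@Ck_lin _ _ _ _ _ (idfun : {linear rV -> rV})) => z; exact: cvg_id.
have H := @Ck_comp R rV (rV * rV)%type k (cimg c) (cimg c `*` cimg c0) (fun y => (y, y0))
  (fun p => 'D_(0, tau X) P p)
  (has_coords_prod (has_coords_rV R n) (has_coords_rV R n)) oc
  (fun y cy => conj cy cy0) Pr (DP (0, tau X)).
apply: (Ck_ext oc _ H) => y cy /=; rewrite lderivE//.
by rewrite -derive_slice//; apply: dP; split=> //; exact: cy0.
Qed.

(** Near [q] the coordinate is [fc i / b + y0 i], and the quotient rule applies. The resulting value
    is expressed by derivatives at 1 so that its continuity in [q] is visible. *)
Lemma coord_gam_mul X q i : cdom c0 q -> 0 < b q ->
  is_derive (0 : R^o) (1 : R^o)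
    ((fun t => cmap c0 (gam X t * q)%g ord0 i) : R^o -> R^o)
    ((lderiv (lie_exp g) X (fun x => fc i (x * q)%g) 1%g * b q -
      fc i q * lderiv (lie_exp g) X (fun x => b (x * q)%g) 1%g) / b q ^+ 2).
Proof.
move=> cq bq.
have d1 := lderiv_at 1%g X 0 (smooth_mulr q (fc_smooth i)).
have d2 := lderiv_at 1%g X 0 (smooth_mulr q bS).
rewrite scale0r lie_exp0 mulg1 in d1 d2.
have b0 : b (1 * gam X 0 * q)%g != 0 by rewrite scale0r lie_exp0 !mul1g gt_eqF.
have d3 := is_deriveM d1 (is_deriveV b0 d2).
have d4 := is_deriveD d3 (is_derive_cst (y0 ord0 i : R^o) (0 : R^o) (1 : R^o)).
have [oc _ _ _ _] := chart_spec ac0.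
have tq : {for (0 : R), continuous (fun t : R => (gam X t * q)%g)}.
  apply: mulg_continuous_at; [exact: lie_exp_continuous|exact: cvg_cst].
have bc : \forall t \near (0 : R), 0 < b (gam X t * q)%g.
  have : {for (0 : R), continuous (fun t : R => b (gam X t * q)%g)}.
    by apply: continuous_comp; [exact: tq|exact: smooth_continuous].
  by move=> /cvgr_gt; apply; rewrite scale0r lie_exp0 mul1g.
have E : \forall t \near (0 : R^o), ((fun t => fc i (1 * gam X t * q)%g) *
   (fun t => (b (1 * gam X t * q)%g)^-1) + cst (y0 ord0 i)) t = cmap c0 (gam X t * q)%g ord0 i.
  apply: filterS bc => t bt.
  rewrite -[LHS]/(fc i (1 * gam X t * q)%g * (b (1 * gam X t * q)%g)^-1 + y0 ord0 i).
  by rewrite mul1g /fc mulrC mulKf ?gt_eqF// subrK.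
apply: (is_derive_eq (near_eq_is_derive E d4)).
rewrite !scale0r lie_exp0 !mul1g addr0 /GRing.scale/=.
by field; rewrite gt_eqF.
Qed.

(** The quantity is the derivative of [f] at 1 along [t |-> x gam X t x^-1], so this is the
    continuity at 1 of the adjoint representation, tested on [f]. The chain rule through the chart
    at [x^-1] gives the finite sum [E] of continuous terms. *)
Lemma lderiv_conj_continuous f X : smooth_fun f ->
  {for (1%g : G), continuous (fun x : G => lderiv (lie_exp g) X (fun u => f (u * x^-1)%g) x)}.
Proof.
move=> fS.
pose V i q : R := (lderiv (lie_exp g) X (fun x => fc i (x * q)%g) 1%g * b q -
      fc i q * lderiv (lie_exp g) X (fun x => b (x * q)%g) 1%g) / b q ^+ 2.
pose F (x : G) (y : rV) : R^o := f (x * cinv c0 y)%g.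
have [_ [dF DF]] := JC_mulgl 1 fS ac0; rewrite -/F in dF DF.
pose E (x : G) : R := \sum_i V i x^-1%g * 'D_(delta_mx ord0 i) (F x) (cmap c0 x^-1%g).
have [oc _ Ec cc _] := chart_spec ac0.
have [k k0 Hk] := cmap_le.
have iv1 : (x^-1)%g @[x --> (1%g : G)] --> (1%g : G).
  by have := @invg_continuous R G 1%g; rewrite /continuous_at invg1.
have {}Hk : \forall x \near (1%g : G), cdom c0 x^-1%g /\ 0 < b x^-1%g.
  have : \forall x \near (1%g : G), cdom c0 x /\ 0 < b x by apply: filterS Hk => x [].
  by move=> /iv1.
apply: (@near_eq_continuous _ _ E).
  apply: filterS Hk => x [cx bx].
  pose cu := (fun t => cmap c0 (gam X t * x^-1)%g) : R^o -> rV.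
  have dcu : derivable cu 0 1.
    by apply/derivable_mxP => i0 i; rewrite ord1; have [] := coord_gam_mul X i cx bx.
  have cu0 : cu 0 = cmap c0 x^-1%g by rewrite /cu scale0r lie_exp0 mul1g.
  have dFx : differentiable (F x) (cu 0) by rewrite cu0; apply: dF; exact: cimg_cmap.
  have dcomp := is_derive_compd dcu dFx.
  have nE : \forall t \near (0 : R^o), (F x \o cu) t = f (x * gam X t * x^-1)%g.
    have tq : {for (0 : R), continuous (fun t : R => (gam X t * x^-1)%g)}.
      apply: mulg_continuous_at; [exact: lie_exp_continuous|exact: cvg_cst].
    have : \forall t \near (0 : R), cdom c0 (gam X t * x^-1)%g.
      by apply: tq; rewrite scale0r lie_exp0 mul1g; exact: open_nbhs_nbhs.
    by apply: filterS => t ct; rewrite /F /cu /= Ec// mulgA.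
  have [_ DE] := near_eq_is_derive nE dcomp.
  rewrite /lderiv derive1E DE cu0.
  rewrite derive_rVE; last by apply: dF; exact: cimg_cmap.
  apply: eq_bigr => i _; congr (_ * _).
  rewrite derive_mx// mxE; have [_ ->] := coord_gam_mul X i cx bx.
  by [].
have cL f' : smooth_fun f' -> continuous (fun q => lderiv (lie_exp g) X (fun x => f' (x * q)%g) 1%g).
  move=> f'S.
  have H := JC_contl (JC_derive (tau X) (JC_mulg 1 f'S ac0)) cy0.
  rewrite (_ : (fun q => _) = (fun q => 'D_(tau X) ((fun y => f' (cinv c0 y * q)%g) : rV -> R^o) y0))//.
  apply/funext => q; rewrite (lderivE _ _ (smooth_mulr q f'S)).
  by under eq_fun do rewrite mul1g.
have cV i : {for (1%g : G), continuous (fun x => V i x^-1%g)}.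
  apply: (@continuous_comp _ _ _ (fun x : G => x^-1%g) (V i)); first exact: invg_continuous.
  rewrite invg1 /V.
  have cb : {for (1%g : G), continuous b} by exact: smooth_continuous.
  have cf : {for (1%g : G), continuous (fc i)} by exact: smooth_continuous (fc_smooth i) _.
  have c1 := cL _ (fc_smooth i) 1%g; have c2 := cL _ bS 1%g.
  apply: continuousM.
    by apply: continuousB; apply: continuousM.
  apply: continuousV; first by rewrite expf_neq0// gt_eqF.
  exact: (continuousM cb cb).
have c1 : {for (1%g : G), continuous (fun x : G => cmap c0 x^-1%g)}.
  apply: (@continuous_comp _ _ _ (fun x : G => x^-1%g) (cmap c0)); first exact: invg_continuous.
  by rewrite invg1; exact: cc.
have cD i : {for (1%g : G), continuous (fun x => 'D_(delta_mx ord0 i) (F x) (cmap c0 x^-1%g))}.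
  apply: (@continuous_comp _ _ _ (fun x : G => (x, cmap c0 x^-1%g))
    (fun p : G * rV => 'D_(delta_mx ord0 i) (F p.1) p.2)).
    exact: (cvg_pair cvg_id c1).
  rewrite invg1; exact: (proj1 (DF (delta_mx ord0 i)) _ _ cy0).
apply: continuous_sum_at => i.
by apply: continuousM; [exact: cV|exact: cD].
Qed.

End OneParameterSubgroups.

Section RealFacts2.
Variable R : realType.

Lemma is_derive0_of_near (A : R -> R) (l : R) : A 0 = 0 ->
  (forall e, 0 < e -> \forall t \near 0, `|A t - t * l| <= e * `|t|) ->
  is_derive (0 : R^o) (1 : R^o) (A : R^o -> R^o) l.
Proof.
move=> A0 H.
suff L : h^-1 *: (((A : R^o -> R^o) \o shift (0 : R^o)) (h *: (1 : R^o)) - A 0) @[h --> (0 : R)^'] --> (l : R^o).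
  by split; [apply/cvg_ex; exists l|exact: cvg_lim L].
apply/cvgrPdist_le => e e0.
have : \forall t \near 0^', `|A t - t * l| <= e * `|t| by apply: cvg_within; exact: H.
apply: filter_app; near=> t => Ht.
have t0 : t != 0 by near: t; exact: nbhs_dnbhs_neq.
rewrite /= A0 subr0 addr0 /GRing.scale/= mulr1.
have -> : l - t^-1 * A t = - (t^-1 * (A t - t * l)).
  by rewrite mulrBr mulKf// opprB.
by rewrite normrN normrM normfV ler_pdivrMl ?normr_gt0// [leRHS]mulrC.
Unshelve. all: by end_near. Qed.

Lemma near0_ball (P : R -> Prop) : (\forall s \near 0, P s) ->
  exists2 d : R, 0 < d & forall s, `|s| < d -> P s.
Proof.
move=> /nbhs_ballP[d /= d0 Hd]; exists d => // s sd; apply: Hd.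
by rewrite -ball_normE/= sub0r normrN.
Qed.

Lemma exists_small (d d' : R) : 0 < d -> 0 < d' ->
  exists s : R, [/\ 0 < s, `|s| < d & `|s| < d'].
Proof.
move=> d0 d'0; exists (Num.min d d' / 2).
have m0 : 0 < Num.min d d' by rewrite lt_min d0.
have md : Num.min d d' <= d by rewrite ge_min lexx.
have md' : Num.min d d' <= d' by rewrite ge_min lexx orbT.
set m := Num.min d d' in m0 md md' *.
have m20 : 0 < m / 2 by lra.
by rewrite gtr0_norm//; split; lra.
Qed.

(** Since [e] vanishes at 0, continuity of [z] is enough for the product rule. In
    [lderiv_Ad_derive], [z] is a coordinate of [Ad (gam X t) Y], whose derivative is the one to be
    found. *)
Lemma is_derive0_mulc (z e : R -> R) (l : R) : {for 0, continuous z} -> e 0 = 0 ->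
  is_derive (0 : R^o) (1 : R^o) (e : R^o -> R^o) l ->
  is_derive (0 : R^o) (1 : R^o) ((fun t => z t * e t) : R^o -> R^o) (z 0 * l).
Proof.
move=> cz e0 de; apply: is_derive0_of_near => [|w w0]; first by rewrite e0 mulr0.
have M0 : 0 < `|z 0| + 1 by rewrite ltr_wpDl.
have L0 : 0 < `|l| + 1 by rewrite ltr_wpDl.
have w1 : 0 < w / 2 / (`|z 0| + 1) by rewrite !divr_gt0.
have w2 : 0 < w / 2 / (`|l| + 1) by rewrite !divr_gt0.
have H1 := is_derive0_near de e0 w1.
have H2 : \forall t \near 0, `|z 0 - z t| <= w / 2 / (`|l| + 1).
  by move/cvgrPdist_le : cz => /(_ _ w2).
have H3 : \forall t \near 0, `|z 0 - z t| <= 1.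
  by move/cvgrPdist_le : cz => /(_ _ ltr01).
apply: filterS3 H1 H2 H3 => t H1 H2 H3.
have -> : z t * e t - t * (z 0 * l) = z t * (e t - t * l) - (z 0 - z t) * (t * l) by ring.
apply: (le_trans (ler_normB _ _)); have -> : w * `|t| = w / 2 * `|t| + w / 2 * `|t| by field.
rewrite lerD//.
  have zt : `|z t| <= `|z 0| + 1.
    rewrite -[z t](subKr (z 0)) (le_trans (ler_normB _ _))// lerD//.
  rewrite normrM; apply: (le_trans (ler_pM _ _ zt H1)) => //.
  by rewrite mulrA (mulrC _ (w / 2 / _)) divfK// gt_eqF.
rewrite !normrM mulrA mulrAC.
apply: (@le_trans _ _ (w / 2 / (`|l| + 1) * (`|l| + 1) * `|t|)); last first.
  by rewrite divfK// gt_eqF.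
rewrite ler_wpM2r//; apply: ler_pM => //; by rewrite lerDl.
Qed.

Lemma MVT_bound_abs (g dg : R -> R) (e B : R) :
  (forall s, `|s| <= `|e| -> is_derive (s : R^o) (1 : R^o) (g : R^o -> R^o) (dg s)) ->
  (forall s, `|s| <= `|e| -> `|dg s| <= B) -> `|g e - g 0| <= B * `|e|.
Proof.
move=> Hd HB; have [e0|e0] := leP 0 e.
  rewrite (ger0_norm e0) in Hd HB *.
  by apply: (@MVT_bound _ g dg) => // s /andP[s0 s1]; [apply: Hd|apply: HB]; rewrite ger0_norm.
rewrite (ltr0_norm e0) in Hd HB *.
have -> : g e - g 0 = (g \o -%R) (- e) - (g \o -%R) 0.
  by rewrite /= opprK oppr0.
apply: (@MVT_bound _ (g \o -%R) (fun s => - dg (- s))) => [|s /andP[s0 s1]|s /andP[s0 s1]].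
- by rewrite oppr_ge0 ltW.
- have d1 : is_derive (- s : R^o) (1 : R^o) (g : R^o -> R^o) (dg (- s)).
    by apply: Hd; rewrite normrN ger0_norm.
  have d2 : is_derive (s : R^o) (1 : R^o) (-%R : R^o -> R^o) (-1 : R).
    exact: is_deriveNid.
  by have := is_derive1_comp d1 d2; rewrite mulrN1.
- by rewrite normrN; apply: HB; rewrite normrN ger0_norm.
Qed.

End RealFacts2.

Lemma linear_form_sum (R : realType) (V : lmodType R) (l : {linear V -> R^o}) (I : Type)
    (s : seq I) (c : I -> R) (v : I -> V) :
  l (\sum_(i <- s) c i *: v i) = \sum_(i <- s) c i * l (v i).
Proof. by rewrite linear_sum; apply: eq_bigr => i _; rewrite linearZ. Qed.

Section AdjointRepresentation.
Variables (R : realType) (G : lieGroupType R) (g : lieAlgebra G).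
Local Notation gam X t := (lie_exp g (t *: X)).
Local Notation LD X f := (lderiv (lie_exp g) X f).

Lemma chart_at_one : exists c0 : chart R G (@lie_dim R G), exists b : G -> R, exists Kb : set G,
  [/\ atlas c0, cdom c0 1%g, smooth_fun b & 0 < b 1%g] /\
  [/\ compact Kb, Kb `<=` cdom c0 & forall y, ~ Kb y -> b y = 0].
Proof.
have [c ac cx] := @atlas_cover R G 1%g; have [oc _ _ _ _] := chart_spec ac.
have [b [bS _ b1 [K [cK Kc bK]]]] := smooth_bump oc cx.
by exists c, b, K.
Qed.

(** Finitely many smooth functions whose derivatives at 1 separate the vectors of [g]; through them,
    linear forms on [g] become combinations of derivatives. *)
Lemma lie_coordinates : exists N (F : 'I_N -> G -> R) (T : g -> 'rV[R]_N),
  [/\ forall i, smooth_fun (F i), linear T, forall X, T X = 0 -> X = 0 &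
      forall X i, LD X (F i) 1%g = T X ord0 i].
Proof.
have [c [b [K [[ac cx bS b1] [cK Kc bK]]]]] := chart_at_one.
exists (@lie_dim R G), (fc c b), (fun X => b 1%g *: tau c X); split.
- exact: (fc_smooth ac bS cK Kc bK).
- move=> a X Y; rewrite (tau_linear ac cx bS b1 cK Kc bK) scalerDr !scalerA.
  by rewrite (mulrC a).
- move=> X /eqP; rewrite scaler_eq0 gt_eqF//= => /eqP.
  exact: (tau_inj0 ac cx bS b1 cK Kc bK).
- by move=> X i; rewrite mxE; exact: (lderiv_fc ac cx bS b1 cK Kc bK).
Qed.

Lemma is_derive_lderiv f x X (t : R) : smooth_fun f ->
  is_derive (t : R^o) (1 : R^o) ((fun t => f (x * gam X t)%g) : R^o -> R^o)
    (LD X f (x * gam X t)%g).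
Proof.
have [c [b [K [[ac cx bS b1] [cK Kc bK]]]]] := chart_at_one.
exact: (lderiv_at ac cx bS b1 cK Kc bK).
Qed.

Lemma is_derive_lderiv0 f x X : smooth_fun f ->
  is_derive (0 : R^o) (1 : R^o) ((fun t => f (x * gam X t)%g) : R^o -> R^o) (LD X f x).
Proof.
by move=> fS; have := is_derive_lderiv x X 0 fS; rewrite scale0r lie_exp0 mulg1.
Qed.

Lemma smooth_lderiv f X : smooth_fun f -> smooth_fun (LD X f).
Proof.
have [c [b [K [[ac cx bS b1] [cK Kc bK]]]]] := chart_at_one.
exact: (lderiv_smooth ac cx bS b1 cK Kc bK).
Qed.

Lemma lderivB f h X x : smooth_fun f -> smooth_fun h ->
  LD X (fun u => f u - h u) x = LD X f x - LD X h x.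
Proof.
move=> fS hS; have d1 := is_derive_lderiv0 x X fS; have d2 := is_derive_lderiv0 x X hS.
by have [_ <-] := is_deriveB d1 d2; rewrite /lderiv derive1E.
Qed.

Lemma lderivD X Y f x : smooth_fun f -> LD (X + Y) f x = LD X f x + LD Y f x.
Proof. by move=> fS; rewrite -{1}[X]scale1r lie_linear// mul1r. Qed.

Lemma lderiv0 f x : smooth_fun f -> LD 0 f x = 0.
Proof.
move=> fS; have := lderivD 0 0 x fS; rewrite addr0 => /eqP.
by rewrite -subr_eq subrr eq_sym => /eqP.
Qed.

Lemma lderivZ a X f x : smooth_fun f -> LD (a *: X) f x = a * LD X f x.
Proof. by move=> fS; rewrite -[a *: X]addr0 lie_linear// lderiv0// addr0. Qed.

Lemma lderiv_sumv (I : Type) (s : seq I) (c : I -> R) (Y : I -> g) f x : smooth_fun f ->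
  LD (\sum_(i <- s) c i *: Y i) f x = \sum_(i <- s) c i * LD (Y i) f x.
Proof.
move=> fS; elim: s => [|i s IH]; first by rewrite !big_nil lderiv0.
by rewrite !big_cons lie_linear// IH.
Qed.

Lemma lderiv_inj X Y : (forall f, smooth_fun f -> LD X f 1%g = LD Y f 1%g) -> X = Y.
Proof.
have [N [F [T [FS TL Tinj TE]]]] := lie_coordinates.
move=> H; apply/eqP; rewrite -subr_eq0; apply/eqP/Tinj/rowP => i.
rewrite mxE -TE -scaleN1r lderivD// lderivZ// H// mulN1r subrr//.
Qed.

Lemma gam_inj X Y : (forall t : R, gam X t = gam Y t) -> X = Y.
Proof.
move=> H.
have [|s t|Z [_ ZU]] := @lie_exp_onto _ _ g (fun t : R => gam X t).
- exact: lie_exp_continuous.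
- by rewrite lie_expD.
- by rewrite -(ZU X) ?(ZU Y).
Qed.

Lemma Ad_subproof (x : G) (X : g) :
  exists Z : g, forall t : R, gam Z t = (x * gam X t * x^-1)%g.
Proof.
have [|s t|Z [HZ _]] := @lie_exp_onto _ _ g (fun t : R => (x * gam X t * x^-1)%g).
- move=> t; apply: (@mulg_continuous_at R G R (fun t => x * gam X t)%g (cst x^-1%g)); last exact: cvg_cst.
  by apply: (@mulg_continuous_at R G R (cst x) (fun t => gam X t)); [exact: cvg_cst|exact: lie_exp_continuous].
- by rewrite lie_expD !mulgA mulgVK.
- by exists Z => t; rewrite HZ.
Qed.

(** The generator, provided by [lie_exp_onto], of the conjugated one-parameter subgroup; [gam_inj]
    makes it unique. *)
Definition Ad (x : G) (X : g) : g := sval (cid (Ad_subproof x X)).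

Lemma gam_Ad x X (t : R) : gam (Ad x X) t = (x * gam X t * x^-1)%g.
Proof. exact: (svalP (cid (Ad_subproof x X))). Qed.

Lemma Ad1 X : Ad 1%g X = X.
Proof. by apply: gam_inj => t; rewrite gam_Ad mul1g invg1 mulg1. Qed.

Lemma AdM x y X : Ad (x * y)%g X = Ad x (Ad y X).
Proof. by apply: gam_inj => t; rewrite !gam_Ad invgM !mulgA. Qed.

Lemma AdK x : cancel (Ad x) (Ad x^-1%g).
Proof. by move=> X; rewrite -AdM mulVg Ad1. Qed.

Lemma AdVK x : cancel (Ad x^-1%g) (Ad x).
Proof. by move=> X; rewrite -AdM mulgV Ad1. Qed.

Lemma lderiv_Ad x X f z : LD (Ad x X) f z = LD X (fun u => f (u * x^-1)%g) (z * x)%g.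
Proof. by rewrite /lderiv; under eq_fun do rewrite gam_Ad !mulgA. Qed.

Lemma lderiv_transl X f z h : LD X (fun u => f (u * h)%g) z = LD (Ad h^-1%g X) f (z * h)%g.
Proof.
rewrite lderiv_Ad mulgK; congr (lderiv _ X _ z).
by apply/funext => u; rewrite invgK.
Qed.

(** Deriving [f] along [Ad x X] amounts to deriving a translate of [f] along [X], and the latter is
    linear in [X] by [lie_linear]. *)
Lemma Ad_is_linear x : linear (Ad x).
Proof.
move=> a X Y; apply: lderiv_inj => f fS.
have fS' : smooth_fun (fun u => f (u * x^-1)%g) by exact: smooth_mulr.
by rewrite lie_linear// !lderiv_Ad lie_linear.
Qed.

HB.instance Definition _ x := GRing.isLinear.Build R g g _ (Ad x) (Ad_is_linear x).

(** The map [T] of [lie_coordinates] is injective, and [l] is composed with a left inverse of it. *)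
Lemma functional_lderiv (l : g -> R) : linear (l : g -> R^o) ->
  exists N (F : 'I_N -> G -> R) (k : 'I_N -> R), (forall i, smooth_fun (F i)) /\
  forall X, l X = \sum_i k i * LD X (F i) 1%g.
Proof.
move=> ll; have [N [F [T [FS TL Tinj TE]]]] := lie_coordinates.
pose T' : {linear g -> 'rV[R]_N} := HB.pack T (GRing.isLinear.Build R g 'rV[R]_N _ _ TL).
pose l' : {linear g -> R^o} := HB.pack (l : g -> R^o) (GRing.isLinear.Build R g R^o _ _ ll).
have kT : lker (linfun T') == 0%VS.
  apply/eqP/vspaceP => X; rewrite memv_ker memv0 lfunE/=.
  by apply/eqP/eqP => [/Tinj//|->]; exact: (linear0 T').
exists N, F, (fun i => l' ((linfun T')^-1%VF (delta_mx 0 i))); split=> // X.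
rewrite -[LHS]/(l' X) -{1}(lker0_lfunK kT X) lfunE/= (row_sum_delta (T X)).
have := linear_form_sum (l' \o (linfun T')^-1%VF : {linear 'rV[R]_N -> R^o})
  (index_enum 'I_N) (fun j => T X 0 j) (fun j => delta_mx 0 j).
move=> /= ->; by apply: eq_bigr => i _; rewrite -TE mulrC.
Qed.

(** Continuity at 1 comes from [lderiv_conj_continuous]; at [x0] the form [l] is replaced by
    [l \o Ad x0]. *)
Lemma Ad_continuous (l : g -> R) X : linear (l : g -> R^o) ->
  continuous (fun x => l (Ad x X)).
Proof.
move=> ll.
have at1 (l' : g -> R) : linear (l' : g -> R^o) -> {for 1%g, continuous (fun x => l' (Ad x X))}.
  move=> ll'; have [N [F [k [FS lE]]]] := functional_lderiv ll'.
  rewrite (_ : (fun x => _) = (fun x => \sum_i k i * LD X (fun u => F i (u * x^-1)%g) x)); last first.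
    by apply/funext => x; rewrite lE; under eq_bigr do rewrite lderiv_Ad mul1g.
  apply: continuous_sum_at => i; apply: continuousM; first exact: cst_continuous.
  have [c [b [K [[ac cx bS b1] [cK Kc bK]]]]] := chart_at_one.
  exact: (lderiv_conj_continuous ac cx bS b1 cK Kc bK).
move=> x0.
rewrite (_ : (fun x => _) = (fun y => l (Ad x0 (Ad y X))) \o (fun x => (x0^-1 * x)%g)); last first.
  by apply/funext => x /=; rewrite -AdM mulVKg.
apply: continuous_comp.
  by apply: mulg_continuous_at; [exact: cvg_cst|exact: cvg_id].
rewrite mulVg; apply: (at1 (fun Z => l (Ad x0 Z))) => a u v.
by rewrite linearP ll.
Qed.

Lemma lderiv_Ad_sum x X f z : smooth_fun f ->
  LD (Ad x X) f z = \sum_(i < \dim {:g}) coord (vbasis {:g}) i (Ad x X) * LD (vbasis {:g})`_i f z.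
Proof.
move=> fS; rewrite {1}(coord_vbasis (memvf (Ad x X))) lderiv_sumv//.
Qed.

Lemma coord_linear i : linear (coord (vbasis {:g}) i : g -> R^o).
Proof. by move=> a u v; rewrite linearP. Qed.

(** The symmetry at the origin of the mixed derivative of [f (gam Y s * gam X t)]. Two mean value
    estimates, in [t] and then in [s], compare the second difference [q s] with [s t LD Y h 1]; they
    rest on the continuity at [(0, 0)] of the mixed derivative [K]. *)
Lemma lderiv_transl_derive X Y f : smooth_fun f ->
  is_derive (0 : R^o) (1 : R^o)
    ((fun t => LD Y (fun u => f (u * gam X t)%g) 1%g) : R^o -> R^o)
    (LD Y (LD X f) 1%g).
Proof.
move=> fS; pose h := LD X f; have hS : smooth_fun h by exact: smooth_lderiv.
pose K (p : R * R) := LD Y (fun u => h (u * gam X p.2)%g) (gam Y p.1).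
have K0 : K (0, 0) = LD Y h 1%g.
  have E : (fun u => h (u * gam X 0)%g) = h by apply/funext => u; rewrite scale0r lie_exp0 mulg1.
  by rewrite -[LHS]/(LD Y (fun u => h (u * gam X 0)%g) (gam Y 0)) E scale0r lie_exp0.
have cK : {for (0, 0) : R * R, continuous K}.
  rewrite (_ : K = fun p => \sum_(i < \dim {:g})
     coord (vbasis {:g}) i (Ad (gam X (- p.2)) Y) *
     LD (vbasis {:g})`_i h (gam Y p.1 * gam X p.2)%g); last first.
    by apply/funext => p; rewrite /K lderiv_transl -gamN lderiv_Ad_sum.
  have c2 : {for (0, 0) : R * R, continuous (fun p : R * R => p.2)} by exact: cvg_snd.
  have c1 : {for (0, 0) : R * R, continuous (fun p : R * R => p.1)} by exact: cvg_fst.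
  apply: continuous_sum_at => i; apply: continuousM.
    apply: (@continuous_comp _ _ _ (fun p : R * R => gam X (- p.2)) (fun x => coord (vbasis {:g}) i (Ad x Y))).
      apply: (@continuous_comp _ _ _ (fun p : R * R => - p.2) (fun t => gam X t)).
        exact: continuousN c2.
      exact: lie_exp_continuous.
    by apply: Ad_continuous; exact: coord_linear.
  apply: (@continuous_comp _ _ _ (fun p : R * R => (gam Y p.1 * gam X p.2)%g) (LD (vbasis {:g})`_i h)).
    apply: mulg_continuous_at.
      by apply: (@continuous_comp (R * R)%type R G fst (fun t => gam Y t) (0, 0) c1); exact: lie_exp_continuous.
    by apply: (@continuous_comp (R * R)%type R G snd (fun t => gam X t) (0, 0) c2); exact: lie_exp_continuous.
  exact/smooth_continuous/smooth_lderiv.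
pose w t := LD Y (fun u => f (u * gam X t)%g) 1%g - LD Y f 1%g.
suff dw : is_derive (0 : R^o) (1 : R^o) (w : R^o -> R^o) (LD Y h 1%g).
  have := is_deriveD dw (is_derive_cst (LD Y f 1%g : R^o) (0 : R^o) (1 : R^o)).
  rewrite addr0; congr (is_derive _ _ _ _); apply/funext => t.
  by rewrite -[LHS]/(w t + LD Y f 1%g) /w subrK.
apply: is_derive0_of_near => [|e e0].
  rewrite /w scale0r lie_exp0; under [X in LD _ X]eq_fun do rewrite mulg1.
  by rewrite subrr.
move/cvgrPdist_le : cK => /(_ _ e0); rewrite K0 => -[[A B] /= [A0 B0] AB].
have [d d0 Hd] : exists2 d : R, 0 < d & forall s, `|s| < d -> A s /\ B s.
  have AB0 : \forall s \near (0 : R), A s /\ B s by exact: filterI.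
  exact: near0_ball AB0.
apply/nbhs_ballP; exists d => //= t; rewrite -ball_normE/= sub0r normrN => td.
pose q s := f (gam Y s * gam X t)%g - f (gam X t) - (f (gam Y s) - f 1%g).
have Hq s : `|s| < d -> `|q s - t * (s * LD Y h 1%g)| <= (e * `|s|) * `|t|.
  move=> sd.
  pose gg t' := f (gam Y s * gam X t')%g - f (1 * gam X t')%g - t' * (s * LD Y h 1%g).
  have -> : q s - t * (s * LD Y h 1%g) = gg t - gg 0.
    by rewrite /gg /q scale0r lie_exp0 !mul1g mulg1; ring.
  apply: (@MVT_bound_abs _ gg (fun t' => h (gam Y s * gam X t')%g - h (1 * gam X t')%g - s * LD Y h 1%g)) => t' tt.
    apply: is_deriveB; last exact: is_derive_mulr.
    by apply: is_deriveB; exact: is_derive_lderiv.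
  pose g2 s' := h (1 * gam Y s' * gam X t')%g - s' * LD Y h 1%g.
  have -> : h (gam Y s * gam X t')%g - h (1 * gam X t')%g - s * LD Y h 1%g = g2 s - g2 0.
    by rewrite /g2 scale0r lie_exp0 !mul1g; ring.
  apply: (@MVT_bound_abs _ g2 (fun s' => K (s', t') - LD Y h 1%g)) => s' ss.
    apply: is_deriveB; last exact: is_derive_mulr.
    have := is_derive_lderiv 1%g Y s' (smooth_mulr (gam X t') hS).
    by rewrite /K /= mul1g.
  rewrite distrC; apply: (AB (s', t')); split=> /=.
    by apply: (Hd s' _).1; apply: le_lt_trans ss sd.
  by apply: (Hd t' _).2; apply: le_lt_trans tt td.
have dq : is_derive (0 : R^o) (1 : R^o) (q : R^o -> R^o) (w t).
  have d1 := is_derive_lderiv0 1%g Y (smooth_mulr (gam X t) fS).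
  have d2 := is_derive_lderiv0 1%g Y fS.
  have := is_deriveB (is_deriveB d1 (is_derive_cst (f (gam X t) : R^o) (0 : R^o) (1 : R^o)))
    (is_deriveB d2 (is_derive_cst (f 1%g : R^o) (0 : R^o) (1 : R^o))).
  rewrite !subr0; congr (is_derive _ _ _ _); apply/funext => s.
  by rewrite /q -[LHS]/(f (1 * gam Y s * gam X t)%g - f (gam X t) - (f (1 * gam Y s)%g - f 1%g)) !mul1g.
have q0 : q 0 = 0 by rewrite /q scale0r lie_exp0 mul1g !subrr.
(* The bound [Hq] is divided by [s], and [s] tends to 0: the quotient [q s / s] tends to [w t]. *)
apply/ler_addgt0Pr => e' e'0.
have [d' d'0 Hd'] := near0_ball (is_derive0_near dq q0 e'0).
have [s [s0 sd sd']] := exists_small d0 d'0.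
have h1 := Hd' s sd'.
have h2 := Hq s sd.
rewrite -(ler_pM2l s0) -{1}(gtr0_norm s0) -normrM.
have -> : s * (w t - t * LD Y h 1%g) = (q s - t * (s * LD Y h 1%g)) - (q s - s * w t) by ring.
apply: (le_trans (ler_normB _ _)); rewrite (gtr0_norm s0) in h1 h2.
by apply: (le_trans (lerD h2 h1)); rewrite le_eqVlt; apply/orP; left; apply/eqP; ring.
Qed.

(** [LD Y f (gam X t)] is the derivative at 1 of the translate of [f] by [gam X t] along
    [Ad (gam X t) Y]. Hence [LD (Ad (gam X t) Y) f 1] is [LD Y f (gam X t)], which contributes
    [LD X (LD Y f) 1], minus the effect of translating [f], which contributes [LD Y (LD X f) 1]. *)
Lemma lderiv_Ad_derive X Y f : smooth_fun f ->
  is_derive (0 : R^o) (1 : R^o) ((fun t => LD (Ad (gam X t) Y) f 1%g) : R^o -> R^o)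
    (LD (lie_br g X Y) f 1%g).
Proof.
move=> fS; rewrite lie_bracket//.
have d1 := is_derive_lderiv0 1%g X (smooth_lderiv Y fS).
pose e j (t : R) : R := LD (vbasis {:g})`_j (fun u => f (u * gam X t)%g) 1%g - LD (vbasis {:g})`_j f 1%g.
pose z j (t : R) : R := coord (vbasis {:g}) j (Ad (gam X t) Y).
have dz j : is_derive (0 : R^o) (1 : R^o) ((fun t => z j t * e j t) : R^o -> R^o)
    (z j 0 * LD (vbasis {:g})`_j (LD X f) 1%g).
  apply: is_derive0_mulc.
  - apply: (@continuous_comp R G R (fun t => gam X t) (fun x => coord (vbasis {:g}) j (Ad x Y))).
      exact: lie_exp_continuous.
    by apply: Ad_continuous; exact: coord_linear.
  - rewrite /e scale0r lie_exp0; under [X in LD _ X]eq_fun do rewrite mulg1.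
    by rewrite subrr.
  - have := is_deriveB (lderiv_transl_derive X (vbasis {:g})`_j fS)
      (is_derive_cst (LD (vbasis {:g})`_j f 1%g : R^o) (0 : R^o) (1 : R^o)).
    by rewrite subr0.
have dS := is_derive_sum (fun j : 'I_(\dim {:g}) => dz j).
have := is_deriveB d1 dS.
have -> : \sum_j z j 0 * LD (vbasis {:g})`_j (LD X f) 1%g = LD Y (LD X f) 1%g.
  rewrite -[in RHS](Ad1 Y) lderiv_Ad_sum; last exact: smooth_lderiv.
  by apply: eq_bigr => j _; rewrite /z scale0r lie_exp0.
congr (is_derive _ _ _ _); apply/funext => t.
rewrite -[LHS]/(LD Y f (1 * gam X t)%g - (\sum_j (fun t => z j t * e j t)) t).
have -> : (\sum_j (fun t => z j t * e j t)) t = \sum_j z j t * e j t.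
  by elim/big_rec2 : _ => // j u v _ <-.
rewrite mul1g.
have -> : LD Y f (gam X t) = LD (Ad (gam X t) Y) (fun u => f (u * gam X t)%g) 1%g.
  rewrite lderiv_Ad mul1g; congr (lderiv _ Y _ _).
  by apply/funext => u; rewrite mulgVK.
rewrite !lderiv_Ad_sum//; last exact: smooth_mulr.
rewrite -sumrB; apply: eq_bigr => j _; rewrite /e /z; ring.
Qed.

(** The differential of [Ad] is the bracket. As [g] is a vector space without topology, curves in it
    are differentiated through linear forms. *)
Lemma Ad_derive (l : g -> R) X Y : linear (l : g -> R^o) ->
  is_derive (0 : R^o) (1 : R^o) ((fun t => l (Ad (gam X t) Y)) : R^o -> R^o)
    (l (lie_br g X Y)).
Proof.
move=> ll; have [N [F [k [FS lE]]]] := functional_lderiv ll.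
have dF i : is_derive (0 : R^o) (1 : R^o)
    ((fun t => k i * LD (Ad (gam X t) Y) (F i) 1%g) : R^o -> R^o)
    (k i * LD (lie_br g X Y) (F i) 1%g).
  exact: (is_deriveZ (k i) (lderiv_Ad_derive X Y (FS i))).
have := is_derive_sum dF; rewrite lE.
congr (is_derive _ _ _ _); apply/funext => t; rewrite lE.
by elim/big_rec2 : _ => // j u v _ <-.
Qed.

End AdjointRepresentation.

(** * The Killing form and the root space decomposition *)

Section LinearActionOfPolynomials.
Variables (R : realType) (V : vectType R) (S : {linear V -> V}).

Definition pact (q : {poly R}) (v : V) : V := \sum_(i < size q) q`_i *: iter i S v.

Lemma pact_ord n (q : {poly R}) v : (size q <= n)%N -> pact q v = \sum_(i < n) q`_i *: iter i S v.
Proof.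
move=> qn; rewrite /pact (big_ord_widen _ (fun i => q`_i *: iter i S v) qn).
rewrite big_mkcond/=; apply: eq_bigr => i _.
by case: ltnP => // /leq_sizeP ->//; rewrite scale0r.
Qed.

Lemma pactD p q v : pact (p + q) v = pact p v + pact q v.
Proof.
pose n := maxn (size p) (size q).
rewrite (@pact_ord n) ?size_polyD// (@pact_ord n p) ?leq_maxl// (@pact_ord n q) ?leq_maxr//.
by rewrite -big_split/=; apply: eq_bigr => i _; rewrite coefD scalerDl.
Qed.

Lemma pactC c v : pact c%:P v = c *: v.
Proof.
by rewrite (@pact_ord 1) ?size_polyC_leq1// big_ord1 coefC.
Qed.

Lemma pactZ a q v : pact (a *: q) v = a *: pact q v.
Proof.
rewrite (@pact_ord (size q)) ?size_scale_leq// scaler_sumr.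
by apply: eq_bigr => i _; rewrite coefZ scalerA.
Qed.

Lemma pactMX q v : pact (q * 'X) v = pact q (S v).
Proof.
rewrite (@pact_ord (size q).+1); last first.
  by apply: (leq_trans (size_polyMleq _ _)); rewrite size_polyX addn2.
rewrite big_ord_recl coefMX/= scale0r add0r; apply: eq_bigr => i _.
by rewrite coefMX/= -iterS iterSr.
Qed.

Lemma pact_is_linear q : linear (pact q).
Proof.
have il i : linear (iter i S).
  by elim: i => // i IH a u v; rewrite !iterS IH linearP.
move=> a u v; rewrite /pact scaler_sumr -big_split/=; apply: eq_bigr => i _.
by rewrite il scalerDr !scalerA mulrC.
Qed.

HB.instance Definition _ q := GRing.isLinear.Build R V V _ (pact q) (pact_is_linear q).

Lemma pact0 v : pact 0 v = 0.
Proof. by rewrite /pact size_poly0 big_ord0. Qed.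

Lemma pact_comm q v : pact q (S v) = S (pact q v).
Proof.
rewrite /pact linear_sum; apply: eq_bigr => i _.
by rewrite linearZ -iterSr.
Qed.

Lemma pactM p q v : pact (p * q) v = pact p (pact q v).
Proof.
elim/poly_ind: p v => [|p c IH] v; first by rewrite mul0r !pact0.
rewrite mulrDl mulrAC !pactD !pactMX IH pact_comm; congr (_ + _).
by rewrite mul_polyC pactZ pactC.
Qed.

Lemma pact_eigen q a v : S v = a *: v -> pact q v = q.[a] *: v.
Proof.
move=> Sv; elim/poly_ind: q => [|p c IH]; first by rewrite pact0 horner0 scale0r.
by rewrite pactD pactMX pactC Sv linearZ/= IH hornerMXaddC scalerDl scalerA mulrC.
Qed.

Lemma pact_annihilator v : exists2 q, q != 0 & pact q v = 0.
Proof.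
pose s := [tuple iter i S v | i < (\dim {:V}).+1].
have : ~~ free s.
  apply/negP => fs; have := dimvS (subvf (span s)).
  by rewrite (eqnP fs) size_tuple ltnn.
move=> /freeP; move/contra_not; move=> H.
have /existsNP[k Hk] : ~ forall k : 'I_(\dim {:V}).+1 -> R, \sum_i k i *: s`_i = 0 -> forall i, k i = 0.
  by move=> K; have := @freeP; move=> fP; apply: H => // => nf; exact: nf.
move/not_implyP : Hk => [k0 /existsNP[i ki]].
exists (\poly_(j < (\dim {:V}).+1) (if insub j is Some j then k j else 0)).
  apply/eqP => /polyP/(_ i); rewrite coef_poly coef0 ltn_ord.
  by rewrite valK => /ki.
rewrite (@pact_ord (\dim {:V}).+1) ?size_poly// -{}[RHS]k0; apply: eq_bigr => j _.
by rewrite coef_poly ltn_ord valK (nth_map j) ?size_enum_ord// nth_ord_enum.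
Qed.

(** A real substitute for an eigenvector. An annihilator of [v] has a complex root [a + i b], hence
    a real factor [d], either [X - a] or [(X - a)^2 + b^2]. If the cofactor [f] still kills [v], it
    is an annihilator of smaller degree; otherwise [f] applied to [v] is the vector sought. *)
Lemma quadratic_vector v : v != 0 ->
  exists a b f, pact f v != 0 /\ pact (('X - a%:P) ^+ 2 + (b ^+ 2)%:P) (pact f v) = 0.
Proof.
move=> v0; have [q q0 qv] := pact_annihilator v.
have [n] := ubnP (size q); elim: n => // n IH in q q0 qv *; rewrite ltnS => qn.
pose C := real_complex R.
have [/size_poly1P[c c0 qc]|] := boolP (size q == 1%N).
  by move/eqP: qv; rewrite qc pactC scaler_eq0 (negPf v0) (negPf c0).
rewrite -(size_map_poly C q) => /closed_rootP[[a b] /rootP qz].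
have [d [f [dq [d0 sd] dD]]] : exists d f : {poly R}, [/\ q = f * d, d != 0 /\ (1 < size d)%N &
    exists f', ('X - a%:P) ^+ 2 + (b ^+ 2)%:P = f' * d].
  have [b0|b0] := eqVneq b 0.
    have /factor_theorem[f qf] : root q a.
      apply/rootP; move: qz; rewrite b0 -[(a +i* 0)%C]/(C a) horner_map => /eqP.
      by rewrite fmorph_eq0 => /eqP.
    exists ('X - a%:P), f; split=> //; first by rewrite polyXsubC_eq0 size_XsubC.
    by exists ('X - a%:P); rewrite b0 expr0n/= addr0 expr2.
  pose d : {poly R} := ('X - a%:P) ^+ 2 + (b ^+ 2)%:P.
  have sd : size d = 3%N.
    rewrite /d size_polyDl size_exp_XsubC//.
    exact: leq_ltn_trans (size_polyC_leq1 _) _.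
  have d0 : d != 0 by rewrite -size_poly_eq0 sd.
  have dz : (map_poly C d).[(a +i* b)%C] = 0.
    rewrite rmorphD rmorphXn/= rmorphB/= map_polyX !map_polyC/= !hornerE/=.
    by apply/eqP; rewrite eq_complex/=; apply/andP; split; apply/eqP; rewrite /=; ring.
  exists d, (q %/ d); split; [|by rewrite sd|by exists 1; rewrite mul1r].
  (* The remainder has degree at most 1 and vanishes at [a + i b] with [b != 0]: the imaginary part
     kills its leading coefficient and the real part its constant term. *)
  have rq : (map_poly C (q %% d)).[(a +i* b)%C] = 0.
    move: qz; rewrite {1}(divp_eq q d) rmorphD rmorphM/= hornerD hornerM dz mulr0 add0r//.
  have sr : (size (q %% d)%R <= 2)%N by rewrite -ltnS -sd ltn_modp.
  have r1 : (q %% d)`_1 = 0.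
    move: rq; rewrite (horner_coef_wide _ (_ : size _ <= 2)%N) ?size_map_poly//.
    rewrite !big_ord_recl big_ord0 !coef_map/= expr0 expr1 /bump/= => /eqP.
    rewrite eq_complex/= => /andP[_ /eqP].
    rewrite ?(mulr0, mul0r, addr0, add0r, subr0) => /eqP.
    by rewrite mulf_eq0 (negPf b0) orbF => /eqP.
  have r0 : (q %% d)`_0 = 0.
    move: rq; rewrite (horner_coef_wide _ (_ : size _ <= 2)%N) ?size_map_poly//.
    rewrite !big_ord_recl big_ord0 !coef_map/= expr0 expr1 /bump/= r1 => /eqP.
    rewrite eq_complex/= => /andP[/eqP + _].
    by rewrite ?(mulr0, mul0r, addr0, add0r, subr0, mulr1).
  have -> : q = q %/ d * d + 0.
    rewrite {1}(divp_eq q d); congr (_ + _); apply/polyP => i; rewrite coef0.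
    case: i => [//|[//|i]]; move/leq_sizeP : sr; exact.
  by rewrite addr0 mulpK.
have [fv|fv] := eqVneq (pact f v) 0.
  have f0 : f != 0 by apply: contra_neq q0 => f0; rewrite dq f0 mul0r.
  apply: (IH f f0 fv); apply: leq_trans qn.
  rewrite dq size_mul//.
  by case: (size d) sd => [|[|m]]// _; rewrite !addnS/= ltnS leq_addr.
exists a, b, f; split=> //; have [f' ->] := dD.
by rewrite pactM -(pactM d) mulrC -dq qv linear0.
Qed.

End LinearActionOfPolynomials.

(** * Semidefinite symmetric bilinear forms *)

Section InnerProduct.
Variables (R : realType) (V : lmodType R) (b : V -> V -> R).
Hypotheses (bl : forall a u v w, b (a *: u + v) w = a * b u w + b v w)
  (bs : forall u v, b u v = b v u) (bp : forall u, 0 <= b u u).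

Lemma ipDl u v w : b (u + v) w = b u w + b v w.
Proof. by rewrite -{1}[u]scale1r bl mul1r. Qed.

Lemma ip0l w : b 0 w = 0.
Proof. by have /eqP := ipDl 0 0 w; rewrite addr0 -subr_eq subrr eq_sym => /eqP. Qed.

Lemma ipZl a u w : b (a *: u) w = a * b u w.
Proof. by rewrite -[a *: u]addr0 bl ip0l addr0. Qed.

Lemma ipNl u w : b (- u) w = - b u w.
Proof. by rewrite -scaleN1r ipZl mulN1r. Qed.

Lemma ipDr u v w : b w (u + v) = b w u + b w v.
Proof. by rewrite bs ipDl !(bs w). Qed.

Lemma ipZr a u w : b w (a *: u) = a * b w u.
Proof. by rewrite bs ipZl (bs w). Qed.

Lemma ip0r w : b w 0 = 0. Proof. by rewrite bs ip0l. Qed.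

Lemma ipNr u w : b w (- u) = - b w u.
Proof. by rewrite bs ipNl (bs w). Qed.

Lemma ip_suml (I : Type) (s : seq I) (P : pred I) (F : I -> V) w :
  b (\sum_(i <- s | P i) F i) w = \sum_(i <- s | P i) b (F i) w.
Proof.
by apply: (big_morph (fun u => b u w)) => [u v|]; rewrite ?ip0l ?ipDl.
Qed.

Lemma ip_sumr (I : Type) (s : seq I) (P : pred I) (F : I -> V) w :
  b w (\sum_(i <- s | P i) F i) = \sum_(i <- s | P i) b w (F i).
Proof. by rewrite bs ip_suml; apply: eq_bigr => i _; rewrite bs. Qed.

Lemma ip_null u w : b u u = 0 -> b u w = 0.
Proof.
move=> u0; apply/eqP/negPn/negP => uw.
(* For this multiple of [u] the form would take the value [-1] at the difference. *)
have := bp (w - ((b w w + 1) / (2 * b u w)) *: u).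
rewrite ipDl !ipDr !ipNr !ipNl ipZl !ipZr ipZl u0 (bs w u) !mulr0 oppr0 oppr0 addr0.
set k := _ / _; have -> : k * b u w = (b w w + 1) / 2 by rewrite /k; field.
lra.
Qed.

(** The form being semidefinite, a vector whose residual is null is skipped, whence [N <= n], and
    each [v m] is recovered up to a null vector. That [e i] is a combination of the [v m] is
    recorded for properties that pass to linear combinations. *)
Lemma gram_schmidt (v : nat -> V) n : exists N (e : nat -> V),
  [/\ (N <= n)%N,
      forall i k, (i < N)%N -> (k < N)%N -> b (e i) (e k) = (i == k)%:R,
      forall i, (i < N)%N -> exists d : nat -> R, e i = \sum_(m < n) d m *: v m &
      forall m, (m < n)%N -> let r := v m - \sum_(i < N) b (v m) (e i) *: e i in b r r = 0].
Proof.
elim: n => [|n [N [e [Nn eo ev er]]]]; first by exists 0%N, (fun=> 0).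
pose r := v n - \sum_(i < N) b (v n) (e i) *: e i.
have re k : (k < N)%N -> b r (e k) = 0.
  move=> kN; rewrite ipDl ipNl ip_suml (bigD1 (Ordinal kN))//= ipZl eo// eqxx mulr1.
  rewrite big1 ?addr0 ?subrr// => i ik; rewrite ipZl eo//.
  by rewrite (_ : (_ == k) = false) ?mulr0//; apply: negbTE.
have span_mono (d0 : nat -> R) (u : V) : u = \sum_(m < n) d0 m *: v m -> exists d : nat -> R, u = \sum_(m < n.+1) d m *: v m.
  move=> ->; exists (fun m => if (m < n)%N then d0 m else 0).
  rewrite big_ord_recr/= ltnn scale0r addr0; apply: eq_bigr => i _; by rewrite ltn_ord.
have [r0|r0] := eqVneq (b r r) 0.
  exists N, e; split=> //; first exact: leqW.
    by move=> i iN; have [d] := ev i iN; exact: span_mono.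
  move=> m; rewrite ltnS leq_eqVlt => /predU1P[->//|]; exact: er.
pose c := (Num.sqrt (b r r))^-1.
have rr : 0 < b r r by rewrite lt0r r0 bp.
have c2 : c * (c * b r r) = 1.
  by rewrite mulrA /c -invfM -expr2 sqr_sqrtr ?bp// mulVf.
pose e' i := if i == N then c *: r else e i.
have e'N : e' N = c *: r by rewrite /e' eqxx.
have e'i i : (i < N)%N -> e' i = e i by move=> iN; rewrite /e' ltn_eqF.
exists N.+1, e'; split=> //.
- move=> i k; rewrite !ltnS => iN kN.
  move: iN kN; rewrite leq_eqVlt => /predU1P[->|iN]; rewrite leq_eqVlt => /predU1P[->|kN].
  + by rewrite e'N ipZl ipZr c2 eqxx.
  + by rewrite e'N e'i// ipZl re// mulr0 gtn_eqF.
  + by rewrite e'N e'i// ipZr bs re// mulr0 ltn_eqF.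
  + by rewrite !e'i// eo.
- move=> i; rewrite ltnS leq_eqVlt => /predU1P[->|iN]; last first.
    by rewrite e'i//; have [d] := ev i iN; exact: span_mono.
  rewrite e'N.
  have Hd (i0 : 'I_N) : exists d : nat -> R, e i0 = \sum_(m < n) d m *: v m by exact: ev.
  have [d dE] := choice Hd.
  exists (fun m => if m == n then c else - (c * \sum_(i < N) b (v n) (e i) * d i m)).
  rewrite big_ord_recr/= eqxx addrC scalerDr; congr (_ + _).
  rewrite scalerN scaler_sumr -sumrN.
  under [RHS]eq_bigr => m _.
    rewrite ltn_eqF// scaleNr mulr_sumr scaler_suml -sumrN; over.
  rewrite exchange_big/=; apply: eq_bigr => k _.
  rewrite sumrN scalerA; set K := c * b _ _.
  transitivity (- (K *: \sum_(m < n) d k m *: v m)); first by rewrite -dE.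
  rewrite scaler_sumr; congr (- _); apply: eq_bigr => m _.
  by rewrite scalerA /K mulrA.
- move=> m; rewrite ltnS => mn /=.
  have -> : v m - \sum_(i < N.+1) b (v m) (e' i) *: e' i =
      v m - \sum_(i < N) b (v m) (e i) *: e i - (c * b (v m) r) *: (c *: r).
    rewrite big_ord_recr/= e'N ipZr opprD addrA; congr (_ - _ - _).
    by apply: eq_bigr => i _; rewrite e'i.
  move: mn; rewrite leq_eqVlt => /predU1P[->|mn].
    rewrite -/r.
    have -> : b (v n) r = b r r.
      rewrite {2}/r ipDl ipNl ip_suml big1 ?subr0// => i _.
      by rewrite ipZl (bs (e i) r) re// mulr0.
    by rewrite scalerA (mulrC (c * b r r) c) c2 scale1r subrr ip0l.
  set s := v m - _.
  have ss : b s s = 0 by exact: er.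
  have -> : b (v m) r = 0.
    have -> : v m = s + \sum_(i < N) b (v m) (e i) *: e i by rewrite subrK.
    rewrite ipDl (ip_null _ ss) add0r ip_suml big1// => i _.
    by rewrite ipZl (bs (e i) r) re ?mulr0.
  by rewrite mulr0 scale0r subr0.
Qed.

End InnerProduct.

Lemma is_derive_uniq (R : realType) (f : R -> R) (t a b : R) :
  is_derive (t : R^o) (1 : R^o) (f : R^o -> R^o) a ->
  is_derive (t : R^o) (1 : R^o) (f : R^o -> R^o) b -> a = b.
Proof. by move=> [_ <-] [_ <-]. Qed.

(** * The Jacobi identity, derivatives of the adjoint action and the invariance of the Killing
    form *)

Section LieAlgebraStructure.
Variables (R : realType) (G : lieGroupType R) (g : lieAlgebra G).
Local Notation gam X t := (lie_exp g (t *: X)).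
Local Notation LD X f := (lderiv (lie_exp g) X f).
Local Notation br := (lie_br g).
Local Notation e_ i := ((vbasis {:g})`_i).

(** By [lderiv_Ad_derive] both sides are derivatives at 0 of functions of [t] that agree because
    [Ad (gam X t)] is linear. *)
Lemma lie_br_is_linear X : linear (br X).
Proof.
move=> a Y Z; apply: lderiv_inj => f fS.
rewrite lie_linear//.
apply: is_derive_uniq (lderiv_Ad_derive X (a *: Y + Z) fS) _.
have := is_deriveD (is_deriveZ a (lderiv_Ad_derive X Y fS)) (lderiv_Ad_derive X Z fS).
congr (is_derive _ _ _ _); apply/funext => t.
by rewrite linearP lie_linear.
Qed.

HB.instance Definition _ X := GRing.isLinear.Build R g g _ (br X) (lie_br_is_linear X).

Lemma lie_brC X Y : br X Y = - br Y X.
Proof.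
apply: lderiv_inj => f fS.
rewrite -scaleN1r (lderivZ _ _ _ fS) (@lie_bracket _ _ g X Y f fS 1%g) (@lie_bracket _ _ g Y X f fS 1%g).
by rewrite mulN1r opprB.
Qed.

Lemma lie_brP a X Y Z : br (a *: X + Y) Z = a *: br X Z + br Y Z.
Proof. by rewrite lie_brC linearP/= opprD -scalerN -!lie_brC. Qed.

Lemma jacobi X Y Z : br X (br Y Z) = br (br X Y) Z + br Y (br X Z).
Proof.
apply: lderiv_inj => f fS.
have S W := smooth_lderiv W fS.
have SS W W' : smooth_fun (LD W (LD W' f)) by do 2 apply: smooth_lderiv.
(* The third-order derivatives are abstracted into a symbol [D], so that the identity becomes one of
   formal sums. *)
have [D H] : exists D : g -> g -> g -> R, forall U V W,
    LD (br U (br V W)) f 1%g = D U V W - D U W V - (D V W U - D W V U).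
  exists (fun U V W => LD U (LD V (LD W f)) 1%g) => U V W.
  have E : LD (br V W) f = fun x => LD V (LD W f) x - LD W (LD V f) x.
    by apply/funext => x; exact: lie_bracket.
  rewrite (@lie_bracket _ _ g U (br V W) f fS 1%g) E (lderivB U 1%g (SS V W) (SS W V)).
  by rewrite (@lie_bracket _ _ g V W _ (S _ U) 1%g).
rewrite (lderivD _ _ _ fS) (lie_brC (br X Y)) -scaleN1r (lderivZ _ _ _ fS) !H; ring.
Qed.

Lemma adE (X Y : g) : ad X Y = br X Y.
Proof. by rewrite lfunE. Qed.

(** Both sides are velocities at 0 of the curve [Ad x (Ad (gam X t) Y)], which is also
    [Ad (gam (Ad x X) t) (Ad x Y)]. *)
Lemma Ad_br x X Y : Ad x (br X Y) = br (Ad x X) (Ad x Y).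
Proof.
apply: lderiv_inj => f fS.
apply: is_derive_uniq (lderiv_Ad_derive (Ad x X) (Ad x Y) fS).
have ll : linear ((fun Z => LD (Ad x Z) f 1%g) : g -> R^o).
  by move=> a u v; rewrite linearP lie_linear.
have := Ad_derive X Y ll; congr (is_derive _ _ _ _); apply/funext => t.
by rewrite -!AdM gam_Ad mulgVK.
Qed.

Lemma Ad_derive_at (l : g -> R) X Y (t : R) : linear (l : g -> R^o) ->
  is_derive (t : R^o) (1 : R^o) ((fun t => l (Ad (gam X t) Y)) : R^o -> R^o)
    (l (Ad (gam X t) (br X Y))).
Proof.
move=> ll.
have ll' : linear ((fun Z => l (Ad (gam X t) Z)) : g -> R^o).
  by move=> a u v; rewrite linearP ll.
have [d1 d2] := Ad_derive X Y ll'.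
set F := (fun t => l (Ad (gam X t) Y)) : R^o -> R^o.
set F2 := (fun s => l (Ad (gam X t) (Ad (gam X s) Y))) : R^o -> R^o.
have E : (fun h : R => h^-1 *: ((F \o shift (t : R^o)) (h *: (1 : R^o)) - F t)) =
    (fun h : R => h^-1 *: ((F2 \o shift (0 : R^o)) (h *: (1 : R^o)) - F2 0)).
  apply/funext => h /=; rewrite /F /F2 addr0 scale0r lie_exp0 Ad1.
  by rewrite -AdM -lie_expD (addrC t).
by split; rewrite /derivable /derive ?E.
Qed.

Lemma linear_coord (l : g -> R) Y : linear (l : g -> R^o) ->
  l Y = \sum_(i < \dim {:g}) coord (vbasis {:g}) i Y * l (e_ i).
Proof.
move=> ll; pose l' : {linear g -> R^o} := HB.pack (l : g -> R^o) (GRing.isLinear.Build R g R^o _ _ ll).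
have := linear_form_sum l' (index_enum _) (fun i : 'I_(\dim {:g}) => coord (vbasis {:g}) i Y) (fun i => e_ i).
by move=> /= <-; rewrite -coord_vbasis ?memvf.
Qed.

(** Expanding the first argument in a basis reduces the claim to products of two real functions. *)
Lemma is_derive_bilinear (b : g -> g -> R) (u v : R -> g) (u' v' : g) (t : R) :
  (forall w, linear (b^~ w : g -> R^o)) -> (forall w, linear (b w : g -> R^o)) ->
  (forall l : g -> R, linear (l : g -> R^o) -> is_derive (t : R^o) (1 : R^o) (l \o u : R^o -> R^o) (l u')) ->
  (forall l : g -> R, linear (l : g -> R^o) -> is_derive (t : R^o) (1 : R^o) (l \o v : R^o -> R^o) (l v')) ->
  is_derive (t : R^o) (1 : R^o) ((fun t => b (u t) (v t)) : R^o -> R^o) (b u' (v t) + b (u t) v').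
Proof.
move=> bl br du dv.
pose c i Y : R := coord (vbasis {:g}) i Y.
have dci i : is_derive (t : R^o) (1 : R^o) ((fun t => c i (u t) * b (e_ i) (v t)) : R^o -> R^o)
    (c i (u t) * b (e_ i) v' + b (e_ i) (v t) * c i u').
  exact: (is_deriveM (du _ (coord_linear (g := g) i)) (dv _ (br (e_ i)))).
have := is_derive_sum dci.
rewrite big_split/= addrC (linear_coord u' (bl (v t))) (linear_coord (u t) (bl v')).
under [X in is_derive _ _ _ (X + _)]eq_bigr do rewrite mulrC.
congr (is_derive _ _ _ _); apply/funext => s; rewrite (linear_coord (u s) (bl (v s))).
by elim/big_rec2 : _ => // j x y _ <-.
Qed.

Definition lftrace (f : g -> g) : R := \sum_(i < \dim {:g}) coord (vbasis {:g}) i (f (e_ i)).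

Lemma lftraceC (f h : {linear g -> g}) : lftrace (f \o h) = lftrace (h \o f).
Proof.
have E (f' h' : {linear g -> g}) : lftrace (f' \o h') = \sum_(i < \dim {:g}) \sum_(j < \dim {:g})
    coord (vbasis {:g}) j (h' (e_ i)) * coord (vbasis {:g}) i (f' (e_ j)).
  apply: eq_bigr => i _ /=.
  rewrite (@linear_coord (fun Y => coord (vbasis {:g}) i (f' Y)))// => a u v.
  by rewrite !linearP.
rewrite !E exchange_big/=; apply: eq_bigr => i _; apply: eq_bigr => j _; exact: mulrC.
Qed.

Lemma lftraceB (f h : g -> g) : lftrace (fun Y => f Y - h Y) = lftrace f - lftrace h.
Proof. by rewrite /lftrace -sumrB; apply: eq_bigr => i _; rewrite linearB. Qed.

Lemma killingE (X Y : g) : killing X Y = lftrace (br X \o br Y).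
Proof. by []. Qed.

Lemma killingC (X Y : g) : killing X Y = killing Y X.
Proof. exact: lftraceC. Qed.

Lemma killing_linear a (X Y Z : g) : killing (a *: X + Y) Z = a * killing X Z + killing Y Z.
Proof.
rewrite /killing mulr_sumr -big_split; apply: eq_bigr => i _ /=.
by rewrite lie_brP linearP.
Qed.

(** By the Jacobi identity both sides are differences of traces of triple products of [ad], equal by
    cyclicity of the trace. *)
Lemma killing_invariant (X Y Z : g) : killing (br X Y) Z = killing X (br Y Z).
Proof.
have E U V W : killing (br U V) W = lftrace (br U \o (br V \o br W)) - lftrace (br V \o (br U \o br W)).
  rewrite -lftraceB killingE /lftrace; apply: eq_bigr => i _ /=.
  by rewrite (jacobi U V) addrK.
rewrite E (killingC X (br Y Z)) E; congr (_ - _).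
  exact: (lftraceC (br X) (br Y \o br Z : {linear g -> g})).
exact: (lftraceC (br Y \o br X : {linear g -> g}) (br Z)).
Qed.

Lemma killing_automorphism (f h : {linear g -> g}) X Y : cancel f h -> cancel h f ->
  (forall X Y, f (br X Y) = br (f X) (f Y)) -> killing (f X) (f Y) = killing X Y.
Proof.
move=> fh hf fb; rewrite killingE.
have -> : br (f X) \o br (f Y) = f \o (br X \o (br Y \o h)).
  by apply/funext => Z /=; rewrite !fb hf.
rewrite (lftraceC f (br X \o (br Y \o h) : {linear g -> g})) killingE.
congr lftrace; apply/funext => Z /=.
by rewrite fh.
Qed.

End LieAlgebraStructure.

Lemma form_linearZ (R : realType) (V : lmodType R) (l : {linear V -> R^o}) c v :
  l (c *: v) = c * l v.
Proof. by rewrite linearZ. Qed.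

Section AdFlow.
Variables (R : realType) (G : lieGroupType R) (g : lieAlgebra G).
Local Notation gam X t := (lie_exp g (t *: X)).
Local Notation br := (lie_br g).

Lemma linear_formZ (l : g -> R) : linear (l : g -> R^o) -> forall c w, l (c *: w) = c * l w.
Proof.
move=> ll c w.
pose l' : {linear g -> R^o} := HB.pack (l : g -> R^o) (GRing.isLinear.Build R g R^o _ _ ll).
exact: (form_linearZ l').
Qed.

Lemma lie_br0l Y : br 0 Y = 0.
Proof. by have := lie_brP (-1) (0 : g) 0 Y; rewrite scaler0 addr0 scaleN1r addNr. Qed.

Lemma lie_brZl c Z Y : br (c *: Z) Y = c *: br Z Y.
Proof. by rewrite -[c *: Z]addr0 lie_brP lie_br0l addr0. Qed.

Lemma lie_brNl Z Y : br (- Z) Y = - br Z Y.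
Proof. by rewrite -scaleN1r lie_brZl scaleN1r. Qed.

Lemma linear_ext (u v : g) : (forall l : g -> R, linear (l : g -> R^o) -> l u = l v) -> u = v.
Proof.
move=> H; rewrite (coord_vbasis (memvf u)) (coord_vbasis (memvf v)).
by apply: eq_bigr => i _; congr (_ *: _); apply: H; exact: coord_linear.
Qed.

(** For each linear form [l], the function [l (Ad (gam W s) u) e^(- a s)] has derivative 0. *)
Lemma Ad_eigen W u (a t : R) : br W u = a *: u -> Ad (gam W t) u = expR (a * t) *: u.
Proof.
move=> Wu; apply: linear_ext => l ll.
pose F s := l (Ad (gam W s) u) * expR (- a * s).
have dF (s : R) : is_derive (s : R^o) (1 : R^o) (F : R^o -> R^o) 0.
  have d1 := Ad_derive_at W u s ll.
  have d2 : is_derive (s : R^o) (1 : R^o) ((fun s => expR (- a * s)) : R^o -> R^o) (expR (- a * s) * - a).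
    have := is_derive1_comp (is_derive_expR (- a * s)) (is_deriveZ (- a) (is_derive_id (s : R^o) (1 : R^o))).
    by rewrite /GRing.scale/= mulr1.
  apply: (is_derive_eq (is_deriveM d1 d2)).
  have lZ := linear_formZ ll.
  have -> : Ad (gam W s) (br W u) = a *: Ad (gam W s) u by rewrite Wu linearZ.
  rewrite lZ /GRing.scale/=; ring.
have := is_derive_0_is_cst t 0 dF.
rewrite /F scale0r lie_exp0 Ad1 mulr0 expR0 mulr1 mulNr expRN => E.
have lZ := linear_formZ ll.
by rewrite lZ -E mulrCA mulfV ?mulr1// gt_eqF// expR_gt0.
Qed.

Lemma Ad_self Z (t : R) : Ad (gam Z t) Z = Z.
Proof.
by apply: gam_inj => s; rewrite gam_Ad -gamN -!lie_expD addrAC subrr add0r.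
Qed.

Lemma Ad_derive_br (l : g -> R) Z u (t : R) : linear (l : g -> R^o) ->
  is_derive (t : R^o) (1 : R^o) ((fun t => l (Ad (gam Z t) u)) : R^o -> R^o)
    (l (br Z (Ad (gam Z t) u))).
Proof.
move=> ll; have -> : br Z (Ad (gam Z t) u) = Ad (gam Z t) (br Z u) by rewrite Ad_br Ad_self.
exact: Ad_derive_at.
Qed.

End AdFlow.

(** * The inner product of a Cartan involution and the spectrum of [ad H0] *)

Section RankOne.
Variables (R : realType) (G : lieGroupType R) (g : lieAlgebra G) (X : rankOneSpace g).
Local Notation gam Y t := (lie_exp g (t *: Y)).
Local Notation br := (lie_br g).
Local Notation th := (theta X).
Local Notation H0 := (H0 X).

(** The inner product of the Cartan involution: [ad Z] is skew for [Z] in [kk] and symmetric for [Z]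
    in [pp], in particular for [H0]. *)
Definition Bth (u v : g) : R := - killing u (th v).
Local Notation B := Bth.

Lemma thK u : th (th u) = u. Proof. by have [H _ _] := theta_cartan X; exact: H. Qed.

Lemma th_br u v : th (br u v) = br (th u) (th v).
Proof. by have [_ H _] := theta_cartan X; exact: H. Qed.

Lemma Bth_pos u : u != 0 -> 0 < B u u.
Proof. by have [_ _ H] := theta_cartan X; exact: H. Qed.

Lemma killing_th u v : killing (th u) (th v) = killing u v.
Proof. exact: (@killing_automorphism _ _ _ th th _ _ thK thK th_br). Qed.

Lemma Bth_linear a u v w : B (a *: u + v) w = a * B u w + B v w.
Proof. by rewrite /B killing_linear; ring. Qed.

Lemma Bth_sym u v : B u v = B v u.
Proof. by rewrite /B -killing_th thK killingC. Qed.

Lemma Bth_ge0 u : 0 <= B u u.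
Proof.
have [->|/Bth_pos/ltW//] := eqVneq u 0.
by rewrite (ip0l Bth_linear).
Qed.

Lemma Bth_linl w : linear (B^~ w : g -> R^o).
Proof. by move=> a u v; rewrite Bth_linear. Qed.

Lemma Bth_linr w : linear (B w : g -> R^o).
Proof. by move=> a u v; rewrite Bth_sym Bth_linear !(Bth_sym w). Qed.

Lemma Bth_br Z u v : B (br Z u) v = - B u (br (th Z) v).
Proof.
rewrite /B th_br thK opprK -killing_invariant lie_brC.
by rewrite (ipNl (@killing_linear _ _ g)) opprK.
Qed.

Lemma kkP Z : Z \in kk th -> th Z = Z.
Proof.
by rewrite memv_ker !lfun_simp /= subr_eq0 => /eqP.
Qed.

Lemma ppP Z : Z \in pp th -> th Z = - Z.
Proof.
by rewrite memv_ker !lfun_simp /= addr_eq0 => /eqP.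
Qed.

Lemma derive_Bth_Ad Z u v (t : R) :
  is_derive (t : R^o) (1 : R^o) ((fun t => B (Ad (gam Z t) u) (Ad (gam Z t) v)) : R^o -> R^o)
    (B (br Z (Ad (gam Z t) u)) (Ad (gam Z t) v) + B (Ad (gam Z t) u) (br Z (Ad (gam Z t) v))).
Proof.
apply: (is_derive_bilinear Bth_linl Bth_linr) => l ll; exact: Ad_derive_br.
Qed.

Lemma Bth_Ksub k u v : Ksub X k -> B (Ad k u) (Ad k v) = B u v.
Proof.
move=> [Z /= Zk <-].
pose F t := B (Ad (gam Z t) u) (Ad (gam Z t) v).
have dF (t : R) : is_derive (t : R^o) (1 : R^o) (F : R^o -> R^o) 0.
  by apply: (is_derive_eq (derive_Bth_Ad Z u v t)); rewrite Bth_br kkP// addNr.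
have := is_derive_0_is_cst 1 0 dF.
by rewrite /F scale1r scale0r lie_exp0 !Ad1.
Qed.

Lemma th_H0 : th H0 = - H0.
Proof.
apply: ppP; have [/subvP H _ _] := fa_maximal X.
exact/H/H0_fa.
Qed.

Lemma H0_neq0 : H0 != 0.
Proof. by apply: contra_eq_neq (alpha_H0 X) => ->; rewrite linear0 eq_sym oner_neq0. Qed.

Lemma fa_line : fa X = <[H0]>%VS.
Proof.
apply/eqP; rewrite eq_sym eqEdim -memvE H0_fa/=.
by rewrite fa_dim1 dim_vline H0_neq0.
Qed.

Lemma rootspaceP (beta : 'Hom(g, R^o)) Y :
  reflect (br H0 Y = beta H0 *: Y) (Y \in rootspace (fa X) beta).
Proof.
apply: (iffP idP).
  rewrite memvE => /subv_bigcapP H.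
  rewrite (coord_vbasis (H0_fa X)) !linear_sum/= scaler_suml.
  rewrite (big_morph (fun W => br W Y) (id1 := 0) (op1 := +%R)); last 2 first.
  - by move=> u v; rewrite -{1}[u]scale1r lie_brP scale1r.
  - exact: lie_br0l.
  apply: eq_bigr => i _; rewrite linearZ/=.
  have := H i isT; rewrite -memvE memv_ker !lfun_simp/= ?adE subr_eq0 => /eqP E.
  by rewrite -scalerA -E lie_brZl.
move=> HY; rewrite memvE; apply/subv_bigcapP => i _; rewrite -memvE memv_ker.
have /vlineP[c ->] : (vbasis (fa X))`_i \in <[H0]>%VS.
  by rewrite -fa_line vbasis_mem// mem_nth// size_tuple.
have -> : beta (c *: H0) = c *: beta H0 by rewrite linearZ.
by rewrite add_lfunE opp_lfunE scale_lfunE id_lfunE adE lie_brZl HY scalerA subrr.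
Qed.

(** A nonzero eigenvalue [a] makes [a alpha] a root, because [fa] is the line of [H0], and
    [roots_alpha] lists the roots. *)
Lemma eigenvalues u (a : R) : u != 0 -> br H0 u = a *: u -> a \in [:: 0; 1; -1; 2; -2].
Proof.
move=> u0 Hu; rewrite inE; have [//|a0] := eqVneq a 0; apply/orP; right.
have [|c c4 /(_ _ (H0_fa X))] := @roots_alpha _ _ _ X (a *: alpha X).
  split.
    by exists H0; [exact: H0_fa|rewrite scale_lfunE alpha_H0 /GRing.scale/= mulr1].
  apply/eqP => r0; have : u \in rootspace (fa X) (a *: alpha X).
    by apply/rootspaceP; rewrite scale_lfunE alpha_H0 /GRing.scale/= mulr1.
  by rewrite r0 memv0 (negPf u0).
by rewrite scale_lfunE alpha_H0 /GRing.scale/= !mulr1 => ->.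
Qed.

Lemma Bth_H0 u v : B (br H0 u) v = B u (br H0 v).
Proof.
by rewrite Bth_br th_H0 lie_brNl (ipNr Bth_linear Bth_sym) opprK.
Qed.

Local Notation pS := (pact (br H0)).

Lemma Bth_pact q u v : B (pS q u) v = B u (pS q v).
Proof.
elim/poly_ind: q u v => [|q c IH] u v.
  by rewrite !pact0 (ip0l Bth_linear) (ip0r Bth_linear Bth_sym).
rewrite !pactD !pactMX !pactC (ipDl Bth_linear) (ipDr Bth_linear Bth_sym).
by rewrite IH (ipZl Bth_linear) (ipZr Bth_linear Bth_sym) pact_comm Bth_H0.
Qed.

Definition pev : {poly R} := 'X * ('X^2 - 1) * ('X^2 - 4%:R).

(** Diagonalizability of the symmetric operator [ad H0]. If [pev] did not kill [u], some nonzero [w]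
    in the image of [pev] would satisfy [(S - a)^2 w = - b^2 w]. By symmetry the square length of
    [(S - a) w] is [- b^2 B w w], so [w] is an eigenvector and is killed by [pev]; moving [pev]
    across [B] gives [B w w = 0]. *)
Lemma pact_pev u : pS pev u = 0.
Proof.
apply/eqP/negPn/negP => u0.
have [a [b [f [w0 dw]]]] := quadratic_vector (br H0) u0.
set w := pS f _ in w0 dw.
have wE : w = pS pev (pS f u) by rewrite /w -!pactM mulrC.
have aw : br H0 w = a *: w.
  pose w' := pS ('X - a%:P) w.
  have w'E : w' = br H0 w - a *: w.
    by rewrite /w' pactD -polyCN pactC -[X in pS X]mul1r pactMX -[1]/(1%:P) pactC scale1r scaleNr.
  have : B w' w' = - b ^+ 2 * B w w.
    rewrite {1}/w' Bth_pact -pactM; move: dw; rewrite pactD pactC => /eqP.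
    by rewrite addr_eq0 => /eqP; rewrite expr2 => ->; rewrite (ipNr Bth_linear Bth_sym) (ipZr Bth_linear Bth_sym) mulNr.
  move=> ww; have [w'0|/Bth_pos] := eqVneq w' 0.
    by apply/eqP; rewrite -subr_eq0 -w'E w'0.
  by rewrite ww mulNr oppr_gt0 ltNge mulr_ge0 ?sqr_ge0 ?Bth_ge0.
have ev := eigenvalues w0 aw.
have pw : pS pev w = 0.
  rewrite (pact_eigen _ aw).
  have -> : pev.[a] = a * (a ^+ 2 - 1) * (a ^+ 2 - 4) by rewrite /pev !hornerE/=; ring.
  suff -> : a * (a ^+ 2 - 1) * (a ^+ 2 - 4) = 0 by rewrite scale0r.
  by move: ev; rewrite !inE => /or4P[|||/orP[]] /eqP ->; ring.
have := Bth_pos w0; rewrite {1}wE Bth_pact pw (ip0r Bth_linear Bth_sym) ltxx//.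
Qed.

Lemma eigen_decomposition u : exists w : 'I_5 -> g,
  u = \sum_i w i /\ forall i : 'I_5, br H0 (w i) = (i%:R - 2) *: w i.
Proof.
(* Lagrange interpolation at the nodes -2, ..., 2, with common denominator 24: the index [i] stands
   for the eigenvalue [i - 2]. *)
pose k : {poly R} := (24%:R^-1)%:P.
have k24 : k * 24%:R = 1.
  by rewrite -polyC_natr -polyCM mulVf// pnatr_eq0.
pose q (i : 'I_5) : {poly R} := k * nth 0
  [:: 'X * ('X^2 - 1) * ('X - 2%:R); - 4%:R * 'X * ('X - 1) * ('X^2 - 4%:R);
      6%:R * ('X^2 - 1) * ('X^2 - 4%:R);
      - 4%:R * 'X * ('X + 1) * ('X^2 - 4%:R); 'X * ('X^2 - 1) * ('X + 2%:R)] i.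
exists (fun i => pS (q i) u); split.
  have -> : \sum_i pS (q i) u = pS (\sum_i q i) u.
    by apply/esym; apply: (big_morph (pS^~ u)) => [x y|]; rewrite ?pactD ?pact0.
  rewrite -[LHS]scale1r -(pactC (br H0)); congr pact.
  rewrite !big_ord_recl big_ord0 /q /= -[1%:P]k24; ring.
move=> i; rewrite -pact_comm -pactMX -pactZ; apply/eqP; rewrite -subr_eq0 -scaleN1r -pactZ -pactD.
suff [r ->] : exists r : {poly R}, q i * 'X + -1 *: ((i%:R - 2) *: q i) = r * pev by rewrite pactM pact_pev linear0.
rewrite scalerA mulN1r opprB -mul_polyC polyCB !polyC_natr.
by case: i => [[|[|[|[|[|//]]]]] i5]; rewrite /q /pev /=;
  [exists k|exists (- 4%:R * k)|exists (6%:R * k)|exists (- 4%:R * k)|exists k]; ring.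
Qed.

End RankOne.

(** * The Iwasawa projection and the radial coordinate *)

Section IwasawaProjection.
Variables (R : realType) (G : lieGroupType R) (g : lieAlgebra G) (X : rankOneSpace g).
Local Notation gam Y t := (lie_exp g (t *: Y)).
Local Notation br := (lie_br g).
Local Notation H0 := (H0 X).
Local Notation B := (Bth X).
Local Notation Bl := (@Bth_linear _ _ _ X).
Local Notation Bs := (@Bth_sym _ _ _ X).

Lemma aexp0 : aexp X 0 = 1%g.
Proof. by rewrite /aexp scale0r lie_exp0. Qed.

Lemma aexpN t : aexp X (- t) = (aexp X t)^-1%g.
Proof. exact: gamN. Qed.

Lemma aexp_continuous : continuous (aexp X).
Proof. exact: lie_exp_continuous. Qed.

Lemma g1_neq0 : g1 X != 0%VS.
Proof. by have [_] := alpha_root X. Qed.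

Lemma m1_gt0 : (0 < m1 X)%N.
Proof. by rewrite lt0n dimv_eq0 g1_neq0. Qed.

Lemma rho_gt0 : 0 < rho X.
Proof.
rewrite divr_gt0// ltr_wpDr ?mulr_ge0//.
by rewrite ltr0n m1_gt0.
Qed.

Lemma g1P Y : reflect (br H0 Y = Y) (Y \in g1 X).
Proof. by rewrite /g1; apply: (iffP (rootspaceP X (alpha X) Y)); rewrite alpha_H0 scale1r. Qed.

Lemma g2P Y : reflect (br H0 Y = 2 *: Y) (Y \in g2 X).
Proof. by rewrite /g2; apply: (iffP (rootspaceP X _ Y)); rewrite scale_lfunE alpha_H0 /GRing.scale/= mulr1. Qed.

(** [j] is 2 if [2 alpha] is a root and 1 otherwise. The witness in ['I_5] ties it to the indices of
    [eigen_decomposition]. *)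
Lemma top_eigenvalue : exists j : R, [/\ exists2 m : 'I_5, j = m%:R - 2 & 1 <= j,
  (exists2 v : g, v != 0 & br H0 v = j *: v) &
  forall u (a : R), u != 0 -> br H0 u = a *: u -> a <= j].
Proof.
have [[v v0 Hv]|H] := pselect (exists2 v : g, v != 0 & br H0 v = 2 *: v).
  exists 2; split; [exists (@Ordinal 5 4 isT) => /=; lra|by exists v|].
  move=> u a u0 /(eigenvalues u0); rewrite !inE.
  by move=> /or4P[|||/orP[]] /eqP ->; lra.
exists 1; split; [exists (@Ordinal 5 3 isT) => /=; lra| |].
  by exists (vpick (g1 X)); rewrite ?vpick0 ?g1_neq0// scale1r; exact/g1P/memv_pick.
move=> u a u0 Hu; have := eigenvalues u0 Hu; rewrite !inE.
move=> /or4P[|||/orP[]] /eqP aE; rewrite ?aE; try lra.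
by exfalso; apply: H; exists u; rewrite // -aE.
Qed.

Lemma Bth_eigen_orth u v (a b : R) : br H0 u = a *: u -> br H0 v = b *: v ->
  a != b -> B u v = 0.
Proof.
move=> Hu Hv; rewrite -subr_eq0 => ab; apply: (mulfI ab).
rewrite mulr0 mulrBl -(ipZl Bl) -Hu Bth_H0 Hv (ipZr Bl Bs) subrr//.
Qed.

(** On the orthogonal eigenspaces of [ad H0], with eigenvalues between -2 and 2, [Ad (aexp X t)]
    acts by factors between [e^(- 2 |t|)] and [e^(2 |t|)]. *)
Lemma Bth_aexp w (t : R) :
  expR (- (4 * `|t|)) * B w w <= B (Ad (aexp X t) w) (Ad (aexp X t) w) <= expR (4 * `|t|) * B w w.
Proof.
have [u [-> Hu]] := eigen_decomposition X w.
have au i : Ad (aexp X t) (u i) = expR ((i%:R - 2) * t) *: u i by exact: Ad_eigen.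
have orth i k : i != k -> B (u i) (u k) = 0.
  move=> ik; apply: (Bth_eigen_orth (Hu i) (Hu k)).
  by apply: contra_neq ik => /addIr/eqP; rewrite eqr_nat => /eqP/val_inj.
have sq (c : 'I_5 -> R) : B (\sum_i c i *: u i) (\sum_i c i *: u i) = \sum_i c i ^+ 2 * B (u i) (u i).
  rewrite (ip_suml Bl); apply: eq_bigr => i _.
  rewrite (ip_sumr Bl Bs) (bigD1 i)//= big1 ?addr0 => [|k ki].
    by rewrite (ipZl Bl) (ipZr Bl Bs) mulrA -expr2.
  by rewrite (ipZl Bl) (ipZr Bl Bs) orth ?mulr0// eq_sym.
have -> : Ad (aexp X t) (\sum_i u i) = \sum_(i < 5) expR ((i%:R - 2) * t) *: u i.
  by rewrite linear_sum/=; apply: eq_bigr => i _; exact: au.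
rewrite sq; have := sq (fun=> 1).
under eq_bigr do rewrite scale1r.
move=> ->; rewrite !mulr_sumr.
have bd (i : 'I_5) : - (4 * `|t|) <= 2 * ((i%:R - 2) * t) <= 4 * `|t|.
  rewrite -ler_norml normrM normrM (_ : `|2| = 2) ?normr_nat// mulrA ler_wpM2r//.
  have : `|i%:R - 2| <= 2 :> R; last by lra.
  rewrite ler_norml; have : (i <= 4)%N by rewrite -ltnS.
  by rewrite -(ler_nat R) => i4; have : 0 <= i%:R :> R by []; lra.
apply/andP; split; apply: ler_sum => i _; rewrite expr1n mul1r; apply: ler_wpM2r; rewrite ?Bth_ge0//;
  rewrite -expRM_natl ler_expR; by have /andP[] := bd i.
Qed.

Lemma Bth_continuous u v : continuous (fun x => B (Ad x u) (Ad x v)).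
Proof.
rewrite (_ : (fun x => _) = (fun x => \sum_(i < \dim {:g})
   coord (vbasis {:g}) i (Ad x u) * B (vbasis {:g})`_i (Ad x v))); last first.
  by apply/funext => x; exact: (linear_coord (Ad x u) (Bth_linl X (Ad x v))).
move=> x; apply: continuous_sum_at => i; apply: continuousM.
  by apply: Ad_continuous; exact: coord_linear.
by apply: Ad_continuous; exact: Bth_linr.
Qed.

Variables (kap : G -> G) (H : G -> R) (nu : G -> G).
Hypothesis Hiw : iwasawa X kap H nu.
Variables (j : R) (v0 : g).
Hypotheses (j1 : 1 <= j) (v00 : v0 != 0) (v0E : br H0 v0 = j *: v0)
  (jtop : forall u (a : R), u != 0 -> br H0 u = a *: u -> a <= j).

(** The bracket of [v] with a vector of eigenvalue 1 or 2 would have an eigenvalue above [j], hence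
    vanishes. *)
Lemma Ad_Nsub n v : Nsub X n -> br H0 v = j *: v -> Ad n v = v.
Proof.
move=> [W /= /memv_addP[W1 W1g [W2 W2g ->]] <-] vE.
have br0 W' (a : R) : 0 < a -> br H0 W' = a *: W' -> br W' v = 0.
  move=> a0 W'E; apply/eqP/negPn/negP => bn0.
  have : a + j <= j; last by lra.
  apply: jtop bn0 _; rewrite jacobi W'E vE lie_brZl linearZ/= -scalerDl//.
have bW : br (W1 + W2) v = 0 *: v.
  rewrite -[W1]scale1r lie_brP scale1r (br0 _ 1) ?(br0 _ 2) ?scale0r ?addr0//.
    by apply/g2P.
  by rewrite scale1r; apply/g1P.
by rewrite -[_ + W2]scale1r (Ad_eigen 1 bW) mul0r expR0 scale1r.
Qed.

(** In [x = k a n] the factor [n] fixes [v], the factor [a] multiplies it by [e^(j H x)] and [k] is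
    an isometry. This describes [H] through the adjoint representation, from which its continuity
    and its invariance follow. *)
Lemma Bth_H x v : br H0 v = j *: v -> B (Ad x v) (Ad x v) = expR (2 * j * H x) * B v v.
Proof.
move=> vE; have [Kx Nx xE] := Hiw x.
rewrite {1 2}xE !AdM (Ad_Nsub Nx vE) (Bth_Ksub _ _ Kx).
rewrite (_ : Ad (aexp X (H x)) v = expR (j * H x) *: v); last exact: Ad_eigen.
rewrite (ipZl Bl) (ipZr Bl Bs) mulrA -expRD; congr (expR _ * _); ring.
Qed.

Local Lemma Bv0 : 0 < B v0 v0. Proof. exact: Bth_pos. Qed.

Local Lemma j_gt0 : 0 < j. Proof. exact: lt_le_trans ltr01 j1. Qed.

Lemma HE x : H x = ln (B (Ad x v0) (Ad x v0) / B v0 v0) / (2 * j).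
Proof.
have j0 := j_gt0; rewrite Bth_H// mulfK ?gt_eqF ?Bv0// expRK.
by field; rewrite gt_eqF.
Qed.

Lemma Ad_inj x (v : g) : v != 0 -> Ad x v != 0.
Proof.
by apply: contra_neq => /(congr1 (Ad x^-1%g)); rewrite AdK linear0.
Qed.

Lemma H_continuous : continuous H.
Proof.
rewrite (_ : H = fun x => ln (B (Ad x v0) (Ad x v0) / B v0 v0) / (2 * j)); last exact/funext/HE.
move=> x; apply: (@continuousM R G (fun x => ln (B (Ad x v0) (Ad x v0) / B v0 v0)) (cst (2 * j)^-1) x);
  last exact: cst_continuous.
apply: (@continuous_comp _ _ _ (fun x => B (Ad x v0) (Ad x v0) / B v0 v0) (@ln R)).
  by apply: continuousM; [exact: Bth_continuous|exact: cst_continuous].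
apply: continuous_ln; rewrite divr_gt0 ?Bv0//.
exact/Bth_pos/Ad_inj.
Qed.

(** In [y x = y kap(x) a n] the factor [n] fixes [v0] and [a] multiplies it by [e^(j H x)]; the
    lengths of [Ad (y x) v0] and [Ad (y kap(x)) v0] are then compared. *)
Lemma H_cocycle x y : H (y * x)%g = H (y * kap x)%g + H x.
Proof.
have [Kx Nx xE] := Hiw x; have j0 := j_gt0.
have E : expR (2 * j * H (y * x)%g) = expR (2 * j * (H (y * kap x)%g + H x)).
  apply: (mulIf (lt0r_neq0 Bv0)).
  rewrite -Bth_H// {1 2}xE !mulgA AdM (Ad_Nsub Nx v0E) AdM.
  rewrite (_ : Ad (aexp X (H x)) v0 = expR (j * H x) *: v0); last exact: Ad_eigen.
  rewrite !linearZ/= (ipZl Bl) (ipZr Bl Bs) Bth_H// !mulrA -!expRD; congr (expR _ * _); ring.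
move/expR_inj : E => /mulfI; apply.
by rewrite mulf_neq0// gt_eqF.
Qed.

Lemma H_Kl k x : Ksub X k -> H (k * x)%g = H x.
Proof. by move=> Kk; rewrite !HE AdM Bth_Ksub. Qed.

Lemma H_K k : Ksub X k -> H k = 0.
Proof. by move=> Kk; rewrite HE Bth_Ksub// mulfV ?gt_eqF ?Bv0// ln1 mul0r. Qed.

(** [Bth_H] and [Bth_aexp] give [2 j |H| <= 4 |t|], and [j >= 1]. *)
Lemma H_aexp_bound k t : Ksub X k -> `|H (aexp X t * k)%g| <= 2 * `|t|.
Proof.
move=> Kk; have j0 := j_gt0.
have E := Bth_H (aexp X t * k)%g v0E; rewrite AdM in E.
have := Bth_aexp (Ad k v0) t; rewrite E (Bth_Ksub _ _ Kk) !(ler_pM2r Bv0).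
rewrite !ler_expR -ler_norml normrM (gtr0_norm (mulr_gt0 (ltr0Sn R 1) j0)).
move=> Hb; have : 2 * `|H (aexp X t * k)%g| <= 4 * `|t|.
  apply: le_trans Hb; rewrite -mulrA ler_pM2l// ler_peMl//.
by rewrite (_ : 4 * `|t| = 2 * (2 * `|t|)) ?ler_pM2l//; ring.
Qed.

End IwasawaProjection.

Lemma iwasawa_projection (R : realType) (G : lieGroupType R) (g : lieAlgebra G)
    (X : rankOneSpace g) (kap : G -> G) (H : G -> R) (nu : G -> G) :
  iwasawa X kap H nu ->
  [/\ continuous H, forall x y, H (y * x)%g = H (y * kap x)%g + H x,
      forall k x, Ksub X k -> H (k * x)%g = H x, forall k, Ksub X k -> H k = 0 &
      forall k t, Ksub X k -> `|H (aexp X t * k)%g| <= 2 * `|t|].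
Proof.
move=> Hiw; have [j [[_ _ j1] [v0 v00 v0E] jtop]] := top_eigenvalue X.
split=> [||k x Kk|k Kk|k t Kk].
- exact: (H_continuous Hiw j1 v00 v0E jtop).
- exact: (H_cocycle Hiw j1 v00 v0E jtop).
- exact: (H_Kl Hiw j1 v00 v0E jtop x Kk).
- exact: (H_K Hiw j1 v00 v0E jtop Kk).
- exact: (H_aexp_bound Hiw j1 v00 v0E jtop t Kk).
Qed.

Lemma cvg_sumr (R : realType) (T : Type) (F : set_system T) (FF : Filter F) (I : Type)
    (s : seq I) (P : pred I) (f : I -> T -> R) (l : I -> R) :
  (forall i, P i -> f i x @[x --> F] --> l i) ->
  \sum_(i <- s | P i) f i x @[x --> F] --> \sum_(i <- s | P i) l i.
Proof.
move=> H; elim: s => [|i s IH].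
  by under eq_fun do rewrite big_nil; rewrite big_nil; exact: cvg_cst.
rewrite big_cons; under eq_fun do rewrite big_cons.
by case: ifP => [/H Hi|//]; exact: cvgD.
Qed.

Lemma cauchy_schwarz_sum (R : realType) (I : finType) (a b : I -> R) :
  (\sum_i a i * b i) ^+ 2 <= (\sum_i a i ^+ 2) * \sum_i b i ^+ 2.
Proof.
set A := \sum_i a i ^+ 2; set C := \sum_i b i ^+ 2; set D := \sum_i a i * b i.
have A0 : 0 <= A by apply: sumr_ge0 => i _; exact: sqr_ge0.
have C0 : 0 <= C by apply: sumr_ge0 => i _; exact: sqr_ge0.
have q (s t : R) : 0 <= s ^+ 2 * A - 2 * s * t * D + t ^+ 2 * C.
  have -> : s ^+ 2 * A - 2 * s * t * D + t ^+ 2 * C = \sum_i (s * a i - t * b i) ^+ 2.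
    rewrite !mulr_sumr -sumrB -big_split/=; apply: eq_bigr => i _; ring.
  by apply: sumr_ge0 => i _; exact: sqr_ge0.
have [C00|C1] := eqVneq C 0.
  rewrite C00 mulr0; have := q D (A + 1); rewrite C00 mulr0 addr0.
  by have := sqr_ge0 D; nra.
have {}C1 : 0 < C by rewrite lt0r C1.
rewrite -subr_ge0 -(pmulr_rge0 _ C1) (_ : C * _ = C ^+ 2 * A - 2 * C * D * D + D ^+ 2 * C)//.
ring.
Qed.

(** * The Hilbert-Schmidt norm of [Ad x] and its growth along the geodesics [a_t] *)

Section RadialCoordinate.
Variables (R : realType) (G : lieGroupType R) (g : lieAlgebra G) (X : rankOneSpace g).
Local Notation gam Y t := (lie_exp g (t *: Y)).
Local Notation br := (lie_br g).
Local Notation H0 := (H0 X).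
Local Notation B := (Bth X).
Local Notation Bl := (@Bth_linear _ _ _ X).
Local Notation Bs := (@Bth_sym _ _ _ X).

Lemma orthonormal_basis : exists N (e : 'I_N -> g),
  (forall i k, B (e i) (e k) = (i == k)%:R) /\ forall u, u = \sum_i B u (e i) *: e i.
Proof.
have [N [e [_ eo _ er]]] := gram_schmidt Bl Bs (@Bth_ge0 _ _ _ X) (fun m => (vbasis {:g})`_m) (\dim {:g}).
exists N, (fun i : 'I_N => e i); split=> [i k|u]; first by rewrite eo.
have Hv (m : 'I_(\dim {:g})) : (vbasis {:g})`_m = \sum_(i < N) B (vbasis {:g})`_m (e i) *: e i.
  apply/eqP; rewrite -subr_eq0; apply/negPn/negP => /(@Bth_pos _ _ _ X).
  by have /= -> := er _ (ltn_ord m); rewrite ltxx.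
rewrite {1}(coord_vbasis (memvf u)).
under eq_bigr do rewrite Hv scaler_sumr.
rewrite exchange_big/=; apply: eq_bigr => i _.
rewrite {2}(coord_vbasis (memvf u)) (ip_suml Bl) scaler_suml; apply: eq_bigr => m _.
by rewrite (ipZl Bl) scalerA.
Qed.

Section Basis.
Variables (N : nat) (e : 'I_N -> g).
Hypotheses (eo : forall i k, B (e i) (e k) = (i == k)%:R)
  (eb : forall u, u = \sum_i B u (e i) *: e i).

Lemma parseval u : B u u = \sum_i B u (e i) ^+ 2.
Proof.
rewrite {1}(eb u) (ip_suml Bl); apply: eq_bigr => i _.
by rewrite (ipZl Bl) (Bs (e i)) expr2.
Qed.

(** The square of the Hilbert-Schmidt norm of [Ad x] for the inner product [B]. *)
Definition hsn (x : G) : R := \sum_i B (Ad x (e i)) (Ad x (e i)).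

Lemma hsn_continuous : continuous hsn.
Proof. by move=> x; apply: continuous_sum_at => i; exact: Bth_continuous. Qed.

Lemma hsn_Kl k x : Ksub X k -> hsn (k * x)%g = hsn x.
Proof. by move=> Kk; apply: eq_bigr => i _; rewrite AdM (Bth_Ksub _ _ Kk). Qed.

Lemma hsn_bound x u : B (Ad x u) (Ad x u) <= hsn x * B u u.
Proof.
rewrite parseval /hsn; under [X in X * _]eq_bigr do rewrite parseval.
rewrite exchange_big/= mulr_suml; apply: ler_sum => k _.
have -> : B (Ad x u) (e k) = \sum_i B (Ad x (e i)) (e k) * B u (e i).
  rewrite {1}(eb u) linear_sum (ip_suml Bl); apply: eq_bigr => i _.
  by rewrite linearZ/= (ipZl Bl) mulrC.
by rewrite (parseval u); exact: cauchy_schwarz_sum.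
Qed.

Lemma hsnM x y : hsn (x * y)%g <= hsn x * hsn y.
Proof.
by rewrite [X in _ * X]/hsn mulr_sumr; apply: ler_sum => i _; rewrite AdM; exact: hsn_bound.
Qed.

Lemma hsn_ge0 x : 0 <= hsn x.
Proof. by apply: sumr_ge0 => i _; exact: Bth_ge0. Qed.

(** [Ad k] maps the orthonormal basis to another one, and the Hilbert-Schmidt norm is the same in
    both: the matrix [c] of [Ad k] is orthogonal. *)
Lemma hsn_Kr k x : Ksub X k -> hsn (x * k)%g = hsn x.
Proof.
move=> Kk; pose c i l := B (Ad k (e i)) (e l).
have -> : hsn (x * k)%g = \sum_i \sum_l \sum_l' c i l * c i l' * B (Ad x (e l)) (Ad x (e l')).
  apply: eq_bigr => i _; rewrite AdM {1 2}(eb (Ad k (e i))).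
  rewrite linear_sum/= (ip_suml Bl); apply: eq_bigr => l _.
  rewrite (ip_sumr Bl Bs); apply: eq_bigr => l' _.
  by rewrite !linearZ/= (ipZl Bl) (ipZr Bl Bs) mulrA.
rewrite exchange_big/=; apply: eq_bigr => l _.
rewrite exchange_big/= (bigD1 l)//= [X in _ + X]big1 ?addr0; last first.
  move=> l' ll'; rewrite -mulr_suml.
  suff -> : \sum_i c i l * c i l' = 0 by rewrite mul0r.
  have cE i l0 : c i l0 = B (Ad k^-1%g (e l0)) (e i).
    by rewrite /c -{1}(AdVK k (e l0)) (Bth_Ksub _ _ Kk) Bs.
  under eq_bigr do rewrite !cE.
  have -> : \sum_i B (Ad k^-1%g (e l)) (e i) * B (Ad k^-1%g (e l')) (e i) =
     B (Ad k^-1%g (e l)) (Ad k^-1%g (e l')).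
    rewrite [X in _ = B X _]eb (ip_suml Bl); apply: eq_bigr => i _.
    by rewrite (ipZl Bl) (Bs (e i)).
  by rewrite -(Bth_Ksub _ _ Kk) !AdVK eo eq_sym (negPf ll').
rewrite -mulr_suml.
suff -> : \sum_i c i l * c i l = 1 by rewrite mul1r.
have cE i l0 : c i l0 = B (Ad k^-1%g (e l0)) (e i).
  by rewrite /c -{1}(AdVK k (e l0)) (Bth_Ksub _ _ Kk) Bs.
under eq_bigr do rewrite !cE -expr2.
by rewrite -parseval -(Bth_Ksub _ _ Kk) !AdVK eo eqxx.
Qed.

Lemma hsn_gt0 x : (0 < N)%N -> 0 < hsn x.
Proof.
move=> N0; rewrite lt0r hsn_ge0 andbT; apply/negP => /eqP h0.
have := hsnM x x^-1%g; rewrite mulgV h0 mul0r.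
rewrite /hsn (bigD1 (Ordinal N0))//= Ad1 eo eqxx leNgt ltr_wpDr//.
by apply: sumr_ge0 => i _; exact: Bth_ge0.
Qed.

End Basis.

Variables (kap : G -> G) (H : G -> R) (nu : G -> G).
Hypothesis Hiw : iwasawa X kap H nu.

(* [tau] is, up to scaling, the logarithm of the Hilbert-Schmidt norm of [Ad x]. *)
Lemma radial_coordinate : exists tau : G -> R,
 [/\ continuous tau, forall k1 k2 x, Ksub X k1 -> Ksub X k2 -> tau (k1 * x * k2)%g = tau x,
     forall y, exists M, forall x, `|tau (y * x)%g - tau x| <= M &
     exists M, forall t, 0 <= t -> `|tau (aexp X t) - t| <= M] /\
  (forall y, (tau (y * aexp X t)%g - t) @[t --> +oo] --> H y) /\
  (forall M, exists r, forall x, (forall u, B (Ad x u) (Ad x u) <= M * B u u) -> tau x <= r).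
Proof.
have [j [[mj jE] j1 [v0 v00 v0E] jtop]] := top_eigenvalue X.
have j0 : 0 < j := lt_le_trans ltr01 j1.
have [N [e [eo eb]]] := orthonormal_basis.
have [w Hw] := choice (fun i => eigen_decomposition X (e i)).
have we i : e i = \sum_m w i m by have [] := Hw i.
have wH i (m : 'I_5) : br H0 (w i m) = (m%:R - 2) *: w i m by have [_] := Hw i.
have N0 : (0 < N)%N.
  rewrite lt0n; apply/negP => /eqP N0; have := @Bth_pos _ _ _ X _ v00.
  rewrite (parseval eb) big1 ?ltxx// => i _.
  by exfalso; move: i; rewrite N0 => -[].
have w0 i (m : 'I_5) : j < m%:R - 2 -> w i m = 0.
  move=> jm; apply/eqP/negPn/negP => wn0.
  by have := jtop _ _ wn0 (wH i m); rewrite leNgt jm.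
pose T := hsn e.
(* The total mass of the basis vectors in the top eigenspace; it is positive because [v0] lies
   there. *)
pose mm := \sum_i B (w i mj) (w i mj).
have mm0 : 0 < mm.
  rewrite lt0r sumr_ge0 ?andbT => [|i _]; last exact: Bth_ge0.
  apply/negP => /eqP mm0; have := @Bth_pos _ _ _ X _ v00.
  rewrite (parseval eb) big1 ?ltxx// => i _.
  have wi0 : w i mj = 0.
    apply/eqP/negPn/negP => /(@Bth_pos _ _ _ X).
    rewrite lt_neqAle eq_sym => /andP[/negP + _]; apply; apply/eqP.
    by apply: (psumr_eq0P _ mm0) => // k _; exact: Bth_ge0.
  rewrite we (ip_sumr Bl Bs) big1 ?expr0n// => m _.
  have [->|mmj] := eqVneq m mj; first by rewrite wi0 (ip0r Bl Bs).
  apply: (Bth_eigen_orth v0E (wH i m)).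
  apply: contra_neq mmj; rewrite jE => /addIr/eqP; rewrite eqr_nat => /eqP E.
  exact/val_inj.
(* The coefficients of [T (y a_t)] as a combination of exponentials of [t]. The largest exponent is
   [2 j], attained by the pair [(mj, mj)] alone, with coefficient [e^(2 j H y) mm] by [Bth_H]. *)
pose c y (m m' : 'I_5) := \sum_i B (Ad y (w i m)) (Ad y (w i m')).
have TE y t : T (y * aexp X t)%g = \sum_(m < 5) \sum_(m' < 5) expR ((m%:R - 2 + (m'%:R - 2)) * t) * c y m m'.
  rewrite /T /hsn.
  have E i : B (Ad (y * aexp X t)%g (e i)) (Ad (y * aexp X t)%g (e i)) =
    \sum_(m < 5) \sum_(m' < 5) expR ((m%:R - 2 + (m'%:R - 2)) * t) * B (Ad y (w i m)) (Ad y (w i m')).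
    have Ee : Ad (y * aexp X t)%g (e i) = \sum_(m < 5) expR ((m%:R - 2) * t) *: Ad y (w i m).
      rewrite AdM we !linear_sum/=; apply: eq_bigr => m _.
      by rewrite -linearZ/=; congr (Ad y _); exact: (Ad_eigen t (wH i m)).
    rewrite Ee (ip_suml Bl); apply: eq_bigr => m _.
    rewrite (ip_sumr Bl Bs); apply: eq_bigr => m' _.
    by rewrite (ipZl Bl) (ipZr Bl Bs) mulrA -expRD -mulrDl.
  under eq_bigr do rewrite E.
  rewrite exchange_big/=; apply: eq_bigr => m _.
  by rewrite exchange_big/=; apply: eq_bigr => m' _; rewrite mulr_sumr.
have cjj y : c y mj mj = expR (2 * j * H y) * mm.
  rewrite /c /mm mulr_sumr; apply: eq_bigr => i _.
  by apply: (Bth_H Hiw jtop); rewrite jE.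
have c0 y (m m' : 'I_5) : (j < m%:R - 2) || (j < m'%:R - 2) -> c y m m' = 0.
  move=> jm; rewrite /c big1// => i _.
  by case/orP : jm => /(w0 i) ->; rewrite linear0 ?(ip0l Bl) ?(ip0r Bl Bs).
have Tlim y : (expR (- (2 * j * t)) * T (y * aexp X t)%g) @[t --> +oo] --> expR (2 * j * H y) * mm.
  rewrite -cjj.
  have -> : c y mj mj = \sum_(m < 5) \sum_(m' < 5) (if (m == mj) && (m' == mj) then c y m m' else 0).
    rewrite (bigD1 mj)//= (bigD1 mj)//= !eqxx/= [X in _ + X + _]big1 => [|m' /negPf ->//].
    rewrite [X in _ + _ + X]big1 ?addr0// => m /negPf mE.
    by rewrite big1// => m' _; rewrite mE.
  rewrite (_ : (fun t => _) = (fun t => \sum_(m < 5) \sum_(m' < 5)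
     expR ((m%:R - 2 + (m'%:R - 2) - 2 * j) * t) * c y m m')); last first.
    apply/funext => t; rewrite TE mulr_sumr; apply: eq_bigr => m _.
    rewrite mulr_sumr; apply: eq_bigr => m' _; rewrite mulrA -expRD; congr (expR _ * _); ring.
  apply: cvg_sumr => m _; apply: cvg_sumr => m' _.
  case: ifPn => [/andP[/eqP -> /eqP ->]|mm'].
    rewrite -jE (_ : j + j - 2 * j = 0); last by ring.
    under eq_fun do rewrite mul0r expR0 mul1r.
    exact: cvg_cst.
  have [jm|] := boolP ((j < m%:R - 2) || (j < m'%:R - 2)).
    rewrite c0//; under eq_fun do rewrite mulr0.
    exact: cvg_cst.
  rewrite negb_or -!leNgt => /andP[jm jm'].
  have jlt : m%:R - 2 + (m'%:R - 2) - 2 * j < 0.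
    have neq (m0 : 'I_5) : m0 != mj -> m0%:R - 2 <= j -> m0%:R - 2 < j.
      move=> m0j; rewrite le_eqVlt => /predU1P[|//]; rewrite jE => /addIr/eqP.
      by rewrite eqr_nat => /eqP/val_inj m0E; rewrite m0E eqxx in m0j.
    by move: mm'; rewrite negb_and => /orP[/neq/(_ jm)|/neq/(_ jm')]; lra.
  rewrite -[X in _ --> X](mul0r (c y m m')); apply: cvgMl.
  set b := _ - _ in jlt *.
  have -> : (fun t => expR (b * t)) = (fun t => expR (- t)) \o (fun t => - b * t).
    by apply/funext => t /=; rewrite mulNr opprK.
  apply: (@cvg_comp _ _ _ (fun t => - b * t) (fun t => expR (- t)) _ (+oo%R)).
    by apply: gt0_cvgMry; [rewrite oppr_gt0|exact: cvg_id].
  exact: cvgr_expR.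
have T0 x : 0 < T x by exact: (hsn_gt0 eo eb).
(* The divisor [2 j] turns the leading exponent into [t], and [mm] makes the limit of
   [tau (y a_t) - t] exactly [H y]. *)
pose tau x := ln (T x / mm) / (2 * j).
have tauB x y : tau x - tau y = ln (T x / T y) / (2 * j).
  rewrite /tau -mulrBl -ln_div ?posrE ?divr_gt0//; congr (ln _ / _).
  by rewrite invf_div mulrA divfK// gt_eqF.
have Tb y x : T (y * x)%g / T x <= T y /\ (T y^-1%g)^-1 <= T (y * x)%g / T x.
  split; first by rewrite ler_pdivrMr//; exact: (hsnM eb).
  rewrite ler_pdivlMr// ler_pdivrMl//.
  by rewrite -{1}(mulKg y x); exact: (hsnM eb).
have j20 : 0 < 2 * j by rewrite mulr_gt0.
have lnE t x : ln (expR (- (2 * j * t)) * T x / mm) = - (2 * j * t) + ln (T x / mm).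
  by rewrite -mulrA lnM ?posrE ?expR_gt0 ?divr_gt0// expRK.
(* For [t >= 0] every exponential of the normalized sum is at most 1, which gives the upper bound
   [Cs]; the lower bound 1 comes from the vector [v0] alone. *)
pose Cs := \sum_m \sum_m' `|c 1%g m m'|.
have Tle (s : R) : 0 <= s -> 1 <= expR (- (2 * j * s)) * T (aexp X s) <= Cs.
  move=> s0; apply/andP; split.
    have := hsn_bound eb (aexp X s) v0.
    rewrite (_ : Ad (aexp X s) v0 = expR (j * s) *: v0); last exact: Ad_eigen.
    rewrite (ipZl Bl) (ipZr Bl Bs) mulrA -expRD ler_pM2r ?Bth_pos// => H1.
    have E1 : expR (- (2 * j * s)) * expR (j * s + j * s) = 1.
      by rewrite -expRD (_ : - _ + _ = 0) ?expR0//; ring.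
    by rewrite -[leLHS]E1 ler_pM2l ?expR_gt0.
  rewrite -[aexp X s]mul1g TE mulr_sumr; apply: ler_sum => m _.
  rewrite mulr_sumr; apply: ler_sum => m' _; rewrite mulrA -expRD.
  apply: (le_trans (ler_norm _)); rewrite normrM (gtr0_norm (expR_gt0 _)).
  have [jm|] := boolP ((j < m%:R - 2) || (j < m'%:R - 2)).
    by rewrite c0// normr0 mulr0.
  rewrite negb_or -!leNgt => /andP[jm jm'].
  rewrite ler_piMl//; rewrite -[leRHS]expR0 ler_expR.
  rewrite -mulNr -mulrDl mulr_le0_ge0//; lra.
exists tau; split; [split|split].
- move=> x; apply: (@continuousM R G (fun x => ln (T x / mm)) (cst (2 * j)^-1) x); last exact: cst_continuous.
  apply: (@continuous_comp _ _ _ (fun x => T x / mm) (@ln R)).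
    by apply: (@continuousM R G T (cst mm^-1)); [exact: hsn_continuous|exact: cst_continuous].
  by apply: continuous_ln; rewrite divr_gt0.
- by move=> k1 k2 x K1 K2; rewrite /tau /T (hsn_Kr eo eb _ K2) (hsn_Kl _ _ K1).
- move=> y; exists ((`|ln (T y)| + `|ln (T y^-1%g)|) / (2 * j)) => x.
  rewrite tauB normrM (gtr0_norm (_ : 0 < (2 * j)^-1)) ?invr_gt0// ler_pM2r ?invr_gt0//.
  have [b1 b2] := Tb y x; have r0 : 0 < T (y * x)%g / T x by rewrite divr_gt0.
  rewrite ler_norml; apply/andP; split.
    apply: (@le_trans _ _ (ln (T y^-1%g)^-1)).
      by rewrite lnV ?posrE// lerNl opprK -[leLHS]add0r lerD// ler_norm.
    by rewrite ler_ln// posrE invr_gt0.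
  apply: (@le_trans _ _ (ln (T y))); first by rewrite ler_ln ?posrE.
  by rewrite -[leLHS]addr0 lerD// ler_norm.
- exists ((`|ln mm^-1| + `|ln (Cs / mm)|) / (2 * j)) => t t0; have /andP[T1 T2] := Tle t t0.
  have -> : tau (aexp X t) - t = ln (expR (- (2 * j * t)) * T (aexp X t) / mm) / (2 * j).
    rewrite lnE /tau.
    by field; rewrite gt_eqF.
  rewrite normrM (gtr0_norm (_ : 0 < (2 * j)^-1)) ?invr_gt0// ler_pM2r ?invr_gt0//.
  have r0 : 0 < expR (- (2 * j * t)) * T (aexp X t) by rewrite mulr_gt0 ?expR_gt0.
  rewrite ler_norml; apply/andP; split.
    apply: (@le_trans _ _ (ln mm^-1)).
      rewrite lerNl (le_trans (ler_norm _))// normrN lerDl//.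
    by rewrite ler_ln ?posrE ?invr_gt0 ?divr_gt0// ler_peMl// invr_ge0 ltW.
  apply: (@le_trans _ _ (ln (Cs / mm))).
    rewrite ler_ln ?posrE ?divr_gt0//; last exact: lt_le_trans T2.
    by rewrite ler_pM2r ?invr_gt0.
  by rewrite (le_trans (ler_norm _))// lerDr.
- move=> y.
  rewrite (_ : (fun t => _) = (fun t => ln (expR (- (2 * j * t)) * T (y * aexp X t)%g / mm) / (2 * j))); last first.
    apply/funext => t; rewrite lnE /tau.
    by field; rewrite gt_eqF.
  have -> : H y = ln (expR (2 * j * H y) * mm / mm) / (2 * j).
    by rewrite mulfK ?gt_eqF// expRK; field; rewrite gt_eqF.
  apply: cvgMl; apply: continuous_cvg.
    by apply: continuous_ln; rewrite mulfK ?gt_eqF// expR_gt0.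
  by apply: cvgMl.
- move=> M; exists (ln (M * N%:R / mm) / (2 * j)) => x Hx.
  have TM : T x <= M * N%:R.
    have -> : M * N%:R = \sum_(i < N) M by rewrite sumr_const card_ord mulr_natr.
    apply: ler_sum => i _.
    by rewrite (le_trans (Hx _))// eo eqxx mulr1.
  rewrite ler_pM2r ?invr_gt0// ler_ln ?posrE ?divr_gt0//; last exact: lt_le_trans TM.
  by rewrite ler_pM2r ?invr_gt0.
Qed.

End RadialCoordinate.

(** * The group [K], and boundedness of the radial coordinate on balls *)

Section MaximalCompact.
Variables (R : realType) (G : lieGroupType R) (g : lieAlgebra G) (X : rankOneSpace g).
Variables (dk : probability (borel G) R).
Hypotheses (Kmax : maximal_compact X) (Hdk : haarK X dk).
Local Notation K := (Ksub X).
Local Notation th := (theta X).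
Local Notation gam Y t := (lie_exp g (t *: Y)).
Local Notation br := (lie_br g).
Local Notation B := (Bth X).
Local Notation Bl := (@Bth_linear _ _ _ X).
Local Notation Bs := (@Bth_sym _ _ _ X).

Lemma Ksub1 : K 1%g.
Proof. by exists 0; rewrite /= ?mem0v// lie_exp0. Qed.

Lemma KsubV k : K k -> K k^-1%g.
Proof.
move=> [Y /= Yk <-]; exists (- Y); first by rewrite /= memvN.
by rewrite -{2}[Y]scale1r -gamN scaleN1r.
Qed.

Lemma Ksub_compact : compact K. Proof. by case: Kmax. Qed.

Lemma Ksub_measurable : measurable (K : set (borel G)).
Proof. exact: compact_borel Ksub_compact. Qed.

Lemma borel_continuous (f : G -> G) : continuous f ->
  measurable_fun setT (f : borel G -> borel G).
Proof.
move=> cf; apply: (@measurability _ _ (borel G) (borel G) setT f (@open G)) => //.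
move=> _ [U oU <-]; rewrite setTI; apply: open_borel.
by apply: open_comp => // x _; exact: cf.
Qed.

Lemma mulg_continuousl (x : G) : continuous (fun y : G => (x * y)%g).
Proof. by move=> y; apply: mulg_continuous_at; [exact: cvg_cst|exact: cvg_id]. Qed.

Lemma mulg_continuousr (x : G) : continuous (fun y : G => (y * x)%g).
Proof. by move=> y; apply: mulg_continuous_at; [exact: cvg_id|exact: cvg_cst]. Qed.

Lemma borel_preimage (f : G -> G) (A : set (borel G)) : continuous f -> measurable A ->
  measurable (f @^-1` A : set (borel G)).
Proof.
by move=> cf mA; rewrite -[X in measurable X]setTI; apply: borel_continuous.
Qed.

(* The translates of [K] by products of elements of [K] still have full measure,
   hence meet [K], so that [K K] is a group. *)
Lemma KsubM k1 k2 : K k1 -> K k2 -> K (k1 * k2)%g.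
Proof.
pose L := [set x | exists a b : G, [/\ K a, K b & x = (a * b)%g]].
have mK := Ksub_measurable.
have HL (s : seq G) : (forall a, a \in s -> K a) -> L (foldr (fun a b => (a * b)%g) 1%g s).
  move=> sK; set x := foldr _ _ _.
  have inv (A : set (borel G)) : measurable A -> dk ((fun y : G => (x * y)%g) @^-1` A) = dk A.
    rewrite /x; elim: s sK {x} A => [|a s IH] sK A mA /=.
      by congr (dk _); apply/seteqP; split => y /=; rewrite mul1g.
    have Ka : K a by apply: sK; rewrite mem_head.
    rewrite -[RHS](Hdk.2 a A Ka mA) -IH//.
    - by congr (dk _); apply/seteqP; split => y /=; rewrite mulgA.
    - by move=> b bs; apply: sK; rewrite in_cons bs orbT.
    - by apply: borel_preimage => //; exact: mulg_continuousl.
  have mxK : measurable ((fun y : G => (x * y)%g) @^-1` K : set (borel G)).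
    by apply: borel_preimage => //; exact: mulg_continuousl.
  have [y [Ky Kxy]] : exists y, K y /\ K (x * y)%g.
    apply: contrapT => H.
    have KC : K `<=` ~` ((fun y : G => (x * y)%g) @^-1` K) by move=> y Ky Kxy; apply: H; exists y.
    have : (dk (K : set (borel G)) <= dk (~` ((fun y : G => (x * y)%g) @^-1` K) : set (borel G)))%E.
      by apply: le_measure; rewrite ?inE//; exact: measurableC.
    by rewrite probability_setC// inv// Hdk.1 subee// lee_fin ler10.
  by exists (x * y)%g, y^-1%g; split=> //; [exact: KsubV|rewrite mulgK].
move=> K1 K2.
have KL : L `<=` K.
  apply: Kmax.2.
  - have -> : L = (fun p : G * G => (p.1 * p.2)%g) @` (K `*` K).
      apply/seteqP; split=> [_ [a [b [Ka Kb ->]]]|_ [[a b] [/= Ka Kb] <-]]; first by exists (a, b).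
      by exists a, b.
    apply: continuous_compact; last by apply: compact_setX; exact: Ksub_compact.
    by apply: continuous_subspaceT; exact: mulg_continuous.
  - by exists 1%g, 1%g; split; rewrite ?mulg1//; exact: Ksub1.
  - move=> _ _ [a [b [Ka Kb ->]]] [c [d [Kc Kd ->]]].
    have := HL [:: a; b; d^-1%g; c^-1%g]; rewrite /= mulg1 invgM !mulgA; apply => e.
    by rewrite !inE => /or4P[] /eqP ->//; exact: KsubV.
  - by move=> k Kk; exists k, 1%g; split=> //; [exact: Ksub1|rewrite mulg1].
by apply: KL; exists k1, k2.
Qed.

(** The squared length [F] of [Ad (exp (t Y)) u] satisfies [F' <= 2 q F], so that [F e^(- 2 q t)]
    decreases on [[0, 1]]. The constant [q] comes from the structure constants in an orthonormal
    basis and from the length of [Y]. *)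
Lemma pp_Gronwall (r : R) : exists M, forall Y u, Y \in pp (theta X) -> B Y Y <= r ->
  B (Ad (lie_exp g Y) u) (Ad (lie_exp g Y) u) <= M * B u u.
Proof.
have [N [e [eo eb]]] := orthonormal_basis X.
pose c := \sum_i \sum_k \sum_l `|B (br (e i) (e k)) (e l)|.
pose q := Num.sqrt `|r| * c.
have Hc Y u : B Y Y <= r -> B (br Y u) u <= q * B u u.
  move=> Yr.
  have coo v i : `|B v (e i)| <= Num.sqrt (B v v).
    rewrite -sqrtr_sqr ler_sqrt ?Bth_ge0// (parseval eb v) (bigD1 i)//= lerDl.
    by apply: sumr_ge0 => k _; exact: sqr_ge0.
  have -> : B (br Y u) u = \sum_i \sum_k \sum_l B Y (e i) * B u (e k) * B u (e l) * B (br (e i) (e k)) (e l).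
    have E1 : br Y u = \sum_i \sum_k (B Y (e i) * B u (e k)) *: br (e i) (e k).
      rewrite {1}(eb u) linear_sum/= exchange_big/=; apply: eq_bigr => k _.
      rewrite linearZ/= lie_brC {1}(eb Y) linear_sum/= -sumrN scaler_sumr; apply: eq_bigr => i _.
      by rewrite linearZ/= -scalerN -lie_brC scalerA mulrC.
    rewrite E1 (ip_suml Bl); apply: eq_bigr => i _.
    rewrite (ip_suml Bl); apply: eq_bigr => k _.
    rewrite (ipZl Bl) {2}(eb u) (ip_sumr Bl Bs) mulr_sumr; apply: eq_bigr => l _.
    by rewrite (ipZr Bl Bs) mulrA.
  rewrite /q /c mulrAC !mulr_sumr; apply: ler_sum => i _.
  rewrite mulr_sumr; apply: ler_sum => k _; rewrite mulr_sumr; apply: ler_sum => l _.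
  apply: (le_trans (ler_norm _)); rewrite !normrM ler_wpM2r//.
  rewrite -(sqr_sqrtr (Bth_ge0 X u)) expr2 mulrA.
  apply: ler_pM => //.
  apply: ler_pM => //.
  apply: (le_trans (coo Y i)); rewrite ler_sqrt//.
  exact: le_trans Yr (ler_norm _).
exists (expR (2 * q)) => Y u Yp Yr.
pose F t := B (Ad (gam Y t) u) (Ad (gam Y t) u).
pose f t := F t * expR (- (2 * q) * t).
pose df t := (2 * B (br Y (Ad (gam Y t) u)) (Ad (gam Y t) u) - 2 * q * F t) * expR (- (2 * q) * t).
have dF (t : R) : is_derive (t : R^o) (1 : R^o) (f : R^o -> R^o) (df t).
  have d1 := derive_Bth_Ad X Y u u t.
  have d2 : is_derive (t : R^o) (1 : R^o) ((fun s => expR (- (2 * q) * s)) : R^o -> R^o)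
      (expR (- (2 * q) * t) * - (2 * q)).
    have := is_derive1_comp (is_derive_expR (- (2 * q) * t)) (is_deriveZ (- (2 * q)) (is_derive_id (t : R^o) (1 : R^o))).
    by rewrite /GRing.scale/= mulr1.
  apply: (is_derive_eq (is_deriveM d1 d2)).
  rewrite /df /F (Bs _ (br Y _)) /GRing.scale/=; ring.
have f01 : f 1 <= f 0.
  apply: (@ler0_derive1_le_cc R f 0 1) => //; rewrite ?in_itv/= ?ler01 ?lexx//.
  - move=> t _; rewrite derive1E; have [_ ->] := dF t.
    rewrite mulr_le0_ge0 ?expR_ge0// subr_le0 -mulrA ler_pM2l//.
    exact: Hc.
  - apply: continuous_subspaceT => t; have [d _] := dF t.
    by apply/differentiable_continuous/derivable1_diffP.
move: f01; rewrite /f /F scale1r scale0r lie_exp0 !Ad1 mulr0 expR0 !mulr1 mulrC expRN.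
by rewrite ler_pdivrMl ?expR_gt0.
Qed.

(** The exponential of a bounded subset of [pp] acts on [g] with bounded norm, hence has bounded
    [tau]. The translation by [x0] changes [tau] by a bounded amount, and the factor in [K] does not
    change it. The factor [B H0 H0] in the radius undoes the normalization of [pnorm]. *)
Lemma ball_radial (tau : G -> R) (x0 : G) (r : R) :
  (forall k1 k2 x, K k1 -> K k2 -> tau (k1 * x * k2)%g = tau x) ->
  (forall y, exists M, forall x, `|tau (y * x)%g - tau x| <= M) ->
  (forall M, exists r', forall x, (forall u, B (Ad x u) (Ad x u) <= M * B u u) -> tau x <= r') ->
  exists r', forall x, ball_GK X x0 r x -> tau x <= r'.
Proof.
move=> tK tM tB; have [M HM] := pp_Gronwall (r ^+ 2 * B (H0 X) (H0 X)).
have [r1 Hr1] := tB M; have [r2 Hr2] := tM x0.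
exists (r2 + r1) => _ [Y [k [Yp Yr Kk ->]]].
rewrite -[(x0 * _)%g]mul1g (tK _ _ _ Ksub1 Kk).
rewrite -(subrK (tau (lie_exp g Y)) (tau _)) lerD//.
  exact: le_trans (ler_norm _) (Hr2 _).
apply: Hr1 => u; apply: (HM Y u Yp).
have h0 : 0 < B (H0 X) (H0 X) by apply: Bth_pos; exact: H0_neq0.
have kE Z : th Z = - Z -> B Z Z = killing Z Z.
  move=> ZE; rewrite /Bth ZE killingC (ipNl (@killing_linear _ _ g)) opprK//.
rewrite -ler_pdivrMr// (kE Y (ppP Yp)) (kE _ (th_H0 X)).
move: Yr; rewrite /pnorm => Yr.
have d0 : 0 <= killing Y Y / killing (H0 X) (H0 X).
  by rewrite -(kE Y (ppP Yp)) -(kE _ (th_H0 X)) divr_ge0// ?Bth_ge0.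
rewrite -(sqr_sqrtr d0) ler_sqr ?nnegrE ?sqrtr_ge0//; first exact: ltW.
exact: le_trans (sqrtr_ge0 _) (ltW Yr).
Qed.

End MaximalCompact.

(** * Haar measures and radial functions *)

Section NormIndic.
Context d (T : measurableType d) (R : realType) (m : {measure set T -> \bar R}).
Variables (D : set T) (b : T -> R).
Hypotheses (mD : measurable D) (ib : m.-integrable D (EFin \o b)).

Lemma measurable_norm_indic : measurable_fun setT (fun x => (`|b x| * \1_D x)%:E).
Proof.
have [/measurable_EFinP mb _] := integrableP _ _ _ ib.
apply/measurable_EFinP; rewrite (_ : (fun x => _) = (fun x => `|(b \_ D) x|)).
  apply: measurableT_comp => //.
  exact/(measurable_restrictT _ mD).
by apply/funext => x; rewrite patchE indicE; case: ifP => _; rewrite ?mulr1 ?mulr0 ?normr0.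
Qed.

Lemma integral_norm_indic : (\int[m]_x (`|b x| * \1_D x)%:E < +oo)%E.
Proof.
have /integrableP[_] := ib; rewrite integral_mkcond; congr (_ < _)%E.
apply: eq_integral => x _; rewrite patchE/= indicE.
by case: ifP => _; rewrite ?mulr1 ?mulr0.
Qed.

End NormIndic.

Section FubiniDominated.
Context d1 d2 (T1 : measurableType d1) (T2 : measurableType d2) (R : realType).
Variables (m1 : {sigma_finite_measure set T1 -> \bar R}) (m2 : {sigma_finite_measure set T2 -> \bar R}).
Variables (D1 : set T1) (D2 : set T2) (f : T1 -> T2 -> R) (b1 : T1 -> R) (b2 : T2 -> R).
Hypotheses (mD1 : measurable D1) (mD2 : measurable D2)
  (mf : measurable_fun setT (fun p => f p.1 p.2))
  (ib1 : m1.-integrable D1 (EFin \o b1)) (ib2 : m2.-integrable D2 (EFin \o b2))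
  (fb : forall x y, D1 x -> D2 y -> `|f x y| <= b1 x * b2 y).

Let g (p : T1 * T2) : \bar R := ((f p.1 p.2) * (\1_D1 p.1 * \1_D2 p.2))%:E.

Let mg : measurable_fun setT g.
Proof.
apply/measurable_EFinP; apply: measurable_funM => //; apply: measurable_funM.
  by apply: measurableT_comp => //; exact: measurable_indic.
by apply: measurableT_comp => //; exact: measurable_indic.
Qed.

Lemma dom_integrable1 x : D1 x -> m2.-integrable D2 (EFin \o f x).
Proof.
move=> Dx; apply: (@le_integrable _ _ _ _ _ mD2 _ (EFin \o (fun y => b1 x * b2 y))).
- apply/measurable_EFinP; apply: measurable_funTS.
  by have := measurable_fun_pair2 x mf.
- move=> y Dy /=; rewrite lee_fin (le_trans (fb Dx Dy))// ler_norm//.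
- rewrite (_ : EFin \o _ = (fun y => (b1 x)%:E * (EFin \o b2) y)%E)//.
  exact: integrableZl.
Qed.

Lemma dom_integrable2 y : D2 y -> m1.-integrable D1 (EFin \o f^~ y).
Proof.
move=> Dy; apply: (@le_integrable _ _ _ _ _ mD1 _ (EFin \o (fun x => b1 x * b2 y))).
- apply/measurable_EFinP; apply: measurable_funTS.
  by have := measurable_fun_pair1 y mf.
- move=> x Dx /=; rewrite lee_fin (le_trans (fb Dx Dy))// ler_norm//.
- rewrite (_ : EFin \o _ = (fun x => (EFin \o b1) x * (b2 y)%:E)%E)//.
  exact: integrableZr.
Qed.

Let gE1 x : (\int[m2]_y g (x, y) = (\1_D1 x * \int[m2]_(y in D2) f x y)%:E)%E.
Proof.
have [Dx|Dx] := pselect (D1 x); last first.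
  rewrite indicE memNset// mul0r; apply: integral0_eq => y _.
  by rewrite /g/= indicE memNset// mul0r mulr0.
rewrite indicE mem_set// mul1r /Rintegral fineK; last first.
  by apply: integrable_fin_num => //; exact: dom_integrable1.
rewrite integral_mkcond; apply: eq_integral => y _.
rewrite /g patchE /= indicE mem_set// mul1r indicE.
by case: ifP => _; rewrite ?mulr1 ?mulr0.
Qed.

Let gE2 y : (\int[m1]_x g (x, y) = (\1_D2 y * \int[m1]_(x in D1) f x y)%:E)%E.
Proof.
have [Dy|Dy] := pselect (D2 y); last first.
  rewrite indicE memNset// mul0r; apply: integral0_eq => x _.
  by rewrite /g/= [X in _ * X]mulrC indicE memNset// mul0r mulr0.
rewrite indicE mem_set// mul1r /Rintegral fineK; last first.
  by apply: integrable_fin_num => //; exact: dom_integrable2.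
rewrite integral_mkcond; apply: eq_integral => x _.
rewrite /g patchE /= [\1_D2 y]indicE mem_set// mulr1 indicE.
by case: ifP => _; rewrite ?mulr1 ?mulr0.
Qed.

Let ig : (m1 \x m2)%E.-integrable setT g.
Proof.
apply/integrable12ltyP => //.
apply: (@le_lt_trans _ _ (\int[m1]_x ((`|b1 x| * \1_D1 x)%:E * \int[m2]_y (`|b2 y| * \1_D2 y)%:E))%E).
  apply: ge0_le_integral => //.
  - by move=> x _; apply: integral_ge0.
  - apply: (measurable_fun_fubini_tonelli_F (abse \o g)) => //=.
    exact: measurableT_comp.
  - by apply: emeasurable_funM => //; exact: (measurable_norm_indic mD1 ib1).
  move=> x _; rewrite -ge0_integralZl//; last exact: (measurable_norm_indic mD2 ib2).
  apply: ge0_le_integral => //.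
  - by apply: measurableT_comp => //; exact: (measurable_fun_pair2 x mg).
  - by apply: emeasurable_funM => //; exact: (measurable_norm_indic mD2 ib2).
  move=> y _; rewrite /g/= -EFinM lee_fin !indicE.
  have [Dx|Dx] := boolP (x \in D1); last by rewrite !(mul0r, mulr0) normr0.
  have [Dy|Dy] := boolP (y \in D2); last by rewrite !(mul0r, mulr0) normr0.
  rewrite !mulr1 -normrM (le_trans (fb _ _))// ?ler_norm//; exact/set_mem.
have i2 := integral_norm_indic ib2.
have i20 : (0 <= \int[m2]_y (`|b2 y| * \1_D2 y)%:E)%E.
  by apply: integral_ge0 => y _; rewrite lee_fin mulr_ge0.
rewrite ge0_integralZr//; last exact: (measurable_norm_indic mD1 ib1).
rewrite lte_mul_pinfty//; first by rewrite integral_ge0.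
- by rewrite ge0_fin_numE ?integral_ge0//; exact: (integral_norm_indic ib1).
Qed.

Lemma dom_integrable_Rintegral1 :
  m1.-integrable D1 (EFin \o (fun x => \int[m2]_(y in D2) f x y)).
Proof.
have := integrable_fubini_F ig; rewrite /fubini_F (integrable_mkcond _ mD1).
apply: eq_integrable => // x _; rewrite gE1 patchE /= indicE.
by case: ifP => _; rewrite ?mul1r ?mul0r.
Qed.

(** The domains are absorbed into the integrand [g] by indicator functions; the product bound makes
    [g] integrable on the whole product space. *)
Lemma fubini_dominated :
  \int[m1]_(x in D1) \int[m2]_(y in D2) f x y = \int[m2]_(y in D2) \int[m1]_(x in D1) f x y.
Proof.
have := Fubini ig; under eq_integral do rewrite gE1.
under [in RHS]eq_integral do rewrite gE2.
move=> H; apply: EFin_inj; rewrite /Rintegral.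
rewrite [in LHS]integral_mkcond [in RHS]integral_mkcond.
congr (fine _)%:E; rewrite (_ : \int[m1]_x _ = \int[m1]_x (\1_D1 x * \int[m2]_(y in D2) f x y)%:E)%E.
  rewrite H; apply: eq_integral => y _; rewrite patchE indicE /Rintegral.
  by case: ifP => _; rewrite ?mul1r ?mul0r.
apply: eq_integral => x _; rewrite patchE indicE /Rintegral.
by case: ifP => _; rewrite ?mul1r ?mul0r.
Qed.

End FubiniDominated.

Section ChangeOfVariables.
Context d (T : measurableType d) (R : realType) (m : {measure set T -> \bar R}) (h : T -> T).
Hypotheses (mh : measurable_fun setT h) (hm : forall A, measurable A -> m (h @^-1` A) = m A).

Lemma ge0_integral_invariant (D : set T) (f : T -> \bar R) : measurable D ->
  measurable_fun setT f -> (forall x, 0 <= f x)%E ->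
  (\int[m]_(x in h @^-1` D) f (h x) = \int[m]_(x in D) f x)%E.
Proof.
move=> mD mf f0; have := @ge0_integral_pushforward _ _ T T R h mh m D f mD.
rewrite /= => <-//; last exact: measurable_funTS.
by apply: eq_measure_integral => A mA _; exact: hm.
Qed.

Lemma Rintegral_invariant (D : set T) (f : T -> R) : measurable D ->
  measurable_fun setT f ->
  \int[m]_(x in h @^-1` D) f (h x) = \int[m]_(x in D) f x.
Proof.
move=> mD mf; have mEf : measurable_fun setT (EFin \o f) by exact/measurable_EFinP.
rewrite /Rintegral; congr fine; rewrite [LHS]integralE [RHS]integralE.
congr (_ - _)%E.
  by rewrite -[RHS](ge0_integral_invariant mD (measurable_funepos mEf))//; apply: eq_integral => x _; rewrite !funeposE.
by rewrite -[RHS](ge0_integral_invariant mD (measurable_funeneg mEf))//; apply: eq_integral => x _; rewrite !funenegE.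
Qed.

End ChangeOfVariables.

Lemma bigcup_countable_measurable d (T : measurableType d) (I : Type) (D : set I)
    (F : I -> set T) : countable D -> (forall i, D i -> measurable (F i)) ->
  measurable (\bigcup_(i in D) F i).
Proof.
move=> /countable_injP[f fi] mF.
have -> : \bigcup_(i in D) F i = \bigcup_n \bigcup_(i in [set i | D i /\ f i = n]) F i.
  apply/seteqP; split=> [x [i Di Fx]|x [n _ [i [Di _] Fx]]]; last by exists i.
  by exists (f i) => //; exists i.
apply: bigcupT_measurable => n.
have [[i [Di fin]]|H] := pselect (exists i, D i /\ f i = n); last first.
  by rewrite (_ : [set i | _] = set0) ?bigcup_set0//; apply/seteqP; split=> // i Hi; apply: H; exists i.
rewrite (_ : [set i | _] = [set i]) ?bigcup_set1; first exact: mF.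
apply/seteqP; split=> [k [Dk fk]|k ->] //=.
by apply: fi; rewrite ?inE// fk fin.
Qed.

Section MeasurableGroup.
Variables (R : realType) (G : lieGroupType R).

(** The product sigma-algebra is generated by rectangles. By second countability the preimage of an
    open set is a countable union of open rectangles contained in it. *)
Lemma mulg_measurable :
  measurable_fun setT (fun p : borel G * borel G => (p.1 * p.2)%g : borel G).
Proof.
apply: (@measurability _ _ _ (borel G) setT _ (@open G)) => //.
move=> _ [U oU <-]; rewrite setTI.
have [Bs cB [Bo BB]] := @lie_second_countable R G.
pose F (q : set G * set G) : set (borel G * borel G) :=
  if `[< forall a b, q.1 a -> q.2 b -> U (a * b)%g >] then q.1 `*` q.2 else set0.
have -> : (fun p : borel G * borel G => (p.1 * p.2)%g : borel G) @^-1` U =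
    \bigcup_(q in Bs `*` Bs) F q.
  apply/seteqP; split=> [[x y] /= Uxy|[x y] [[A C] [/= BA BC]]].
    have [[A C] /= [Ax Cy] AC] : nbhs ((x, y) : G * G) ((fun p : G * G => (p.1 * p.2)%g) @^-1` U).
      by apply: mulg_continuous; exact: open_nbhs_nbhs.
    have [A' [BA' A'x A'A]] := BB x A Ax; have [C' [BC' C'y C'C]] := BB y C Cy.
    exists (A', C') => //; rewrite /F/=; case: asboolP => // H; exfalso; apply: H => a b A'a C'b.
    by apply: (AC (a, b)); split => /=; [exact: A'A|exact: C'C].
  by rewrite /F/=; case: asboolP => //= H [Ax Cy]; exact: H.
apply: bigcup_countable_measurable.
  have /countable_injP[f fi] := cB; apply/countable_injP.
  exists (fun q => pickle (f q.1, f q.2)) => -[a b] [a' b'].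
  rewrite !inE => -[/= Ba Bb] [/= Ba' Bb'] /(pcan_inj pickleK) [fa fb].
  by congr (_, _); apply: fi => //; exact/mem_set.
move=> [A C] [/= BA BC]; rewrite /F; case: ifP => // _.
by apply: measurableX; apply: open_borel; exact: Bo.
Qed.

Lemma measurable_mulg d (T : measurableType d) (f h : T -> borel G) :
  measurable_fun setT f -> measurable_fun setT h ->
  measurable_fun setT (fun x => (f x * h x)%g : borel G).
Proof.
move=> mf mh.
exact: (measurableT_comp mulg_measurable (measurable_fun_pair mf mh)).
Qed.

Lemma measurable_invg d (T : measurableType d) (f : T -> borel G) :
  measurable_fun setT f -> measurable_fun setT (fun x => (f x)^-1%g : borel G).
Proof.
move=> mf; apply: (measurableT_comp _ mf).
by apply: borel_continuous; exact: invg_continuous.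
Qed.

Lemma compact_bound (Q : set G) (f : G -> R) : compact Q -> continuous f ->
  exists2 M, 0 <= M & forall x, Q x -> `|f x| <= M.
Proof.
move=> cQ cf.
have : bounded_set (f @` Q).
  by apply: compact_bounded; apply: continuous_compact => //; exact: continuous_subspaceT.
move=> [B [_ HB]]; exists (`|B| + 1); first by rewrite addr_ge0.
move=> x Qx; apply: (HB (`|B| + 1)); last by exists x.
by rewrite (le_lt_trans (ler_norm _))// ltrDl.
Qed.

Variables (m : {measure set (borel G) -> \bar R}) (Q : set G).
Hypotheses (cQ : compact Q) (Qfin : (m Q < +oo)%E).
Let mQ : measurable (Q : set (borel G)). Proof. exact: compact_borel. Qed.

Lemma compact_integrable (f : G -> R) : continuous f ->
  m.-integrable (Q : set (borel G)) (EFin \o (f : borel G -> R)).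
Proof.
move=> cf; have [M _ fM] := compact_bound cQ cf.
apply: (@bounded_integrable _ (borel G) R m Q f M) => //.
by apply: measurable_funTS; exact: continuous_borel.
Qed.

Lemma Rintegral_support (f : G -> R) : (forall x, ~ Q x -> f x = 0) ->
  \int[m]_(x in setT) (f : borel G -> R) x = \int[m]_(x in (Q : set (borel G))) f x.
Proof.
move=> fQ; rewrite [RHS]Rintegral_mkcond; apply: eq_Rintegral => x _.
by rewrite patchE; case: ifPn => //; rewrite notin_setE => /fQ.
Qed.

Lemma support_integrable (f : G -> R) : continuous f -> (forall x, ~ Q x -> f x = 0) ->
  m.-integrable setT (EFin \o (f : borel G -> R)).
Proof.
move=> cf fQ.
have -> : EFin \o f = (EFin \o (f : borel G -> R)) \_ Q.
  apply/funext => x; rewrite patchE; case: ifPn => //.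
  by rewrite notin_setE => /fQ /= ->.
by rewrite -(integrable_mkcond _ mQ); exact: compact_integrable.
Qed.

End MeasurableGroup.

(** * Two-sided invariance of the Haar measure of [K] *)

Section HaarK.
Variables (R : realType) (G : lieGroupType R) (g : lieAlgebra G) (X : rankOneSpace g).
Variables (dk : probability (borel G) R).
Hypotheses (Kmax : maximal_compact X) (Hdk : haarK X dk).
Local Notation K := (Ksub X : set (borel G)).
Local Notation KM := (KsubM Kmax Hdk).
Local Notation cK := (Ksub_compact Kmax).

Lemma dkK : dk K = 1%E. Proof. exact: Hdk.1. Qed.

Lemma dkK_fin : (dk K < +oo)%E. Proof. by rewrite dkK ltry. Qed.

Let mK : measurable K. Proof. exact: Ksub_measurable. Qed.

Lemma intK_cst (a : R) : \int[dk]_(k in K) a = a.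
Proof. by rewrite Rintegral_cst// [X in fine X]dkK mulr1. Qed.

Lemma Ksub_preim k : K k -> (fun y : G => (k * y)%g) @^-1` K = K.
Proof.
move=> Kk; apply/seteqP; split=> y /= Ky; last exact: KM.
by rewrite -(mulKg k y); apply: KM => //; exact: KsubV.
Qed.

Lemma intK_left (f : G -> R) k : continuous f -> K k ->
  \int[dk]_(y in K) f (k * y)%g = \int[dk]_(y in K) f y.
Proof.
move=> cf Kk; rewrite -{1}(Ksub_preim Kk).
apply: (@Rintegral_invariant _ (borel G) R dk (fun y : G => (k * y)%g)) => //.
- by apply: borel_continuous; exact: mulg_continuousl.
- by move=> A mA; exact: Hdk.2.
- exact: continuous_borel.
Qed.

Lemma integrableK (f : G -> R) : continuous f -> dk.-integrable K (EFin \o (f : borel G -> R)).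
Proof. by move=> cf; apply: compact_integrable => //; [exact: cK|exact: dkK_fin]. Qed.

Lemma invg_comp_continuous (f : G -> R) : continuous f -> continuous (fun y => f y^-1%g).
Proof. by move=> cf y; apply: continuous_comp; [exact: invg_continuous|exact: cf]. Qed.

Lemma mulgl_comp_continuous (f : G -> R) x : continuous f -> continuous (fun y => f (x * y)%g).
Proof. by move=> cf y; apply: continuous_comp; [exact: mulg_continuousl|exact: cf]. Qed.

Lemma mulgr_comp_continuous (f : G -> R) x : continuous f -> continuous (fun y => f (y * x)%g).
Proof. by move=> cf y; apply: continuous_comp; [exact: mulg_continuousr|exact: cf]. Qed.

(** The two iterated integrals of [f (x^-1 y)] over [K] times [K]: by left invariance the inner
    integral over [y] is that of [f], and the one over [x], after the substitution of [y x] for [x],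
    is that of [f] at the inverse. *)
Lemma intK_inv (f : G -> R) : continuous f ->
  \int[dk]_(y in K) f y^-1%g = \int[dk]_(y in K) f y.
Proof.
move=> cf; have [M M0 fM] := compact_bound cK cf.
have icst (a : R) : dk.-integrable K (EFin \o cst a) by apply: integrableK; exact: cst_continuous.
have := @fubini_dominated _ _ (borel G) (borel G) R dk dk K K
  (fun x y => f (x^-1 * y)%g) (cst M) (cst 1) mK mK _ (icst M) (icst 1).
rewrite (_ : \int[dk]_(x in K) \int[dk]_(y in K) f (x^-1 * y)%g = \int[dk]_(y in K) f y); last first.
  rewrite (@eq_Rintegral _ _ _ _ _ (cst (\int[dk]_(y in K) f y))) ?intK_cst// => x.
  by rewrite inE => Kx /=; rewrite intK_left//; exact: KsubV.
rewrite (_ : \int[dk]_(y in K) \int[dk]_(x in K) f (x^-1 * y)%g = \int[dk]_(y in K) f y^-1%g); last first.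
  rewrite (@eq_Rintegral _ _ _ _ _ (cst (\int[dk]_(y in K) f y^-1%g))) ?intK_cst// => y.
  rewrite inE => Ky /=; rewrite -(@intK_left (fun x => f (x^-1 * y)%g) y)//.
    by apply: eq_Rintegral => x _; rewrite invgM mulgVK.
  move=> x; apply: (@continuous_comp _ _ _ (fun x : G => x^-1%g) (fun x => f (x * y)%g)).
    exact: invg_continuous.
  exact: mulgr_comp_continuous.
move=> ->//.
  apply: (@measurableT_comp _ _ _ _ _ _ (f : borel G -> R)); first exact: continuous_borel.
  by apply: measurable_mulg => //; exact: measurable_invg.
by move=> x y Kx Ky; rewrite mulr1; apply: fM; apply: KM => //; exact: KsubV.
Qed.

Lemma intK_right (f : G -> R) k : continuous f -> K k ->
  \int[dk]_(y in K) f (y * k)%g = \int[dk]_(y in K) f y.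
Proof.
move=> cf Kk.
rewrite -[RHS](intK_inv cf) -[RHS](intK_left (invg_comp_continuous cf) (KsubV Kk)).
rewrite -[LHS](intK_inv (@mulgr_comp_continuous f k cf)).
by apply: eq_Rintegral => y _; rewrite invgM invgK.
Qed.

End HaarK.

(** Fubini's theorem takes measures bundled with their sigma-finiteness; the equation allows the
    hypotheses on [mu] to be rewritten. *)
Lemma sigma_finite_pack d (T : measurableType d) (R : realType) (mu : {measure set T -> \bar R}) :
  sigma_finite setT mu -> exists m : {sigma_finite_measure set T -> \bar R},
    (m : {measure set T -> \bar R}) = mu.
Proof.
case: mu => mu [c1 c2] sf.
pose mu' : {measure set T -> \bar R} := @Measure.Pack _ _ _ mu (@Measure.Class _ _ _ mu c1 c2).
pose m : {sigma_finite_measure set T -> \bar R} := HB.pack mu c1 c2 (Measure_isSigmaFinite.Build _ _ _ mu' sf).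
by exists m.
Qed.

Section CartanBalls.
Variables (R : realType) (G : lieGroupType R) (g : lieAlgebra G) (X : rankOneSpace g).
Hypothesis Kmax : maximal_compact X.
Local Notation K := (Ksub X : set (borel G)).
Local Notation cK := (Ksub_compact Kmax).

(** The preimage in [G] of the closed ball of radius [T] around [o], in polar coordinates; this form
    makes it compact and biinvariant. *)
Definition Kball (T : R) : set G := [set x | exists k1 t k2,
  [/\ K k1, 0 <= t <= T, K k2 & x = (k1 * aexp X t * k2)%g]].

Lemma compact_mulg (A B : set G) : compact A -> compact B ->
  compact [set x | exists a b, [/\ A a, B b & x = (a * b)%g]].
Proof.
move=> cA cB.
have -> : [set x | exists a b, [/\ A a, B b & x = (a * b)%g]] = (fun p : G * G => (p.1 * p.2)%g) @` (A `*` B).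
  apply/seteqP; split=> [_ [a [b [Ka Kb ->]]]|_ [[a b] [/= Ka Kb] <-]]; first by exists (a, b).
  by exists a, b.
apply: continuous_compact; last exact: compact_setX.
by apply: continuous_subspaceT; exact: mulg_continuous.
Qed.

Lemma Kball_compact T : compact (Kball T).
Proof.
have cA : compact (aexp X @` `[0, T]).
  apply: continuous_compact; last exact: segment_compact.
  by apply: continuous_subspaceT; exact: aexp_continuous.
have := compact_mulg (compact_mulg cK cA) cK; congr compact.
apply/seteqP; split=> [_ [_ [k2 [[k1 [_ [K1 [t tT <-] ->]]] K2 ->]]]|_ [k1 [t [k2 [K1 tT K2 ->]]]]].
  by exists k1, t, k2; split; rewrite // -in_itv.
by exists (k1 * aexp X t)%g, k2; split=> //; exists k1, (aexp X t); split=> //; exists t; rewrite //= in_itv.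
Qed.

Variables (dk : probability (borel G) R) (Hdk : haarK X dk).
Variables (mu0 : {measure set (borel G) -> \bar R}) (Hmu0 : haar mu0).
Hypothesis Hcartan : forall x : G, exists k1 t k2,
     [/\ Ksub X k1, 0 <= t, Ksub X k2 & x = (k1 * aexp X t * k2)%g].

Lemma haar_sigma_finite : sigma_finite setT mu0.
Proof.
exists (fun n => Kball n%:R).
  apply/seteqP; split=> // x _; have [k1 [t [k2 [K1 t0 K2 ->]]]] := Hcartan x.
  exists (Num.truncn t).+1 => //; exists k1, t, k2; split=> //.
  by rewrite t0/= ltW// truncnS_gt.
move=> n; split; first by apply: compact_borel; exact: Kball_compact.
have [_ H _] := Hmu0; apply: H; exact: Kball_compact.
Qed.

End CartanBalls.

(** * Radial test functions and averages over [K] *)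

Section Radial.
Variables (R : realType) (G : lieGroupType R) (g : lieAlgebra G) (X : rankOneSpace g).
Variables (dk : probability (borel G) R) (mu : {sigma_finite_measure set (borel G) -> \bar R}).
Hypotheses (Kmax : maximal_compact X) (Hdk : haarK X dk) (Hmu : haar mu).
Local Notation K := (Ksub X : set (borel G)).
Local Notation KM := (KsubM Kmax Hdk).
Local Notation cK := (Ksub_compact Kmax).

Definition biinvariant (f : G -> R) := forall k1 k2 x, K k1 -> K k2 -> f (k1 * x * k2)%g = f x.

Definition radial (f : G -> R) : Prop :=
  [/\ smooth_fun f, exists2 Q, compact Q & forall x, ~ Q x -> f x = 0 & biinvariant f].

Lemma biinvl f k x : biinvariant f -> K k -> f (k * x)%g = f x.
Proof. by move=> fb Kk; have := fb k 1%g x Kk (Ksub1 X); rewrite mulg1. Qed.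

Lemma biinvr f k x : biinvariant f -> K k -> f (x * k)%g = f x.
Proof. by move=> fb Kk; have := fb 1%g k x (Ksub1 X) Kk; rewrite mul1g. Qed.

Lemma mu_fin (Q : set G) : compact Q -> (mu (Q : set (borel G)) < +oo)%E.
Proof. by have [_ H _] := Hmu; exact: H. Qed.

Lemma mu_left (f : G -> R) y : measurable_fun setT (f : borel G -> R) ->
  \int[mu]_(x in setT) f (y * x)%g = \int[mu]_(x in setT) (f : borel G -> R) x.
Proof.
move=> mf.
apply: (@Rintegral_invariant _ (borel G) R mu (fun x : G => (y * x)%g) _ _ setT) => //.
- by apply: borel_continuous; exact: mulg_continuousl.
- by move=> A mA; have [H _ _] := Hmu; exact: H.
Qed.

Lemma Ksub_avg_left_smooth (f : G -> R) : smooth_fun f ->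
  smooth_fun (fun y : G => \int[dk]_(k in K) f (k^-1 * y)%g).
Proof.
move=> fS; have S1 : smooth_fun (fun x : G => \int[dk]_(k in K) (1 * f (x * k)^-1%g)).
  apply: (@smooth_Rintegral _ _ dk K (cst 1) (fun x => f x^-1%g) 1).
  - exact: cK.
  - exact: dkK_fin Hdk.
  - exact: measurable_cst.
  - by move=> z _; rewrite normr1.
  - exact: smooth_invg.
have := smooth_invg S1; congr smooth_fun; apply/funext => y.
by apply: eq_Rintegral => k _; rewrite mul1r invgM invgK.
Qed.

Lemma Ksub_avg_right_smooth (f : G -> R) : smooth_fun f ->
  smooth_fun (fun y : G => \int[dk]_(k in K) f (y * k)%g).
Proof.
move=> fS; have := @smooth_Rintegral _ _ dk K (cst 1) f 1 cK (dkK_fin Hdk).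
move=> H; have := H (measurable_cst _) _ fS; rewrite (_ : (fun x : G => _) = (fun y : G => \int[dk]_(k in K) f (y * k)%g)).
  by apply=> z _; rewrite normr1.
by apply/funext => y; apply: eq_Rintegral => k _; rewrite mul1r.
Qed.

Lemma intK_eq (f h : G -> R) : (forall k, K k -> f k = h k) ->
  \int[dk]_(k in K) f k = \int[dk]_(k in K) h k.
Proof. by move=> fh; apply: eq_Rintegral => k; rewrite inE => /fh. Qed.

Lemma intK_const (f : G -> R) a : (forall k, K k -> f k = a) -> \int[dk]_(k in K) f k = a.
Proof. by move=> fa; rewrite (intK_eq fa) (intK_cst Kmax Hdk). Qed.

(* The mean of [f] over the double coset [x K y]. *)
Definition kmean (f : G -> R) (x y : G) : R := \int[dk]_(k in K) f (x * (k^-1 * y))%g.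

(** The support lies in [K x^-1 Q]. Left invariance comes from the average over [K], right
    invariance from [f]. *)
Lemma kmean_radial f x : radial f -> radial (kmean f x).
Proof.
move=> [fS [Q cQ fQ] fb]; split.
- by apply: (@Ksub_avg_left_smooth (fun y => f (x * y)%g)); exact: smooth_mull.
- exists [set y | exists k b, [/\ K k, ((fun y => (x^-1 * y)%g) @` Q) b & y = (k * b)%g]].
    apply: compact_mulg; first exact: cK.
    by apply: continuous_compact => //; apply: continuous_subspaceT; exact: mulg_continuousl.
  move=> y Hy; apply: intK_const => k Kk; apply: fQ => Qk; apply: Hy.
  exists k, (x^-1 * (x * (k^-1 * y)))%g; split=> //; first by exists (x * (k^-1 * y))%g.
  by rewrite mulKg mulVKg.
- move=> k1 k2 y K1 K2; rewrite /kmean.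
  have cf : continuous f by exact: smooth_continuous.
  rewrite (@intK_eq _ (fun k => f (x * ((k1^-1 * k)^-1 * y))%g)); last first.
    move=> k Kk; rewrite invgM invgK -[RHS](biinvr _ fb K2); congr f.
    by rewrite !mulgA.
  apply: (@intK_left _ _ _ _ dk Kmax Hdk (fun k => f (x * (k^-1 * y))%g)); last exact: KsubV.
  apply: (@invg_comp_continuous _ _ (fun k => f (x * (k * y))%g)).
  apply: (@mulgr_comp_continuous _ _ (fun k => f (x * k)%g)).
  exact: mulgl_comp_continuous.
Qed.

Lemma kmean1 f x : radial f -> kmean f x 1%g = f x.
Proof.
move=> [_ _ fb]; apply: intK_const => k Kk; rewrite mulg1.
by rewrite biinvr//; exact: KsubV.
Qed.

Lemma radial_continuous f : radial f -> continuous f.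
Proof. by move=> [fS _ _]; exact: smooth_continuous. Qed.

Lemma radial_integrable f : radial f -> mu.-integrable setT (EFin \o (f : borel G -> R)).
Proof.
move=> fr; have [_ [Q cQ fQ] _] := fr.
by apply: (support_integrable cQ (mu_fin cQ)) => //; exact: radial_continuous.
Qed.

Lemma radialM f h : radial f -> smooth_fun h -> biinvariant h -> radial (fun x => f x * h x).
Proof.
move=> [fS [Q cQ fQ] fb] hS hb; split; first exact: smooth_mul.
  by exists Q => // x /fQ ->; rewrite mul0r.
by move=> k1 k2 x K1 K2; rewrite fb// hb.
Qed.

Lemma radialZ a f : radial f -> radial (fun x => a * f x).
Proof.
move=> [fS [Q cQ fQ] fb]; split; first by apply: smooth_mul => //; exact: smooth_cst.
  by exists Q => // x /fQ ->; rewrite mulr0.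
by move=> k1 k2 x K1 K2; rewrite fb.
Qed.

Lemma radialD f h : radial f -> radial h -> radial (fun x => f x + h x).
Proof.
move=> [fS [Q cQ fQ] fb] [hS [Q' cQ' hQ] hb]; split; first exact: smooth_add.
  exists (Q `|` Q'); first exact: compactU.
  by move=> x /not_orP[/fQ -> /hQ ->]; rewrite addr0.
by move=> k1 k2 x K1 K2; rewrite fb// hb.
Qed.

Lemma le_RintegralK (f h : G -> R) : continuous f -> continuous h -> (forall k, K k -> f k <= h k) ->
  \int[dk]_(k in K) f k <= \int[dk]_(k in K) h k.
Proof.
move=> cf ch fh; apply: le_Rintegral.
- exact: (Ksub_measurable Kmax).
- exact: (integrableK Kmax Hdk).
- exact: (integrableK Kmax Hdk).
- exact: fh.
Qed.

(** A finite sum [S] of bump functions is at least [d > 0] on the compact set [Kball X T]. Averages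
    over [K], on the right and then on the left, make it biinvariant; they keep the lower bound
    because the set is stable under [K] on both sides. *)
Lemma radial_cutoff (T : R) : exists chi : G -> R,
  [/\ radial chi, forall x, 0 <= chi x & forall x, Kball X T x -> 1 <= chi x].
Proof.
have cQ := @Kball_compact _ _ _ X Kmax T; set Q := Kball X T in cQ *.
have /choice[b Hb] : forall x : G, exists b : G -> R, [/\ smooth_fun b, forall y, 0 <= b y, 0 < b x &
    exists2 Kx, compact Kx & forall y, ~ Kx y -> b y = 0].
  move=> x; have [b [bS b0 bx [Kx [cKx _ bK]]]] := @smooth_bump R G x setT openT I.
  by exists b; split=> //; exists Kx.
have := cQ; rewrite compact_cover => /(_ _ Q (fun x => [set y | 0 < b x y])) HF.
have [||F _ QF] := HF.
- move=> x Qx; have [bS _ _ _] := Hb x.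
  have -> : [set y | 0 < b x y] = b x @^-1` [set r | 0 < r] by [].
  by apply: open_comp; [move=> y _; exact: (smooth_continuous bS)|exact: open_gt].
- by move=> x Qx; exists x => //; have [] := Hb x.
pose S y := \sum_(x <- finmap.enum_fset F) b x y.
have SS : smooth_fun S by apply: smooth_sum => x; have [] := Hb x.
have S0 y : 0 <= S y by apply: sumr_ge0 => x _; have [_ ->] := Hb x.
have Spos y : Q y -> 0 < S y.
  move=> /QF[x /= xF bxy]; rewrite /S (big_rem x)//=.
  by rewrite ltr_wpDr// sumr_ge0// => z _; have [_ ->] := Hb z.
have [QS cQS SQ] : exists2 QS, compact QS & forall y, ~ QS y -> S y = 0.
  have : forall s : seq G, exists2 QS, compact QS & forall y, ~ QS y -> \sum_(x <- s) b x y = 0.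
    elim=> [|x s [QS cQS IH]]; first by exists set0 => [|y _]; [exact: compact0|rewrite big_nil].
    have [_ _ _ [Kx cKx bK]] := Hb x.
    exists (Kx `|` QS); first exact: compactU.
    by move=> y /not_orP[/bK b0 /IH s0]; rewrite big_cons b0 s0 addr0.
  exact.
have cS : continuous S by exact: smooth_continuous.
(* The set is empty for negative [T], and then has no minimum of [S] to offer. *)
have [Q0|Q0] := pselect (Q !=set0); last first.
  exists (fun=> 0); split=> // [|x Qx]; last by exfalso; apply: Q0; exists x.
  split=> //; first exact: smooth_cst.
  by exists set0 => //; exact: compact0.
have [d d0 Sd] : exists2 d, 0 < d & forall y, Q y -> d <= S y.
  have cSQ : compact (S @` Q) by apply: continuous_compact => //; exact: continuous_subspaceT.
  have [y Qy Hy] : exists2 y, Q y & forall z, Q z -> S y <= S z.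
    have cN : {within Q, continuous S} by exact: continuous_subspaceT.
    have [y /set_mem Qy Hy] := compact_EVT_min Q0 cQ cN.
    by exists y => // z Qz; apply: Hy; exact/mem_set.
  by exists (S y) => //; exact: Spos.
pose S1 y := \int[dk]_(k in K) S (y * k)%g.
pose chi y := d^-1 * \int[dk]_(k in K) S1 (k^-1 * y)%g.
have S1S : smooth_fun S1 by exact: Ksub_avg_right_smooth.
have cS1 : continuous S1 by exact: smooth_continuous.
have S1r k y : K k -> S1 (y * k)%g = S1 y.
  move=> Kk; rewrite /S1 -[RHS](intK_left Kmax Hdk (@mulgl_comp_continuous _ _ S y cS) Kk).
  by apply: intK_eq => k' _; rewrite mulgA.
have Qinv k1 k2 y : K k1 -> K k2 -> Q y -> Q (k1 * y * k2)%g.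
  move=> K1 K2 [k3 [t [k4 [K3 tT K4 ->]]]]; exists (k1 * k3)%g, t, (k4 * k2)%g.
  by split; rewrite ?mulgA//; exact: KM.
have S1d y : Q y -> d <= S1 y.
  move=> Qy; rewrite -(intK_cst Kmax Hdk d); apply: le_RintegralK.
  - exact: cst_continuous.
  - exact: mulgl_comp_continuous.
  - move=> k Kk; apply: Sd; rewrite -[y]mul1g; apply: Qinv => //; exact: Ksub1.
exists chi; split.
- split.
  + by apply: smooth_mul; [exact: smooth_cst|exact: Ksub_avg_left_smooth].
  + exists [set y | exists k b, [/\ K k, [set x | exists a c, [/\ QS a, K c & x = (a * c)%g]] b & y = (k * b)%g]].
      by apply: compact_mulg; [exact: cK|apply: compact_mulg => //; exact: cK].
    move=> y Hy; rewrite /chi (@intK_const _ 0) ?mulr0// => k Kk.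
    apply: intK_const => k' Kk'; apply: SQ => HQ; apply: Hy.
    exists k, (k^-1 * y)%g; split; rewrite ?mulVKg//.
    by exists (k^-1 * y * k')%g, k'^-1%g; split; rewrite ?mulgK//; exact: KsubV.
  + move=> k1 k2 y K1 K2; rewrite /chi; congr (_ * _).
    rewrite -(@intK_left _ _ _ _ dk Kmax Hdk (fun k => S1 (k^-1 * (k1 * y * k2))%g) k1)//.
      apply: intK_eq => k Kk; rewrite -[RHS](S1r k2)//; congr S1.
      by rewrite invgM !mulgA mulgVK.
    apply: (@invg_comp_continuous _ _ (fun k => S1 (k * (k1 * y * k2))%g)).
    exact: mulgr_comp_continuous.
- move=> y; apply: mulr_ge0; first by rewrite invr_ge0 ltW.
  by apply: Rintegral_ge0 => k _; apply: Rintegral_ge0.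
- move=> y Qy; rewrite -(mulVf (lt0r_neq0 d0)) ler_pM2l ?invr_gt0//.
  rewrite -(intK_cst Kmax Hdk d); apply: le_RintegralK.
  + exact: cst_continuous.
  + by apply: (@invg_comp_continuous _ _ (fun k => S1 (k * y)%g)); exact: mulgr_comp_continuous.
  + move=> k Kk; apply: S1d; rewrite -[(k^-1 * y)%g]mulg1; apply: Qinv => //; last exact: Ksub1.
    exact: KsubV.
Qed.

End Radial.

(** * Spherical averages and the inversion formula *)

Lemma smooth_loc (R : realType) (G : lieGroupType R) (f : G -> R) :
  (forall x, exists U F, [/\ open U, U x, smooth_fun F & forall y, U y -> F y = f y]) ->
  smooth_fun f.
Proof.
move=> H c ac k; have [_ oi _ _ ci] := chart_spec ac.
apply: Ck_loc => y cy; have [U [F [oU Ux FS FE]]] := H (cinv c y).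
exists (cimg c `&` cinv c @^-1` U); split=> //.
apply: (Ck_ext (f := F \o cinv c)); first exact: open_setI_preimage.
  by move=> z [_ /= Uz]; exact: FE.
by apply: (Ck_sub _ (FS c ac k)) => z [].
Qed.

Section SphericalAverages.
Variables (R : realType) (G : lieGroupType R) (g : lieAlgebra G) (X : rankOneSpace g).
Variables (dk : probability (borel G) R) (mu : {sigma_finite_measure set (borel G) -> \bar R}).
Hypotheses (Kmax : maximal_compact X) (Hdk : haarK X dk) (Hmu : haar mu).
Hypothesis Hcartan : forall x : G, exists k1 t k2,
     [/\ Ksub X k1, 0 <= t, Ksub X k2 & x = (k1 * aexp X t * k2)%g].
Variables (kap : G -> G) (H : G -> R) (nu : G -> G).
Hypothesis Hiw : iwasawa X kap H nu.
Local Notation K := (Ksub X : set (borel G)).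
Local Notation KM := (KsubM Kmax Hdk).
Local Notation cK := (Ksub_compact Kmax).

Let Hcont : continuous H. Proof. by have [] := iwasawa_projection Hiw. Qed.
Let Hcoc x y : H (y * x)%g = H (y * kap x)%g + H x.
Proof. by have [_ h _ _ _] := iwasawa_projection Hiw. Qed.
Let HKl k x : Ksub X k -> H (k * x)%g = H x.
Proof. by have [_ _ h _ _] := iwasawa_projection Hiw; exact: h. Qed.
Let HK0 k : Ksub X k -> H k = 0.
Proof. by have [_ _ _ h _] := iwasawa_projection Hiw; exact: h. Qed.
Let Kkap x : Ksub X (kap x). Proof. by have [] := Hiw x. Qed.

Lemma radial_positive : exists chi : G -> R, [/\ radial X chi, forall x, 0 <= chi x &
  0 < \int[mu]_(x in setT) (chi : borel G -> R) x].
Proof.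
have [n Hn] : exists n : nat, (0 < mu (Kball X n%:R : set (borel G)))%E.
  apply: contrapT => /forallNP Hn; have [_ _] := Hmu.
  have -> : (setT : set (borel G)) = \bigcup_n (Kball X n%:R : set (borel G)).
    apply/seteqP; split=> // x _; have [k1 [t [k2 [K1 t0 K2 ->]]]] := Hcartan x.
    exists (Num.truncn t).+1 => //; exists k1, t, k2; split=> //.
    by rewrite t0/= ltW// truncnS_gt.
  have mB m : measurable (Kball X m%:R : set (borel G)) by apply: compact_borel; exact: Kball_compact.
  have : mu.-negligible (\bigcup_n (Kball X n%:R : set (borel G))).
    apply: negligible_bigcup => m; apply/negligibleP; first exact: mB.
    by apply/eqP; rewrite eq_le measure_ge0 leNgt andbT; exact/negP/Hn.
  by move/negligibleP => ->; rewrite ?ltxx//; exact: bigcupT_measurable.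
have [chi [chir chi0 chi1]] := radial_cutoff Kmax Hdk n%:R.
exists chi; split=> //.
have mB : measurable (Kball X n%:R : set (borel G)) by apply: compact_borel; exact: Kball_compact.
have fB : (mu (Kball X n%:R : set (borel G)) < +oo)%E.
  by apply: (mu_fin Hmu); exact: Kball_compact.
have ci := radial_integrable Hmu chir.
apply: (@lt_le_trans _ _ (\int[mu]_(x in (Kball X n%:R : set (borel G))) 1)).
  rewrite Rintegral_cst// mul1r fine_gt0// Hn//=.
have iB : mu.-integrable (Kball X n%:R : set (borel G)) (EFin \o (chi : borel G -> R)).
  by apply: (integrableS _ _ _ ci).
apply: (@le_trans _ _ (\int[mu]_(x in (Kball X n%:R : set (borel G))) (chi : borel G -> R) x)).
  apply: le_Rintegral => //.
  by apply: (@bounded_integrable _ _ _ _ _ _ 1) => // x _; rewrite normr1.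
rewrite [leLHS]Rintegral_mkcond; apply: le_Rintegral => //.
  by rewrite -restrict_EFin -integrable_mkcond.
move=> x _; rewrite patchE; case: ifP => // _; exact: chi0.
Qed.

(* [H] is, up to affine normalization, a right convolution of a test function with [H]. *)
Lemma H_smooth : smooth_fun H.
Proof.
have [chi [chir chi0 Ipos]] := radial_positive.
have [chiS [Q cQ chiQ] chib] := chir.
have cchi : continuous chi by exact: smooth_continuous.
set I0 := (X in 0 < X) in Ipos.
pose u0 := \int[mu]_(z in setT) (chi z * H z^-1%g).
have cHi : continuous (fun z => H z^-1%g) by exact: invg_comp_continuous.
have ci (h : G -> R) : continuous h ->
    mu.-integrable setT (EFin \o (fun z : borel G => chi z * h z)).
  move=> ch; apply: (support_integrable cQ (mu_fin Hmu cQ)) => [|z /chiQ ->]; last by rewrite mul0r.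
  by move=> z; apply: continuousM; [exact: cchi|exact: ch].
(* After the translation by [y] the integrand contains [H (z^-1 y) = H (z^-1 kap y) + H y]; the
   element [kap y] of [K] disappears by the invariance of [mu] and of [chi]. *)
have E y : \int[mu]_(z in setT) (chi (y * z)%g * H z^-1%g) = u0 + H y * I0.
  have mm : measurable_fun setT ((fun z => chi z * H (z^-1 * y)%g) : borel G -> R).
    apply: continuous_borel => z; apply: continuousM; first exact: cchi.
    by apply: (@invg_comp_continuous _ _ (fun z => H (z * y)%g)); exact: mulgr_comp_continuous.
  rewrite (_ : (fun z => chi (y * z)%g * H z^-1%g) = (fun z => chi (y * z)%g * H ((y * z)^-1 * y)%g)); last first.
    by apply/funext => z; rewrite invgM mulgVK.
  rewrite (mu_left Hmu y mm).
  have mm2 : measurable_fun setT ((fun z => chi z * H (z^-1 * kap y)%g) : borel G -> R).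
    apply: continuous_borel => z; apply: continuousM; first exact: cchi.
    by apply: (@invg_comp_continuous _ _ (fun z => H (z * kap y)%g)); exact: mulgr_comp_continuous.
  have -> : u0 = \int[mu]_(z in setT) (chi z * H (z^-1 * kap y)%g).
    rewrite -(mu_left Hmu (kap y) mm2); apply: eq_Rintegral => z _.
    by rewrite (biinvl _ chib (Kkap y)) invgM mulgVK.
  rewrite /I0 -RintegralZl//; last exact: (radial_integrable Hmu chir).
  rewrite -RintegralD//; last 2 first.
  - apply: (ci (fun z => H (z^-1 * kap y)%g)).
    by apply: (@invg_comp_continuous _ _ (fun z => H (z * kap y)%g)); exact: mulgr_comp_continuous.
  - have := ci (cst (H y)) (@cst_continuous _ _ _); congr (integrable _ _ _).
    by apply/funext => z /=; rewrite mulrC.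
  apply: eq_Rintegral => z _; rewrite (Hcoc y z^-1%g); ring.
apply: smooth_loc => y0.
have [b [bS b0 by0 [Kx [cKx _ bK]]]] := @smooth_bump R G y0 setT openT I.
(* For [y] in [Kx] the function [z |-> chi (y z)] is supported in [Kx^-1 Q], so near [y0] the
   convolution is an integral over a compact set that does not depend on [y]. *)
pose Q' := [set z | exists a q : G, [/\ ((fun y : G => y^-1%g) @` Kx) a, Q q & z = (a * q)%g]].
have cQ' : compact Q'.
  apply: compact_mulg => //; apply: continuous_compact => //.
  by apply: continuous_subspaceT; exact: invg_continuous.
exists [set y | 0 < b y], (fun y => I0^-1 * (\int[mu]_(z in (Q' : set (borel G))) (H z^-1%g * chi (y * z)%g) - u0)).
split=> //.
- have -> : [set y | 0 < b y] = b @^-1` [set r | 0 < r] by [].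
  by apply: open_comp; [move=> y _; exact: (smooth_continuous bS)|exact: open_gt].
- apply: smooth_mul; first exact: smooth_cst.
  apply: smooth_add; last exact: smooth_cst.
  have [M _ HM] := compact_bound cQ' cHi.
  apply: (@smooth_Rintegral _ _ mu Q' (fun z => H z^-1%g) chi M) => //.
    exact: mu_fin.
  by apply: measurable_funTS; exact: continuous_borel.
move=> y /= by1.
rewrite (_ : \int[mu]_(z in (Q' : set (borel G))) _ = u0 + H y * I0); last first.
  rewrite -E; rewrite (@Rintegral_support _ _ mu Q'); first by apply: eq_Rintegral => z _; rewrite mulrC.
  move=> z Qz; rewrite chiQ ?mul0r// => Qyz; apply: Qz.
  exists y^-1%g, (y * z)%g; split=> //; last by rewrite mulKg.
  by exists y => //; apply: contrapT => /bK by10; rewrite by10 ltxx in by1.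
by rewrite addrC addKr mulrC mulfK// gt_eqF.
Qed.

Definition smooth1 (u : R -> R) := forall k, C_k k setT (u : R^o -> R^o).

(** For [u s = e^(- (i lam + rho) s)] this would be the spherical function [phi_lam]; real profiles
    [u] give its real and imaginary parts and its Taylor coefficients in [lam]. *)
Definition sphavg (u : R -> R) (x : G) : R := \int[dk]_(k in K) u (H (x^-1 * k)%g).

Lemma smooth1_continuous u : smooth1 u -> continuous u.
Proof. by move=> uS x; exact: (uS 0%N x I). Qed.

Lemma uH_continuous u : smooth1 u -> continuous (fun x => u (H x)).
Proof. by move=> uS x; apply: continuous_comp; [exact: Hcont|exact: smooth1_continuous]. Qed.

Lemma sphavg_smooth u : smooth1 u -> smooth_fun (sphavg u).
Proof.
move=> uS; have := Ksub_avg_right_smooth Kmax Hdk (smooth_comp uS H_smooth).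
by move=> /smooth_invg.
Qed.

Lemma sphavg_continuous u : smooth1 u -> continuous (sphavg u).
Proof. by move=> uS; exact/smooth_continuous/sphavg_smooth. Qed.

Lemma sphavg_biinv u : smooth1 u -> biinvariant X (sphavg u).
Proof.
move=> uS k1 k2 x K1 K2; rewrite /sphavg.
rewrite -[RHS](@intK_left _ _ _ _ dk Kmax Hdk (fun k => u (H (x^-1 * k)%g)) k1^-1%g); last 2 first.
- apply: (@mulgl_comp_continuous _ _ (fun k => u (H k))); exact: uH_continuous.
- exact: KsubV.
by apply: eq_Rintegral => k _; rewrite !invgM -!mulgA HKl//; exact: KsubV.
Qed.

Lemma sphavg_Kl u k x : smooth1 u -> K k -> sphavg u (k * x)%g = sphavg u x.
Proof. by move=> uS Kk; exact: (biinvl x (sphavg_biinv uS) Kk). Qed.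

(** The functional equation of spherical functions, for profiles with an addition formula such as
    that of the cosine. After Fubini, [H (y^-1 k x^-1 k')] splits by the cocycle identity into
    [H (y^-1 k kap (x^-1 k'))] and [H (x^-1 k')], and the element [kap (x^-1 k')] is absorbed by
    right invariance in [k]. *)
Lemma sphavg_prod u v1 w1 v2 w2 x y : smooth1 u -> smooth1 v1 -> smooth1 w1 -> smooth1 v2 -> smooth1 w2 ->
  (forall a b, u (a + b) = v1 a * w1 b + v2 a * w2 b) ->
  kmean X dk (sphavg u) x y = sphavg v1 y * sphavg w1 x + sphavg v2 y * sphavg w2 x.
Proof.
move=> uS v1S w1S v2S w2S uD.
have icst (a : R) : dk.-integrable K (EFin \o cst a) by apply: (integrableK Kmax Hdk); exact: cst_continuous.
have mK := Ksub_measurable Kmax.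
pose F (k k' : borel G) := u (H (y^-1 * k * x^-1 * k')%g).
have cuH := uH_continuous uS.
have [M M0 HM] : exists2 M, 0 <= M & forall k k', K k -> K k' -> `|F k k'| <= M.
  have cP : compact [set z | exists a b : G, [/\ ((fun k => (y^-1 * k * x^-1)%g) @` K) a, K b & z = (a * b)%g]].
    apply: compact_mulg; last exact: cK.
    apply: continuous_compact; last exact: cK.
    apply: continuous_subspaceT => k.
    apply: (@continuous_comp _ _ _ (fun k => y^-1 * k)%g (fun k => k * x^-1)%g).
      exact: mulg_continuousl.
    exact: mulg_continuousr.
  have [M M0 HM] := compact_bound cP cuH.
  exists M => // k k' Kk Kk'; apply: HM; exists (y^-1 * k * x^-1)%g, k'; split=> //.
  by exists k.
have mF : measurable_fun setT (fun p => F p.1 p.2).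
  apply: (@measurableT_comp _ _ _ _ _ _ ((fun z => u (H z)) : borel G -> R)); first exact: continuous_borel.
  apply: measurable_mulg => //; apply: measurable_mulg => //.
  by apply: measurable_mulg.
transitivity (\int[dk]_(k in K) \int[dk]_(k' in K) F k k').
  by apply: eq_Rintegral => k _; apply: eq_Rintegral => k' _; rewrite /F !invgM invgK.
rewrite (@fubini_dominated _ _ (borel G) (borel G) R dk dk K K F (cst M) (cst 1) mK mK mF (icst M) (icst 1)); last first.
  by move=> k k' Kk Kk'; rewrite mulr1; exact: HM.
have c1 (v : R -> R) z : smooth1 v -> continuous (fun k => v (H (z^-1 * k)%g)).
  by move=> vS; apply: (@mulgl_comp_continuous _ _ (fun k => v (H k))); exact: uH_continuous.
transitivity (\int[dk]_(k' in K) (sphavg v1 y * w1 (H (x^-1 * k')%g) + sphavg v2 y * w2 (H (x^-1 * k')%g))).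
  apply: intK_eq => k' Kk'.
  have Ks := Kkap (x^-1 * k')%g; set kk := kap _ in Ks.
  have c2 (v : R -> R) : smooth1 v -> continuous (fun k => v (H (y^-1 * k * kk)%g)).
    move=> vS; apply: (@mulgl_comp_continuous _ _ (fun k => v (H (k * kk)%g))).
    by apply: (@mulgr_comp_continuous _ _ (fun k => v (H k))); exact: uH_continuous.
  have E v : smooth1 v -> \int[dk]_(k in K) v (H (y^-1 * k * kk)%g) = sphavg v y.
    move=> vS; rewrite -[RHS](@intK_right _ _ _ _ dk Kmax Hdk (fun k => v (H (y^-1 * k)%g)) kk)//; last exact: c1.
    by apply: eq_Rintegral => k _; rewrite mulgA.
  rewrite -(E v1)// -(E v2)//.
  rewrite -RintegralZr//; last exact: (integrableK Kmax Hdk (c2 _ v1S)).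
  rewrite -RintegralZr//; last exact: (integrableK Kmax Hdk (c2 _ v2S)).
  rewrite -RintegralD//.
  - by apply: eq_Rintegral => k _; rewrite /F -(mulgA _ x^-1%g) Hcoc uD.
  - apply: (integrableK Kmax Hdk (f := fun k => v1 (H (y^-1 * k * kk)%g) * w1 (H (x^-1 * k')%g))) => k.
    by apply: continuousM; [exact: c2|exact: cst_continuous].
  - apply: (integrableK Kmax Hdk (f := fun k => v2 (H (y^-1 * k * kk)%g) * w2 (H (x^-1 * k')%g))) => k.
    by apply: continuousM; [exact: c2|exact: cst_continuous].
have i1 (w : R -> R) a : smooth1 w -> dk.-integrable K (EFin \o (fun k' : borel G => a * w (H (x^-1 * k')%g))).
  move=> wS; apply: (integrableK Kmax Hdk (f := fun k' => a * w (H (x^-1 * k')%g))) => k.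
  by apply: continuousM; [exact: cst_continuous|exact: c1].
rewrite RintegralD//; [|exact: i1|exact: i1].
by rewrite !RintegralZl//; apply: (integrableK Kmax Hdk); exact: c1.
Qed.

(** Invariance of [mu] moves the translation from [f] to [sphavg u]. As [f] is left invariant, the
    translate can be averaged over [K], and [sphavg_prod] at [x^-1] factors the result. *)
Lemma kmean_transform f u v1 w1 v2 w2 x : radial X f ->
  smooth1 u -> smooth1 v1 -> smooth1 w1 -> smooth1 v2 -> smooth1 w2 ->
  (forall a b, u (a + b) = v1 a * w1 b + v2 a * w2 b) ->
  \int[mu]_(y in setT) (kmean X dk f x y * sphavg u y) =
  (\int[mu]_(y in setT) (f y * sphavg v1 y)) * sphavg w1 x^-1%g +
  (\int[mu]_(y in setT) (f y * sphavg v2 y)) * sphavg w2 x^-1%g.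
Proof.
move=> fr uS v1S w1S v2S w2S uD.
have [fS [Q cQ fQ] fb] := fr; have cf := smooth_continuous fS.
have mK := Ksub_measurable Kmax.
have icst (a : R) : dk.-integrable K (EFin \o cst a) by apply: (integrableK Kmax Hdk); exact: cst_continuous.
have cu := sphavg_continuous uS.
pose J := \int[mu]_(y in setT) (f y * sphavg u (x^-1 * y)%g).
have mfu (h : G -> R) : continuous h -> measurable_fun setT ((fun y => f y * h y) : borel G -> R).
  by move=> ch; apply: continuous_borel => y; apply: continuousM; [exact: cf|exact: ch].
have I1 : \int[mu]_(y in setT) (kmean X dk f x y * sphavg u y) = J.
  pose Q' := [set y | exists k b : G, [/\ K k, ((fun y => (x^-1 * y)%g) @` Q) b & y = (k * b)%g]].
  have cQ' : compact Q'.
    apply: compact_mulg; first exact: cK.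
    by apply: continuous_compact => //; apply: continuous_subspaceT; exact: mulg_continuousl.
  have mQ' : measurable (Q' : set (borel G)) by exact: compact_borel.
  have Q'E k y : K k -> ~ Q' y -> f (x * (k^-1 * y))%g = 0.
    move=> Kk Qy; apply: fQ => Qk; apply: Qy.
    exists k, (x^-1 * (x * (k^-1 * y)))%g; split=> //; first by exists (x * (k^-1 * y))%g.
    by rewrite mulKg mulVKg.
  have km0 y : ~ Q' y -> kmean X dk f x y = 0.
    by move=> Qy; apply: (intK_const Kmax Hdk) => k Kk; exact: Q'E.
  rewrite (@Rintegral_support _ _ mu Q'); last by move=> y /km0 ->; rewrite mul0r.
  have [M1 M10 HM1] := compact_bound cQ cf.
  have {}HM1 y : `|f y| <= M1.
    by have [Qy|/fQ ->] := pselect (Q y); [exact: HM1|rewrite normr0].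
  have [M2 M20 HM2] := compact_bound cQ' cu.
  pose F (y k : borel G) := f (x * (k^-1 * y))%g * sphavg u y.
  have mF : measurable_fun setT (fun p => F p.1 p.2).
    apply: measurable_funM.
      apply: (@measurableT_comp _ _ _ _ _ _ (f : borel G -> R)); first exact: continuous_borel.
      by apply: measurable_mulg => //; apply: measurable_mulg => //; exact: measurable_invg.
    apply: (@measurableT_comp _ _ _ _ _ _ (sphavg u : borel G -> R)) => //; exact: continuous_borel.
  have imu : mu.-integrable (Q' : set (borel G)) (EFin \o cst (M1 * M2)).
    apply: (compact_integrable cQ' (mu_fin Hmu cQ')); exact: cst_continuous.
  transitivity (\int[mu]_(y in (Q' : set (borel G))) \int[dk]_(k in K) F y k).
    apply: eq_Rintegral => y _; rewrite /kmean -RintegralZr//.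
    apply: (integrableK Kmax Hdk (f := fun k => f (x * (k^-1 * y))%g)).
    apply: (@invg_comp_continuous _ _ (fun k => f (x * (k * y))%g)).
    apply: (@mulgr_comp_continuous _ _ (fun k => f (x * k)%g)).
    exact: mulgl_comp_continuous.
  rewrite (@fubini_dominated _ _ (borel G) (borel G) R mu dk Q' K F (cst (M1 * M2)) (cst 1) mQ' mK mF imu (icst 1)); last first.
    by move=> y k Qy Kk; rewrite mulr1 normrM ler_pM// ?HM2.
  apply: (intK_const Kmax Hdk) => k Kk.
  rewrite -(@Rintegral_support _ _ mu Q'); last by move=> y Qy; rewrite /F Q'E// mul0r.
  have mm : measurable_fun setT ((fun y => f (x * (k^-1 * y))%g * sphavg u y) : borel G -> R).
    apply: continuous_borel => y; apply: continuousM; last exact: cu.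
    apply: (@mulgl_comp_continuous _ _ (fun y => f (x * y)%g)); exact: mulgl_comp_continuous.
  rewrite -(mu_left Hmu (k * x^-1)%g mm); apply: eq_Rintegral => y _.
  by rewrite -mulgA mulKg mulVKg sphavg_Kl.
rewrite I1.
have J2 k : K k -> J = \int[mu]_(y in setT) (f y * sphavg u (x^-1 * (k^-1 * y))%g).
  move=> Kk.
  have mm : measurable_fun setT ((fun y => f y * sphavg u (x^-1 * (k^-1 * y))%g) : borel G -> R).
    apply: mfu; apply: (@mulgl_comp_continuous _ _ (fun y => sphavg u (x^-1 * y)%g)).
    exact: mulgl_comp_continuous.
  rewrite -(mu_left Hmu k mm); apply: eq_Rintegral => y _.
  by rewrite (biinvl _ fb Kk) mulKg.
have mQ : measurable (Q : set (borel G)) by exact: compact_borel.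
have -> : J = \int[mu]_(y in setT) (f y * kmean X dk (sphavg u) x^-1%g y).
  rewrite (@Rintegral_support _ _ mu Q); last by move=> y /fQ ->; rewrite mul0r.
  pose F (y k : borel G) := f y * sphavg u (x^-1 * (k^-1 * y))%g.
  have mF : measurable_fun setT (fun p => F p.1 p.2).
    apply: measurable_funM.
      apply: (@measurableT_comp _ _ _ _ _ _ (f : borel G -> R)) => //; exact: continuous_borel.
    apply: (@measurableT_comp _ _ _ _ _ _ (sphavg u : borel G -> R)); first exact: continuous_borel.
    by apply: measurable_mulg => //; apply: measurable_mulg => //; exact: measurable_invg.
  have [M1 M10 HM1] := compact_bound cQ cf.
  have [M2 M20 HM2] : exists2 M, 0 <= M & forall y k, Q y -> K k -> `|sphavg u (x^-1 * (k^-1 * y))%g| <= M.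
    have cP : compact [set z | exists a b : G, [/\ K a, Q b & z = (a * b)%g]].
      by apply: compact_mulg => //; exact: cK.
    have [M M0 HM] := compact_bound cP (@mulgl_comp_continuous _ _ (sphavg u) x^-1%g cu).
    exists M => // y k Qy Kk; apply: HM; exists k^-1%g, y; split=> //; exact: KsubV.
  have imu : mu.-integrable (Q : set (borel G)) (EFin \o cst (M1 * M2)).
    apply: (compact_integrable cQ (mu_fin Hmu cQ)); exact: cst_continuous.
  transitivity (\int[mu]_(y in (Q : set (borel G))) \int[dk]_(k in K) F y k); last first.
    apply: eq_Rintegral => y _; rewrite /kmean -RintegralZl//.
    apply: (integrableK Kmax Hdk (f := fun k => sphavg u (x^-1 * (k^-1 * y))%g)).
    apply: (@invg_comp_continuous _ _ (fun k => sphavg u (x^-1 * (k * y))%g)).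
    apply: (@mulgr_comp_continuous _ _ (fun k => sphavg u (x^-1 * k)%g)).
    exact: mulgl_comp_continuous.
  rewrite (@fubini_dominated _ _ (borel G) (borel G) R mu dk Q K F (cst (M1 * M2)) (cst 1) mQ mK mF imu (icst 1)); last first.
    by move=> y k Qy Kk; rewrite mulr1 normrM ler_pM// ?HM2// HM1.
  apply/esym/(intK_const Kmax Hdk) => k Kk.
  rewrite -(@Rintegral_support _ _ mu Q); last by move=> y /fQ; rewrite /F => ->; rewrite mul0r.
  by rewrite -J2.
under eq_Rintegral do rewrite (sphavg_prod _ _ uS v1S w1S v2S w2S uD).
have ri v w : smooth1 v -> mu.-integrable setT (EFin \o (fun y : borel G => (f y * sphavg v y) * w)).
  move=> vS; apply: (support_integrable cQ (mu_fin Hmu cQ)) => [y|y /fQ ->]; last by rewrite !mul0r.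
  apply: (@continuousM R G (fun y => f y * sphavg v y) (cst w) y); last exact: cst_continuous.
  by apply: (@continuousM R G f (sphavg v) y); [exact: cf|exact: sphavg_continuous].
have ri1 v : smooth1 v -> mu.-integrable setT (EFin \o (fun y : borel G => f y * sphavg v y)).
  by move=> vS; have := ri v 1 vS; congr (integrable _ _ _); apply/funext => y /=; rewrite mulr1.
rewrite -!RintegralZr//; [|exact: ri1|exact: ri1].
rewrite -RintegralD//; [|exact: ri|exact: ri].
by apply: eq_Rintegral => y _; rewrite mulrDr !mulrA.
Qed.

End SphericalAverages.

Section SmoothProfiles.
Variable R : realType.

Lemma Ck_cos_sin k : C_k k setT (@cos R : R^o -> R^o) /\ C_k k setT (@sin R : R^o -> R^o).
Proof.
pose F : set (R -> R) := [set f | exists a b : R, f = (fun x => a * cos x + b * sin x)].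
have H f : F f -> C_k k setT (f : R^o -> R^o).
  move=> Ff; apply: (@Ck_family R F _ f Ff) => {Ff}f [a [b ->]]; exists (fun x => b * cos x + (- a) * sin x); first by exists b, (- a).
  move=> x.
  have := is_deriveD (is_deriveZ a (is_derive_cos x)) (is_deriveZ b (is_derive_sin x)).
  by move=> D; apply: (is_derive_eq D); rewrite /GRing.scale/=; ring.
split; apply: H; [exists 1, 0|exists 0, 1]; apply/funext => x; ring.
Qed.

(** [ucos] and the opposite of [usin] are the real and imaginary parts of [e^(- (i lam + rh) s)].
    The functions [upow rh j] are the profiles in the Taylor expansion of [ucos] in [lam]; the
    average of [upow rh 0] is [phi_0]. *)
Definition ucos (rh lam s : R) : R := cos (lam * s) * expR (- rh * s).
Definition usin (rh lam s : R) : R := sin (lam * s) * expR (- rh * s).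
Definition upow (rh : R) (j : nat) (s : R) : R := s ^+ j * expR (- rh * s).

Lemma smooth1_mul (u v : R -> R) : smooth1 u -> smooth1 v -> smooth1 (fun s => u s * v s).
Proof. by move=> uS vS k; apply: Ck_mul; [exact: openT|exact: uS|exact: vS]. Qed.

Lemma smooth1_id : smooth1 (fun s : R => s).
Proof.
move=> k; apply: (@Ck_lin _ _ _ _ _ (idfun : {linear R^o -> R^o})) => z; exact: cvg_id.
Qed.

Lemma smooth1_cst (a : R) : smooth1 (fun _ => a).
Proof. by move=> k; exact: Ck_cst. Qed.

Lemma smooth1_comp_scale (u : R -> R) (a : R) : smooth1 u -> smooth1 (fun s => u (a * s)).
Proof.
move=> uS k; apply: (@Ck_comp R R^o R^o k setT setT (fun s => a * s) u (has_coords_R R) openT) => //.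
by apply: smooth1_mul; [exact: smooth1_cst|exact: smooth1_id].
Qed.

Lemma smooth1_exp (rh : R) : smooth1 (fun s => expR (- rh * s)).
Proof. by apply: smooth1_comp_scale => k; exact: Ck_expR. Qed.

Lemma smooth1_ucos rh lam : smooth1 (ucos rh lam).
Proof.
apply: smooth1_mul; last exact: smooth1_exp.
by apply: (smooth1_comp_scale (u := cos)) => k; have [] := Ck_cos_sin k.
Qed.

Lemma smooth1_usin rh lam : smooth1 (usin rh lam).
Proof.
apply: smooth1_mul; last exact: smooth1_exp.
by apply: (smooth1_comp_scale (u := sin)) => k; have [] := Ck_cos_sin k.
Qed.

Lemma smooth1_upow rh j : smooth1 (upow rh j).
Proof.
apply: smooth1_mul; last exact: smooth1_exp.
elim: j => [|j IH]; first by under eq_fun do rewrite expr0; exact: smooth1_cst.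
by under eq_fun do rewrite exprS; apply: smooth1_mul => //; exact: smooth1_id.
Qed.

Lemma ucosD rh lam a b : ucos rh lam (a + b) =
  ucos rh lam a * ucos rh lam b + - usin rh lam a * usin rh lam b.
Proof. rewrite /ucos /usin !mulrDr cosD expRD; ring. Qed.

Lemma smooth1N (u : R -> R) : smooth1 u -> smooth1 (fun s => - u s).
Proof.
move=> uS; have := smooth1_mul (smooth1_cst (- 1)) uS.
by congr smooth1; apply/funext => s; rewrite mulN1r.
Qed.

End SmoothProfiles.

Section Inversion.
Variables (R : realType) (G : lieGroupType R) (g : lieAlgebra G) (X : rankOneSpace g).
Variables (dk : probability (borel G) R) (mu : {sigma_finite_measure set (borel G) -> \bar R}).
Hypotheses (Kmax : maximal_compact X) (Hdk : haarK X dk) (Hmu : haar mu).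
Hypothesis Hcartan : forall x : G, exists k1 t k2,
     [/\ Ksub X k1, 0 <= t, Ksub X k2 & x = (k1 * aexp X t * k2)%g].
Variables (kap : G -> G) (H : G -> R) (nu : G -> G).
Hypothesis Hiw : iwasawa X kap H nu.
Variables (cf : R[i] -> R[i]) (c : R).
Hypothesis Hinv : inversion_formula X mu dk H cf c.
Local Notation K := (Ksub X : set (borel G)).
Local Notation rh := (rho X).
Local Notation avg u := (sphavg X dk H u).
Local Notation Ac lam := (avg (ucos rh lam)).
Local Notation As lam := (avg (usin rh lam)).
Local Notation w := (plancherel cf).

Lemma phiE (lam : R) x : phi X dk H lam%:C%C x = (Ac lam x +i* - As lam x)%C.
Proof.
have E h : cexp (- ('i%C * lam%:C%C + rh%:C%C) * h%:C%C) =
    (ucos rh lam h +i* - usin rh lam h)%C.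
  rewrite /cexp /ucos /usin.
  have -> : complex.Re (- ('i%C * lam%:C%C + rh%:C%C) * h%:C%C) = - rh * h by rewrite /=; ring.
  have -> : complex.Im (- ('i%C * lam%:C%C + rh%:C%C) * h%:C%C) = - (lam * h) by rewrite /=; ring.
  by rewrite cosN sinN mulrN ![expR _ * _]mulrC.
rewrite /phi /cint; congr (_ +i* _)%C.
  by apply: eq_Rintegral => k _; rewrite E.
under eq_Rintegral do rewrite E/=.
transitivity (\int[dk]_(k in K) (-1 * usin rh lam (H (x^-1 * k)%g))).
  by apply: eq_Rintegral => k _; rewrite mulN1r.
rewrite RintegralZl ?mulN1r//; first exact: (Ksub_measurable Kmax).
apply: (integrableK Kmax Hdk); apply: (@mulgl_comp_continuous _ _ (fun k => usin rh lam (H k))).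
by apply: (uH_continuous Hiw); exact: smooth1_usin.
Qed.

Lemma Cc_radial_real f : radial X f -> Cc_radial X (fun x => (f x)%:C%C).
Proof.
move=> [fS [Q cQ fQ] fb]; split=> //=.
- exact: smooth_cst.
- apply: (@subclosed_compact _ _ Q) => //; first exact: closed_closure.
  have clQ : closure Q = Q.
    by apply/esym/closure_id; apply: compact_closed => //; exact: lie_hausdorff.
  rewrite -clQ; apply: closureS => x /= fx; apply: contrapT => /fQ fx0.
  by rewrite fx0 eqxx in fx.
- by move=> k1 k2 x K1 K2; rewrite fb.
Qed.

Definition Fc f lam := \int[mu]_(x in setT) (f x * Ac lam x).
Definition Fs f lam := \int[mu]_(x in setT) (f x * As lam x).

Lemma radial_avg_integrable f u : radial X f -> smooth1 u ->
  mu.-integrable setT (EFin \o (fun x : borel G => f x * avg u x)).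
Proof.
move=> fr uS; have [fS [Q cQ fQ] fb] := fr.
apply: (support_integrable cQ (mu_fin Hmu cQ)) => [y|y /fQ ->]; last by rewrite mul0r.
apply: (@continuousM R G f (avg u) y); first exact: smooth_continuous.
exact: (sphavg_continuous Kmax Hdk Hmu Hcartan Hiw).
Qed.

Lemma fhatE f lam : radial X f ->
  fhat X mu dk H (fun x => (f x)%:C%C) lam = (Fc f lam +i* - Fs f lam)%C.
Proof.
move=> fr; rewrite /fhat /cint; congr (_ +i* _)%C.
  apply: eq_Rintegral => x _; rewrite phiE/=; ring.
transitivity (\int[mu]_(x in setT) (-1 * (f x * As lam x))).
  apply: eq_Rintegral => x _; rewrite phiE/=; ring.
rewrite RintegralZl ?mulN1r//.
by apply: radial_avg_integrable => //; exact: smooth1_usin.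
Qed.

Lemma inversion_real f x : radial X f -> f x = c *
  \int[lebesgue_measure]_(lam in `[0%R, +oo[) ((Fc f lam * Ac lam x - Fs f lam * As lam x) * w lam).
Proof.
move=> fr; have := Hinv (Cc_radial_real fr) x.
have ReZ (z : R[i]) : complex.Re (c%:C%C * z) = c * complex.Re z.
  by case: z => a b /=; rewrite mul0r subr0.
move=> /(congr1 (@complex.Re R)) E; rewrite -[LHS]/(complex.Re (f x)%:C%C) {}E ReZ.
apply: (congr1 (fun z => c * z)).
apply: eq_Rintegral => lam _; rewrite (fhatE _ fr) phiE/=; ring.
Qed.

(** This is [kmean_transform] for the addition formula [ucosD]; the point [x] enters through its
    inverse, which is what [radial_inv] exploits. *)
Lemma kmean_Fc f x lam : radial X f ->
  Fc (kmean X dk f x) lam = Fc f lam * Ac lam x^-1%g - Fs f lam * As lam x^-1%g.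
Proof.
move=> fr; rewrite /Fc.
rewrite (kmean_transform Kmax Hdk Hmu Hcartan Hiw x fr (smooth1_ucos rh lam) (smooth1_ucos rh lam)
  (smooth1_ucos rh lam) (smooth1N (smooth1_usin rh lam)) (smooth1_usin rh lam) (@ucosD _ rh lam)).
congr (_ + _); rewrite -mulNr; congr (_ * _).
rewrite -mulN1r -RintegralZl//; last by apply: radial_avg_integrable => //; exact: smooth1_usin.
apply: eq_Rintegral => y _; rewrite mulrCA; congr (_ * _).
rewrite /sphavg -RintegralZl//.
- by apply: eq_Rintegral => k _; rewrite mulN1r.
- exact: (Ksub_measurable Kmax).
- apply: (integrableK Kmax Hdk); apply: (@mulgl_comp_continuous _ _ (fun k => usin rh lam (H k))).
  by apply: (uH_continuous Hiw); exact: smooth1_usin.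
Qed.

Let HK0 k : Ksub X k -> H k = 0.
Proof. by have [_ _ _ h _] := iwasawa_projection Hiw; exact: h. Qed.

Lemma avg1 u : avg u 1%g = u 0.
Proof. by apply: (intK_const Kmax Hdk) => k Kk; rewrite invg1 mul1g HK0. Qed.

Lemma Ac1 lam : Ac lam 1%g = 1.
Proof. by rewrite avg1 /ucos !mulr0 cos0 expR0 mulr1. Qed.

Lemma As1 lam : As lam 1%g = 0.
Proof. by rewrite avg1 /usin !mulr0 sin0 mul0r. Qed.

(* At [1], the inversion formula for the mean of [f] over [x K y] reads like the
   one for [f] at [x^-1]. *)
Lemma radial_inv f x : radial X f -> f x^-1%g = f x.
Proof.
move=> fr.
have E1 := inversion_real 1%g (kmean_radial Kmax Hdk x fr); rewrite (kmean1 Kmax Hdk x fr) in E1.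
apply: (etrans (inversion_real x^-1%g fr)); apply: etrans (esym E1).
apply: (congr1 (fun z => c * z)); apply: eq_Rintegral => lam _.
apply: (congr1 (fun z => z * w lam)).
by rewrite Ac1 As1 mulr0 subr0 mulr1 (kmean_Fc _ _ fr).
Qed.

(** The average has no compact support, so [radial_inv] is applied to its product with a cutoff
    [chi] and to [chi] itself, where [chi x >= 1]. *)
Lemma avg_inv u x : smooth1 u -> avg u x^-1%g = avg u x.
Proof.
move=> uS; have [k1 [t [k2 [K1 t0 K2 xE]]]] := Hcartan x.
have [chi [chir chi0 chi1]] := radial_cutoff Kmax Hdk t.
have chix : 1 <= chi x by apply: chi1; exists k1, t, k2; split=> //; rewrite t0 lexx.
have r2 := radialM chir (sphavg_smooth Kmax Hdk Hmu Hcartan Hiw uS)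
  (sphavg_biinv Kmax Hdk Hiw uS).
have := radial_inv x r2; rewrite (radial_inv x chir).
by apply: mulfI; rewrite gt_eqF// (lt_le_trans ltr01).
Qed.

End Inversion.

(** * The action on K and the reality of spherical functions *)

Section LebesgueTranslation.
Variable R : realType.
Local Notation leb := (@lebesgue_measure R).

Lemma measurable_translation (a : R) :
  measurable_fun (setT : set (measurableTypeR R)) (fun x : measurableTypeR R => (a + x : measurableTypeR R)).
Proof.
have : measurable_fun setT (fun x : R => a + x); last by [].
by apply: measurable_funD => //; exact: measurable_cst. Qed.

Lemma lebesgue_translation (a : R) (A : set (measurableTypeR R)) : measurable A ->
  leb ((fun x => a + x) @^-1` A) = leb A.
Proof.
pose h : {mfun (measurableTypeR R) >-> (measurableTypeR R)} :=
  HB.pack (fun x : R => a + x) (isMeasurableFun.Build _ _ (measurableTypeR R) (measurableTypeR R) _ (measurable_translation a)).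
move=> mA; apply/esym; apply: (lebesgue_measure_unique (mu := pushforward leb h)) => // _ [[x y] _ <-].
have e : (fun z : R => a + z) @^-1` `]x, y]%classic = `]x - a, y - a]%classic.
  by apply/seteqP; split=> z /=; rewrite !in_itv/= => /andP[u v]; apply/andP; split; lra.
transitivity (leb `]x - a, y - a]%classic); last by rewrite -e.
rewrite !lebesgue_measure_itv/= !lte_fin ltrD2r; case: ifP => // _.
by rewrite -!EFinB; congr EFin; ring.
Qed.

Lemma ge0_integral_translation (a x y : R) (f : R -> \bar R) :
  measurable_fun setT f -> (forall t, 0 <= f t)%E ->
  (\int[leb]_(t in `[(a + x)%R, (a + y)%R]) f t = \int[leb]_(t in `[x, y]) f (a + t)%R)%E.
Proof.
move=> mf f0.
have := @ge0_integral_invariant _ (measurableTypeR R) R leb _ (measurable_translation a)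
  (fun A mA => lebesgue_translation a mA) `[a + x, a + y]%classic f (measurable_itv _) mf f0.
move=> <-.
congr (integral _ _ _).
by apply/seteqP; split=> z /=; rewrite !in_itv/= => /andP[u v]; apply/andP; split; lra.
Qed.

Definition tent (s : R) : R := Num.max 0 (1 - `|s|).

Lemma tent_ge0 s : 0 <= tent s. Proof. by rewrite le_max lexx. Qed.

Lemma tent_le1 s : tent s <= 1.
Proof. by rewrite ge_max ler01 lerBlDr lerDl normr_ge0. Qed.

Lemma tent_eq0 s : 1 <= `|s| -> tent s = 0.
Proof. by move=> s1; apply: max_idPl; rewrite subr_le0. Qed.

Lemma tent_continuous : continuous tent.
Proof.
rewrite (_ : tent = fun s => (1 - `|s| + `|1 - `|s| |) / 2).
  have n1 : continuous (fun s : R => 1 - `|s|).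
    by move=> s; apply: continuousB; [exact: cst_continuous|exact: norm_continuous].
  have n2 : continuous (fun s : R => 1 - `|s| + `|1 - `|s| |).
    move=> s; apply: (@continuousD R R _ (fun s => 1 - `|s|)); first exact: n1.
    by apply: (@continuous_comp _ _ _ (fun s : R => 1 - `|s|) (fun z : R => `|z|)); [exact: n1|exact: norm_continuous].
  by move=> s; exact: (@continuousM R R _ (cst 2^-1) s (n2 s) (@cst_continuous _ _ _ s)).
by apply/funext => s; rewrite /tent; case: (lerP 0 (1 - `|s|)) => h; [rewrite (ger0_norm h)|rewrite (ltr0_norm h)]; lra.
Qed.

End LebesgueTranslation.

(** * Asymptotics of the integral over a distant shell *)

Section RadialAsymptotics.
Context d (T1 : measurableType d) (R : realType) (m : probability T1 R).
Local Notation leb := (@lebesgue_measure R).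
Variables (K : set T1) (p q : T1 -> R -> R) (P Q : T1 -> R) (h D : R -> R)
  (M1 M2 Bh S r Dinf : R).
Hypotheses (mK : measurable K)
  (mp : measurable_fun setT (fun x : T1 * R => p x.1 x.2))
  (mq : measurable_fun setT (fun x : T1 * R => q x.1 x.2))
  (mPQ : measurable_fun K (fun k => h (Q k) * expR (- (2 * r * P k))))
  (hp : forall k t, K k -> 0 <= t -> `|p k t - t| <= M1)
  (hq : forall k t, K k -> 0 <= t -> `|q k t| <= M2)
  (hP : forall k, K k -> `|P k| <= M1)
  (lp : forall k, K k -> (p k t - t) @[t --> +oo] --> P k)
  (lq : forall k, K k -> q k t @[t --> +oo] --> Q k)
  (ch : continuous h) (h0 : forall s, 0 <= h s) (hB : forall s, `|s| <= M2 -> h s <= Bh)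
  (mD : measurable_fun setT D) (D0 : forall t, 0 <= D t)
  (D1 : forall t, 0 <= t -> D t <= expR (2 * r * t))
  (lD : (D t * expR (- (2 * r * t))) @[t --> +oo] --> Dinf)
  (r0 : 0 <= r) (M10 : 0 <= M1) (SM : 1 + 2 * M1 <= S).

(** The offset [S + M1] keeps the window of half-width [S] around [tcut n - P k] in the half-line
    [t >= 0] for every [n]. *)
Definition tcut n : R := n%:R + (S + M1).
(** The shell where the coordinate [p] is about [tcut n], weighted by [h] of the coordinate [q] and
    divided by [e^(2 r tcut n)], the growth of the density [D]. *)
Definition radial_integrand n k t : R :=
  tent (p k t - tcut n) * h (q k t) * (D t * expR (- (2 * r * tcut n))).
Local Notation F := radial_integrand.

Let mh : measurable_fun setT h. Proof. exact: continuous_measurable_fun. Qed.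

Let mF n : measurable_fun setT (fun x : T1 * R => F n x.1 x.2).
Proof.
apply: measurable_funM.
  apply: measurable_funM; last exact: (measurableT_comp mh mq).
  apply: (measurableT_comp (continuous_measurable_fun (@tent_continuous R))).
  by apply: measurable_funB => //; exact: measurable_cst.
by apply: measurable_funM; [exact: (measurableT_comp mD)|exact: measurable_cst].
Qed.

Let F0 n k t : 0 <= F n k t.
Proof. by rewrite !mulr_ge0 ?tent_ge0 ?expR_ge0. Qed.

Let mF2 n k : measurable_fun setT (fun t => (F n k t)%:E).
Proof. by apply/measurable_EFinP; exact: (measurable_fun_pair2 k (mF n)). Qed.

(** Since [p k t] is within [M1] of [t] and [|P k| <= M1], the tent vanishes outside of the window
    of half-width [S >= 1 + 2 M1] around [tcut n - P k]. *)
Let JE n k : K k -> (\int[leb]_(t in `[0%R, +oo[) (F n k t)%:E =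
  \int[leb]_(s in `[(- S)%R, S]) (F n k (tcut n - P k + s))%:E)%E.
Proof.
move=> Kk; have n0 : 0 <= n%:R :> R by [].
have := hP Kk; rewrite ler_norml => /andP[P1 P2].
rewrite -(ge0_integral_translation (tcut n - P k) (- S) S (mF2 n k)); last by move=> t; rewrite lee_fin.
have aux (t : R) : 0 <= t -> `|p k t - tcut n| < 1 -> tcut n - P k + - S <= t <= tcut n - P k + S.
  move=> t0; have := hp Kk t0; rewrite ler_norml => /andP[p1 p2]; rewrite ltr_norml => /andP[q1 q2].
  by have SM' := SM; rewrite /tcut in q1 q2 *; apply/andP; split; lra.
have aux2 (t : R) : tcut n - P k + - S <= t <= tcut n - P k + S -> 0 <= t.
  by rewrite /tcut => /andP[t1 _]; lra.
rewrite integral_mkcond [RHS]integral_mkcond; apply: eq_integral => t _.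
rewrite !patchE; case: ifPn => tI; case: ifPn => tJ //.
- rewrite /F tent_eq0 ?mul0r//; move: tI tJ; rewrite !inE/= notin_setE/= !in_itv/= andbT => t0 tJ.
  rewrite leNgt; apply/negP => q1; apply: tJ; exact: aux.
- exfalso; move: tI tJ; rewrite inE/= notin_setE/= !in_itv/= andbT => tI tJ; apply: tI; exact: aux2.
Qed.

(** The exponent [2 r (s - P k)] left by the density and its normalization is bounded independently
    of [n] and [k]: this is the dominating function of both limits below. *)
Let Fb n k s : K k -> s \in `[- S, S] -> F n k (tcut n - P k + s) <= Bh * expR (2 * r * (S + M1)).
Proof.
move=> Kk; rewrite in_itv/= => /andP[s1 s2]; have n0 : 0 <= n%:R :> R by [].
have := hP Kk; rewrite ler_norml => /andP[P1 P2].
set t := tcut n - P k + s; have t0 : 0 <= t by rewrite /t /tcut; lra.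
have Bh0 : 0 <= Bh by apply: le_trans (hB (hq Kk t0)).
rewrite /F; apply: ler_pM.
- by rewrite mulr_ge0// tent_ge0.
- by rewrite mulr_ge0// expR_ge0.
- rewrite -[leRHS]mul1r; apply: ler_pM => //; [exact: tent_ge0|exact: tent_le1|exact/hB/hq].
- apply: (le_trans (ler_wpM2r (expR_ge0 _) (D1 t0))); rewrite -expRD ler_expR.
  have -> : 2 * r * t + - (2 * r * tcut n) = 2 * r * (s - P k) by rewrite /t; ring.
  by rewrite ler_wpM2l ?mulr_ge0//; lra.
Qed.

(** At [t = tcut n - P k + s] the coordinate [p k t - tcut n] tends to [s], and the normalized
    density tends to [Dinf e^(2 r (s - P k))], the origin of the factor [e^(- 2 r P k)]. *)
Let Flim k s : K k -> s \in `[- S, S] ->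
  (F n k (tcut n - P k + s)) @[n --> \oo] --> tent s * h (Q k) * (Dinf * expR (2 * r * (s - P k))).
Proof.
move=> Kk sI; pose t n := tcut n - P k + s.
have tl : t n @[n --> \oo] --> +oo%R.
  rewrite (_ : t = fun n => n%:R + (S + M1 - P k + s)); last by apply/funext => n; rewrite /t /tcut; ring.
  have := @cvgr_idn R; move=> /cvgryPge cn; apply/cvgryPge => A.
  by have := cn (A - (S + M1 - P k + s)); apply: filterS => n; rewrite lerBlDr.
have c1 : (p k (t n) - tcut n) @[n --> \oo] --> s.
  have -> : s = P k + (s - P k) by ring.
  rewrite (_ : (fun n => p k (t n) - tcut n) = (fun n => (p k (t n) - t n) + (s - P k))); last first.
    by apply/funext => n; rewrite /t; ring.
  apply: cvgD; last exact: cvg_cst.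
  exact: (cvg_comp _ _ tl (lp Kk)).
have c2 : q k (t n) @[n --> \oo] --> Q k by exact: (cvg_comp _ _ tl (lq Kk)).
apply: cvgM.
  apply: cvgM; first by apply: continuous_cvg => //; exact: tent_continuous.
  by apply: continuous_cvg => //; exact: ch.
rewrite (_ : (fun n => D (t n) * _) = (fun n => (D (t n) * expR (- (2 * r * t n))) * expR (2 * r * (s - P k)))); last first.
  apply/funext => n; rewrite -[RHS]mulrA -expRD; congr (_ * expR _); rewrite /t; ring.
by apply: cvgMl; exact: (cvg_comp _ _ tl lD).
Qed.

Definition kappa : R := Dinf * \int[leb]_(s in `[(- S)%R, S]) (tent s * expR (2 * r * s)).

Let itvfin : (leb (`[(- S)%R, S]%classic : set R) < +oo)%E.
Proof. by rewrite lebesgue_measure_itv/=; case: ifP => _; rewrite ?ltry// -EFinB ltry. Qed.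

Let tent_int : leb.-integrable `[- S, S] (EFin \o (fun s => tent s * expR (2 * r * s))).
Proof.
apply: (@bounded_integrable _ _ _ leb _ _ (expR (2 * r * S))) => //.
- apply: measurable_funTS; apply: continuous_measurable_fun => s; apply: continuousM; first exact: tent_continuous.
  apply: (@continuous_comp _ _ _ (fun s => 2 * r * s) (@expR R)); last exact: continuous_expR.
  by apply: continuousM; [exact: cst_continuous|exact: cvg_id].
- move=> s; rewrite /= in_itv/= => /andP[s1 s2].
  rewrite ger0_norm ?mulr_ge0 ?tent_ge0 ?expR_ge0// -[leRHS]mul1r ler_pM ?tent_ge0 ?expR_ge0 ?tent_le1//.
  by rewrite ler_expR ler_wpM2l// mulr_ge0.
Qed.

Let inner k : K k -> (\int[leb]_(t in `[0%R, +oo[) (F n k t)%:E)%E @[n --> \oo] -->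
  (kappa * (h (Q k) * expR (- (2 * r * P k))))%:E.
Proof.
move=> Kk; rewrite (_ : (fun n => _) = (fun n => \int[leb]_(s in `[(- S)%R, S]) (F n k (tcut n - P k + s))%:E)%E); last first.
  by apply/funext => n; exact: JE.
have -> : ((kappa * (h (Q k) * expR (- (2 * r * P k))))%:E =
    \int[leb]_(s in `[(- S)%R, S]) (tent s * h (Q k) * (Dinf * expR (2 * r * (s - P k))))%:E)%E.
  have -> : kappa * (h (Q k) * expR (- (2 * r * P k))) =
    \int[leb]_(s in `[(- S)%R, S]) ((Dinf * (h (Q k) * expR (- (2 * r * P k)))) * (tent s * expR (2 * r * s))).
    by rewrite RintegralZl// /kappa; ring.
  rewrite /Rintegral fineK; last first.
    apply: integrable_fin_num => //.
    have := integrableZl _ (Dinf * (h (Q k) * expR (- (2 * r * P k)))) tent_int.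
    by move=> /(_ (measurable_itv _)); congr (integrable _ _ _); apply/funext => s /=; rewrite EFinM.
  apply: eq_integral => s _; congr EFin.
  have -> : 2 * r * (s - P k) = 2 * r * s + - (2 * r * P k) by ring.
  rewrite expRD; ring.
apply: (@dominated_cvg _ _ _ leb _ _ _ _ (cst (Bh * expR (2 * r * (S + M1)))%:E)) => //.
- move=> n; apply: measurable_funTS; apply/measurable_EFinP.
  apply: (@measurableT_comp _ _ _ _ _ _ (F n k) _ (fun s => tcut n - P k + s)).
    by apply/measurable_EFinP; exact: mF2.
  exact: measurable_translation.
- by move=> s sI; apply/cvg_EFin; [exact: nearW|exact: Flim].
- by apply/integrableP; split=> //; rewrite integral_cst//= lte_mul_pinfty// lee_fin.
- by move=> n s sI /=; rewrite lee_fin ger0_norm//; exact: Fb.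
Qed.

(* Substitute [t = tcut n + s - P k] and let [n] tend to infinity. *)
Lemma radial_asymptotics :
  (\int[m]_(k in K) \int[leb]_(t in `[0%R, +oo[) (F n k t)%:E)%E @[n --> \oo] -->
  (kappa * \int[m]_(k in K) (h (Q k) * expR (- (2 * r * P k))))%:E.
Proof.
have S0 : 0 <= S by have := SM; have := M10; lra.
have mfin : (m K < +oo)%E by apply: (le_lt_trans (probability_le1 m mK)); rewrite ltry.
have Bh0 k : K k -> 0 <= h (Q k) <= Bh.
  move=> Kk; rewrite h0/=; have c2 : h (q k t) @[t --> +oo] --> h (Q k).
    by apply: continuous_cvg; [exact: ch|exact: lq].
  rewrite -(cvg_lim _ c2)//; apply: limr_le; [exact: cvgP c2|]; near=> t; apply: hB; apply: hq => //; near: t; exact: nbhs_pinfty_ge.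
have -> : ((kappa * \int[m]_(k in K) (h (Q k) * expR (- (2 * r * P k))))%:E =
   \int[m]_(k in K) (kappa * (h (Q k) * expR (- (2 * r * P k))))%:E)%E.
  have ii : m.-integrable K (EFin \o (fun k => h (Q k) * expR (- (2 * r * P k)))).
    apply: (@bounded_integrable _ _ _ m _ _ (Bh * expR (2 * r * M1))) => // k Kk.
    have /andP[q1 q2] := Bh0 k Kk.
    rewrite ger0_norm ?mulr_ge0 ?expR_ge0// ler_pM ?expR_ge0// ler_expR -mulrN ler_wpM2l ?mulr_ge0//.
    by have := hP Kk; rewrite ler_norml => /andP[P1 P2]; lra.
  rewrite -RintegralZl// /Rintegral fineK//.
  apply: integrable_fin_num => //.
  by have := integrableZl mK kappa ii; congr (integrable _ _ _); apply/funext => k /=; rewrite EFinM.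
apply: (@dominated_cvg _ _ _ m _ _ _ _ (cst (Bh * expR (2 * r * (S + M1)) * (2 * S))%:E)) => //.
- move=> n; apply: measurable_funTS.
  rewrite (_ : (fun k => _) = (fun k => \int[leb]_t (((F n k t) * \1_(`[0%R, +oo[%classic) t)%:E))%E); last first.
    apply/funext => k; rewrite integral_mkcond; apply: eq_integral => t _.
    by rewrite patchE indicE; case: ifP => _; rewrite ?mulr1 ?mulr0.
  apply: (@measurable_fun_fubini_tonelli_F _ _ _ _ _ leb (fun x : T1 * R => ((F n x.1 x.2) * \1_(`[0%R, +oo[%classic) x.2)%:E)) => //=.
    apply/measurable_EFinP; apply: measurable_funM; last first.
    have mi : measurable_fun setT (\1_(`[0%R, +oo[%classic) : R -> R) by exact: measurable_indic.
      exact: (measurableT_comp mi measurable_snd).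
    exact: mF.
  by move=> x; rewrite lee_fin mulr_ge0.
- by apply/integrableP; split=> //; rewrite integral_cst//= lte_mul_pinfty// lee_fin.
- move=> n k Kk /=; rewrite JE// gee0_abs ?integral_ge0//; last by move=> s _; rewrite lee_fin.
  apply: (@le_trans _ _ (\int[leb]_(s in `[(- S)%R, S]) (cst (Bh * expR (2 * r * (S + M1)))%:E) s)%E).
    apply: ge0_le_integral => //.
    + by move=> s _; rewrite lee_fin.
    + apply: measurable_funTS; apply/measurable_EFinP.
      apply: (@measurableT_comp _ _ _ _ _ _ (F n k) _ (fun s => tcut n - P k + s)).
        by apply/measurable_EFinP; exact: mF2.
      exact: measurable_translation.
    + by move=> s sI /=; rewrite lee_fin; exact: Fb.
  rewrite integral_cst//= lebesgue_measure_itv/=; case: ifP => _.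
    by rewrite -EFinD -EFinM lee_fin opprK (_ : S + S = 2 * S)//; ring.
  rewrite mule0 lee_fin mulr_ge0//; last by rewrite mulr_ge0.
  rewrite mulr_ge0 ?expR_ge0//; have /andP[q1 q2] := Bh0 k Kk; exact: le_trans q1 q2.
Unshelve. all: by end_near. Qed.

End RadialAsymptotics.

(** * The density of the Haar measure in polar coordinates *)

Section PolarDensity.
Variables (R : realType) (G : lieGroupType R) (g : lieAlgebra G) (X : rankOneSpace g).

Lemma measurable_polarD : measurable_fun setT (polarD X).
Proof.
have ms (a : R) : measurable_fun setT (fun t : R => Defs.sinh (a * t)).
  apply: measurable_funM; last exact: measurable_cst.
  have me (b : R) : measurable_fun setT (fun t : R => expR (b * t)).
    by apply: (measurableT_comp (@measurable_expR R)); apply: measurable_funM => //; exact: measurable_cst.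
  apply: measurable_funB; first exact: me.
  by rewrite (_ : (fun t => _) = (fun t => expR (- a * t))) //; apply/funext => t; rewrite mulNr.
apply: measurable_funM; apply: measurable_funX; last exact: ms.
by have := ms 1; under eq_fun do rewrite mul1r.
Qed.

Lemma sinh_ge0 (t : R) : 0 <= t -> 0 <= Defs.sinh t.
Proof.
move=> t0; rewrite /Defs.sinh divr_ge0// subr_ge0 ler_expR; lra.
Qed.

Lemma polarD_ge0 t : 0 <= t -> 0 <= polarD X t.
Proof. by move=> t0; rewrite mulr_ge0// exprn_ge0// sinh_ge0// mulr_ge0. Qed.

Lemma exp_2rho (t : R) : expR (2 * rho X * t) = expR t ^+ m1 X * expR (2 * t) ^+ m2 X.
Proof.
have E (a b : R) : 2 * ((a + 2 * b) / 2) * t = a * t + b * (2 * t) by field.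
by rewrite -!expRM_natl -expRD /rho E.
Qed.

Lemma exp_2rhoN (t : R) : expR (- (2 * rho X * t)) = expR (- t) ^+ m1 X * expR (- (2 * t)) ^+ m2 X.
Proof. by rewrite -mulrN exp_2rho mulrN. Qed.

Lemma polarD_le t : 0 <= t -> polarD X t <= expR (2 * rho X * t).
Proof.
have S (u : R) : 0 <= u -> Defs.sinh u <= expR u.
  move=> u0; rewrite /Defs.sinh; have := expR_gt0 u; have := expR_gt0 (- u); lra.
move=> t0; have t2 : 0 <= 2 * t by rewrite mulr_ge0.
rewrite exp_2rho ler_pM ?exprn_ge0 ?sinh_ge0//.
  by rewrite lerXn2r// ?nnegrE ?sinh_ge0 ?expR_ge0 ?S.
by rewrite lerXn2r// ?nnegrE ?sinh_ge0 ?expR_ge0 ?S.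
Qed.

(** Each hyperbolic sine contributes a factor [1 / 2]. The absolute value makes the density
    nonnegative on the whole line, as [radial_asymptotics] asks. *)
Lemma polarD_lim : exists2 L : R, 0 < L &
  (`|polarD X t| * expR (- (2 * rho X * t))) @[t --> +oo] --> L.
Proof.
exists ((1 / 2) ^+ m1 X * (1 / 2) ^+ m2 X); first by rewrite mulr_gt0 ?exprn_gt0.
have e0 (a : R) : 0 < a -> expR (- (a * t)) @[t --> +oo] --> (0 : R).
  move=> a0; have au : a * t @[t --> +oo] --> +oo%R.
    by apply: gt0_cvgMry => //; exact: cvg_id.
  exact: (cvg_comp _ _ au (@cvgr_expR R)).
have sl (a : R) : 0 < a -> (`|Defs.sinh (a * t)| * expR (- (a * t))) @[t --> +oo] --> (1 / 2 : R).
  move=> a0; have E (t : R) : `|Defs.sinh (a * t)| * expR (- (a * t)) = `|(1 - expR (- (2 * a * t))) / 2|.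
    rewrite -[X in _ * X]ger0_norm ?expR_ge0// -normrM /Defs.sinh; congr `|_|.
    rewrite mulrAC mulrBl -!expRD subrr expR0; congr ((1 - expR _) / 2); ring.
  rewrite (_ : (fun t => _) = (fun t => `|(1 - expR (- (2 * a * t))) / 2|)); last exact/funext.
  have -> : 1 / 2 = `|(1 - 0) / 2| :> R by rewrite subr0 ger0_norm.
  apply: cvg_norm; apply: cvgM; last exact: cvg_cst.
  by apply: cvgB; [exact: cvg_cst|apply: e0; rewrite mulr_gt0].
rewrite (_ : (fun t => _) = (fun t : R => (`|Defs.sinh (1 * t)| * expR (- (1 * t))) ^+ m1 X *
   (`|Defs.sinh (2 * t)| * expR (- (2 * t))) ^+ m2 X)); last first.
  apply/funext => t; by rewrite !mul1r !exprMn exp_2rhoN /polarD normrM !normrX mulrACA.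
have cX (f : R -> R) (l : R) n : f t @[t --> +oo] --> l -> f t ^+ n @[t --> +oo] --> l ^+ n.
  move=> fl; elim: n => [|n IH]; first by under eq_cvg do rewrite expr0; exact: cvg_cst.
  by under eq_cvg do rewrite exprS; rewrite exprS; exact: cvgM.
by apply: cvgM; apply: cX; apply: sl.
Qed.

End PolarDensity.

Lemma continuous_measurable_borel (R : realType) (G : lieGroupType R) (f : R -> G) :
  continuous f -> measurable_fun setT (f : R -> borel G).
Proof.
move=> cf; apply: (@measurability _ _ _ (borel G) setT _ (@open G)) => //.
move=> _ [U oU <-]; rewrite setTI; apply: open_measurable.
by move/continuousP: cf; apply.
Qed.

Lemma muleI_gt0 (R : realType) (C : R) (a b : \bar R) :
  0 < C -> (C%:E * a = C%:E * b)%E -> a = b.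
Proof.
move=> C0 /(congr1 (fun z => C^-1%:E * z)%E).
by rewrite !muleA -!EFinM mulVf ?gt_eqF// !mul1e.
Qed.

Section KappaPositive.
Variables (R : realType).
Local Notation leb := (@lebesgue_measure R).

(** On [[- 1/2, 1/2]] the tent is at least [1 / 2] and the exponential at least [e^(- r)].
    Positivity allows [kappa] to be cancelled in [iwasawa_change]. *)
Lemma kappa_gt0 (S r L : R) : 0 < L -> 0 <= r -> 1 <= S -> 0 < kappa S r L.
Proof.
move=> L0 r0 S1; rewrite mulr_gt0//.
pose f s := tent s * expR (2 * r * s).
have f0 s : 0 <= f s by rewrite mulr_ge0 ?tent_ge0 ?expR_ge0.
have mf : measurable_fun setT (EFin \o f).
  apply/measurable_EFinP; apply: continuous_measurable_fun => s; apply: continuousM; first exact: tent_continuous.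
  apply: (@continuous_comp _ _ _ (fun s => 2 * r * s) (@expR R)); last exact: continuous_expR.
  by apply: continuousM; [exact: cst_continuous|exact: cvg_id].
have lo s : s \in `[(- 2^-1)%R, 2^-1] -> 2^-1 * expR (- r) <= f s.
  rewrite in_itv/= => /andP[s1 s2]; rewrite /f ler_pM ?expR_ge0//.
    by rewrite le_max; apply/orP; right; have : `|s| <= 2^-1 by [rewrite ler_norml s1 s2]; lra.
  by rewrite ler_expR; nra.
have fin : (\int[leb]_(s in `[(- S)%R, S]) (f s)%:E < +oo)%E.
  apply: (@le_lt_trans _ _ (\int[leb]_(s in `[(- S)%R, S]) (cst (expR (2 * r * S))%:E) s)%E).
    apply: ge0_le_integral => //.
    - by move=> s _; rewrite lee_fin; exact: f0.
    - exact: measurable_funTS.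
    - move=> s /=; rewrite in_itv/= => /andP[s1 s2]; rewrite lee_fin /f -[leRHS]mul1r ler_pM ?tent_ge0 ?expR_ge0 ?tent_le1//.
      by rewrite ler_expR ler_wpM2l// mulr_ge0.
  rewrite integral_cst//= lebesgue_measure_itv/=; case: ifP => _; last by rewrite mule0 ltry.
  by rewrite -EFinB -EFinM ltry.
have I1 : (0 < \int[leb]_(s in `[(- 2^-1)%R, 2^-1%R]) (cst (2^-1 * expR (- r))%:E) s)%E.
  rewrite integral_cst//= lebesgue_measure_itv/= lte_fin.
  have -> : - 2^-1 < 2^-1 :> R by lra.
  by rewrite -EFinB -EFinM lte_fin !mulr_gt0 ?expR_gt0//; lra.
have I2 : (\int[leb]_(s in `[(- 2^-1)%R, 2^-1%R]) (cst (2^-1 * expR (- r))%:E) s <=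
    \int[leb]_(s in `[(- 2^-1)%R, 2^-1%R]) (f s)%:E)%E.
  apply: ge0_le_integral => //.
  - by move=> s _; rewrite lee_fin mulr_ge0 ?expR_ge0.
  - exact: measurable_funTS.
have I3 : (\int[leb]_(s in `[(- 2^-1)%R, 2^-1%R]) (f s)%:E <= \int[leb]_(s in `[(- S)%R, S]) (f s)%:E)%E.
  apply: ge0_subset_integral => //.
  - exact: measurable_funTS.
  - by move=> s _; rewrite lee_fin; exact: f0.
  - by move=> s /=; rewrite !in_itv/= => /andP[s1 s2]; apply/andP; split; lra.
have I4 : (0 < \int[leb]_(s in `[(- S)%R, S]) (f s)%:E)%E by exact: (lt_le_trans I1 (le_trans I2 I3)).
by apply: fine_gt0; apply/andP; split.
Qed.

End KappaPositive.

Section QuasiInvariance.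
Variables (R : realType) (G : lieGroupType R) (g : lieAlgebra G) (X : rankOneSpace g).
Variables (dk : probability (borel G) R) (mu : {sigma_finite_measure set (borel G) -> \bar R}).
Hypotheses (Kmax : maximal_compact X) (Hdk : haarK X dk) (Hmu : haar mu).
Variables (C : R) (C0 : 0 < C) (Hpolar : polar_coordinates X mu dk C).
Variables (kap : G -> G) (H : G -> R) (nu : G -> G).
Hypothesis Hiw : iwasawa X kap H nu.
Local Notation K := (Ksub X : set (borel G)).
Local Notation rh := (rho X).
Local Notation leb := (@lebesgue_measure R).
Local Notation a_ := (aexp X).

Lemma polar_right_invariant (f : G -> R) : measurable_fun setT (f : borel G -> R) ->
  (forall x, 0 <= f x) -> (forall x k, Ksub X k -> f (x * k)%g = f x) ->
  (\int[mu]_x (f x)%:E = C%:E * \int[dk]_(k in K) \int[leb]_(t in `[0%R, +oo[)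
     (f (k * a_ t)%g * `|polarD X t|)%:E)%E.
Proof.
move=> mf f0 fK; rewrite (Hpolar.2 (fun x => (f x)%:E)); last 2 first.
- exact/measurable_EFinP.
- by move=> x; rewrite lee_fin.
congr (_ * _)%E; apply: eq_integral => k _; apply: eq_integral => t.
rewrite inE/= in_itv/= andbT => t0; rewrite ger0_norm ?polarD_ge0//.
transitivity (\int[dk]_(k2 in K) (cst (f (k * a_ t)%g * polarD X t)%:E) k2)%E.
  by apply: eq_integral => k2; rewrite inE => Kk2; rewrite fK.
by rewrite integral_cst//= ?(dkK Hdk) ?mule1//; exact: Ksub_measurable.
Qed.

(* The modulus of [k |-> kap (y k)] on [K] is [e^(-2 rho H (y k))]. *)
Lemma iwasawa_change (h : R -> R) (y : G) : continuous h -> (forall s, 0 <= h s) ->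
  \int[dk]_(k in K) (h (- H (y * k)%g) * expR (- (2 * rh * H (y * k)%g))) =
  \int[dk]_(k in K) h (H (y^-1 * k)%g).
Proof.
move=> ch h0.
have [Hc _ HKl HK0 _] := iwasawa_projection Hiw.
have [tau [[tc tK ty [M0 tM]] [tl _]]] := radial_coordinate Hiw.
have [M tyM] := ty y; have [M' tyM'] := ty y^-1%g.
have cK := Ksub_compact Kmax.
have [MH MH0 HMH] := compact_bound cK (@mulgl_comp_continuous _ _ H y Hc).
have K1 := Ksub1 X.
have tk k x : Ksub X k -> tau (k * x)%g = tau x.
  by move=> Kk; have := tK k 1%g x Kk K1; rewrite mulg1.
have tkr x k : Ksub X k -> tau (x * k)%g = tau x.
  by move=> Kk; have := tK 1%g k x K1 Kk; rewrite mul1g.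
pose M1 := `|M| + `|M'| + `|M0| + MH; pose M2 := `|M| + `|M'|.
pose S := 1 + 2 * M1.
have M10 : 0 <= M1 by rewrite !addr_ge0.
(* [h] is only evaluated at differences of values of [tau], which stay in [[- M2, M2]]; its maximum
   there serves as the bound [Bh]. *)
have [c _ hc] : exists2 c, c \in `[- M2, M2] & forall t, t \in `[- M2, M2] -> h t <= h c.
  apply: EVT_max; first by have : 0 <= M2 by [rewrite addr_ge0]; lra.
  exact: continuous_subspaceT.
have hB s : `|s| <= M2 -> h s <= h c by move=> sM; apply: hc; rewrite in_itv/= -ler_norml.
have [L L0 Ll] := polarD_lim X.
pose D t := `|polarD X t|.
have mD : measurable_fun setT D by apply: (measurableT_comp (@normr_measurable R setT)); exact: measurable_polarD.
have D1 t : 0 <= t -> D t <= expR (2 * rh * t).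
  by move=> t0; rewrite /D ger0_norm ?polarD_ge0//; exact: polarD_le.
have r0 : 0 <= rh by apply: ltW; exact: rho_gt0.
have mact z : measurable_fun setT (fun x : borel G * R => (z * x.1 * a_ x.2)%g : borel G).
  apply: measurable_mulg; first by apply: measurable_mulg; [exact: measurable_cst|exact: measurable_fst].
  apply: (measurableT_comp (continuous_measurable_borel (@aexp_continuous _ _ _ X))); exact: measurable_snd.
have mtau := continuous_borel tc.
have mta z : measurable_fun setT (fun x : borel G * R => tau (z * x.1 * a_ x.2)%g).
  exact: (measurableT_comp mtau (mact z)).
have mta1 : measurable_fun setT (fun x : borel G * R => tau (x.1 * a_ x.2)%g).
  by have := mta 1%g; under eq_fun do rewrite mul1g.
have mK : measurable K by exact: Ksub_measurable.
have SM : 1 + 2 * M1 <= S by [].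
have chH z (e : R -> R) : continuous e -> measurable_fun K (fun k => e (H (z * k)%g)).
  move=> ce; apply: measurable_funTS; apply: continuous_borel.
  apply: (@mulgl_comp_continuous _ _ (fun x => e (H x))) => x.
  by apply: continuous_comp; [exact: Hc|exact: ce].
have cexp (b : R) : continuous (fun s : R => expR (b * s)).
  move=> s; apply: (@continuous_comp _ _ _ (fun s => b * s) (@expR R)); last exact: continuous_expR.
  by apply: continuousM; [exact: cst_continuous|exact: cvg_id].
have chN : continuous (fun s => h (- s)).
  by move=> s; apply: (@continuous_comp _ _ _ -%R h); [exact: opp_continuous|exact: ch].
have nM : M <= `|M| /\ M' <= `|M'| /\ M0 <= `|M0| by rewrite !ler_norm.
have nP : 0 <= `|M| /\ 0 <= `|M'| /\ 0 <= `|M0| by rewrite !normr_ge0.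
have mPQ1 : measurable_fun K (fun k => h (- H (y * k)%g) * expR (- (2 * rh * H (y * k)%g))).
  apply: measurable_funM; first exact: (chH y _ chN).
  have := chH y _ (cexp (- (2 * rh))); apply: eq_measurable_fun => k _; rewrite mulNr //.
have mPQ2 : measurable_fun K (fun k => h (H (y^-1 * k)%g) * expR (- (2 * rh * 0))).
  by apply: measurable_funM; [exact: (chH y^-1%g _ ch)|exact: measurable_cst].
(* [p1] describes the shell around [y^-1] and [p2] the one around 1. The differences [q1] and [q2]
   of the two radial coordinates converge to [- H (y k)] and [H (y^-1 k)]. *)
pose p1 (k : borel G) (t : R) := tau (y * k * a_ t)%g.
pose q1 (k : borel G) (t : R) := tau (k * a_ t)%g - tau (y * k * a_ t)%g.
pose p2 (k : borel G) (t : R) := tau (k * a_ t)%g.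
pose q2 (k : borel G) (t : R) := tau (y^-1 * k * a_ t)%g - tau (k * a_ t)%g.
have A1 := @radial_asymptotics _ (borel G) R dk K p1 q1 (fun k => H (y * k)%g) (fun k => - H (y * k)%g)
  h D M1 M2 (h c) S rh L mK (mta y) (measurable_funB mta1 (mta y)) mPQ1.
have A2 := @radial_asymptotics _ (borel G) R dk K p2 q2 (fun k => 0) (fun k => H (y^-1 * k)%g)
  h D M1 M2 (h c) S rh L mK mta1 (measurable_funB (mta y^-1%g) mta1) mPQ2.
have {}A1 := A1 _ _ _ _ _ ch h0 hB mD (fun t => normr_ge0 _) D1 Ll r0 M10 SM.
have {}A2 := A2 _ _ _ _ _ ch h0 hB mD (fun t => normr_ge0 _) D1 Ll r0 M10 SM.
have B1 k t : K k -> 0 <= t -> `|tau (y * k * a_ t)%g - t| <= M1.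
  move=> Kk t0; have := tyM (k * a_ t)%g; rewrite mulgA (tk k)// => u; have := tM t t0 => v.
  have -> : tau (y * k * a_ t)%g - t = (tau (y * k * a_ t)%g - tau (a_ t)) + (tau (a_ t) - t) by ring.
  by apply: (le_trans (ler_normD _ _)); rewrite /M1; lra.
have B2 k t : K k -> 0 <= t -> `|tau (k * a_ t)%g - tau (y * k * a_ t)%g| <= M2.
  move=> Kk t0; have := tyM (k * a_ t)%g; rewrite mulgA distrC => u; rewrite /M2; lra.
have B3 k : K k -> `|H (y * k)%g| <= M1 by move=> /HMH u; rewrite /M1; lra.
have B4 k : K k -> (tau (y * k * a_ t)%g - t) @[t --> +oo] --> H (y * k)%g by move=> _; exact: tl.
have l0 k : K k -> (tau (k * a_ t)%g - t) @[t --> +oo] --> (0 : R).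
  by move=> Kk; have := tl k; rewrite HK0.
have B5 k : K k -> (tau (k * a_ t)%g - tau (y * k * a_ t)%g) @[t --> +oo] --> - H (y * k)%g.
  move=> Kk; rewrite -[X in _ --> X]add0r.
  rewrite (_ : (fun t => _) = (fun t => (tau (k * a_ t)%g - t) - (tau (y * k * a_ t)%g - t))); last first.
    by apply/funext => t; ring.
  by apply: cvgB; [exact: l0|exact: tl].
have {}A1 := A1 B1 B2 B3 B4 B5.
have D1' k t : K k -> 0 <= t -> `|tau (k * a_ t)%g - t| <= M1.
  by move=> Kk t0; rewrite (tk k)//; have := tM t t0; rewrite /M1; lra.
have D2' k t : K k -> 0 <= t -> `|tau (y^-1 * k * a_ t)%g - tau (k * a_ t)%g| <= M2.
  by move=> Kk t0; have := tyM' (k * a_ t)%g; rewrite mulgA => u; rewrite /M2; lra.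
have D3' (k : borel G) : K k -> `|0 : R| <= M1 by move=> _; rewrite normr0.
have D5' k : K k -> (tau (y^-1 * k * a_ t)%g - tau (k * a_ t)%g) @[t --> +oo] --> H (y^-1 * k)%g.
  move=> Kk; rewrite -[X in _ --> X]subr0.
  rewrite (_ : (fun t => _) = (fun t => (tau (y^-1 * k * a_ t)%g - t) - (tau (k * a_ t)%g - t))); last first.
    by apply/funext => t; ring.
  by apply: cvgB; [exact: tl|exact: l0].
have {}A2 := A2 D1' D2' D3' l0 D5'.
pose T n := tcut M1 S n.
(* [f1 n x = f2 n (y x)], so both have the same integral for [mu]; in polar coordinates these
   integrals are the ones whose limits are computed by [A1] and [A2]. *)
pose f1 n (x : G) := tent (tau (y * x)%g - T n) * h (tau x - tau (y * x)%g) * expR (- (2 * rh * T n)).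
pose f2 n (x : G) := tent (tau x - T n) * h (tau (y^-1 * x)%g - tau x) * expR (- (2 * rh * T n)).
have mty z : measurable_fun setT (fun x : borel G => tau (z * x)%g).
  by apply: continuous_borel; exact: mulgl_comp_continuous.
have mh : measurable_fun setT h by exact: continuous_measurable_fun.
have mt : measurable_fun setT (@tent R) by exact: (continuous_measurable_fun (@tent_continuous R)).
have mf1 n : measurable_fun setT (f1 n : borel G -> R).
  apply: measurable_funM; last exact: measurable_cst.
  apply: measurable_funM; apply: measurableT_comp => //; apply: measurable_funB => //.
have mf2 n : measurable_fun setT (f2 n : borel G -> R).
  apply: measurable_funM; last exact: measurable_cst.
  apply: measurable_funM; apply: measurableT_comp => //; apply: measurable_funB => //.
have f10 n x : 0 <= f1 n x by rewrite !mulr_ge0 ?tent_ge0 ?expR_ge0.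
have f20 n x : 0 <= f2 n x by rewrite !mulr_ge0 ?tent_ge0 ?expR_ge0.
have inv n : (\int[mu]_x (f1 n x)%:E = \int[mu]_x (f2 n x)%:E)%E.
  have mh1 : measurable_fun setT ((fun x : G => (y * x)%g) : borel G -> borel G).
    by apply: borel_continuous; exact: mulg_continuousl.
  have [hl _ _] := Hmu.
  have := @ge0_integral_invariant _ (borel G) R mu _ mh1 (fun A mA => hl y A mA) setT (fun x => (f2 n x)%:E).
  rewrite preimage_setT => <- //; last 2 first.
  - exact/measurable_EFinP.
  - by move=> x; rewrite lee_fin.
  by apply: eq_integral => x _; rewrite /f1 /f2 mulKg.
have E n : (\int[dk]_(k in K) \int[leb]_(t in `[0%R, +oo[)
     (f1 n (k * a_ t)%g * `|polarD X t|)%:E)%E = (\int[dk]_(k in K) \int[leb]_(t in `[0%R, +oo[)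
     (f2 n (k * a_ t)%g * `|polarD X t|)%:E)%E.
  have g1 x k : Ksub X k -> f1 n (x * k)%g = f1 n x by move=> Kk; rewrite /f1 mulgA !(tkr _ k Kk).
  have g2 x k : Ksub X k -> f2 n (x * k)%g = f2 n x by move=> Kk; rewrite /f2 mulgA !(tkr _ k Kk).
  have P1 := polar_right_invariant (mf1 n) (f10 n) g1.
  have P2 := polar_right_invariant (mf2 n) (f20 n) g2.
  exact: (muleI_gt0 C0 (etrans (esym P1) (etrans (inv n) P2))).
have k0 : 0 < kappa S rh L by apply: kappa_gt0 => //; rewrite /S; lra.
have EF n : (\int[dk]_(k in K) \int[leb]_(t in `[0%R, +oo[) (radial_integrand p1 q1 h D M1 S rh n k t)%:E =
    \int[dk]_(k in K) \int[leb]_(t in `[0%R, +oo[) (radial_integrand p2 q2 h D M1 S rh n k t)%:E)%E.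
  apply: etrans; last apply: etrans (E n) _.
    apply: eq_integral => k _; apply: eq_integral => t _.
    by rewrite /radial_integrand /p1 /q1 /f1 /D !mulgA -/(T n); apply: congr1; rewrite mulrA mulrAC.
  apply: eq_integral => k _; apply: eq_integral => t _.
  by rewrite /radial_integrand /p2 /q2 /f2 /D !mulgA -/(T n); apply: congr1; rewrite mulrA mulrAC.
have A3 := A2; rewrite -(funext EF) in A3.
rewrite (mulfI (lt0r_neq0 k0) (EFin_inj (cvg_unique (@ereal_hausdorff R) A1 A3))).
by apply: intK_eq => k Kk; rewrite mulr0 oppr0 expR0 mulr1.
Qed.

End QuasiInvariance.

(** * The Plancherel identity *)

(** By Tonelli the integrals of the positive and the negative part are measurable in the parameter,
    and so is [fine] of their difference, whether or not it is finite. *)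
Lemma measurable_Rintegral_param d1 d2 (T1 : measurableType d1) (T2 : measurableType d2) (R : realType)
    (m : {sigma_finite_measure set T2 -> \bar R}) (D : set T2) (F : T1 -> T2 -> R) : measurable D ->
  measurable_fun setT (fun x : T1 * T2 => F x.1 x.2) ->
  measurable_fun setT (fun x => \int[m]_(y in D) F x y).
Proof.
move=> mD mF; pose g (x : T1 * T2) := (F x.1 x.2 * \1_D x.2)%:E.
have mg : measurable_fun setT g.
  apply/measurable_EFinP; apply: measurable_funM => //.
  have mi : measurable_fun setT (\1_D : T2 -> R) by exact: measurable_indic.
  exact: (measurableT_comp mi measurable_snd).
rewrite (_ : (fun x => _) = fine \o (fun x => \int[m]_y (fun y => g (x, y))^\+ y - \int[m]_y (fun y => g (x, y))^\- y)%E).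
  apply: (@measurableT_comp _ _ _ _ _ _ (@fine R)) => //.
  apply: emeasurable_funB.
  - have := measurable_fun_fubini_tonelli_F (m2 := m) (g^\+)%E (measurable_funepos mg).
    move=> /(_ (fun x => funepos_ge0 _ x)); apply: eq_measurable_fun => x _.
    by apply: eq_integral => y _; rewrite !funeposE.
  - have := measurable_fun_fubini_tonelli_F (m2 := m) (g^\-)%E (measurable_funeneg mg).
    move=> /(_ (fun x => funeneg_ge0 _ x)); apply: eq_measurable_fun => x _.
    by apply: eq_integral => y _; rewrite !funenegE.
apply/funext => x; rewrite /= /Rintegral integral_mkcond -integralE; congr fine.
by apply: eq_integral => y _; rewrite patchE /g /= indicE; case: ifP => _; rewrite ?mulr1 ?mulr0.
Qed.

Section Plancherel.
Variables (R : realType) (G : lieGroupType R) (g : lieAlgebra G) (X : rankOneSpace g).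
Variables (dk : probability (borel G) R) (mu : {sigma_finite_measure set (borel G) -> \bar R}).
Hypotheses (Kmax : maximal_compact X) (Hdk : haarK X dk) (Hmu : haar mu).
Variables (C : R) (C0 : 0 < C) (Hpolar : polar_coordinates X mu dk C).
Variables (kap : G -> G) (H : G -> R) (nu : G -> G).
Hypothesis Hiw : iwasawa X kap H nu.
Variables (cf : R[i] -> R[i]) (c : R).
Hypothesis Hinv : inversion_formula X mu dk H cf c.
Local Notation K := (Ksub X : set (borel G)).
Local Notation rh := (rho X).
Local Notation avg u := (sphavg X dk H u).
Local Notation Ac lam := (avg (ucos rh lam)).
Local Notation As lam := (avg (usin rh lam)).
Local Notation w := (plancherel cf).
Local Notation leb := (@lebesgue_measure R).
Local Notation I0 := `[0%R, +oo[%classic.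
Local Notation Fc f lam := (\int[mu]_(x in setT) (f x * Ac lam x)).
Local Notation Fs f lam := (\int[mu]_(x in setT) (f x * As lam x)).
Let Hcartan := Hpolar.1.
Let Hc : continuous H. Proof. by have [] := iwasawa_projection Hiw. Qed.

(* For [h s = e^(- rho s) (1 + sin (lam s))], [iwasawa_change] makes the sine
   average odd under [x |-> x^-1]; by [avg_inv] it is even. *)
Lemma As_eq0 lam x : As lam x = 0.
Proof.
pose e (s : R) := expR (- rh * s).
have ce : continuous e by exact: (smooth1_continuous (smooth1_exp rh)).
have cs : continuous (usin rh lam) by exact: (smooth1_continuous (smooth1_usin rh lam)).
have IC0 := iwasawa_change Kmax Hdk Hmu C0 Hpolar Hiw x^-1%g ce (fun s => expR_ge0 _).
have ch : continuous (fun s => e s + usin rh lam s).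
  by move=> s; apply: (@continuousD R R _ e); [exact: ce|exact: cs].
have h0 s : 0 <= e s + usin rh lam s.
  rewrite /usin -/(e s) -[X in X + _]mul1r -mulrDl mulr_ge0 ?expR_ge0//.
have IC1 := iwasawa_change Kmax Hdk Hmu C0 Hpolar Hiw x^-1%g ch h0.
have eN s : e (- s) * expR (- (2 * rh * s)) = e s.
  by rewrite /e -expRD; congr expR; ring.
have iK (u : R -> R) y : continuous u -> dk.-integrable K (EFin \o (fun k : borel G => u (H (y * k)%g))).
  move=> cu; apply: (integrableK Kmax Hdk (f := fun k => u (H (y * k)%g))).
  apply: (@mulgl_comp_continuous _ _ (fun x => u (H x))) => z.
  by apply: continuous_comp; [exact: Hc|exact: cu].
have mK : measurable K by exact: Ksub_measurable Kmax.
have E0 : \int[dk]_(k in K) e (H (x^-1 * k)%g) = \int[dk]_(k in K) e (H (x * k)%g).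
  rewrite -[RHS](congr1 (fun z => \int[dk]_(k in K) e (H (z * k)%g)) (invgK x)).
  by rewrite -IC0; apply: intK_eq => k _; rewrite eN.
have E1 : \int[dk]_(k in K) e (H (x^-1 * k)%g) - As lam x = \int[dk]_(k in K) e (H (x * k)%g) + As lam x^-1%g.
  rewrite /sphavg -RintegralB//; [|exact: iK|exact: iK].
  transitivity (\int[dk]_(k in K) ((e (- H (x^-1 * k)%g) + usin rh lam (- H (x^-1 * k)%g)) * expR (- (2 * rh * H (x^-1 * k)%g)))).
    apply: intK_eq => k _; rewrite mulrDl eN; congr (_ + _).
    by rewrite /usin -!/(e _) [lam * - _]mulrN sinN !mulNr -mulrA eN.
  rewrite IC1 !invgK RintegralD//; [exact: iK|exact: iK].
have := avg_inv Kmax Hdk Hmu Hcartan Hiw Hinv x (smooth1_usin rh lam).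
move: E1; rewrite E0 => /addrI E1 E2; rewrite E2 in E1; lra.
Qed.

Lemma phi_real (lam : R) x : phi X dk H lam%:C%C x = (Ac lam x)%:C%C.
Proof. by rewrite (phiE Kmax Hdk Hiw) As_eq0 oppr0. Qed.

Lemma inversion_cos f x : radial X f -> f x = c *
  \int[leb]_(lam in I0) (Fc f lam * Ac lam x * w lam).
Proof.
move=> fr; have E (u v z t : R) : t = 0 -> (u - v * t) * z = u * z by move=> ->; rewrite mulr0 subr0.
rewrite {1}(inversion_real Kmax Hdk Hmu Hcartan Hiw Hinv x fr).
apply: (congr1 (fun z => c * z)); apply: eq_Rintegral => lam _.
exact: E (As_eq0 lam x).
Qed.

Let mI : measurable (I0 : set (measurableTypeR R)). Proof. exact: measurable_itv. Qed.

Let mH : measurable_fun setT (H : borel G -> R). Proof. exact: continuous_borel. Qed.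

Lemma measurable_Ac : measurable_fun setT (fun z : borel G * R => Ac z.2 z.1).
Proof.
have mK : measurable K by exact: Ksub_measurable Kmax.
apply: (@measurable_Rintegral_param _ _ (borel G * R)%type (borel G) R dk K
  (fun z k => ucos rh z.2 (H (z.1^-1 * k)%g)) mK).
have mh : measurable_fun setT (fun z : (borel G * R) * borel G => H (z.1.1^-1 * z.2)%g).
  apply: (measurableT_comp mH); apply: measurable_mulg; last exact: measurable_snd.
  by apply: measurable_invg; exact: (measurableT_comp measurable_fst measurable_fst).
apply: measurable_funM.
  apply: (measurableT_comp (continuous_measurable_fun (@continuous_cos R))).
  by apply: measurable_funM => //; exact: (measurableT_comp measurable_snd measurable_fst).
apply: (measurableT_comp (@measurable_expR R)); apply: measurable_funM => //; exact: measurable_cst.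
Qed.

Let mAc2 x : measurable_fun setT (fun lam => Ac lam x).
Proof. exact: (measurable_fun_pair2 (x : borel G) measurable_Ac). Qed.

Lemma measurable_Fc f : measurable_fun setT (f : borel G -> R) -> measurable_fun setT (fun lam => Fc f lam).
Proof.
move=> mf; apply: (@measurable_Rintegral_param _ _ R (borel G) R mu setT
  (fun lam x => f x * Ac lam x)) => //.
apply: measurable_funM; first exact: (measurableT_comp mf measurable_snd).
exact: (measurableT_comp measurable_Ac (measurable_fun_pair measurable_snd measurable_fst)).
Qed.

(** The right-hand side is [phi_0 x]; it provides a dominating function that is uniform in [lam]. *)
Lemma Ac_le lam x : `|Ac lam x| <= avg (upow rh 0) x.
Proof.
have cu (u : R -> R) : smooth1 u -> continuous (fun k => u (H (x^-1 * k)%g)).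
  by move=> uS; apply: (@mulgl_comp_continuous _ _ (fun x => u (H x))); exact: (uH_continuous Hiw uS).
have u1 s : `|ucos rh lam s| <= upow rh 0 s.
  rewrite /ucos /upow expr0 normrM [X in _ * X]ger0_norm ?expR_ge0// ler_wpM2r ?expR_ge0//.
  by rewrite ler_norml cos_geN1 cos_le1.
have mK : measurable K by exact: Ksub_measurable Kmax.
apply: (le_trans (le_normr_Rintegral mK _)).
  by apply: (integrableK Kmax Hdk); apply: cu; exact: smooth1_ucos.
apply: (le_RintegralK Kmax Hdk) => [||k _]; last exact: u1.
- move=> z; apply: (@continuous_comp _ _ _ (fun k => ucos rh lam (H (x^-1 * k)%g)) (fun s : R => `|s|)); last exact: norm_continuous.
  by apply: cu; exact: smooth1_ucos.
- by apply: cu; exact: smooth1_upow.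
Qed.

Hypothesis mw : measurable_fun setT w.

Let w0 lam : 0 <= w lam. Proof. by rewrite /plancherel invr_ge0 sqr_ge0. Qed.

(** The inversion formula at 1 forces integrability: [Rintegral] returns 0 as soon as the positive
    or the negative part has infinite integral, whereas here its value times [c] is [h 1 != 0]. If
    [f 1 = 0], the argument is applied to [f + chi] and to [chi], whose difference is [f]. *)
Lemma Fc_w_integrable f : radial X f -> leb.-integrable I0 (EFin \o (fun lam => Fc f lam * w lam)).
Proof.
have H1 h : radial X h -> h 1%g != 0 -> leb.-integrable I0 (EFin \o (fun lam => Fc h lam * w lam)).
  move=> hr h1.
  have mh : measurable_fun setT (fun lam => Fc h lam * w lam).
    by apply: measurable_funM => //; apply: measurable_Fc; apply: continuous_borel; exact: (radial_continuous hr).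
  have := inversion_cos 1%g hr.
  under eq_Rintegral do rewrite (Ac1 Kmax Hdk Hiw) mulr1.
  move=> hE; have I1 : \int[leb]_(lam in I0) (Fc h lam * w lam) != 0.
    by apply: contraNneq h1 => z; rewrite hE z mulr0.
  apply/integrableP; split; first by apply: measurable_funTS; exact/measurable_EFinP.
  move: I1; rewrite /Rintegral integralE.
  set A := (\int[leb]_(x in _) _^\+ x)%E; set B := (\int[leb]_(x in _) _^\- x)%E.
  have A0 : (0 <= A)%E by apply: integral_ge0.
  have B0 : (0 <= B)%E by apply: integral_ge0.
  move=> AB.
  rewrite (_ : (\int[leb]_(x in _) _)%E = (A + B)%E); last first.
    rewrite /A /B -ge0_integralD//; last 2 first.
    - by apply: measurable_funTS; apply: measurable_funepos; exact/measurable_EFinP.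
    - by apply: measurable_funTS; apply: measurable_funeneg; exact/measurable_EFinP.
    by apply: eq_integral => lam _; have := congr1 (@^~ lam) (fune_abse (EFin \o (fun lam => Fc h lam * w lam))).
  clearbody A B; move: A B A0 B0 AB => [a| |] [b| |] //= _ _; rewrite ?eqxx// => _.
  by rewrite ltry.
move=> fr; have [chi [chir chi0 chi1]] := radial_cutoff Kmax Hdk 1.
have chi11 : 1 <= chi 1%g.
  apply: chi1; exists 1%g, 0, 1%g; split; rewrite ?lexx ?ler01//; try exact: Ksub1.
  by rewrite aexp0 !mulg1.
have chi1n : chi 1%g != 0 by rewrite gt_eqF// (lt_le_trans ltr01).
have [f1|f1] := eqVneq (f 1%g) 0; last exact: H1.
have fcr := radialD fr chir.
have i1 : leb.-integrable I0 (EFin \o (fun lam => Fc (fun x => f x + chi x) lam * w lam)).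
  by apply: H1 => //; rewrite f1 add0r.
have := integrableB mI i1 (H1 _ chir chi1n).
apply: eq_integrable => // lam _ /=; rewrite -EFinB -mulrBl; congr (_ * _)%:E.
have iAc h : radial X h -> mu.-integrable setT (EFin \o (fun x : borel G => h x * Ac lam x)).
  by move=> hr; apply: (radial_avg_integrable Kmax Hdk Hmu Hcartan Hiw hr); exact: smooth1_ucos.
rewrite -RintegralB//; [|exact: iAc|exact: iAc].
by apply: eq_Rintegral => x _; rewrite mulrDl addrK.
Qed.

Lemma plancherel_identity f : radial X f ->
  c * \int[leb]_(lam in I0) (Fc f lam ^+ 2 * w lam) = \int[mu]_(x in setT) f x ^+ 2.
Proof.
move=> fr.
have mf : measurable_fun setT (f : borel G -> R) by apply: continuous_borel; exact: (radial_continuous fr).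
have ib1 : mu.-integrable setT (EFin \o (fun x : borel G => f x * avg (upow rh 0) x)).
  by apply: (radial_avg_integrable Kmax Hdk Hmu Hcartan Hiw fr); exact: smooth1_upow.
have ib2 := Fc_w_integrable fr.
have mF : measurable_fun setT (fun z : borel G * R => f z.1 * (Fc f z.2 * Ac z.2 z.1 * w z.2)).
  apply: measurable_funM; first exact: (measurableT_comp mf measurable_fst).
  apply: measurable_funM; last exact: (measurableT_comp mw measurable_snd).
  apply: measurable_funM; last exact: measurable_Ac.
  exact: (measurableT_comp (measurable_Fc mf) measurable_snd).
(* Since [|Ac lam x| <= phi_0 x], the integrand is dominated by a function of [x] times a function
   of [lam], both integrable. *)
have dm (a F A P z : R) : `|A| <= P -> `|a * (F * A * z)| <= `|a * P| * `|F * z|.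
  move=> AP; have -> : a * (F * A * z) = a * (F * z) * A by ring.
  have -> : `|a * P| * `|F * z| = `|a * (F * z)| * `|P| by rewrite -!normrM; congr (`| _ |); ring.
  by rewrite normrM ler_wpM2l// (le_trans AP)// ler_norm.
have dom x lam : setT x -> I0 lam -> `|f x * (Fc f lam * Ac lam x * w lam)| <=
    `|f x * avg (upow rh 0) x| * `|Fc f lam * w lam|.
  by move=> _ _; apply: dm; exact: Ac_le.
have ib1' := integrable_norm ib1; have ib2' := integrable_norm ib2.
have FB := @fubini_dominated _ _ (borel G) (measurableTypeR R) R mu leb setT I0 (fun x lam => f x * (Fc f lam * Ac lam x * w lam))
  (fun x => `|f x * avg (upow rh 0) x|) (fun lam => `|Fc f lam * w lam|) measurableT mI mF ib1' ib2' dom.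
have iAc x : leb.-integrable I0 (EFin \o (fun lam => Fc f lam * Ac lam x * w lam)).
  apply: (@le_integrable _ _ _ leb _ mI _ (EFin \o (fun lam => avg (upow rh 0) x * (Fc f lam * w lam)))).
  - apply: measurable_funTS; apply/measurable_EFinP; apply: measurable_funM => //; apply: measurable_funM.
      exact: measurable_Fc.
    exact: mAc2.
  - move=> lam _ /=; rewrite lee_fin.
    by have := dm 1 (Fc f lam) _ _ (w lam) (Ac_le lam x); rewrite !mul1r -normrM.
  - have := integrableZl mI (avg (upow rh 0) x) ib2.
    by congr (integrable _ _ _); apply/funext => lam /=; rewrite EFinM.
have iFA lam : mu.-integrable setT (EFin \o (fun x : borel G => f x * Ac lam x)).
  by apply: (radial_avg_integrable Kmax Hdk Hmu Hcartan Hiw fr); exact: smooth1_ucos.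
transitivity (c * \int[mu]_(x in setT) \int[leb]_(lam in I0) (f x * (Fc f lam * Ac lam x * w lam))).
  apply: (congr1 (fun z => c * z)); apply: etrans (esym FB); apply: eq_Rintegral => lam _.
  rewrite expr2 -mulrA [X in _ = X](_ : _ = \int[mu]_(x in setT) (f x * Ac lam x * (Fc f lam * w lam))).
    by rewrite RintegralZr.
  by apply: eq_Rintegral => x _; rewrite -!mulrA; congr (_ * _); rewrite mulrCA.
have idom := @dom_integrable_Rintegral1 _ _ (borel G) (measurableTypeR R) R mu leb setT I0 (fun x lam => f x * (Fc f lam * Ac lam x * w lam))
  (fun x => `|f x * avg (upow rh 0) x|) (fun lam => `|Fc f lam * w lam|) measurableT mI mF ib1' ib2' dom.
rewrite -RintegralZl//; apply: eq_Rintegral => x _.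
rewrite RintegralZl// mulrCA expr2; apply: (congr1 (fun z => f x * z)).
by apply: esym; exact: inversion_cos.
Qed.

End Plancherel.

(** * Measurability of the Plancherel density *)

Section MeromorphicDensity.
Variable R : realType.
Local Notation normc := ComplexField.Normc.normc.

(** The centre of each interval is excluded because it may be a pole; adding one point preserves
    measurability. Countably many intervals with rational end points cover the line. *)
Lemma measurable_local (f : R -> R) :
  (forall x, exists2 d : R, 0 < d & measurable_fun (`]x - d, x + d[ `\ x) f) ->
  measurable_fun setT f.
Proof.
move=> fl; have {}fl x : exists2 d : R, 0 < d & measurable_fun `]x - d, x + d[ f.
  have [d d0 fd] := fl x; exists d => //.
  apply: (@measurable_funS _ _ _ _ ((`]x - d, x + d[ `\ x) `|` [set x])).
  - by apply: measurableU => //; apply: measurableD.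
  - by move=> y yI; have [->|/eqP yx] := eqVneq y x; [right|left].
  apply/measurable_funU => //; first by apply: measurableD.
  by split=> //; exact: measurable_fun_set1.
move=> _ Y mY; rewrite setTI.
pose D := [set p : rat * rat | measurable_fun `](ratr p.1 : R), ratr p.2[ f].
have -> : f @^-1` Y = \bigcup_(p in D) (`](ratr p.1 : R), ratr p.2[ `&` f @^-1` Y).
  apply/seteqP; split=> [x Yx|x [p _ []]//].
  have [d d0 fd] := fl x.
  have l1 : x - d < x by lra.
  have l2 : x < x + d by lra.
  have [p] := rat_in_itvoo l1; rewrite in_itv/= => /andP[p1 p2].
  have [q] := rat_in_itvoo l2; rewrite in_itv/= => /andP[q1 q2].
  exists (p, q); last by split=> //=; rewrite in_itv/= p2 q1.
  rewrite /D/=; apply: (measurable_funS _ _ fd) => // y /=; rewrite !in_itv/= => /andP[y1 y2].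
  by rewrite (lt_trans p1 y1) (lt_trans y2 q2).
apply: bigcup_countable_measurable => [|p Dp]; first exact: countableP.
by apply: Dp.
Qed.

(** The norm of [R[i]] and the radii of its balls take values in [R[i]]; a positive radius is real,
    and the comparison becomes one of real numbers. *)
Lemma normc_lt (z : R[i]) (e : R[i]) : 0 < e -> (`|z| < e) = (normc z < complex.Re e).
Proof.
case: e => a b; rewrite ltcE /= => /andP[/eqP/= b0 a0].
by rewrite b0 -[(a +i* _)%C]/(a%:C%C) -[`|z|]/((normc z)%:C%C) ltcR.
Qed.

Lemma normc_real (x : R) : normc x%:C%C = `|x|.
Proof. by rewrite /= expr0n/= addr0 sqrtr_sqr. Qed.

Lemma normc_realB (x y : R) : normc (x%:C%C - y%:C%C) = `|x - y|.
Proof. by rewrite /= subr0 expr0n/= addr0 sqrtr_sqr. Qed.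

Lemma normcX (z : R[i]) n : normc (z ^+ n) = normc z ^+ n.
Proof.
elim: n => [|n IH]; first by rewrite !expr0 ComplexField.Normc.normc1.
by rewrite !exprS ComplexField.Normc.normcM IH.
Qed.

Lemma normc_diff (a b : R[i]) : `|normc a - normc b| <= normc (a - b).
Proof.
have t (x y : R[i]) : normc x - normc y <= normc (x - y).
  rewrite lerBlDr; have := @le_normcD R (x - y) y; by rewrite subrK.
rewrite ler_norml t andbT lerNl opprB; apply: le_trans (t b a) _.
by rewrite -[b - a]opprB (@normcN R (a - b)).
Qed.

Lemma near_normc (z0 : R[i]^o) (P : R[i]^o -> Prop) : (\forall z \near z0, P z) ->
  exists2 d : R, 0 < d & forall z : R[i], normc (z0 - z) < d -> P z.
Proof.
move=> /nbhs_ballP[e /= e0 eP]; exists (complex.Re e).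
  by move: e0; case: (e) => a b; rewrite ltcE/= => /andP[].
by move=> z zd; apply: eP; rewrite /ball/= (normc_lt _ e0).
Qed.

Lemma continuous_normc_real (u : R[i]^o -> R[i]^o) (x : R) :
  {for (x%:C%C : R[i]^o), continuous u} -> {for x, continuous (fun t : R => normc (u t%:C%C))}.
Proof.
move=> cu; apply/cvgrPdist_lt => e e0.
have eC : 0 < (e%:C%C : R[i]) by rewrite ltcR.
have [d d0 dP] : exists2 d : R, 0 < d & forall z : R[i], normc (x%:C%C - z) < d -> normc (u x%:C%C - u z) < e.
  have /cvgrPdist_lt/(_ _ eC)/near_normc[d d0 dP] := cu; exists d => // z zd.
  by have := dP z zd; rewrite (normc_lt _ eC).
apply/nbhs_ballP; exists d => // t; rewrite /ball/= => xt.
apply: le_lt_trans (normc_diff _ _) _; apply: dP.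
by rewrite normc_realB.
Qed.

(** Near each real point, that point excluded, [|cf|] is the quotient of the continuous function
    [|u|] by a power of the distance. *)
Lemma measurable_plancherel (cf : R[i] -> R[i]) : meromorphic cf ->
  measurable_fun setT (plancherel cf).
Proof.
move=> mcf; apply: measurable_local => x.
have [n [u [du cu]]] := mcf (x%:C%C : R[i]^o).
have [d1 d10 d1P] := near_normc du.
have [d2 d20 d2P] : exists2 d : R, 0 < d & forall z : R[i], normc (x%:C%C - z) < d -> z != x%:C%C -> cf z = u z / (z - x%:C%C) ^+ n.
  by move: cu; rewrite near_withinE => /near_normc.
have d0 : 0 < Num.min d1 d2 by rewrite lt_min d10.
exists (Num.min d1 d2) => //.
set d := Num.min d1 d2.
pose v (t : R) := normc (u t%:C%C).
have bl t : `]x - d, x + d[%classic t -> normc (x%:C%C - t%:C%C) < d.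
  move=> tI; rewrite normc_realB; move: tI; rewrite /= in_itv/= => /andP[a b].
  by rewrite ltr_norml; apply/andP; split; lra.
have mv : measurable_fun `]x - d, x + d[ v.
  apply: open_continuous_measurable_fun; first exact: interval_open.
  move=> t; rewrite inE => /bl td; apply: continuous_normc_real.
  apply: differentiable_continuous; apply/derivable1_diffP; apply: d1P.
  by apply: lt_le_trans td _; rewrite ge_min lexx.
have mv' : measurable_fun (`]x - d, x + d[ `\ x) v.
  by apply: measurable_funS mv => // t [].
(* The inverse is written as a power of exponent -1, which is measurable and, like the inverse,
   takes the value 0 at 0. *)
apply: (eq_measurable_fun (fun t : R => `|t - x| ^+ (n * 2) * ((v t ^+ 2) `^ (- 1)))).
  move=> t; rewrite inE => -[tI tx].
  have tx' : t%:C%C != x%:C%C :> R[i].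
    by apply/eqP => /(congr1 (@complex.Re R))/= ?; apply: tx.
  rewrite powR_inv1 ?sqr_ge0// /plancherel /cabs d2P//; last first.
    by apply: lt_le_trans (bl _ tI) _; rewrite ge_min lexx orbT.
  rewrite ComplexField.Normc.normcM ComplexField.Normc.normcV normcX normc_realB -/(v t).
  by rewrite exprM -[RHS]exprVn invf_div expr_div_n.
apply: measurable_funM.
  apply: measurable_funTS; apply: measurable_funX; apply: (measurableT_comp (@normr_measurable R setT)).
  by apply: measurable_funB => //; exact: measurable_cst.
apply: (@measurableT_comp _ _ _ _ _ _ (fun z : R => z `^ (- 1)) _ (fun t => v t ^+ 2)).
  exact: measurable_powR.
exact: measurable_funX.
Qed.

End MeromorphicDensity.

(** * The spectral bound *)

Section BestApproximation.
Variables (R : realType) (V : lmodType R) (b : V -> V -> R).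
Hypotheses (bl : forall a u v w, b (a *: u + v) w = a * b u w + b v w)
  (bs : forall u v, b u v = b v u) (bp : forall u, 0 <= b u u).

(** The orthogonal projection [q] of [f] is its best approximation by the span of the [e i], so [p]
    cannot be closer to [f]. The second hypothesis places [p] in this span up to a null vector,
    which is orthogonal to everything. *)
Lemma best_approximation (N : nat) (e : nat -> V) (f p : V) :
  (forall i k, (i < N)%N -> (k < N)%N -> b (e i) (e k) = (i == k)%:R) ->
  (let r := p - \sum_(i < N) b p (e i) *: e i in b r r = 0) ->
  b f f <= \sum_(i < N) b f (e i) ^+ 2 + b (f - p) (f - p).
Proof.
move=> eo /= r0.
pose q := \sum_(i < N) b f (e i) *: e i.
pose pe := \sum_(i < N) b p (e i) *: e i.
have qe i : (i < N)%N -> b q (e i) = b f (e i).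
  move=> iN; rewrite /q (ip_suml bl) (bigD1 (Ordinal iN))//= (ipZl bl) eo// eqxx mulr1.
  rewrite big1 ?addr0// => k ki; rewrite (ipZl bl) eo// (_ : _ == _ = false) ?mulr0//.
  by apply/negbTE; apply: contra ki => /eqP ki; apply/eqP/val_inj.
have fq (s : V) (a : 'I_N -> R) : s = \sum_(i < N) a i *: e i -> b (f - q) s = 0.
  move=> ->; rewrite (ip_sumr bl bs) big1// => i _.
  by rewrite (ipZr bl bs) (ipDl bl) (ipNl bl) qe// subrr mulr0.
have fqp : b (f - q) (q - p) = 0.
  have -> : q - p = (q - pe) - (p - pe) by rewrite opprB addrA subrK.
  rewrite (ipDr bl bs) (ipNr bl bs) [X in _ - X](bs) (ip_null bl bs bp _ r0) subr0.
  apply: (fq _ (fun i => b f (e i) - b p (e i))).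
  by rewrite /q /pe -sumrB; apply: eq_bigr => i _; rewrite scalerBl.
have -> : b (f - p) (f - p) = b (f - q) (f - q) + b (q - p) (q - p).
  have -> : f - p = (f - q) + (q - p) by rewrite addrA subrK.
  move: (f - q) (q - p) fqp => u v uv.
  by rewrite (ipDl bl) !(ipDr bl bs) (bs v) uv addr0 add0r.
have -> : b (f - q) (f - q) = b f f - \sum_(i < N) b f (e i) ^+ 2.
  rewrite {2}/q (ipDr bl bs) (ipNr bl bs) (fq q _ erefl) subr0 (ipDl bl) (ipNl bl).
  congr (_ - _); rewrite bs /q (ip_sumr bl bs); apply: eq_bigr => i _.
  by rewrite (ipZr bl bs) expr2.
rewrite addrA addrCA subrr addr0 lerDl; exact: bp.
Qed.

End BestApproximation.

Section ContinuousFunctions.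
Variables (R : realType) (T : topologicalType).

Definition continuous_pred : {pred (T -> R)} := fun f => `[< continuous f >].

(** Gram-Schmidt needs a module on which [chi_ip] is bilinear. On continuous functions its integrals
    converge, as [chi] has compact support. *)
Record cfun := CFun { cval :> T -> R; cvalP : cval \in continuous_pred }.

HB.instance Definition _ := [isSub for cval].
HB.instance Definition _ := [Choice of cfun by <:].

Lemma continuous_submod_closed : submod_closed continuous_pred.
Proof.
split=> [|a u v /asboolP cu /asboolP cv]; apply/asboolP; first exact: cst_continuous.
move=> x; apply: (@continuousD R R T (fun x => a * u x) v); last exact: cv.
by apply: (@continuousM R T (cst a) u); [exact: cst_continuous|exact: cu].
Qed.

HB.instance Definition _ := GRing.isSubmodClosed.Build R (T -> R) continuous_pred continuous_submod_closed.
HB.instance Definition _ := [SubChoice_isSubLmodule of cfun by <:].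

End ContinuousFunctions.

(** * Elementary estimates for the cosine and the hyperbolic sine *)

Section CosineTaylor.
Variable R : realType.

Definition cos_taylor (k : nat) : R := (~~ odd k)%:R * (-1) ^+ k./2 / k`!%:R.

Lemma cos_coeff_taylor (x : R) k : cos_coeff x k = cos_taylor k * x ^+ k.
Proof. by rewrite /cos_coeff /cos_taylor /= -!mulrA; congr (_ * (_ * _)); rewrite mulrC. Qed.

(* The tail of the series is dominated by [e^(-n)] times the exponential series
   of [e |x|]. *)
Lemma cos_taylor_le (x : R) n :
  `|cos x - \sum_(k < n) cos_taylor k * x ^+ k| <= expR (expR 1 * `|x|) * expR (- n%:R).
Proof.
pose u k := cos_taylor k * x ^+ k.
have sc : series u @ \oo --> cos x.
  have -> : u = cos_coeff x by apply/funext => k; rewrite cos_coeff_taylor.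
  have /cvg_ex[l cl] := @is_cvg_series_cos_coeff R x.
  by rewrite cos.unlock (cvg_lim _ cl).
pose y := expR 1 * `|x|.
have y0 : 0 <= y by rewrite mulr_ge0 ?expR_ge0.
have ub k : `|u k| <= exp_coeff `|x| k.
  rewrite /u /cos_taylor /exp_coeff/= !normrM normfV !normrX normrN1 expr1n !normr_nat mulr1.
  rewrite [leRHS]mulrC; apply: ler_wpM2r; first exact: exprn_ge0.
  rewrite -[leRHS]mul1r; apply: ler_wpM2r; first by rewrite invr_ge0.
  by case: odd.
have ux k : (n <= k)%N -> exp_coeff `|x| k <= expR (- n%:R) * exp_coeff y k.
  move=> nk; rewrite /exp_coeff /= /y exprMn -expRM_natl mulr1 !mulrA -expRD -mulrA -[leLHS]mul1r.
  rewrite ler_wpM2r ?divr_ge0 ?exprn_ge0//.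
  by rewrite -[leLHS]expR0 ler_expR addrC subr_ge0 ler_nat.
have e0 k : 0 <= exp_coeff y k by rewrite /exp_coeff/= divr_ge0 ?exprn_ge0.
have es N : series (exp_coeff y) N <= expR y.
  rewrite /expR; apply: nondecreasing_cvgn_le; last exact: is_cvg_series_exp_coeff.
  by apply: nondecreasing_series.
have tail N : (n <= N)%N -> `|series u N - series u n| <= expR y * expR (- n%:R).
  move=> nN; rewrite sub_series_geq//; apply: (le_trans (ler_norm_sum _ _ _)).
  apply: (@le_trans _ _ (\sum_(n <= k < N) expR (- n%:R) * exp_coeff y k)).
    by rewrite [leLHS]big_nat [leRHS]big_nat; apply: ler_sum => k /andP[nk _]; exact: le_trans (ub k) (ux k nk).
  rewrite -mulr_sumr mulrC ler_wpM2r ?expR_ge0//; apply: le_trans (es N).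
  by rewrite /series/= (big_cat_nat (n := n) (leq0n n) nN)/= lerDr sumr_ge0.
have -> : \sum_(k < n) cos_taylor k * x ^+ k = series u n by rewrite /series/= big_mkord.
have cv : `|series u N - series u n| @[N --> \oo] --> `|cos x - series u n|.
  by apply: cvg_norm; apply: cvgB => //; exact: cvg_cst.
rewrite -(cvg_lim _ cv)//; apply: limr_le; first exact: cvgP cv.
near=> N; apply: tail; near: N; exact: nbhs_infty_ge.
Unshelve. all: by end_near. Qed.

Lemma cos_ge_cos1 (y : R) : `|y| <= 1 -> cos 1 <= cos y.
Proof.
move=> y1; have p2 : (2 : R) <= pi by exact: pi_ge2.
have -> : cos y = cos `|y| by case: (lerP 0 y) => h; [rewrite (ger0_norm h)|rewrite (ltr0_norm h) cosN].
by rewrite leNgt ltr_cos ?in_itv/= ?normr_ge0 ?ler01 ?ltNge ?y1//=; have := normr_ge0 y; lra.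
Qed.

Lemma sinh_ge (t : R) : 0 <= t -> t / 2 <= Defs.sinh t.
Proof.
move=> t0; rewrite /Defs.sinh ler_pdivrMr// divfK//.
have h1 := expR_ge1Dx t; have h2 : expR (- t) <= 1 by rewrite -[leRHS]expR0 ler_expR oppr_le0.
lra.
Qed.

End CosineTaylor.

(** * A lower bound for the mass of [phi_lam] near [o] *)

Section LowerBound.
Variables (R : realType) (G : lieGroupType R) (g : lieAlgebra G) (X : rankOneSpace g).
Variables (dk : probability (borel G) R) (mu : {sigma_finite_measure set (borel G) -> \bar R}).
Hypotheses (Kmax : maximal_compact X) (Hdk : haarK X dk) (Hmu : haar mu).
Variables (C : R) (C0 : 0 < C) (Hpolar : polar_coordinates X mu dk C).
Variables (kap : G -> G) (H : G -> R) (nu : G -> G).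
Hypothesis Hiw : iwasawa X kap H nu.
Local Notation K := (Ksub X : set (borel G)).
Local Notation rh := (rho X).
Local Notation avg u := (sphavg X dk H u).
Local Notation Ac lam := (avg (ucos rh lam)).
Local Notation leb := (@lebesgue_measure R).
Let Hcartan := Hpolar.1.
Let r0 : 0 <= rh. Proof. by apply: ltW; exact: rho_gt0. Qed.

(** [|H (a_(- t) k)| <= 2 t], so the phase [lam H] stays in [[- 1, 1]], where the cosine is at least
    [cos 1 > 0]. *)
Lemma Ac_lower (lam t : R) : 0 <= t -> t <= 1 -> 2 * `|lam| * t <= 1 ->
  cos 1 * expR (- (2 * rh)) <= Ac lam (aexp X t).
Proof.
move=> t0 t1 lt; have [_ _ _ _ Hb] := iwasawa_projection Hiw.
rewrite -[leLHS](intK_cst Kmax Hdk) /sphavg.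
apply: (le_RintegralK Kmax Hdk).
- exact: cst_continuous.
- by apply: (@mulgl_comp_continuous _ _ (fun x => ucos rh lam (H x))); exact: (uH_continuous Hiw (smooth1_ucos rh lam)).
move=> k Kk; rewrite -aexpN; have := Hb k (- t) Kk; rewrite normrN (ger0_norm t0) => Hk.
set h := H _ in Hk *.
have h1 : `|lam * h| <= 1.
  rewrite normrM; apply: le_trans lt.
  by rewrite (_ : 2 * `|lam| * t = `|lam| * (2 * t)); [exact: ler_wpM2l|ring].
have c1 : 0 <= cos 1 :> R by exact: ltW (cos1_gt0 R).
rewrite /ucos; apply: ler_pM => //; first exact: cos_ge_cos1.
rewrite ler_expR mulNr lerN2 mulrC ler_wpM2r//.
by move: Hk; rewrite ler_norml => /andP[_ h2]; apply: (le_trans h2); lra.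
Qed.

Lemma polarD_lower (e t : R) : 0 <= e -> e / 2 <= t -> (e / 4) ^+ (m1 X + m2 X) <= polarD X t.
Proof.
move=> e0 et; have t0 : 0 <= t by lra.
have := sinh_ge t0; have t20 : 0 <= 2 * t by lra.
have := sinh_ge t20 => s2 s1.
have e4 : 0 <= e / 4 by lra.
rewrite exprD /polarD ler_pM ?exprn_ge0//; rewrite lerXn2r ?nnegrE//; try lra.
Qed.

(** Only the shell [e / 2 <= t <= e] is kept, where [e = 1 / (2 (1 + L))] satisfies [2 lam e <= 1],
    as [Ac_lower] asks. The exponent is the dimension of the space: [m1 + m2] from the density and 1
    from the width of the shell. *)
Lemma mass_lower (chi : G -> R) (lam L : R) : radial X chi -> (forall x, 0 <= chi x) ->
  (forall x, Kball X 1 x -> 1 <= chi x) -> 0 <= lam <= L ->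
  C * (cos 1 * expR (- (2 * rh))) ^+ 2 * ((2 * (1 + L))^-1 / 4) ^+ (m1 X + m2 X).+1 <=
  \int[mu]_(x in setT) (chi x * Ac lam x ^+ 2).
Proof.
move=> chir chi0 chi1 /andP[l0 lL].
have L0 : 0 <= L by lra.
set e := (2 * (1 + L))^-1; set q := cos 1 * expR (- (2 * rh)).
have q0 : 0 <= q by rewrite mulr_ge0 ?expR_ge0// ltW// cos1_gt0.
have e0 : 0 < e by rewrite invr_gt0; lra.
have e1 : e <= 1 by rewrite invf_le1; lra.
have le1 : 2 * lam * e <= 1 by rewrite ler_pdivrMr; lra.
have Ar : radial X (fun x => chi x * Ac lam x ^+ 2).
  have AS := sphavg_smooth Kmax Hdk Hmu Hcartan Hiw (smooth1_ucos rh lam).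
  have Ab := sphavg_biinv Kmax Hdk Hiw (smooth1_ucos rh lam).
  have -> : (fun x => chi x * Ac lam x ^+ 2) = (fun x => chi x * Ac lam x * Ac lam x).
    by apply/funext => x; rewrite expr2 mulrA.
  exact: radialM (radialM chir AS Ab) AS Ab.
pose f x := chi x * Ac lam x ^+ 2.
have f0 x : 0 <= f x by rewrite mulr_ge0 ?sqr_ge0.
have fb : biinvariant X f by have [] := Ar.
have mf : measurable_fun setT (f : borel G -> R) by apply: continuous_borel; exact: (radial_continuous Ar).
have fin := integrable_fin_num measurableT (radial_integrable Hmu Ar).
rewrite -lee_fin /Rintegral fineK//.
have fr x k : Ksub X k -> f (x * k)%g = f x.
  by move=> Kk; have := fb 1%g k x (Ksub1 X) Kk; rewrite mul1g.
have fl k x : Ksub X k -> f (k * x)%g = f x.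
  by move=> Kk; have := fb k 1%g x Kk (Ksub1 X); rewrite mulg1.
rewrite (_ : (\int[mu]_x _)%E = (\int[mu]_x (f x)%:E)%E)//.
rewrite (polar_right_invariant Kmax Hdk Hpolar mf f0 fr) -(mulrA C) EFinM; apply: lee_wpmul2l; first by rewrite lee_fin ltW.
have mK : measurable K by exact: Ksub_measurable Kmax.
pose c1 := q ^+ 2 * (e / 4) ^+ (m1 X + m2 X).
rewrite (_ : (\int[dk]_(k in K) _)%E = (\int[leb]_(t in `[0%R, +oo[) (f (aexp X t) * `|polarD X t|)%:E)%E); last first.
  transitivity (\int[dk]_(k in K) (cst (\int[leb]_(t in `[0%R, +oo[) (f (aexp X t) * `|polarD X t|)%:E)) k)%E.
    apply: eq_integral => k; rewrite inE => Kk; apply: eq_integral => t _; rewrite fl//.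
  by rewrite integral_cst//= (dkK Hdk) mule1.
have mft : measurable_fun setT (fun t => (f (aexp X t) * `|polarD X t|)%:E).
  apply/measurable_EFinP; apply: measurable_funM.
    exact: (measurableT_comp mf (continuous_measurable_borel (@aexp_continuous _ _ _ X))).
  by apply: (measurableT_comp (@normr_measurable R setT)); exact: measurable_polarD.
apply: (@le_trans _ _ (\int[leb]_(t in `[(e / 2)%R, e]) (cst c1%:E) t)%E).
  rewrite integral_cst//= lebesgue_measure_itv/= lte_fin ifT; last by lra.
  rewrite -EFinD -EFinM lee_fin.
  have E (z y : R) : 0 <= z -> 0 <= y -> z * (y * (e / 4)) <= z * y * (e - e / 2).
    by move=> z0 y0; rewrite mulrA; apply: ler_wpM2l; [exact: mulr_ge0|lra].
  rewrite (exprSr (e / 4)) /c1; apply: E; first exact: sqr_ge0.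
  by rewrite exprn_ge0//; lra.
apply: (@le_trans _ _ (\int[leb]_(t in `[(e / 2)%R, e]) (f (aexp X t) * `|polarD X t|)%:E)%E).
  apply: ge0_le_integral => //.
  - by move=> t _; rewrite lee_fin mulr_ge0 ?sqr_ge0// exprn_ge0//; lra.
  - exact: measurable_funTS.
  - move=> t /=; rewrite in_itv/= => /andP[te1 te2]; have t0 : 0 <= t by lra.
    rewrite lee_fin (ger0_norm (polarD_ge0 _ t0)); apply: ler_pM.
    + exact: sqr_ge0.
    + by rewrite exprn_ge0//; lra.
    + rewrite /f -[leLHS]mul1r; apply: ler_pM => //; first exact: sqr_ge0.
        by apply: chi1; exists 1%g, t, 1%g; split; rewrite ?mul1g ?mulg1//; [exact: Ksub1|apply/andP; split; lra|exact: Ksub1].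
      have Al : q <= Ac lam (aexp X t).
        apply: Ac_lower => //; first by lra.
        by rewrite ger0_norm//; apply: le_trans le1; rewrite ler_wpM2l// mulr_ge0.
      by rewrite lerXn2r ?nnegrE// (le_trans q0 Al).
    + by apply: polarD_lower => //; lra.
apply: ge0_subset_integral => //.
- exact: measurable_funTS.
- by move=> t _; rewrite lee_fin mulr_ge0.
- by move=> t /=; rewrite !in_itv/= andbT => /andP[te1 _]; lra.
Qed.

End LowerBound.

(** Weakens the polynomial lower bound to an exponential one, by [1 + L <= e^L], for comparison with
    a Taylor error [e^(- n)] whose order [n] is linear in [L]. *)
Lemma power_ge_exp (R : realType) (L : R) (M : nat) : 0 <= L ->
  (8^-1) ^+ M * expR (- (M%:R * L)) <= ((2 * (1 + L))^-1 / 4) ^+ M.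
Proof.
move=> L0; have L1 : 0 < 1 + L by lra.
rewrite -mulrN expRM_natl -exprMn.
have -> : (2 * (1 + L))^-1 / 4 = 8^-1 * (1 + L)^-1 by field; rewrite gt_eqF.
apply: lerXn2r; rewrite ?nnegrE.
- by rewrite mulr_ge0 ?expR_ge0.
- by rewrite mulr_ge0// invr_ge0 ltW.
by rewrite ler_wpM2l// expRN lef_pV2 ?posrE ?expR_gt0// expR_ge1Dx.
Qed.

Section SpectralBound.
Variables (R : realType) (G : lieGroupType R) (g : lieAlgebra G) (X : rankOneSpace g).
Variables (dk : probability (borel G) R) (mu : {sigma_finite_measure set (borel G) -> \bar R}).
Hypotheses (Kmax : maximal_compact X) (Hdk : haarK X dk) (Hmu : haar mu).
Variables (C : R) (C0 : 0 < C) (Hpolar : polar_coordinates X mu dk C).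
Variables (kap : G -> G) (H : G -> R) (nu : G -> G).
Hypothesis Hiw : iwasawa X kap H nu.
Variables (cf : R[i] -> R[i]) (c : R).
Hypotheses (Hinv : inversion_formula X mu dk H cf c) (c0 : 0 < c)
  (mw : measurable_fun setT (plancherel cf)).
Variable chi : G -> R.
Hypotheses (chir : radial X chi) (chi0 : forall x, 0 <= chi x)
  (chi1 : forall x, Kball X 1 x -> 1 <= chi x).
Local Notation K := (Ksub X : set (borel G)).
Local Notation rh := (rho X).
Local Notation avg u := (sphavg X dk H u).
Local Notation Ac lam := (avg (ucos rh lam)).
Local Notation psi m := (avg (upow rh m)).
Local Notation w := (plancherel cf).
Local Notation leb := (@lebesgue_measure R).
Local Notation I0 := `[0%R, +oo[%classic.
Let Hcartan := Hpolar.1.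
Let r0 : 0 <= rh. Proof. by apply: ltW; exact: rho_gt0. Qed.
Let mI : measurable (I0 : set (measurableTypeR R)). Proof. exact: measurable_itv. Qed.
Let mK : measurable K. Proof. exact: Ksub_measurable Kmax. Qed.
Let w0 lam : 0 <= w lam. Proof. by rewrite /plancherel invr_ge0 sqr_ge0. Qed.

Let ccont : continuous chi. Proof. exact: radial_continuous chir. Qed.

Definition chi_ip (u v : cfun R G) : R := \int[mu]_(x in setT) (chi x * (u x * v x)).
Local Notation b := chi_ip.

Lemma chi_integrable (u : G -> R) : continuous u ->
  mu.-integrable setT (EFin \o (fun x : borel G => chi x * u x)).
Proof.
move=> cu; have [_ [Q cQ Q0] _] := chir.
apply: (support_integrable cQ (mu_fin Hmu cQ)) => [x|x /Q0 ->]; last by rewrite mul0r.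
exact: (@continuousM R G chi u x (@ccont x) (cu x)).
Qed.

Let cont (u : cfun R G) : continuous u. Proof. by have /asboolP := cvalP u. Qed.
Let contM (u v : cfun R G) : continuous (fun x => u x * v x).
Proof. by move=> x; exact: (@continuousM R G u v x (@cont u x) (@cont v x)). Qed.

Lemma chi_ipl a u v z : b (a *: u + v) z = a * b u z + b v z.
Proof.
rewrite /b -RintegralZl//; last exact: chi_integrable (@contM u z).
rewrite -RintegralD//; last 2 first.
- have := integrableZl measurableT a (chi_integrable (@contM u z)).
  by congr (integrable _ _ _); apply/funext => x /=; rewrite EFinM.
- exact: chi_integrable (@contM v z).
apply: eq_Rintegral => x _; rewrite (_ : (a *: u + v) x = a * u x + v x)//; ring.
Qed.

Lemma chi_ip_sym u v : b u v = b v u.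
Proof. by apply: eq_Rintegral => x _; rewrite (mulrC (u x)). Qed.

Lemma chi_ip_ge0 u : 0 <= b u u.
Proof. by apply: Rintegral_ge0 => x _; rewrite mulr_ge0// -expr2 sqr_ge0. Qed.

Lemma cfun_sum (I : Type) (s : seq I) (F : I -> cfun R G) x :
  (\sum_(i <- s) F i) x = \sum_(i <- s) F i x.
Proof. by apply: (big_morph (fun u : cfun R G => u x)). Qed.

Definition cavg (u : R -> R) (uS : smooth1 u) : cfun R G :=
  CFun (asboolT (sphavg_continuous Kmax Hdk Hmu Hcartan Hiw uS)).

Let phic lam := cavg (smooth1_ucos rh lam).
Let psic m := cavg (smooth1_upow rh m).

Lemma chi_bound : exists2 M, 0 < M & forall x, chi x <= M.
Proof.
have [_ [Q cQ Q0] _] := chir; have [M M0 HM] := compact_bound cQ ccont.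
exists (M + 1) => [|x]; first by lra.
have [Qx|/Q0 ->] := pselect (Q x); last by lra.
have := le_trans (ler_norm _) (HM x Qx); lra.
Qed.

(** [b (phi_lam) e] is the spherical transform of the test function [chi e]. By the Plancherel
    identity the integral is [1 / c] times that of [(chi e)^2], and [chi^2 <= Xm chi]. *)
Lemma bessel (Xm : R) (e : cfun R G) : (forall x, chi x <= Xm) -> radial X (fun x => chi x * e x) ->
  (\int[leb]_(lam in I0) (b (phic lam) e ^+ 2 * w lam)%:E <= (Xm * b e e / c)%:E)%E.
Proof.
move=> HX er; pose f x := chi x * e x.
have Fb lam : \int[mu]_(x in setT) (f x * Ac lam x) = b (phic lam) e.
  by apply: eq_Rintegral => x _; rewrite /f -mulrA (mulrC (e x)).
have PI := plancherel_identity Kmax Hdk Hmu C0 Hpolar Hiw Hinv mw er.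
have FI := Fc_w_integrable Kmax Hdk Hmu C0 Hpolar Hiw Hinv mw er.
have mF : measurable_fun setT (fun lam => b (phic lam) e).
  have := measurable_Fc dk mu Kmax Hiw (f := f) (continuous_borel (radial_continuous er)).
  by apply: eq_measurable_fun => lam _; rewrite Fb.
have [M _ HM] : exists2 M, 0 <= M & forall lam, `|b (phic lam) e| <= M.
  have iP := integrable_norm (radial_avg_integrable Kmax Hdk Hmu Hcartan Hiw er (smooth1_upow rh 0)).
  exists (\int[mu]_(x in setT) `|f x * psi 0 x|); first by apply: Rintegral_ge0.
  move=> lam; rewrite -Fb; apply: (le_trans (le_normr_Rintegral measurableT _)).
    exact: (radial_avg_integrable Kmax Hdk Hmu Hcartan Hiw er (smooth1_ucos rh lam)).
  have iA := integrable_norm (radial_avg_integrable Kmax Hdk Hmu Hcartan Hiw er (smooth1_ucos rh lam)).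
  rewrite -subr_ge0 -RintegralB//; apply: Rintegral_ge0 => x _.
  rewrite subr_ge0 !normrM ler_wpM2l//.
  exact: (le_trans (Ac_le Kmax Hdk Hiw lam x) (ler_norm _)).
(* Integrability identifies the integral in the extended reals with the real one of the Plancherel
   identity: one factor is bounded by [M], the other is integrable against the density. *)
have i2 : leb.-integrable I0 (EFin \o (fun lam => b (phic lam) e ^+ 2 * w lam)).
  apply: (@le_integrable _ _ _ leb _ mI _ (EFin \o (fun lam => M * (b (phic lam) e * w lam)))).
  - apply: measurable_funTS; apply/measurable_EFinP; apply: measurable_funM => //.
    exact: measurable_funX.
  - move=> lam _ /=; rewrite lee_fin expr2 -mulrA normrM [leRHS]normrM ler_wpM2r//.
    exact: (le_trans (HM lam) (ler_norm _)).
  - have := integrableZl mI M FI.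
    by congr (integrable _ _ _); apply/funext => lam /=; rewrite -EFinM -Fb.
rewrite -(fineK (integrable_fin_num mI i2)) lee_fin.
rewrite ler_pdivlMr// mulrC -[leLHS]/(c * \int[leb]_(lam in I0) (b (phic lam) e ^+ 2 * w lam)).
rewrite (_ : c * _ = \int[mu]_(x in setT) f x ^+ 2); last first.
  by rewrite -PI; apply: (congr1 (fun z => c * z)); apply: eq_Rintegral => lam _; rewrite -Fb.
have iee := chi_integrable (@contM e e).
have iee' : mu.-integrable setT (EFin \o (fun x : borel G => Xm * (chi x * (e x * e x)))).
  have := integrableZl measurableT Xm iee.
  by congr (integrable _ _ _); apply/funext => x /=; rewrite EFinM.
have iff : mu.-integrable setT (EFin \o (fun x : borel G => f x ^+ 2)).
  have c2 : continuous (fun x => chi x * (e x * e x)).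
    by move=> x; exact: (@continuousM R G chi _ x (@ccont x) (@contM e e x)).
  have := chi_integrable c2; congr (integrable _ _ _); apply/funext => x /=; congr EFin; rewrite /f; ring.
rewrite /b -RintegralZl// -subr_ge0 -RintegralB//; apply: Rintegral_ge0 => x _.
have -> : Xm * (chi x * (e x * e x)) - f x ^+ 2 = (Xm - chi x) * (chi x * e x ^+ 2) by rewrite /f; ring.
by rewrite mulr_ge0 ?subr_ge0// mulr_ge0 ?sqr_ge0.
Qed.

Lemma sphavg_taylor (a : nat -> R) n x :
  \int[dk]_(k in K) (\sum_(m < n) a m * upow rh m (H (x^-1 * k)%g)) = \sum_(m < n) a m * psi m x.
Proof.
have iu m : dk.-integrable K (EFin \o (fun k : borel G => upow rh m (H (x^-1 * k)%g))).
  apply: (integrableK Kmax Hdk (f := fun k => upow rh m (H (x^-1 * k)%g))).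
  apply: (@mulgl_comp_continuous _ _ (fun x => upow rh m (H x))); exact: (uH_continuous Hiw (smooth1_upow rh m)).
have iau m : dk.-integrable K (EFin \o (fun k : borel G => a m * upow rh m (H (x^-1 * k)%g))).
  have := integrableZl mK (a m) (iu m).
  by congr (integrable _ _ _); apply/funext => k /=; rewrite EFinM.
have is_ N : dk.-integrable K (EFin \o (fun k : borel G => \sum_(m < N) a m * upow rh m (H (x^-1 * k)%g))).
  elim: N => [|N IH].
    by rewrite (_ : EFin \o _ = cst 0%E); [exact: integrable0|apply/funext => k /=; rewrite big_ord0].
  have := integrableD mK IH (iau N).
  by congr (integrable _ _ _); apply/funext => k /=; rewrite big_ord_recr/= EFinD.
elim: n => [|n IH].
  by rewrite big_ord0; under eq_Rintegral do rewrite big_ord0; rewrite /Rintegral integral0.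
under eq_Rintegral do rewrite big_ord_recr/=.
by rewrite (RintegralD mK (is_ n) (iau n)) IH (RintegralZl _ mK (iu n)) big_ord_recr.
Qed.

(** [T] bounds [|H (x^-1 k)|] for [x] in [Q] and [k] in [K]; the estimate of the cosine at [lam H]
    is then averaged over [K]. The averages [psi m] do not depend on [lam]. *)
Lemma taylor_remainder (Q : set G) : compact Q -> exists2 T, 0 <= T &
  forall n lam x, Q x -> `|Ac lam x - \sum_(m < n) cos_taylor R m * lam ^+ m * psi m x| <=
    expR (expR 1 * (`|lam| * T)) * expR (- n%:R) * expR (rh * T).
Proof.
move=> cQ; have [Hc _ _ _ _] := iwasawa_projection Hiw.
have cP : compact [set z | exists a b : G, [/\ ((fun x => x^-1%g) @` Q) a, Ksub X b & z = (a * b)%g]].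
  apply: compact_mulg; last exact: Ksub_compact Kmax.
  by apply: continuous_compact => //; apply: continuous_subspaceT; exact: invg_continuous.
have [T T0 HT] := compact_bound cP Hc; exists T => // n lam x Qx.
have hT k : K k -> `|H (x^-1 * k)%g| <= T.
  by move=> Kk; apply: HT; exists x^-1%g, k; split=> //; exists x.
have cu (u : R -> R) : continuous u -> continuous (fun k => u (H (x^-1 * k)%g)).
  move=> uc; apply: (@mulgl_comp_continuous _ _ (fun x => u (H x))) => z.
  by apply: continuous_comp; [exact: Hc|exact: uc].
pose p s := \sum_(m < n) (cos_taylor R m * lam ^+ m) * upow rh m s.
have cp : continuous p.
  rewrite /p; elim: (n) => [|N IH].
    by under eq_fun do rewrite big_ord0; exact: cst_continuous.
  under eq_fun do rewrite big_ord_recr/=.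
  move=> s; apply: (@continuousD R R R (fun s => \sum_(m < N) cos_taylor R m * lam ^+ m * upow rh m s)); first exact: IH.
  apply: (@continuousM R R (cst _) (upow rh N)); first exact: cst_continuous.
  exact: (smooth1_continuous (smooth1_upow rh N)).
have cc := smooth1_continuous (smooth1_ucos rh lam).
have cd : continuous (fun s => ucos rh lam s - p s).
  by move=> s; apply: (@continuousB R R R (ucos rh lam) p); [exact: cc|exact: cp].
have pE s : p s = (\sum_(m < n) cos_taylor R m * (lam * s) ^+ m) * expR (- rh * s).
  rewrite /p mulr_suml; apply: eq_bigr => m _; rewrite /upow exprMn; ring.
rewrite -(sphavg_taylor (fun m => cos_taylor R m * lam ^+ m)) /sphavg -RintegralB//; last 2 first.
- exact: (integrableK Kmax Hdk (cu _ cc)).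
- exact: (integrableK Kmax Hdk (cu _ cp)).
apply: (le_trans (le_normr_Rintegral mK (integrableK Kmax Hdk (cu _ cd)))).
rewrite -[leRHS](intK_cst Kmax Hdk); apply: (le_RintegralK Kmax Hdk).
- move=> z; apply: (@continuous_comp _ _ _ (fun k => ucos rh lam (H (x^-1 * k)%g) - p (H (x^-1 * k)%g)) (fun s : R => `|s|)); last exact: norm_continuous.
  exact: (cu _ cd).
- exact: cst_continuous.
move=> k Kk; have := hT k Kk; rewrite -/(p _); set h := H _ => hk.
have -> : ucos rh lam h - p h = (cos (lam * h) - \sum_(m < n) cos_taylor R m * (lam * h) ^+ m) * expR (- rh * h).
  by rewrite pE /ucos mulrBl.
rewrite normrM [X in _ * X]ger0_norm ?expR_ge0//; apply: ler_pM => //.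
  apply: (le_trans (cos_taylor_le _ _)); rewrite ler_wpM2r ?expR_ge0// ler_expR ler_wpM2l ?expR_ge0//.
  by rewrite normrM ler_wpM2l.
rewrite ler_expR mulNr -mulrN ler_wpM2l//.
by move: hk; rewrite ler_norml => /andP[h1 _]; lra.
Qed.

(* The order [n] of the Taylor polynomial is proportional to [L]: the remainder,
   of size [e^(- n)], is then absorbed by the lower bound for the left-hand side
   in [key], which is only polynomially small. *)
Lemma spectral_bound : exists2 B, 0 < B & forall L, 1 <= L ->
  (\int[leb]_(lam in `[0%R, L]) ((\int[mu]_(x in setT) (chi x * Ac lam x ^+ 2)) * w lam)%:E <= (B * L)%:E)%E.
Proof.
have [Xm Xm0 HX] := chi_bound.
have [_ [Q cQ Q0] _] := chir.
have [T T0 HT] := taylor_remainder cQ.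
pose M := (m1 X + m2 X).+1.
pose q := C * (cos 1 * expR (- (2 * rh))) ^+ 2 * (8^-1) ^+ M.
have q0 : 0 < q by rewrite !mulr_gt0 ?exprn_gt0 ?mulr_gt0 ?cos1_gt0 ?expR_gt0 ?invr_gt0.
pose I := \int[mu]_(x in setT) chi x.
have I_ge0 : 0 <= I by apply: Rintegral_ge0.
pose A0 := I * expR (rh * T) ^+ 2.
have A00 : 0 <= A0 by rewrite mulr_ge0 ?exprn_ge0 ?expR_ge0.
(* Chosen so that [A0 <= q / 2 * e^B0]. With [n >= al L + B0] the Taylor error is at most half of
   the lower bound [q e^(- M L)]: [al] accounts for the growth [e^(2 e T L)] of the squared
   remainder and for the decay of that bound. *)
pose B0 := 2 * A0 / q.
have B00 : 0 <= B0 by apply: divr_ge0; [exact: mulr_ge0|exact: ltW].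
pose al := 2 * (expR 1 * T) + M%:R.
have al0 : 0 <= al by rewrite addr_ge0 ?mulr_ge0 ?expR_ge0.
(* Each basis vector contributes [2 Xm / c], and there are at most [n <= al L + B0 + 1] of them;
   [L >= 1] makes this a multiple of [L]. *)
exists (2 * (Xm / c) * (al + B0 + 1)) => [|L L1].
  by apply: mulr_gt0; [rewrite mulr_gt0 ?divr_gt0|lra].
have L0 : 0 <= L by lra.
pose N lam := \int[mu]_(x in setT) (chi x * Ac lam x ^+ 2).
have NE lam : N lam = b (phic lam) (phic lam).
  by apply: eq_Rintegral => x _; rewrite expr2.
pose n := (Num.truncn (al * L + B0)).+1.
have nge : al * L + B0 <= n%:R by apply: ltW; exact: truncnS_gt.
have nle : n%:R <= (al + B0 + 1) * L.
  have t0 : 0 <= al * L + B0 by apply: addr_ge0 => //; exact: mulr_ge0.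
  have := truncn_le (al * L + B0); rewrite t0 => tl; rewrite /n -natr1; nra.
have [Ng [e [Ngn eo ec er]]] := gram_schmidt chi_ipl chi_ip_sym chi_ip_ge0 psic n.
(* [bessel] takes a radial test function, and [e i] is a combination of the averages [psi m]. *)
have erad i : (i < Ng)%N -> radial X (fun x => chi x * e i x).
  move=> iN; have [d ->] := ec i iN.
  rewrite (_ : (fun x => _) = (fun x => \sum_(m < n) d m * (chi x * psi m x))); last first.
    apply/funext => x; rewrite cfun_sum mulr_sumr; apply: eq_bigr => m _.
    by rewrite (_ : (d m *: psic m) x = d m * psi m x)// mulrCA.
  elim: (n) => [|k IH].
    rewrite (_ : (fun x => _) = (fun x => 0 * chi x)); last first.
      by apply/funext => x; rewrite big_ord0 mul0r.
    exact: (radialZ 0 chir).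
  rewrite (_ : (fun x => _) = (fun x => \sum_(m < k) d m * (chi x * psi m x) + d k * (chi x * psi k x))); last first.
    by apply/funext => x; rewrite big_ord_recr.
  apply: (radialD IH); apply: radialZ; apply: radialM => //.
    exact: (sphavg_smooth Kmax Hdk Hmu Hcartan Hiw (smooth1_upow rh k)).
  exact: (sphavg_biinv Kmax Hdk Hiw (smooth1_upow rh k)).
(* In [best_approximation] the error of the Taylor polynomial is at most half of [N lam] and is
   absorbed on the left. *)
have key lam : 0 <= lam <= L -> N lam <= 2 * \sum_(i < Ng) b (phic lam) (e i) ^+ 2.
  move=> /andP[l0 lL].
  pose p := \sum_(m < n) (cos_taylor R m * lam ^+ m) *: psic m.
  (* Each [psi m] lies in the span of the [e i] up to a null vector, and combinations of null
     vectors are null. *)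
  have pnull : let r := p - \sum_(i < Ng) b p (e i) *: e i in b r r = 0.
    have -> : p - \sum_(i < Ng) b p (e i) *: e i = \sum_(m < n) (cos_taylor R m * lam ^+ m) *:
        (psic m - \sum_(i < Ng) b (psic m) (e i) *: e i).
      under [RHS]eq_bigr do rewrite scalerBr; rewrite sumrB; congr (_ - _).
      under [RHS]eq_bigr do rewrite scaler_sumr; rewrite exchange_big/=; apply: eq_bigr => i _.
      rewrite /p (ip_suml chi_ipl) scaler_suml; apply: eq_bigr => m _.
      by rewrite (ipZl chi_ipl) scalerA.
    move=> r; rewrite {1}/r (ip_suml chi_ipl) big1// => m _.
    by rewrite (ipZl chi_ipl) (ip_null chi_ipl chi_ip_sym chi_ip_ge0 _ (er m (ltn_ord m))) mulr0.
  have BA := best_approximation chi_ipl chi_ip_sym chi_ip_ge0 (phic lam) eo pnull.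
  rewrite -NE in BA.
  pose E := expR (expR 1 * (L * T)) * expR (- n%:R) * expR (rh * T).
  have remle : b (phic lam - p) (phic lam - p) <= I * E ^+ 2.
    rewrite mulrC /I -RintegralZl//; last exact: (radial_integrable Hmu chir).
    have i1 : mu.-integrable setT (EFin \o (fun x : borel G => E ^+ 2 * chi x)).
      have := integrableZl measurableT (E ^+ 2) (radial_integrable Hmu chir).
      by congr (integrable _ _ _); apply/funext => x /=; rewrite EFinM.
    rewrite -subr_ge0 -RintegralB//; last exact: chi_integrable (@contM _ _).
    apply: Rintegral_ge0 => x _; rewrite subr_ge0 mulrC -expr2.
    have [Qx|/Q0 ->] := pselect (Q x); last by rewrite !mulr0 ?mul0r.
    apply: ler_wpM2r => //.
    have -> : (phic lam - p) x = Ac lam x - \sum_(m < n) cos_taylor R m * lam ^+ m * psi m x.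
      by rewrite (_ : (phic lam - p) x = Ac lam x - p x)// /p cfun_sum.
    rewrite -real_normK ?num_real// lerXn2r ?nnegrE ?normr_ge0 ?mulr_ge0 ?expR_ge0//.
    apply: (le_trans (HT n lam x Qx)); rewrite !ler_wpM2r ?expR_ge0// ler_expR ler_wpM2l ?expR_ge0//.
    by rewrite (ger0_norm l0) ler_wpM2r.
  have low : q * expR (- (M%:R * L)) <= N lam.
    have l0L : 0 <= lam <= L by rewrite l0.
    have ML := mass_lower Kmax Hdk Hmu C0 Hpolar Hiw chir chi0 chi1 l0L.
    suff S : q * expR (- (M%:R * L)) <= C * (cos 1 * expR (- (2 * rh))) ^+ 2 * ((2 * (1 + L))^-1 / 4) ^+ M.
      exact: le_trans S ML.
    rewrite -/M /q -mulrA; apply: ler_wpM2l.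
      by rewrite mulr_ge0 ?sqr_ge0// ltW.
    exact: power_ge_exp.
  have small : I * E ^+ 2 <= q * expR (- (M%:R * L)) / 2.
    have -> : I * E ^+ 2 = A0 * expR (2 * (expR 1 * T) * L - 2 * n%:R).
      rewrite /A0 /E !exprMn -![expR _ ^+ 2]expRM_natl expRD.
      have -> : 2 * (expR 1 * T) * L = 2%:R * (expR 1 * (L * T)) by ring.
      have -> : - (2 * n%:R) = 2%:R * - n%:R :> R by ring.
      rewrite -!mulrA; congr (_ * _); ring.
    have AB : A0 <= q / 2 * expR B0.
      have -> : A0 = q / 2 * B0 by rewrite /B0; field; rewrite gt_eqF.
      by rewrite ler_wpM2l ?divr_ge0 ?(ltW q0)//; apply: le_trans (expR_ge1Dx _); rewrite lerDr.
    apply: (le_trans (ler_wpM2r (expR_ge0 _) AB)).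
    rewrite -(mulrA (q / 2)) -expRD [leRHS]mulrAC ler_wpM2l ?divr_ge0 ?(ltW q0)// ler_expR.
    have n0 : 0 <= n%:R :> R by [].
    have alE : al * L = 2 * (expR 1 * T) * L + M%:R * L by rewrite /al; ring.
    lra.
  lra.
have mb i : (i < Ng)%N -> measurable_fun setT (fun lam => b (phic lam) (e i)).
  move=> iN; have := measurable_Fc dk mu Kmax Hiw (continuous_borel (radial_continuous (erad i iN))).
  apply: eq_measurable_fun => lam _; apply: eq_Rintegral => x _; rewrite -mulrA (mulrC (e i x))//.
have mN : measurable_fun setT N.
  apply: (@measurable_Rintegral_param _ _ R (borel G) R mu setT (fun lam x => chi x * Ac lam x ^+ 2)) => //.
  apply: measurable_funM; first exact: (measurableT_comp (continuous_borel ccont) measurable_snd).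
  apply: measurable_funX.
  exact: (measurableT_comp (measurable_Ac dk Kmax Hiw) (measurable_fun_pair measurable_snd measurable_fst)).
have mJ : measurable (`[0%R, L]%classic : set (measurableTypeR R)) by exact: measurable_itv.
apply: (@le_trans _ _ (\int[leb]_(lam in `[0%R, L]) (\sum_(i < Ng) (2 * (b (phic lam) (e i) ^+ 2 * w lam))%:E))%E).
  apply: ge0_le_integral => //.
  - move=> lam _; rewrite lee_fin mulr_ge0//; apply: Rintegral_ge0 => x _.
    by rewrite mulr_ge0 ?sqr_ge0.
  - by apply: measurable_funTS; apply/measurable_EFinP; exact: measurable_funM.
  - apply: emeasurable_sum => i; apply: measurable_funTS; apply/measurable_EFinP.
    apply: measurable_funM; first exact: measurable_cst.
    by apply: measurable_funM => //; apply: measurable_funX; exact: mb.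
  - move=> lam; rewrite /= in_itv/= => lL.
    rewrite sumEFin lee_fin -mulr_sumr -mulr_suml mulrA ler_wpM2r//; exact: key.
rewrite ge0_integral_sum//; last 2 first.
- move=> i; apply: measurable_funTS; apply/measurable_EFinP.
  apply: measurable_funM; first exact: measurable_cst.
  by apply: measurable_funM => //; apply: measurable_funX; exact: mb.
- by move=> i lam _; rewrite lee_fin mulr_ge0// mulr_ge0 ?sqr_ge0.
(* The integral over [[0, L]] is enlarged to the half-line, where [bessel] applies with
   [b (e i) (e i) = 1]. *)
apply: (@le_trans _ _ (\sum_(i < Ng) (2 * (Xm / c))%:E)%E).
  apply: lee_sum => i _.
  have mbw : measurable_fun setT (fun lam => (b (phic lam) (e i) ^+ 2 * w lam)%:E).
    by apply/measurable_EFinP; apply: measurable_funM => //; apply: measurable_funX; exact: mb.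
  have := bessel HX (erad i (ltn_ord i)); rewrite eo// eqxx mulr1 => Bi.
  under eq_integral do rewrite EFinM.
  rewrite ge0_integralZl//; last 2 first.
  - exact: measurable_funTS.
  - by move=> lam _; rewrite lee_fin mulr_ge0 ?sqr_ge0.
  rewrite EFinM; apply: lee_wpmul2l; first by rewrite lee_fin.
  apply: le_trans Bi; apply: ge0_subset_integral => //.
  - exact: measurable_funTS.
  - by move=> lam _; rewrite lee_fin mulr_ge0 ?sqr_ge0.
  - by move=> lam /=; rewrite !in_itv/= andbT => /andP[].
rewrite sumEFin lee_fin sumr_const card_ord -[leLHS]mulr_natr -(mulrA (2 * (Xm / c))).
apply: ler_wpM2l; first by rewrite mulr_ge0// divr_ge0// ltW.
by apply: le_trans nle; rewrite ler_nat.
Qed.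

End SpectralBound.

(* No measurability is needed: maximal functions need not be measurable. *)
Lemma ge0_le_integral_nonmeas d (T : measurableType d) (R : realType) (m : {measure set T -> \bar R})
    (D : set T) (f h : T -> \bar R) : (forall x, D x -> (0 <= f x)%E) -> (forall x, D x -> (f x <= h x)%E) ->
  (\int[m]_(x in D) f x <= \int[m]_(x in D) h x)%E.
Proof.
move=> f0 fh; rewrite !ge0_integralE//; last by move=> x Dx; exact: le_trans (f0 x Dx) (fh x Dx).
apply: le_ereal_sup => _ [k /= kf <-]; exists k => //= x.
apply: (le_trans (kf x)); rewrite !patchE; case: ifPn => // xD; apply: fh; exact/set_mem.
Qed.

(** * Dyadic summation and the Cauchy-Schwarz inequality *)

Section DyadicSum.
Variables (R : realType) (u v : R -> R) (B V q : R).
Local Notation leb := (@lebesgue_measure R).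
Hypotheses (mu_ : measurable_fun setT u) (mv : measurable_fun setT v)
  (u0 : forall x, 0 <= u x) (v0 : forall x, 0 <= v x)
  (uB : forall L, 1 <= L -> (\int[leb]_(x in `[0%R, L]) (u x)%:E <= (B * L)%:E)%E)
  (V0 : 0 <= V) (vV : forall x, 0 <= x <= 1 -> v x <= V)
  (q0 : 0 <= q) (q1 : 2 * q < 1)
  (vq : forall j x, 2 ^+ j < x -> v x <= q ^+ j).

Let mvu (D : set (measurableTypeR R)) : measurable_fun D (fun x => (v x * u x)%:E).
Proof. by apply: measurable_funTS; apply/measurable_EFinP; exact: measurable_funM. Qed.

Let vu0 x : (0 <= (v x * u x)%:E)%E. Proof. by rewrite lee_fin mulr_ge0. Qed.

Let piece (D : set (measurableTypeR R)) (L a : R) : measurable D -> 1 <= L -> 0 <= a -> D `<=` `[0%R, L] ->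
  (forall x, D x -> v x <= a) -> (\int[leb]_(x in D) (v x * u x)%:E <= (a * (B * L))%:E)%E.
Proof.
move=> mD L1 a0 DL va.
apply: (@le_trans _ _ (\int[leb]_(x in D) (a%:E * (u x)%:E))%E).
  apply: ge0_le_integral => //.
  - by apply: measurable_funTS; apply/measurable_EFinP; apply: measurable_funM => //; exact: measurable_cst.
  - by move=> x Dx; rewrite -EFinM lee_fin ler_wpM2r//; exact: va.
rewrite ge0_integralZl//; last 2 first.
- by apply: measurable_funTS; exact/measurable_EFinP.
- by move=> x _; rewrite lee_fin.
rewrite EFinM; apply: lee_wpmul2l; first by rewrite lee_fin.
apply: le_trans (uB L1); apply: ge0_subset_integral => //.
- by apply: measurable_funTS; exact/measurable_EFinP.
- by move=> x _; rewrite lee_fin.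
Qed.

(** The piece []2^n, 2^(n+1)]] contributes at most [q^n B 2^(n+1)], a term of a geometric series of
    ratio [2 q < 1]; its partial sum is kept in closed form for the induction. *)
Let partial n : (\int[leb]_(x in `[0%R, (2 ^+ n)%R]) (v x * u x)%:E <=
  (V * B + 2 * B * ((1 - (2 * q) ^+ n) / (1 - 2 * q)))%:E)%E.
Proof.
have d0 : 0 < 1 - 2 * q by rewrite subr_gt0.
elim: n => [|n IH].
  apply: (le_trans (@piece `[0%R, (2 ^+ 0)%R]%classic 1 V _ _ _ _ _)) => //.
  by rewrite lee_fin mulr1 expr0 subrr mul0r mulr0 addr0.
have p1 m : 1 <= 2 ^+ m :> R by rewrite exprn_ege1// ler1n.
have itvE : `[0%R, (2 ^+ n.+1)%R]%classic = `[0%R, (2 ^+ n)%R] `|` `](2 ^+ n)%R, (2 ^+ n.+1)%R] :> set R.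
  have p2 : 2 ^+ n <= 2 ^+ n.+1 :> R by rewrite exprS ler_peMl ?exprn_ge0// ler1n.
  have := p1 n => p3; apply/seteqP; split=> x /=; rewrite !in_itv/=.
    by move=> /andP[x0 x1]; case: (lerP x (2 ^+ n)) => h; [left|right]; rewrite ?x0.
  by move=> [|] /andP[x0 x1]; apply/andP; split; lra.
rewrite itvE ge0_integral_setU//; last first.
  apply/disj_set2P; rewrite -subset0 => x /=; rewrite !in_itv/= => -[/andP[_ a] /andP[b _]].
  by move: (lt_le_trans b a); rewrite ltxx.
have h2 : (\int[leb]_(x in `](2 ^+ n)%R, (2 ^+ n.+1)%R]) (v x * u x)%:E <= (q ^+ n * (B * 2 ^+ n.+1))%:E)%E.
  apply: piece => //; first exact: exprn_ge0.
  - move=> x /=; rewrite !in_itv/= => /andP[x0 ->]; rewrite andbT.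
    by apply: le_trans (ltW x0); rewrite exprn_ge0.
  - by move=> x /=; rewrite in_itv/= => /andP[x0 _]; exact: vq.
apply: (le_trans (leeD IH h2)); rewrite -EFinD lee_fin -addrA lerD2l.
have -> : q ^+ n * (B * 2 ^+ n.+1) = 2 * B * (2 * q) ^+ n by rewrite exprS exprMn; ring.
rewrite -mulrDr (_ : _ / _ + _ = (1 - (2 * q) ^+ n.+1) / (1 - 2 * q))// exprS; field.
by rewrite gt_eqF.
Qed.

Lemma dyadic_sum : (\int[leb]_(x in `[0%R, +oo[) (v x * u x)%:E < +oo)%E.
Proof.
have d0 : 0 < 1 - 2 * q by rewrite subr_gt0.
have B0 : 0 <= B.
  have := le_trans _ (uB (lexx 1)); rewrite mulr1 -lee_fin; apply.
  by apply: integral_ge0 => x _; rewrite lee_fin.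
pose F n : set (measurableTypeR R) := `[0%R, (2 ^+ n)%R]%classic.
have pm m n : (m <= n)%N -> 2 ^+ m <= 2 ^+ n :> R by move=> mn; rewrite ler_weXn2l// ler1n.
have FE : `[0%R, +oo[%classic = \bigcup_n F n.
  apply/seteqP; split=> x /=; rewrite in_itv/= andbT.
    move=> x0; exists (Num.truncn x).+1 => //=; rewrite /F/= in_itv/= x0/=.
    apply: le_trans (ltW (truncnS_gt x)) _; rewrite -natrX ler_nat; exact/ltnW/ltn_expl.
  by move=> [n _]; rewrite /F/= in_itv/= => /andP[].
have cv := @ge0_nondecreasing_set_cvg_integral _ (measurableTypeR R) R F (fun x => (v x * u x)%:E) leb.
rewrite FE; apply: (@le_lt_trans _ _ (V * B + 2 * B / (1 - 2 * q))%:E); last exact: ltry.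
have ndF : nondecreasing_seq F.
  apply/nondecreasing_seqP => n; rewrite subsetEset => x; rewrite /F/= !in_itv/= => /andP[-> x1]/=.
  exact: le_trans x1 (pm _ _ (leqnSn n)).
have {}cv := cv ndF (fun n => measurable_itv _) (fun n => @mvu (F n)) (fun n x _ => vu0 x).
rewrite -(cvg_lim _ cv)//.
apply: lime_le; first by apply: cvgP cv.
apply: nearW => n; apply: (le_trans (partial n)); rewrite lee_fin lerD2l.
apply: ler_wpM2l; first exact: mulr_ge0.
apply: ler_piMl; first by rewrite invr_ge0 ltW.
by rewrite gerBl exprn_ge0// mulr_ge0.
Qed.

End DyadicSum.

(** The condition [s > 1/2] in the form [2 q < 1] for [q = 4^(- s)], the decay of the weight from
    one dyadic piece to the next. *)
Lemma powR4_gt2 (R : realType) (s : R) : 2^-1 < s -> 2 < 4 `^ s.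
Proof.
move=> s2; have l2 : 0 < ln 2 :> R by rewrite ln_gt0// ltr1n.
rewrite -[ltLHS](@lnK R) ?posrE// /powR gt_eqF//= ltr_expR.
have -> : (4 : R) = 2 * 2 by ring.
by rewrite lnM ?posrE//; nra.
Qed.

Lemma powR_exprn (R : realType) (a s : R) j : 0 <= a -> (a `^ s) ^+ j = (a ^+ j) `^ s.
Proof. by move=> a0; rewrite -(powR_mulrn j (powR_ge0 a s)) -(powR_mulrn j a0) powRAC. Qed.

Lemma powRN_dyadic (R : realType) (s r x : R) j : 0 < s -> 2 ^+ j < x ->
  (x ^+ 2 + r ^+ 2) `^ (- s) <= (4 `^ s)^-1 ^+ j.
Proof.
move=> s0 xj; have p0 : 0 < 2 ^+ j :> R by rewrite exprn_gt0.
have x0 : 0 < x := lt_trans p0 xj.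
rewrite exprVn powRN (powR_exprn s j (ler0n R 4)) lef_pV2 ?posrE ?powR_gt0 ?exprn_gt0//; last first.
  by rewrite ltr_wpDr ?sqr_ge0// exprn_gt0.
apply: ge0_ler_powR; rewrite ?nnegrE; [exact: ltW|exact: exprn_ge0|by rewrite addr_ge0 ?sqr_ge0|].
apply: (@le_trans _ _ (x ^+ 2)); last by rewrite lerDl sqr_ge0.
have -> : 4 ^+ j = (2 ^+ j) ^+ 2 :> R by rewrite exprAC; congr (_ ^+ j); ring.
by rewrite lerXn2r ?nnegrE ?ltW.
Qed.

Section WeightedCauchySchwarz.
Variables (R : realType).
Local Notation leb := (@lebesgue_measure R).
Variables (D : set (measurableTypeR R)) (a b v w : R -> R).
Hypotheses (mD : measurable D) (ma : measurable_fun setT a) (mb : measurable_fun setT b)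
  (mv : measurable_fun setT v) (mv' : measurable_fun setT (fun x => (v x)^-1))
  (mw : measurable_fun setT w) (a0 : forall x, 0 <= a x) (b0 : forall x, 0 <= b x)
  (w0 : forall x, 0 <= w x) (v0 : forall x, 0 < v x).

(** By the inequality of the means [2 I <= e E + Q / e] for every [e > 0], and [e = I / E] is
    optimal up to replacing [E I] by [I E]. This form tolerates an infinite [Q] and a lower bound
    [I] in place of the integral. *)
Lemma weighted_cauchy_schwarz (I E : R) : 0 <= I -> 0 < E ->
  (I%:E <= \int[leb]_(x in D) (a x * b x * w x)%:E)%E ->
  (\int[leb]_(x in D) (v x * a x ^+ 2 * w x)%:E <= E%:E)%E ->
  ((I ^+ 2)%:E <= E%:E * \int[leb]_(x in D) ((v x)^-1 * b x ^+ 2 * w x)%:E)%E.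
Proof.
move=> I0 E0 hI hE.
pose Q := (\int[leb]_(x in D) ((v x)^-1 * b x ^+ 2 * w x)%:E)%E; rewrite -/Q.
have mA : measurable_fun D (fun x => (v x * a x ^+ 2 * w x)%:E).
  apply: measurable_funTS; apply/measurable_EFinP; apply: measurable_funM => //.
  by apply: measurable_funM => //; exact: measurable_funX.
have mB : measurable_fun D (fun x => ((v x)^-1 * b x ^+ 2 * w x)%:E).
  apply: measurable_funTS; apply/measurable_EFinP; apply: measurable_funM => //.
  by apply: measurable_funM => //; exact: measurable_funX.
have A0 x : (0 <= (v x * a x ^+ 2 * w x)%:E)%E by rewrite lee_fin !mulr_ge0 ?sqr_ge0// ltW.
have B0 x : (0 <= ((v x)^-1 * b x ^+ 2 * w x)%:E)%E by rewrite lee_fin !mulr_ge0 ?sqr_ge0// invr_ge0 ltW.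
have Q0 : (0 <= Q)%E by apply: integral_ge0.
have amgm e : 0 < e -> ((2 * I)%:E <= (e * E)%:E + e^-1%:E * Q)%E.
  move=> e0; rewrite EFinM; apply: (@le_trans _ _ (2%:E * \int[leb]_(x in D) (a x * b x * w x)%:E)%E).
    by apply: lee_wpmul2l.
  apply: (@le_trans _ _ (\int[leb]_(x in D) (e%:E * (v x * a x ^+ 2 * w x)%:E + e^-1%:E * ((v x)^-1 * b x ^+ 2 * w x)%:E))%E).
    rewrite -ge0_integralZl//; last 2 first.
    - by apply: measurable_funTS; apply/measurable_EFinP; apply: measurable_funM => //; exact: measurable_funM.
    - by move=> x _; rewrite lee_fin !mulr_ge0.
    apply: ge0_le_integral_nonmeas => x _; first by rewrite -EFinM lee_fin !mulr_ge0.
    rewrite -!EFinM -EFinD lee_fin.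
    have -> : e * (v x * a x ^+ 2 * w x) + e^-1 * ((v x)^-1 * b x ^+ 2 * w x) =
      ((e * v x) * a x ^+ 2 + (e * v x)^-1 * b x ^+ 2) * w x by rewrite invfM; ring.
    rewrite mulrA ler_wpM2r//.
    have k0 : 0 < e * v x by rewrite mulr_gt0.
    move: (e * v x) k0 (a x) (b x) => k k0 y z.
    rewrite -subr_ge0 (_ : _ - _ = k * (y - k^-1 * z) ^+ 2); last by field; rewrite gt_eqF.
    by rewrite mulr_ge0 ?sqr_ge0// ltW.
  have ei : 0 <= e^-1 by rewrite invr_ge0 ltW.
  rewrite ge0_integralD//; last 4 first.
  - by move=> x _; rewrite mule_ge0// lee_fin ltW.
  - by apply: emeasurable_funM => //; exact: measurable_cst.
  - by move=> x _; rewrite mule_ge0// lee_fin.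
  - by apply: emeasurable_funM => //; exact: measurable_cst.
  rewrite !ge0_integralZl//; last first.
    by rewrite lee_fin ltW.
  rewrite EFinM; apply: leeD => //; apply: lee_wpmul2l => //; by rewrite lee_fin ltW.
move: Q Q0 amgm => [Q| |] //; last by move=> _ _; rewrite gt0_muley ?leey// lte_fin.
rewrite lee_fin => Q0 amgm; rewrite -EFinM lee_fin.
have [->|In] := eqVneq I 0; first by rewrite expr0n mulr_ge0// ltW.
have Ip : 0 < I by rewrite lt0r In.
have := amgm (I / E) (divr_gt0 Ip E0); rewrite -EFinM -EFinD lee_fin divfK ?gt_eqF// invf_div => h.
have : I <= E / I * Q by lra.
by rewrite mulrAC ler_pdivlMr// expr2.
Qed.

End WeightedCauchySchwarz.

(** * The maximal estimate *)

Section PointwiseBound.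
Variables (R : realType) (G : lieGroupType R) (g : lieAlgebra G) (X : rankOneSpace g).
Variables (dk : probability (borel G) R) (mu : {sigma_finite_measure set (borel G) -> \bar R}).
Hypotheses (Kmax : maximal_compact X) (Hdk : haarK X dk) (Hmu : haar mu).
Variables (C : R) (C0 : 0 < C) (Hpolar : polar_coordinates X mu dk C).
Variables (kap : G -> G) (H : G -> R) (nu : G -> G).
Hypothesis Hiw : iwasawa X kap H nu.
Variables (cf : R[i] -> R[i]) (c : R).
Hypotheses (Hinv : inversion_formula X mu dk H cf c) (c0 : 0 < c)
  (mw : measurable_fun setT (plancherel cf)).
Variables (s : R) (s_gt : 2^-1 < s).
Local Notation rh := (rho X).
Local Notation avg u := (sphavg X dk H u).
Local Notation Ac lam := (avg (ucos rh lam)).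
Local Notation w := (plancherel cf).
Local Notation leb := (@lebesgue_measure R).
Local Notation I0 := `[0%R, +oo[%classic.
Let Hcartan := Hpolar.1.
Let mI : measurable (I0 : set (measurableTypeR R)). Proof. exact: measurable_itv. Qed.
Let w0 lam : 0 <= w lam. Proof. by rewrite /plancherel invr_ge0 sqr_ge0. Qed.
Let r0 : 0 < rh. Proof. exact: rho_gt0. Qed.
Let s0 : 0 < s. Proof. by apply: lt_trans s_gt; rewrite invr_gt0. Qed.

Definition sobolev_weight (lam : R) : R := (lam ^+ 2 + rh ^+ 2) `^ s.
Local Notation v := sobolev_weight.

Lemma measurable_bessel (p : R) : measurable_fun setT (fun lam : R => (lam ^+ 2 + rh ^+ 2) `^ p).
Proof.
apply: (@measurableT_comp _ _ _ _ _ _ (fun z : R => z `^ p) _ (fun lam : R => lam ^+ 2 + rh ^+ 2)).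
  exact: measurable_powR.
by apply: measurable_funD; [exact: measurable_funX|exact: measurable_cst].
Qed.

Let mv : measurable_fun setT v. Proof. exact: measurable_bessel. Qed.

Let mv' : measurable_fun setT (fun lam => (v lam)^-1).
Proof.
by have := measurable_bessel (- s); apply: eq_measurable_fun => lam _; rewrite powRN.
Qed.

Let v0 lam : 0 < v lam.
Proof. by rewrite powR_gt0// ltr_wpDl ?sqr_ge0// exprn_gt0. Qed.

Let vi0 lam : 0 <= (v lam)^-1. Proof. by rewrite invr_ge0 ltW. Qed.

(** The function [Q] of the overview; the absolute value gives it the shape of the last factor in
    [weighted_cauchy_schwarz]. It may be infinite at some points. *)
Definition square_function (x : G) : \bar R :=
  (\int[leb]_(lam in I0) ((v lam)^-1 * `|Ac lam x| ^+ 2 * w lam)%:E)%E.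
Local Notation Q := square_function.

Let mAc : measurable_fun setT (fun z : borel G * R => Ac z.2 z.1).
Proof. exact: (measurable_Ac dk Kmax Hiw). Qed.

Let mAc2 x : measurable_fun setT (fun lam => Ac lam x).
Proof. exact: (measurable_fun_pair2 (x : borel G) mAc). Qed.

Lemma square_function_ge0 x : (0 <= Q x)%E.
Proof. by apply: integral_ge0 => lam _; rewrite lee_fin mulr_ge0// mulr_ge0 ?sqr_ge0. Qed.

Section Cutoff.
Variable chi : G -> R.
Hypotheses (chir : radial X chi) (chi0 : forall x, 0 <= chi x)
  (chi1 : forall x, Kball X 1 x -> 1 <= chi x).

Let F (z : borel G * (measurableTypeR R)) : \bar R :=
  (chi z.1 * ((v z.2)^-1 * `|Ac z.2 z.1| ^+ 2 * w z.2) * \1_I0 z.2)%:E.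

Let mF : measurable_fun setT F.
Proof.
have m2 (h : R -> R) : measurable_fun setT h -> measurable_fun setT (fun z : borel G * (measurableTypeR R) => h z.2).
  by move=> mh; exact: (measurableT_comp mh measurable_snd).
apply/measurable_EFinP; apply: measurable_funM; last first.
  have mi : measurable_fun setT (\1_I0 : R -> R) by exact: measurable_indic.
  exact: m2.
apply: measurable_funM.
  exact: (measurableT_comp (continuous_borel (radial_continuous chir)) measurable_fst).
apply: measurable_funM; last exact: m2.
apply: measurable_funM; first exact: (m2 (fun lam => (v lam)^-1)).
by apply: measurable_funX; apply: (measurableT_comp (@normr_measurable R setT)); exact: mAc.
Qed.

Let F0 z : (0 <= F z)%E.
Proof. by rewrite lee_fin mulr_ge0// mulr_ge0// mulr_ge0// mulr_ge0 ?sqr_ge0. Qed.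

Let FQ x : (\int[leb]_lam F (x, lam) = (chi x)%:E * Q x)%E.
Proof.
rewrite -ge0_integralZl//; last 3 first.
- apply: measurable_funTS; apply/measurable_EFinP; apply: measurable_funM => //.
  apply: measurable_funM => //; apply: measurable_funX.
  exact: (measurableT_comp (@normr_measurable R setT) (mAc2 x)).
- by move=> lam _; rewrite lee_fin mulr_ge0// mulr_ge0 ?sqr_ge0.
- by rewrite lee_fin.
rewrite [RHS]integral_mkcond; apply: eq_integral => lam _.
by rewrite patchE /F/= indicE; case: ifP => _; rewrite ?mulr1 ?mulr0// EFinM.
Qed.

Lemma measurable_square_function : measurable_fun setT (fun x : borel G => ((chi x)%:E * Q x)%E).
Proof.
have := measurable_fun_fubini_tonelli_F (m2 := leb) F mF F0.
by apply: eq_measurable_fun => x _; exact: FQ.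
Qed.

Lemma square_function_integrable : (\int[mu]_x ((chi x)%:E * Q x) < +oo)%E.
Proof.
have [B B0 HB] := spectral_bound Kmax Hdk Hmu C0 Hpolar Hiw Hinv c0 mw chir chi0 chi1.
pose N lam := \int[mu]_(x in setT) (chi x * Ac lam x ^+ 2).
have N0 lam : 0 <= N lam by apply: Rintegral_ge0 => x _; rewrite mulr_ge0 ?sqr_ge0.
have mN : measurable_fun setT N.
  apply: (@measurable_Rintegral_param _ _ R (borel G) R mu setT (fun lam x => chi x * Ac lam x ^+ 2)) => //.
  apply: measurable_funM; first exact: (measurableT_comp (continuous_borel (radial_continuous chir)) measurable_snd).
  apply: measurable_funX.
  exact: (measurableT_comp mAc (measurable_fun_pair measurable_snd measurable_fst)).
rewrite (_ : (\int[mu]_x _ = \int[leb]_(lam in I0) ((v lam)^-1 * (N lam * w lam))%:E)%E).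
  have q1 := powR4_gt2 s_gt.
  (* The inverse weight is at most [rho^(- 2 s)] everywhere, which is finite because [rho > 0], and
     at most [4^(- s j)] beyond [2^j]. *)
  apply: (@dyadic_sum R (fun lam => N lam * w lam) (fun lam => (v lam)^-1) B ((rh ^+ 2) `^ (- s)) (4 `^ s)^-1).
  - exact: measurable_funM.
  - exact: mv'.
  - by move=> lam; rewrite mulr_ge0.
  - exact: vi0.
  - exact: HB.
  - exact: powR_ge0.
  - move=> lam _; rewrite powRN lef_pV2 ?posrE ?v0 ?powR_gt0 ?exprn_gt0//.
    apply: ge0_ler_powR; rewrite ?nnegrE ?sqr_ge0 ?addr_ge0 ?sqr_ge0 ?(ltW s0)//.
    by rewrite lerDr sqr_ge0.
  - by rewrite invr_ge0 powR_ge0.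
  - by rewrite ltr_pdivrMr ?mul1r// powR_gt0.
  - by move=> j lam jl; have := @powRN_dyadic R s rh lam j s0 jl; rewrite powRN.
transitivity (\int[mu]_x \int[leb]_lam F (x, lam))%E; first by apply: eq_integral => x _; rewrite FQ.
rewrite (fubini_tonelli _ mF F0) [RHS]integral_mkcond; apply: eq_integral => lam _.
have iN : mu.-integrable setT (EFin \o (fun x : borel G => chi x * Ac lam x ^+ 2)).
  have AS := sphavg_smooth Kmax Hdk Hmu Hcartan Hiw (smooth1_ucos rh lam).
  have Ab := sphavg_biinv Kmax Hdk Hiw (smooth1_ucos rh lam).
  have := radial_integrable Hmu (radialM (radialM chir AS Ab) AS Ab).
  by congr (integrable _ _ _); apply/funext => x /=; rewrite expr2 mulrA.
pose k := (v lam)^-1 * w lam * \1_I0 lam.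
have k0 : 0 <= k by rewrite mulr_ge0// mulr_ge0.
transitivity (k%:E * \int[mu]_x (chi x * Ac lam x ^+ 2)%:E)%E.
  rewrite -ge0_integralZl//; last 2 first.
  - by have /integrableP[mm _] := iN; exact: mm.
  - by move=> x _; rewrite lee_fin mulr_ge0 ?sqr_ge0.
  apply: eq_integral => x _; rewrite /F/= -EFinM; congr EFin.
  by rewrite real_normK ?num_real// /k; ring.
rewrite -[X in (_ * X)%E]fineK; last exact: integrable_fin_num.
rewrite -EFinM patchE /k indicE; case: ifP => _; last by rewrite mulr0 mul0r.
congr EFin; transitivity ((v lam)^-1 * w lam * N lam); last by ring.
by rewrite [(v lam)^-1 * w lam * _]mulr1.
Qed.

End Cutoff.

Lemma radial_Re f : Cc_radial X f -> radial X (fun x => complex.Re (f x)).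
Proof.
move=> [fR _ fc fb]; split=> //; last by move=> k1 k2 x K1 K2; rewrite fb.
exists (closure [set x | f x != 0]) => // x xQ; apply/eqP/negPn/negP => fx; apply: xQ.
by apply: subset_closure => /=; apply: contraNneq fx => ->.
Qed.

Lemma radial_Im f : Cc_radial X f -> radial X (fun x => complex.Im (f x)).
Proof.
move=> [_ fI fc fb]; split=> //; last by move=> k1 k2 x K1 K2; rewrite fb.
exists (closure [set x | f x != 0]) => // x xQ; apply/eqP/negPn/negP => fx; apply: xQ.
by apply: subset_closure => /=; apply: contraNneq fx => ->.
Qed.

Section Transform.
Variable f : G -> R[i].
Hypothesis fr : Cc_radial X f.
Let p lam := \int[mu]_(x in setT) (complex.Re (f x) * Ac lam x).
Let q lam := \int[mu]_(x in setT) (complex.Im (f x) * Ac lam x).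

Let fhat_parts lam : fhat X mu dk H f lam = (p lam +i* q lam)%C.
Proof.
by rewrite /fhat /cint; congr (_ +i* _)%C; apply: eq_Rintegral => x _;
  rewrite (phi_real Kmax Hdk Hmu C0 Hpolar Hiw Hinv); case: (f x) => y z /=; ring.
Qed.

Let mp : measurable_fun setT p.
Proof. exact: (measurable_Fc dk mu Kmax Hiw (continuous_borel (radial_continuous (radial_Re fr)))). Qed.

Let mq : measurable_fun setT q.
Proof. exact: (measurable_Fc dk mu Kmax Hiw (continuous_borel (radial_continuous (radial_Im fr)))). Qed.

Let a lam := cabs (fhat X mu dk H f lam).

Let aE lam : a lam = Num.sqrt (p lam ^+ 2 + q lam ^+ 2).
Proof. by rewrite /a fhat_parts. Qed.

Let ma : measurable_fun setT a.
Proof.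
have : measurable_fun setT (fun lam => Num.sqrt (p lam ^+ 2 + q lam ^+ 2)).
  apply: (@measurableT_comp _ _ _ _ _ _ (@Num.sqrt R)).
    by apply: continuous_measurable_fun; exact: sqrt_continuous.
  by apply: measurable_funD; exact: measurable_funX.
by apply: eq_measurable_fun => lam _; rewrite aE.
Qed.

(** The oscillating factor acts as a rotation, which bounds both components by the modulus; here [t]
    and the exponent [a] disappear from the estimates. *)
Let rot (th y z : R) : `|y * cos th - z * sin th| <= Num.sqrt (y ^+ 2 + z ^+ 2) /\
  `|y * sin th + z * cos th| <= Num.sqrt (y ^+ 2 + z ^+ 2).
Proof.
have cs := cos2Dsin2 th.
have S (b d : R) : b ^+ 2 + d ^+ 2 = y ^+ 2 + z ^+ 2 -> `|b| <= Num.sqrt (y ^+ 2 + z ^+ 2).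
  move=> <-; rewrite -sqrtr_sqr ler_wsqrtr// lerDl sqr_ge0//.
split.
  apply: (S _ (y * sin th + z * cos th)).
  have -> : (y * cos th - z * sin th) ^+ 2 + (y * sin th + z * cos th) ^+ 2 =
    (y ^+ 2 + z ^+ 2) * (cos th ^+ 2 + sin th ^+ 2) by ring.
  by rewrite cs mulr1.
apply: (S _ (y * cos th - z * sin th)).
have -> : (y * sin th + z * cos th) ^+ 2 + (y * cos th - z * sin th) ^+ 2 =
  (y ^+ 2 + z ^+ 2) * (cos th ^+ 2 + sin th ^+ 2) by ring.
by rewrite cs mulr1.
Qed.

(** As [phi_lam] is real, the real and imaginary parts of the integrand are separately bounded by
    [|fhat f| |phi_lam| |c|^-2], and each is treated by [weighted_cauchy_schwarz]. [E] is any
    positive bound for the square of the Sobolev norm, so that a vanishing norm is covered. *)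
Lemma pointwise_bound (al t E : R) (x : G) : 0 < E ->
  (\int[leb]_(lam in I0) (v lam * cabs (fhat X mu dk H f lam) ^+ 2 * w lam)%:E <= E%:E)%E ->
  ((cabs (S_ X mu dk H cf c al t f x) ^+ 2)%:E <= (4 * c ^+ 2 * E)%:E * Q x)%E.
Proof.
move=> E0 hE; pose th lam := t * (lam ^+ 2 + rh ^+ 2) `^ (al / 2).
pose zR lam := (p lam * cos (th lam) - q lam * sin (th lam)) * Ac lam x * w lam.
pose zI lam := (p lam * sin (th lam) + q lam * cos (th lam)) * Ac lam x * w lam.
have SE : S_ X mu dk H cf c al t f x = c%:C%C *
    (\int[leb]_(lam in I0) zR lam +i* \int[leb]_(lam in I0) zI lam)%C.
  have ZE lam : fhat X mu dk H f lam * cexp ('i%C * (t * (lam ^+ 2 + rh ^+ 2) `^ (al / 2))%:C%C) *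
      phi X dk H lam%:C%C x * (w lam)%:C%C = (zR lam +i* zI lam)%C.
    rewrite fhat_parts (phi_real Kmax Hdk Hmu C0 Hpolar Hiw Hinv) -/(th lam).
    have -> : cexp ('i%C * (th lam)%:C%C) = (cos (th lam) +i* sin (th lam))%C.
      have e1 : complex.Re ('i%C * (th lam)%:C%C) = 0 by rewrite /=; ring.
      have e2 : complex.Im ('i%C * (th lam)%:C%C) = th lam by rewrite /=; ring.
      by rewrite /cexp e1 e2 expR0 !mul1r.
    rewrite /zR /zI; move: (cos (th lam)) (sin (th lam)) (p lam) (q lam) (Ac lam x) (w lam) => b1 b2 b3 b4 b5 b6.
    by apply/eqP; rewrite eq_complex /=; apply/andP; split; apply/eqP; ring.
  rewrite /S_ /cint; congr (_ * (_ +i* _))%C.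
    by apply: eq_Rintegral => lam _; rewrite ZE.
  by apply: eq_Rintegral => lam _; rewrite ZE.
have mth : measurable_fun setT th by apply: measurable_funM; [exact: measurable_cst|exact: measurable_bessel].
have mcos : measurable_fun setT (fun lam => cos (th lam)).
  exact: (measurableT_comp (continuous_measurable_fun (@continuous_cos R)) mth).
have msin : measurable_fun setT (fun lam => sin (th lam)).
  exact: (measurableT_comp (continuous_measurable_fun (@continuous_sin R)) mth).
have part (z : R -> R) : measurable_fun setT z -> (forall lam, `|z lam| <= a lam * `|Ac lam x| * w lam) ->
    ((`|\int[leb]_(lam in I0) z lam| ^+ 2)%:E <= E%:E * Q x)%E.
  move=> mz zb; apply: (weighted_cauchy_schwarz mI (a := a) (b := fun lam => `|Ac lam x|) ma _ mv mv' mw) => //.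
  - exact: (measurableT_comp (@normr_measurable R setT) (mAc2 x)).
  - by move=> lam; rewrite aE sqrtr_ge0.
  (* If the extended integral is infinite, [Rintegral] is 0 and the inequality is trivial. *)
  apply: (@le_trans _ _ `|\int[leb]_(lam in I0) (z lam)%:E|%E).
    by rewrite /Rintegral; case: (\int[leb]_(lam in I0) (z lam)%:E)%E => [y| |] //=; rewrite normr0 leey.
  apply: (le_trans (le_abse_integral _ mI _)).
    by apply: measurable_funTS; exact/measurable_EFinP.
  by apply: ge0_le_integral_nonmeas => lam _ //=; rewrite lee_fin.
have bR := part zR; have bI := part zI.
have {}bR : ((`|\int[leb]_(lam in I0) zR lam| ^+ 2)%:E <= E%:E * Q x)%E.
  apply: bR => [|lam].
    apply: measurable_funM => //; apply: measurable_funM => //.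
    by apply: measurable_funB; exact: measurable_funM.
  rewrite /zR !normrM [X in _ * X]ger0_norm// ler_wpM2r// ler_wpM2r// aE.
  by have [] := rot (th lam) (p lam) (q lam).
have {}bI : ((`|\int[leb]_(lam in I0) zI lam| ^+ 2)%:E <= E%:E * Q x)%E.
  apply: bI => [|lam].
    apply: measurable_funM => //; apply: measurable_funM => //.
    by apply: measurable_funD; exact: measurable_funM.
  rewrite /zI !normrM [X in _ * X]ger0_norm// ler_wpM2r// ler_wpM2r// aE.
  by have [] := rot (th lam) (p lam) (q lam).
rewrite SE; move: (\int[leb]_(lam in I0) zR lam) (\int[leb]_(lam in I0) zI lam) bR bI => y z.
rewrite !real_normK ?num_real// => bR bI.
have -> : cabs (c%:C%C * (y +i* z)%C) ^+ 2 = c ^+ 2 * (y ^+ 2 + z ^+ 2).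
  rewrite /cabs ComplexField.Normc.normcM exprMn normc_real real_normK ?num_real//.
  by rewrite /= sqr_sqrtr// addr_ge0 ?sqr_ge0.
(* The two parts add up to [2 E Q]; the constant 4 leaves room. *)
have -> : 4 * c ^+ 2 * E = c ^+ 2 * (2 * (2 * E)) by ring.
rewrite (EFinM (c ^+ 2) (y ^+ 2 + z ^+ 2)) (EFinM (c ^+ 2) (2 * (2 * E))) -muleA.
apply: lee_wpmul2l; first by rewrite lee_fin sqr_ge0.
apply: (@le_trans _ _ (E%:E * Q x + E%:E * Q x)%E); first by rewrite EFinD; exact: leeD.
have Qx0 := square_function_ge0 x.
have EQ : (0 <= E%:E * Q x)%E by rewrite mule_ge0// lee_fin ltW.
rewrite (EFinM 2 (2 * E)) (EFinM 2 E) -!muleA.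
move: (E%:E * Q x)%E EQ => [m| |] //=; last by rewrite !gt0_muley ?leey ?lte_fin.
by rewrite -!EFinM -EFinD !lee_fin => m0; lra.
Qed.

End Transform.

End PointwiseBound.

Section MaximalEstimate.
Variables (R : realType) (G : lieGroupType R) (g : lieAlgebra G) (X : rankOneSpace g).
Variables (dk : probability (borel G) R) (mu : {sigma_finite_measure set (borel G) -> \bar R}).
Hypotheses (Kmax : maximal_compact X) (Hdk : haarK X dk) (Hmu : haar mu).
Variables (C : R) (C0 : 0 < C) (Hpolar : polar_coordinates X mu dk C).
Variables (kap : G -> G) (H : G -> R) (nu : G -> G).
Hypothesis Hiw : iwasawa X kap H nu.
Variables (cf : R[i] -> R[i]) (c : R).
Hypotheses (Hinv : inversion_formula X mu dk H cf c) (c0 : 0 < c) (mcf : meromorphic cf).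
Variables (a s : R) (s_gt : 2^-1 < s) (x0 : G) (r : R).
Local Notation leb := (@lebesgue_measure R).
Local Notation Q := (square_function X dk H cf s).
Let mw := measurable_plancherel mcf.

(** [tau] is bounded on the ball and differs from the polar radius by a bounded amount. [T >= 1]
    lets one cutoff serve both for the ball and for the set [Kball X 1] required by
    [spectral_bound]. *)
Lemma ball_in_Kball : exists T, 1 <= T /\ ball_GK X x0 r `<=` Kball X T.
Proof.
have [tau [[tc tK ty [M tM]] [_ tB]]] := radial_coordinate Hiw.
have [r' Hr'] := ball_radial x0 r tK ty tB.
exists (Num.max 1 (r' + M)); split=> [|x xB]; first by rewrite le_max lexx.
have [k1 [t [k2 [K1 t0 K2 xE]]]] := Hpolar.1 x; exists k1, t, k2; split=> //.
rewrite t0/= le_max; apply/orP; right.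
have := Hr' x xB; rewrite xE tK// => h1; have := tM t t0; rewrite ler_norml => /andP[h2 _]; lra.
Qed.

Lemma maximal_square_bound : exists2 k, 0 < k & forall f, Cc_radial X f -> forall E : R, 0 < E ->
  (\int[leb]_(lam in `[0%R, +oo[) ((lam ^+ 2 + rho X ^+ 2) `^ s * cabs (fhat X mu dk H f lam) ^+ 2
     * plancherel cf lam)%:E <= E%:E)%E ->
  (\int[mu]_x (`|((Sstar X mu dk H cf c a f : borel G -> \bar R) \_ (ball_GK X x0 r)) x| `^ 2) <= (k * E)%:E)%E.
Proof.
have [T [T1 BT]] := ball_in_Kball.
have [chi [chir chi0 chi1]] := radial_cutoff Kmax Hdk T.
have chi11 x : Kball X 1 x -> 1 <= chi x.
  move=> [k1 [t [k2 [K1 /andP[t0 t1] K2 xE]]]]; apply: chi1; exists k1, t, k2; split=> //.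
  by rewrite t0 (le_trans t1 T1).
have Qfin := square_function_integrable Kmax Hdk Hmu C0 Hpolar Hiw Hinv c0 mw s_gt chir chi0 chi11.
have mQ := measurable_square_function dk Kmax Hiw mw s chir chi0.
have Q0 := square_function_ge0 X dk H cf s.
have cQ0 x : (0 <= (chi x)%:E * Q x)%E by rewrite mule_ge0// lee_fin.
pose I := fine (\int[mu]_x ((chi x)%:E * Q x))%E.
have IE : (\int[mu]_x ((chi x)%:E * Q x) = I%:E)%E.
  by rewrite fineK// ge0_fin_numE// integral_ge0.
have I0 : 0 <= I by rewrite fine_ge0// integral_ge0.
(* [I + 1] instead of [I] makes the constant positive. *)
exists (4 * c ^+ 2 * (I + 1)) => [|f fr E E0 hE].
  by rewrite !mulr_gt0 ?exprn_gt0//; lra.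
have k0 : 0 <= 4 * c ^+ 2 * E by rewrite !mulr_ge0 ?sqr_ge0// ltW.
apply: (@le_trans _ _ (\int[mu]_x ((4 * c ^+ 2 * E)%:E * ((chi x)%:E * Q x)))%E); last first.
  rewrite ge0_integralZl//.
  rewrite IE -EFinM lee_fin; have -> : 4 * c ^+ 2 * (I + 1) * E = 4 * c ^+ 2 * E * I + 4 * c ^+ 2 * E by ring.
  by rewrite lerDl.
apply: ge0_le_integral_nonmeas => x _; first exact: poweR_ge0.
rewrite patchE; case: ifPn => [|_]; last first.
  by rewrite abse0 poweR0r// mule_ge0// lee_fin.
rewrite inE => /BT/chi1 cx1.
apply: (@le_trans _ _ ((4 * c ^+ 2 * E)%:E * Q x)%E); last first.
  apply: lee_wpmul2l; first by rewrite lee_fin.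
  by rewrite -[leLHS]mul1e; apply: lee_wpmul2r => //; rewrite lee_fin.
have pb t := pointwise_bound Kmax Hdk Hmu C0 Hpolar Hiw Hinv mw fr a t x E0 hE.
have M0 : (0 <= (4 * c ^+ 2 * E)%:E * Q x)%E by rewrite mule_ge0// lee_fin.
(* Where [Q x] is infinite there is nothing to prove; elsewhere the bound [m] does not depend on
   [t], so it passes to the supremum. *)
move: ((4 * c ^+ 2 * E)%:E * Q x)%E M0 pb => [m| |] //; last by move=> _ _; rewrite leey.
rewrite lee_fin => m0 pb.
have Sle : (Sstar X mu dk H cf c a f x <= (Num.sqrt m)%:E)%E.
  apply: ub_ereal_sup => _ [t _ <-]; rewrite lee_fin.
  have := pb t; rewrite lee_fin => h.
  by rewrite -[leLHS]ger0_norm ?sqrtr_ge0// -sqrtr_sqr ler_wsqrtr.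
(* The supremum runs over a nonempty set of nonnegative numbers, as [t = 1/2] shows. *)
have S0 : (0 <= Sstar X mu dk H cf c a f x)%E.
  apply: ereal_sup_ge; exists (cabs (S_ X mu dk H cf c a (2^-1) f x))%:E; last first.
    by rewrite lee_fin; case: (S_ _ _ _ _ _ _ _ _ _) => y z; rewrite sqrtr_ge0.
  by exists 2^-1 => //=; rewrite in_itv/= invr_gt0 ltr0n invf_lt1// ltr1n.
rewrite gee0_abs//; apply: (@le_trans _ _ ((Num.sqrt m)%:E `^ 2)%E).
  by apply: gt0_ler_poweR => //; rewrite ?in_itv/= ?leey ?andbT// lee_fin sqrtr_ge0.
by rewrite poweR_EFin lee_fin powR_mulrn ?sqrtr_ge0// sqr_sqrtr.
Qed.

Lemma maximal_L2_bound : exists2 C' : R, 0 < C' & forall f, Cc_radial X f ->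
  (L2_norm_on mu (ball_GK X x0 r) (Sstar X mu dk H cf c a f) <= C'%:E * Hs_norm X mu dk H cf s f)%E.
Proof.
have [k k0 Hk] := maximal_square_bound.
exists (k `^ 2^-1) => [|f fr]; first exact: powR_gt0.
rewrite /L2_norm_on Lnorm.unlock /Hs_norm.
set A := (\int[mu]_x _)%E; set E := (\int[leb]_(lam in _) _)%E.
have E0 : (0 <= E)%E.
  apply: integral_ge0 => lam _; rewrite lee_fin mulr_ge0//.
    by rewrite mulr_ge0 ?powR_ge0 ?sqr_ge0.
  by rewrite /plancherel invr_ge0 sqr_ge0.
have A0 : (0 <= A)%E by apply: integral_ge0 => x _; exact: poweR_ge0.
have {}Hk := Hk f fr; rewrite -/A -/E in Hk.
move: E E0 Hk => [e| |] // e0 Hk; last first.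
  by rewrite poweRyr// gt0_muley ?leey// lte_fin powR_gt0.
rewrite lee_fin in e0.
(* [e] may be 0 whereas [Hk] asks for a positive bound: it is applied to [e + d / k], and [d] tends
   to 0. *)
have AE : (A <= (k * e)%:E)%E.
  apply/lee_addgt0Pr => d d0; have ed : 0 < e + d / k by rewrite ltr_wpDl// divr_gt0.
  have := Hk _ ed; rewrite mulrDr mulrCA divff ?gt_eqF// mulr1 EFinD; apply.
  by rewrite lee_fin lerDl divr_ge0// ltW.
apply: (@le_trans _ _ ((k * e)%:E `^ 2^-1)%E).
  by apply: gt0_ler_poweR => //; rewrite ?in_itv/= ?leey ?andbT ?lee_fin ?mulr_ge0// ltW.
by rewrite !poweR_EFin powRM// ltW.
Qed.

End MaximalEstimate.

Theorem theoremB (R : realType)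
  (* the connected noncompact semisimple Lie group G with finite center *)
  (G : lieGroupType R) (g : lieAlgebra G)
  (Gconnected : connected [set: G])
  (Gnoncompact : ~ compact [set: G])
  (Gcenter : finite_set [set z : G | forall x : G, (x * z)%g = (z * x)%g])
  (Gsemisimple : semisimple g)
  (* the rank one data theta, a, alpha, H0, with K = exp k, A, N = exp n *)
  (X : rankOneSpace g)
  (Kmax : maximal_compact X)
  (* the Iwasawa projections *)
  (kap : G -> G) (H : G -> R) (nu : G -> G) (Hiwasawa : iwasawa X kap H nu)
  (* the Haar measures of G and K and the polar coordinates *)
  (mu : {measure set (borel G) -> \bar R}) (Hmu : haar mu)
  (dk : probability (borel G) R) (Hdk : haarK X dk)
  (C : R) (C_gt0 : 0 < C) (Hpolar : polar_coordinates X mu dk C)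
  (* the c-function and the constant of the inversion formula *)
  (cf : R[i] -> R[i]) (Hcf : harish_chandra_c X dk H cf)
  (c : R) (c_gt0 : 0 < c) (Hinv : inversion_formula X mu dk H cf c)
  (* the exponents a > 1 and s > 1/2, the center and the radius of B *)
  (a : R) (a_gt1 : 1 < a) (s : R) (s_gt : 2^-1 < s)
  (x0 : G) (r : R) (r_gt0 : 0 < r) :
  exists2 C' : R, 0 < C' &
    forall f : G -> R[i], Cc_radial X f ->
      (L2_norm_on mu (ball_GK X x0 r) (Sstar X mu dk H cf c a f)
       <= C'%:E * Hs_norm X mu dk H cf s f)%E.
Proof.
(* The balls [Kball X n] exhaust [G] by sets of finite Haar measure, so [mu] can be replaced by a
   measure bundled as sigma-finite. *)
have [m mE] := sigma_finite_pack (haar_sigma_finite Kmax Hmu Hpolar.1).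
move: Hmu Hpolar Hinv; rewrite -mE => Hmu' Hpolar' Hinv'.
exact: (maximal_L2_bound Kmax Hdk Hmu' C_gt0 Hpolar' Hiwasawa Hinv' c_gt0 Hcf.1 a s_gt x0 r).
Qed.
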